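(* Let $\mathbb K$ be an uncountable algebraically closed field of characteristic zero ($\mathbb K=\mathbb C$ in the analytic case). Let $(w,u,x,z)=(w_1,\ldots,w_r,u_1,\ldots,u_q,x_1,\ldots,x_{k-1},z)$ be coordinates in an étale (or analytic) neighbourhood of a point $a_0=0$, and let $$f(w,u,x,z)=z^k+a_1(w,u,x)z^{k-1}+\cdots+a_k(w,u,x),$$ where the coefficients $a_i(w,u,x)$ are regular (or analytic) functions. Assume that $f$ is in the ideal generated by $x_1,\ldots,x_{k-1},z$, and that $f$ splits formally at every point where $z=x=0$ and $w_1\cdots w_r\neq 0$. Then, after finitely many blowings-up with successive centres of the form $$\{z=x=w_j=0\},\quad 1\le j\le r,$$ we can assume that $f$ splits over $\mathbb K[[w^{1/p},u,x]]$ for some positive integer $p$, where $w^{1/p}:=(w_1^{1/p},\ldots,w_r^{1/p})$; i.e., that $$f(w,u,x,z)=\prod_{i=1}^k\bigl(z+b_i(w^{1/p},u,x)\bigr),\qquad b_i(w^{1/p},u,x)\in\mathbb K[[w^{1/p},u,x]].$$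
   Context: ''$f$ splits formally at a point $a=(w,u,x,z)=(w_0,u_0,0,0)$'' means that $f$ factors into $k$ factors of degree $1$ in $z$ (monic) over the power series ring $\mathbb K[[w-w_0,u-u_0,x]]$. Meaning of ''after finitely many blowings-up we can assume'': let $X=\{f=0\}$ and $S=\{z=x=0\}$. If $\sigma$ is a blowing-up with centre $\{z=x=w_j=0\}$, then the strict transform $S'$ of $S$ is isomorphic to $S$; moreover $S'=\{z=x=0\}$ again in the $w_j$-coordinate chart of $\sigma$ (the chart given by substituting $w_jx$ for $x$ and $w_jz$ for $z$, the other coordinates unchanged), and $a_0=0$ lifts to $a_0'=0$ in $S'$. The assertion is that, after finitely many blowings-up with centres of the indicated form, the strict transform $X'$ of $X$ is given at $a_0'=0$ by a function $f'$ (in the coordinates $(w,u,x,z)$ of the chart) which has a splitting of the displayed form.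
   Formalization: ''Splits formally at a'' is taken to require that all k factors z+b_i vanish at a (b_i has zero constant term); without this the claim fails, e.g. for f=z^2+wz+x with k=2, r=1, q=0. *)

(* Defs.v *)
From HB Require Import structures.
From mathcomp Require Import all_boot all_order all_algebra.
From mathcomp Require Import all_classical all_reals all_analysis.
From mathcomp Require Import complex.
(* The notations of mpoly clash with those of mathcomp-analysis: below,
   [mpoly n K] is {mpoly K[n]}, [multinom n] is 'X_{1..n} and [bmultinom n b]
   is 'X_{1..n < b}. *)
From mathcomp Require Import -(notations) mpoly.

Set Implicit Arguments.
Unset Strict Implicit.
Unset Printing Implicit Defensive.

Import Order.TTheory GRing.Theory Num.Theory.
Import numFieldNormedType.Exports.

Local Open Scope ring_scope.

(* Formal power series over [K] in [n] indeterminates, as families of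
   coefficients. *)
Definition fps (K : comNzRingType) (n : nat) : Type := multinom n -> K.

HB.instance Definition _ (K : comNzRingType) (n : nat) :=
  GRing.Zmodule.copy (fps K n) (multinom n -> K).

Section Fps.
Variables (K : comNzRingType) (n : nat).
Implicit Types (f g h : fps K n) (m : multinom n) (b : nat).

Definition fps_const (c : K) : fps K n := fun m => if m == mnm0 then c else 0.

Definition fps_X (i : 'I_n) : fps K n := fun m => (m == mnm1 i)%:R.

Definition fps_mul f g : fps K n := fun m =>
  \sum_(d : bmultinom n (mdeg m).+1 * bmultinom n (mdeg m).+1
        | m == mnm_add d.1 d.2) f d.1 * g d.2.

(* Truncation at total degree < b; reduces the ring axioms to those of
   polynomials. *)
Let tr b f : mpoly n K := \sum_(m : bmultinom n b) f m *: mpolyX K m.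

Let trE b f m : mcoeff m (tr b f) = if (mdeg m < b)%N then f m else 0.
Proof.
rewrite /tr raddf_sum /=; case: ltnP => hm.
  rewrite (bigD1 (BMultinom hm)) //= big1 => [|d hd].
    by rewrite mcoeffZ mcoeffX eqxx mulr1 addr0.
  rewrite mcoeffZ mcoeffX; case: eqP => [dm|]; last by rewrite mulr0.
  by case/eqP: hd; apply: val_inj.
rewrite big1 // => d _; rewrite mcoeffZ mcoeffX; case: eqP => [dm|].
  by have := bmdeg d; rewrite dm ltnNge hm.
by rewrite mulr0.
Qed.

Let fps_mulE (P Q : mpoly n K) f g m :
  (forall d, (mdeg d <= mdeg m)%N -> mcoeff d P = f d) ->
  (forall d, (mdeg d <= mdeg m)%N -> mcoeff d Q = g d) ->
  fps_mul f g m = mcoeff m (P * Q).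
Proof.
move=> hP hQ; rewrite mcoeffM; apply: eq_bigr => d _.
by rewrite hP ?hQ // -ltnS bmdeg.
Qed.

Let tr_le b f d : (d < b)%N ->
  forall m, (mdeg m <= d)%N -> mcoeff m (tr b f) = f m.
Proof. by move=> db m md; rewrite trE (leq_ltn_trans md db). Qed.

Let fps_mul_tr b f g m : (mdeg m < b)%N ->
  fps_mul f g m = mcoeff m (tr b f * tr b g).
Proof. by move=> hb; apply: fps_mulE => //; apply: tr_le. Qed.

Let fps_mulA : associative fps_mul.
Proof.
move=> f g h; apply/funext => m; pose b := (mdeg m).+1.
rewrite (@fps_mulE (tr b f) (tr b g * tr b h)).
- rewrite mulrA; apply/esym/fps_mulE => // d dm; last by rewrite (@tr_le _ _ (mdeg m)).
  by rewrite (@fps_mul_tr b).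
- by apply: tr_le.
- by move=> d dm; rewrite (@fps_mul_tr b).
Qed.

Let fps_mulC : commutative fps_mul.
Proof.
by move=> f g; apply/funext => m; rewrite !(@fps_mul_tr (mdeg m).+1) // mulrC.
Qed.

Let fps_mul1 : left_id (fps_const 1) fps_mul.
Proof.
move=> f; apply/funext => m; pose b := (mdeg m).+1.
rewrite (@fps_mulE 1 (tr b f)) ?mul1r.
- by rewrite (@tr_le _ _ (mdeg m)).
- by move=> d _; rewrite mcoeff1 /fps_const; case: eqP.
- by apply: tr_le.
Qed.

Let fps_mulDl : left_distributive fps_mul +%R.
Proof.
move=> f g h; apply/funext => m; pose b := (mdeg m).+1.
rewrite (@fps_mulE (tr b f + tr b g) (tr b h)).
- by rewrite mulrDl mcoeffD -!(@fps_mul_tr b).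
- by move=> d dm; rewrite mcoeffD !(@tr_le _ _ (mdeg m)).
- by apply: tr_le.
Qed.

Let fps_1_neq0 : fps_const 1 != 0 :> fps K n.
Proof.
apply/eqP => /(congr1 (fun f : fps K n => f mnm0)).
by rewrite /fps_const eqxx => /eqP; rewrite oner_eq0.
Qed.

HB.instance Definition _ := GRing.Zmodule_isComNzRing.Build (fps K n)
  fps_mulA fps_mulC fps_mul1 fps_mulDl fps_1_neq0.

End Fps.

(* Composition c(v_1, ..., v_n), to be used when every v_i has zero constant
   term: then only the monomials of degree at most [mdeg m] contribute to the
   coefficient of [m]. *)
Definition fps_subst (K : comNzRingType) (n n' : nat) (v : 'I_n -> fps K n')
    (c : fps K n) : fps K n' := fun m =>
  \sum_(d : bmultinom n (mdeg m).+1) c d * (mmap1 v d : fps K n') m.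

(* Étale neighbourhoods of the origin of affine n-space: a K-point of the
   scheme {g = 0} in affine (n + e)-space, g = (g_1, ..., g_e), which lies over
   the origin, the Jacobian of g with respect to the last e variables being
   invertible on {g = 0}. Every étale algebra over K[y_1, ..., y_n] has such a
   presentation. *)
Record etale_nbhd (K : fieldType) (n : nat) := EtaleNbhd {
  etale_dim : nat;
  etale_eqs : 'I_etale_dim -> mpoly (n + etale_dim) K;
  etale_origin : 'rV[K]_(n + etale_dim);
  etale_originP : forall l, meval (etale_origin 0) (etale_eqs l) = 0;
  etale_origin0 : lsubmx etale_origin = 0;
  etale_jacobian : forall v : 'rV[K]_(n + etale_dim),
    (forall l, meval (v 0) (etale_eqs l) = 0) ->
    \det (\matrix_(l, j) meval (v 0) (mderiv (rshift n j) (etale_eqs l))) != 0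
}.
Arguments etale_eqs {K n} U l : rename.

Definition etale_point (K : fieldType) n (U : etale_nbhd K n)
    (v : 'rV[K]_(n + etale_dim U)) : Prop :=
  forall l, meval (v 0) (etale_eqs U l) = 0.

(* Regular functions on U are represented by polynomials in the n + e
   variables. The Taylor expansion at [v] of such a function is obtained by
   substituting v_i + Y_i for the first n variables, and for the others the
   unique power series tau_j(Y) with tau_j(0) = v_(n+j) solving g = 0. *)
Definition etale_expansion (K : fieldType) n (U : etale_nbhd K n)
    (v : 'rV[K]_(n + etale_dim U)) (a : mpoly (n + etale_dim U) K)
    (c : fps K n) : Prop :=
  exists tau : 'I_(n + etale_dim U) -> fps K n,
    [/\ forall i : 'I_n, tau (lshift _ i) =
          @fps_const K n (v 0 (lshift _ i)) + fps_X K i,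
        forall j : 'I_(etale_dim U), tau (rshift n j) mnm0 = v 0 (rshift n j),
        forall l, mmap (@fps_const K n) tau (etale_eqs U l) = 0
      & c = mmap (@fps_const K n) tau a].

Definition open_nbhd0 (K : numFieldType) n (V : set 'rV[K]_n) : Prop :=
  open V /\ V 0.

(* [c] is the Taylor expansion of [g] at [p]: it converges absolutely on a
   polydisc around [p], with sum [g]. *)
Definition analytic_expansion (K : numFieldType) n (p : 'rV[K]_n)
    (g : 'rV[K]_n -> K) (c : fps K n) : Prop :=
  exists2 e : K, 0 < e &
    (exists M : K, forall N : nat,
        \sum_(m : bmultinom n N) `|c m| * e ^+ mdeg m <= M) /\
    (forall h : 'rV[K]_n, (forall i, `|h 0 i| < e) ->
      ((fun N : nat => \sum_(m : bmultinom n N) c m * \prod_i h 0 i ^+ m i)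
        @ \oo --> g (p + h))%classic).

Definition analytic_on (K : numFieldType) n (V : set 'rV[K]_n)
    (g : 'rV[K]_n -> K) : Prop :=
  forall p, V p -> exists c, analytic_expansion p g c.

(* [F] is the expansion of z^k + a_1 z^(k-1) + ... + a_k at a point where
   z = 0, [ex a c] saying that [c] is the expansion of [a] at that point;
   [a i] stands for a_(i+1). *)
Definition expands_to (K : comNzRingType) n k (T : Type)
    (ex : T -> fps K n -> Prop) (a : 'I_k -> T) (F : {poly fps K n}) : Prop :=
  exists2 c : 'I_k -> fps K n, forall i, ex (a i) (c i) &
    F = 'X^k + \sum_(i < k) (c i)%:P * 'X^(k - i.+1).

Section Coordinates.
Variables (K : comNzRingType) (r q k : nat).

(* The base coordinates are ordered as (w, u, x). *)
Local Notation n := (r + q + k.-1)%N.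

Definition w_part (y : 'rV[K]_n) : 'rV[K]_r := lsubmx (lsubmx y).
Definition x_part (y : 'rV[K]_n) : 'rV[K]_k.-1 := rsubmx y.

Definition w_ (j : 'I_r) : fps K n := fps_X K (lshift k.-1 (lshift q j)).
Definition x_ (l : 'I_k.-1) : fps K n := fps_X K (rshift (r + q) l).

Definition in_ideal_xz (F : {poly fps K n}) : Prop :=
  exists (h : 'I_k.-1 -> {poly fps K n}) (h0 : {poly fps K n}),
    F = \sum_l (x_ l)%:P * h l + 'X * h0.

(* The k factors are required to pass through the point (zero constant term),
   i.e. not to be units of the formal local ring K[[w - w0, u - u0, x, z]]. *)
Definition splits_formally (F : {poly fps K n}) : Prop :=
  exists2 b : 'I_k -> fps K n, forall i, b i mnm0 = 0 &
    F = \prod_i ('X + (b i)%:P).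

(* The chart of the blowing-up with centre {z = x = w_j = 0}. *)
Definition blowup_chart (j : 'I_r) (i : 'I_n) : fps K n :=
  match fintype.split i with
  | inl _ => fps_X K i
  | inr l => w_ j * x_ l
  end.

Definition blowup_pullback (j : 'I_r) (F : {poly fps K n}) : {poly fps K n} :=
  map_poly (fps_subst (blowup_chart j)) F \Po ((w_ j)%:P * 'X).

(* {w_j = 0} is the exceptional divisor in the chart. *)
Definition strict_transform (j : 'I_r) (F F' : {poly fps K n}) : Prop :=
  (exists d : nat, blowup_pullback j F = (w_ j ^+ d)%:P * F') /\
  ~ (exists G, F' = (w_ j)%:P * G).

Fixpoint strict_transforms (js : seq 'I_r) (F F' : {poly fps K n}) : Prop :=
  if js is j :: js' then
    exists2 G, strict_transform j F G & strict_transforms js' G F'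
  else F' = F.

(* K[[w, u, x]] is embedded in K[[w^(1/p), u, x]], whose indeterminates are
   again numbered as in [n], by sending w_j to the p-th power of the j-th one. *)
Definition root_chart (p : nat) (i : 'I_n) : fps K n :=
  if (i < r)%N then fps_X K i ^+ p else fps_X K i.

Definition splits_over_root (p : nat) (F : {poly fps K n}) : Prop :=
  exists b : 'I_k -> fps K n,
    map_poly (fps_subst (root_chart p)) F = \prod_i ('X + (b i)%:P).

Definition splits_after_blowups (F : {poly fps K n}) : Prop :=
  exists (js : seq 'I_r) (F' : {poly fps K n}),
    strict_transforms js F F' /\
    exists2 p : nat, (0 < p)%N & splits_over_root p F'.

End Coordinates.

(* Main.v *)
(* Substituting t x for x turns f into a polynomial whose coefficients are
   series in t over a ring O of functions of w^(1/p), u, x, closed under the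
   partial derivatives (algebraic functions in the etale case, series convergent
   on a polydisc in the analytic case). At a point of the base with w <> 0 and
   x = 0 the roots are power series there, and the derivatives of the roots are
   universal polynomials in the roots divided by powers of the leading nonzero
   Hankel determinant D of the power sums. Thus D divides certain universal
   expressions at all these points; the nullstellensatz (over uncountable K) or
   evaluation of convergent series, with the Weierstrass preparation of D, turns
   this into divisibility up to a power of w_1 ... w_r over formal power series
   at the origin. The blowings-up t -> w^a t, z -> w^a z absorb the powers of w
   in D. Then all derivatives of the roots, taken in a splitting field, have at
   most poles along w = 0; by Puiseux's theorem along each w_j = 0, with p a
   multiple of the ramification, these poles do not occur and the derivatives are
   integral over the formal power series. A homomorphism from the integral
   closure to K extending evaluation at 0 sends each root to its Taylor series,
   and these are the sought b_i. *)

Require Import Defs.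
From HB Require Import structures.
From mathcomp Require Import all_boot all_order all_algebra.
From mathcomp Require Import all_classical all_reals all_analysis.
From mathcomp Require Import complex.
From mathcomp Require Import -(notations) mpoly.
From mathcomp Require Import fraction.
From mathcomp Require Import fieldext.
From mathcomp Require Import ring lra zify.

Set Implicit Arguments.
Unset Strict Implicit.
Unset Printing Implicit Defensive.

Import Order.TTheory GRing.Theory Num.Theory.
Local Open Scope ring_scope.

(** * Power series in one variable *)

(** The obstacle is that all derivatives of the roots are needed, with no bound on the power of the
    Hankel determinant in their denominators, while only finitely many blowings-up are allowed. So
    the determinant itself is repaired before any derivative is taken: after [t -> w ^ a t] with [a]
    large it is, up to powers of [w] and [t], a monomial in [w] times a series in [t] whose constant
    term is divisible by no [w_j]. Division by every power of that series is then exact, and only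
    powers of [w] remain as denominators. The exponent [p] is a product of factorials depending on
    [k] alone; hence [w -> w ^ p] is performed at the outset, before any root is known, and the ring
    O must also be closed under taking the parts of fixed degree in [x] of f(w^p, u, x). The
    formulas for derivatives are identities over O[[t]] fixed before the place where f splits is
    chosen, so that one identity is read at the points, along each divisor w_j = 0, and in a
    splitting field at the origin. The variable [t] is removed at the end by an Euler derivation: it
    kills the roots, and its kernel consists of the series in w, u and t x. *)

Section ClassicalUnits.
Variable R : comNzRingType.

(** The integral domain structures on rings of series are built on a unit ring structure; deciding
    invertibility classically provides one without a formula for inverses. *)
Definition classical_unit : {pred R} := fun x => `[< exists y, y * x = 1 >].

Definition classical_inv (x : R) : R :=
  if pselect (exists y, y * x = 1) is left h then projT1 (cid h) else x.

Lemma classical_mulVx : {in classical_unit, left_inverse 1 classical_inv *%R}.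
Proof.
move=> x /asboolP h; rewrite /classical_inv; case: pselect => // h'.
by case: cid.
Qed.

Lemma classical_unitP x y : y * x = 1 -> classical_unit x.
Proof. by move=> h; apply/asboolP; exists y. Qed.

Lemma classical_inv_out : {in [predC classical_unit], classical_inv =1 id}.
Proof.
move=> x /= /asboolPn h; rewrite /classical_inv; case: pselect => // h'.
Qed.

End ClassicalUnits.

(** Series in one variable over an arbitrary ring: the coefficients will be functions in O, formal
    series in the other variables, or elements of a field containing these. *)
Definition ser (R : comNzRingType) : Type := nat -> R.

HB.instance Definition _ (R : comNzRingType) :=
  GRing.Zmodule.copy (ser R) (nat -> R).

Section Series.
Variable R : comNzRingType.
Implicit Types (f g h : ser R) (i j n b : nat).

Definition ser_mul f g : ser R := fun n => \sum_(i < n.+1) f i * g (n - i)%N.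
Definition serC (c : R) : ser R := fun n => if n == 0%N then c else 0.
Definition serX : ser R := fun n => (n == 1%N)%:R.

Let tr b f : {poly R} := \poly_(i < b) f i.

Let ser_mulE (P Q : {poly R}) f g n :
  (forall i, (i <= n)%N -> P`_i = f i) -> (forall i, (i <= n)%N -> Q`_i = g i) ->
  ser_mul f g n = (P * Q)`_n.
Proof.
move=> hP hQ; rewrite coefM; apply: eq_bigr => i _.
by rewrite hP ?hQ ?leq_subr // -ltnS.
Qed.

Let trE b f n : (n < b)%N -> forall i, (i <= n)%N -> (tr b f)`_i = f i.
Proof. by move=> nb i ni; rewrite coef_poly (leq_ltn_trans ni nb). Qed.

Let ser_mul_tr b f g n : (n < b)%N -> ser_mul f g n = (tr b f * tr b g)`_n.
Proof. by move=> nb; apply: ser_mulE; apply: trE. Qed.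

Let ser_mulA : associative ser_mul.
Proof.
move=> f g h; apply/funext => n.
rewrite (@ser_mulE (tr n.+1 f) (tr n.+1 g * tr n.+1 h)).
- rewrite mulrA; apply/esym/ser_mulE => i ni; last by rewrite (@trE _ _ n).
  by rewrite (@ser_mul_tr n.+1).
- exact: trE.
- by move=> i ni; rewrite (@ser_mul_tr n.+1).
Qed.

Let ser_mulC : commutative ser_mul.
Proof.
by move=> f g; apply/funext => n; rewrite !(@ser_mul_tr n.+1) // mulrC.
Qed.

Let ser_mul1 : left_id (serC 1) ser_mul.
Proof.
move=> f; apply/funext => n; rewrite (@ser_mulE 1 (tr n.+1 f)) ?mul1r.
- by rewrite (@trE _ _ n).
- by move=> i _; rewrite coef1 /serC; case: eqP.
- exact: trE.
Qed.

Let ser_mulDl : left_distributive ser_mul +%R.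
Proof.
move=> f g h; apply/funext => n.
transitivity (\sum_(i < n.+1) (f i * h (n - i)%N + g i * h (n - i)%N)).
  by apply: eq_bigr => i _; rewrite -mulrDl.
by rewrite big_split.
Qed.

Let ser_1_neq0 : serC 1 != 0 :> ser R.
Proof.
apply/eqP => /(congr1 (fun f : ser R => f 0%N)).
by rewrite /serC eqxx => /eqP; rewrite oner_eq0.
Qed.

HB.instance Definition _ := GRing.Zmodule_isComNzRing.Build (ser R)
  ser_mulA ser_mulC ser_mul1 ser_mulDl ser_1_neq0.

Lemma serME f g n : (f * g) n = \sum_(i < n.+1) f i * g (n - i)%N.
Proof. by []. Qed.

Lemma serDE f g n : (f + g) n = f n + g n. Proof. by []. Qed.
Lemma ser0E n : (0 : ser R) n = 0. Proof. by []. Qed.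
Lemma ser1E n : (1 : ser R) n = (n == 0%N)%:R.
Proof. by rewrite -[1]/(serC 1) /serC; case: eqP. Qed.
Lemma serBE f g n : (f - g) n = f n - g n. Proof. by []. Qed.

Lemma ser_sumE I (s : seq I) (P : pred I) (F : I -> ser R) n :
  (\sum_(i <- s | P i) F i) n = \sum_(i <- s | P i) F i n.
Proof. by elim/big_rec2: _ => // i x y _ <-. Qed.

Lemma serMnE f k n : (f *+ k) n = f n *+ k.
Proof. by elim: k => // k IH; rewrite !mulrS serDE IH. Qed.

Lemma serM0 f g : (f * g) 0%N = f 0%N * g 0%N.
Proof. by rewrite serME big_ord1 subnn. Qed.

HB.instance Definition _ := GRing.ComNzRing_hasMulInverse.Build (ser R)
  (@classical_mulVx (ser R)) (@classical_unitP (ser R)) (@classical_inv_out (ser R)).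

Lemma serC_is_additive : additive serC.
Proof.
move=> x y; apply/funext => n; rewrite serBE /serC; case: eqP => // _.
by rewrite subr0.
Qed.

Lemma serC_is_monoid : monoid_morphism serC.
Proof.
split=> // x y; apply/funext => n; rewrite serME /serC.
rewrite big_ord_recl /= subn0 big1 ?addr0 => [|i _]; last by rewrite mul0r.
by case: eqP; rewrite ?mulr0.
Qed.

HB.instance Definition _ := GRing.isZmodMorphism.Build R (ser R) serC serC_is_additive.
HB.instance Definition _ := GRing.isMonoidMorphism.Build R (ser R) serC serC_is_monoid.

Definition ser0 f : R := f 0%N.
Lemma ser0_is_additive : additive ser0. Proof. by []. Qed.
Lemma ser0_is_monoid : monoid_morphism ser0.
Proof. by split=> [|f g]; rewrite /ser0 ?ser1E ?serM0. Qed.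
HB.instance Definition _ := GRing.isZmodMorphism.Build (ser R) R ser0 ser0_is_additive.
HB.instance Definition _ := GRing.isMonoidMorphism.Build (ser R) R ser0 ser0_is_monoid.

Lemma serCM c f n : (serC c * f) n = c * f n.
Proof.
rewrite serME big_ord_recl /= subn0 big1 ?addr0 // => i _.
by rewrite /serC /= mul0r.
Qed.

Lemma serX_expE k n : (serX ^+ k) n = (n == k)%:R.
Proof.
elim: k n => [|k IH] n; first by rewrite expr0 ser1E.
rewrite exprS serME; case: n => [|n].
  by rewrite big_ord1 /serX mul0r.
rewrite big_ord_recl big_ord_recl big1 => [|i _]; last by rewrite /serX mul0r.
by rewrite /serX /= mul0r mul1r add0r addr0 IH subSS subn0 eqSS.
Qed.

Lemma serX_expM k f n : (serX ^+ k * f) n = if (k <= n)%N then f (n - k)%N else 0.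
Proof.
rewrite serME; case: leqP => kn.
  rewrite (bigD1 (Ordinal (kn : (k < n.+1)%N))) //= serX_expE eqxx mul1r.
  rewrite big1 ?addr0 // => i ik; rewrite serX_expE; case: eqP => [e|].
    by case/eqP: ik; apply: val_inj.
  by rewrite mul0r.
rewrite big1 // => i _; rewrite serX_expE; case: eqP => [e|]; last by rewrite mul0r.
by have := ltn_ord i; rewrite e ltnS leqNgt kn.
Qed.

Definition ser_drop k f : ser R := fun n => f (n + k)%N.

Lemma ser_divX k f : (forall i, (i < k)%N -> f i = 0) ->
  f = serX ^+ k * ser_drop k f.
Proof.
move=> h; apply/funext => n; rewrite serX_expM; case: leqP => kn.
  by rewrite /ser_drop subnK.
exact: h.
Qed.

(** The substitution t -> u t. *)
Definition ser_scale (u : R) f : ser R := fun n => u ^+ n * f n.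
Lemma ser_scale_is_additive u : additive (ser_scale u).
Proof. by move=> f g; apply/funext => n; rewrite serBE /ser_scale serBE mulrBr. Qed.
Lemma ser_scale_is_monoid u : monoid_morphism (ser_scale u).
Proof.
split=> [|f g]; apply/funext => n; rewrite /ser_scale.
  by rewrite !ser1E; case: eqP => [->|]; rewrite ?expr0 ?mulr0 ?mulr1.
rewrite !serME mulr_sumr; apply: eq_bigr => i _.
have ni : (i <= n)%N by rewrite -ltnS.
by rewrite -{1}(subnKC ni) exprD; ring.
Qed.
HB.instance Definition _ u := GRing.isZmodMorphism.Build (ser R) (ser R)
  (ser_scale u) (ser_scale_is_additive u).
HB.instance Definition _ u := GRing.isMonoidMorphism.Build (ser R) (ser R)
  (ser_scale u) (ser_scale_is_monoid u).

Section Ramify.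
Variable p : nat.
Hypothesis p_gt0 : (0 < p)%N.

(** The substitution t -> t^p. *)
Definition ser_ram f : ser R := fun n => if (p %| n)%N then f (n %/ p)%N else 0.
End Ramify.

Lemma ser_ramE p (p_gt0 : (0 < p)%N) f i : ser_ram p f (i * p)%N = f i.
Proof. by rewrite /ser_ram dvdn_mull // mulnK. Qed.

Lemma ser_ram_is_additive p : additive (ser_ram p).
Proof.
move=> f g; apply/funext => n; rewrite serBE /ser_ram; case: ifP => // _.
by rewrite subr0.
Qed.
Lemma ser_ramM p (p_gt0 : (0 < p)%N) f g :
  ser_ram p (f * g) = ser_ram p f * ser_ram p g.
Proof.
apply/funext => n; rewrite [RHS]serME {1}/ser_ram; case: ifP => [/dvdnP[k ->]|hn].
  rewrite mulnK // serME.
  have F i : (i < k.+1)%N -> (i * p < (k * p).+1)%N.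
    by move=> ik; rewrite ltnS leq_mul2r -ltnS ik orbT.
  rewrite [RHS](bigID (fun i : 'I_(k * p).+1 => (p %| i)%N)) /= [X in _ = _ + X]big1 ?addr0; last first.
    by move=> i hi; rewrite /ser_ram (negbTE hi) mul0r.
  rewrite (reindex (fun i : 'I_k.+1 => Ordinal (F i (ltn_ord i)))) /=; last first.
    exists (fun i : 'I_(k * p).+1 => inord (i %/ p)) => i.
      by move=> _; apply: val_inj; rewrite /= mulnK // inordK.
    rewrite inE => hi; apply: val_inj; rewrite /= inordK ?divnK //.
    by rewrite ltnS leq_divLR // -ltnS.
  apply: eq_big => i; first by rewrite dvdn_mull.
  by move=> _; rewrite ser_ramE // -mulnBl ser_ramE.
rewrite big1 // => i _; rewrite /ser_ram; case: ifP => hi; last by rewrite mul0r.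
case: ifP => hj; last by rewrite mulr0.
have ni : (i <= n)%N by rewrite -ltnS.
by have := dvdn_add hi hj; rewrite subnKC // hn.
Qed.
Lemma ser_ram1 p (p_gt0 : (0 < p)%N) : ser_ram p 1 = 1.
Proof.
apply/funext => n; rewrite /ser_ram; case: ifP => [/dvdnP[k ->]|hn].
  by rewrite mulnK // !ser1E muln_eq0 (gtn_eqF p_gt0) orbF.
by rewrite ser1E; case: eqP => // n0; rewrite n0 dvdn0 in hn.
Qed.

End Series.

(** The shift of the index makes this a ring morphism for every [p], so that it can carry a
    canonical structure; the substitution t -> t^p is then [ser_ramp p.-1] for positive [p]. *)
Definition ser_ramp (R : comNzRingType) (p : nat) (f : ser R) : ser R := ser_ram p.+1 f.
Lemma ser_ramp_is_monoid (R : comNzRingType) p : monoid_morphism (@ser_ramp R p).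
Proof. by split=> [|f g]; rewrite /ser_ramp ?ser_ram1 ?ser_ramM. Qed.
HB.instance Definition _ (R : comNzRingType) p :=
  GRing.isZmodMorphism.Build (ser R) (ser R) (@ser_ramp R p) (@ser_ram_is_additive R p.+1).
HB.instance Definition _ (R : comNzRingType) p :=
  GRing.isMonoidMorphism.Build (ser R) (ser R) (@ser_ramp R p) (ser_ramp_is_monoid R p).

Section SeriesMap.
Variables (R S : comNzRingType) (f : {rmorphism R -> S}).
Definition ser_map (a : ser R) : ser S := fun n => f (a n).
Lemma ser_map_is_additive : additive ser_map.
Proof. by move=> a b; apply/funext => n; rewrite /ser_map !serBE rmorphB. Qed.
Lemma ser_map_is_monoid : monoid_morphism ser_map.
Proof.
split=> [|a b]; apply/funext => n; rewrite /ser_map.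
  by rewrite !ser1E rmorph_nat.
by rewrite !serME rmorph_sum; apply: eq_bigr => i _; rewrite rmorphM.
Qed.
HB.instance Definition _ := GRing.isZmodMorphism.Build (ser R) (ser S) ser_map ser_map_is_additive.
HB.instance Definition _ := GRing.isMonoidMorphism.Build (ser R) (ser S) ser_map ser_map_is_monoid.
End SeriesMap.

Lemma ser_neq0 (R : comNzRingType) (f : ser R) : f != 0 ->
  exists2 n, f n != 0 & forall i, (i < n)%N -> f i = 0.
Proof.
move=> f0; have [n hn] : exists n, f n != 0.
  apply: contrapT => h; case/eqP: f0; apply/funext => n.
  by apply: contrapT => /eqP fn; case: h; exists n.
pose P n := f n != 0; have exP : exists n, P n by exists n.
case: (ex_minnP exP) => k Pk kmin; exists k => // i ik.
by apply: contraTeq ik => Pi; rewrite -leqNgt kmin.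
Qed.

Lemma ser_lowM (R : comNzRingType) (f g : ser R) a b :
  (forall i, (i < a)%N -> f i = 0) -> (forall i, (i < b)%N -> g i = 0) ->
  (f * g) (a + b)%N = f a * g b /\ forall i, (i < a + b)%N -> (f * g) i = 0.
Proof.
move=> hf hg; rewrite (ser_divX hf) (ser_divX hg) mulrACA -exprD; split.
  by rewrite !serX_expM !leqnn !subnn serM0.
by move=> i hi; rewrite serX_expM leqNgt hi.
Qed.

Lemma ser_mulf_eq0 (R : idomainType) : GRing.integral_domain_axiom (ser R).
Proof.
move=> f g /eqP; apply: contraTT; rewrite negb_or => /andP[/ser_neq0[a fa hf]].
case/ser_neq0 => b gb hg; have [e _] := ser_lowM hf hg.
apply/eqP => fg0; move/eqP: e; rewrite fg0 ser0E eq_sym mulf_eq0.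
by rewrite (negbTE fa) (negbTE gb).
Qed.
HB.instance Definition _ (R : idomainType) :=
  GRing.ComUnitRing_isIntegral.Build (ser R) (@ser_mulf_eq0 R).

(** The [N]-th iterate [Y N] of the operator is already stable at the indices below [N], and the
    solution is read off the diagonal. *)
Lemma triangular_rec (X : Type) (x0 : X) (G : nat -> (nat -> X) -> X) :
  (forall i x y, (forall j, (j < i)%N -> x j = y j) -> G i x = G i y) ->
  exists x, forall i, x i = G i x.
Proof.
move=> hG; pose Y := fix Y N := if N is N'.+1 then fun i => G i (Y N') else fun=> x0.
have st N : forall M i, (i < N)%N -> (N <= M)%N -> Y N i = Y M i.
  elim: N => // N IH [|M] // i iN NM /=; apply: hG => j ji; apply: IH => //.
  exact: leq_trans ji _.
exists (fun i => Y i.+1 i) => i /=; apply: hG => j ji.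
by rewrite -(st j.+1 i j).
Qed.

(** * Power series in several variables *)

Section FpsBasics.
Variables (K : comNzRingType) (n : nat).
Implicit Types (f g h : fps K n) (m d : multinom n) (b : nat).

Definition fps_tr b f : mpoly n K := \sum_(m : bmultinom n b) f m *: mpolyX K m.

Lemma fps_trE b f m : mcoeff m (fps_tr b f) = if (mdeg m < b)%N then f m else 0.
Proof.
rewrite /fps_tr raddf_sum /=; case: ltnP => hm.
  rewrite (bigD1 (BMultinom hm)) //= big1 => [|d hd].
    by rewrite mcoeffZ mcoeffX eqxx mulr1 addr0.
  rewrite mcoeffZ mcoeffX; case: eqP => [dm|]; last by rewrite mulr0.
  by case/eqP: hd; apply: val_inj.
rewrite big1 // => d _; rewrite mcoeffZ mcoeffX; case: eqP => [dm|].
  by have := bmdeg d; rewrite dm ltnNge hm.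
by rewrite mulr0.
Qed.

Lemma fps_mulE (P Q : mpoly n K) f g m :
  (forall d, (mdeg d <= mdeg m)%N -> mcoeff d P = f d) ->
  (forall d, (mdeg d <= mdeg m)%N -> mcoeff d Q = g d) ->
  (f * g) m = mcoeff m (P * Q).
Proof.
move=> hP hQ; rewrite mcoeffM; apply: eq_bigr => d _.
by rewrite hP ?hQ // -ltnS bmdeg.
Qed.

Lemma fps_tr_le b f (d : nat) : (d < b)%N ->
  forall m, (mdeg m <= d)%N -> mcoeff m (fps_tr b f) = f m.
Proof. by move=> db m md; rewrite fps_trE (leq_ltn_trans md db). Qed.

Lemma fps_mul_tr b f g m : (mdeg m < b)%N ->
  (f * g) m = mcoeff m (fps_tr b f * fps_tr b g).
Proof. by move=> hb; apply: fps_mulE => //; apply: fps_tr_le. Qed.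

Lemma fpsDE f g m : (f + g) m = f m + g m. Proof. by []. Qed.
Lemma fpsNE f m : (- f) m = - f m. Proof. by []. Qed.
Lemma fpsBE f g m : (f - g) m = f m - g m. Proof. by []. Qed.
Lemma fps0E m : (0 : fps K n) m = 0. Proof. by []. Qed.
Lemma fps1E m : (1 : fps K n) m = (m == mnm0)%:R.
Proof. by rewrite -[1]/(@fps_const K n 1) /fps_const; case: eqP. Qed.
Lemma fpsMnE f k m : (f *+ k) m = f m *+ k.
Proof. by elim: k => // k IH; rewrite !mulrS fpsDE IH. Qed.
Lemma fps_sumE I (s : seq I) (P : pred I) (F : I -> fps K n) m :
  (\sum_(i <- s | P i) F i) m = \sum_(i <- s | P i) F i m.
Proof. by elim/big_rec2: _ => // i x y _ <-. Qed.

Definition mp_fps (P : mpoly n K) : fps K n := fun m => mcoeff m P.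
Lemma mp_fps_is_additive : additive mp_fps.
Proof. by move=> P Q; apply/funext => m; rewrite fpsBE /mp_fps mcoeffB. Qed.
Lemma mp_fps_is_monoid : monoid_morphism mp_fps.
Proof.
split=> [|P Q]; apply/funext => m; first by rewrite /mp_fps mcoeff1 fps1E.
by rewrite (@fps_mulE P Q).
Qed.
HB.instance Definition _ := GRing.isZmodMorphism.Build (mpoly n K) (fps K n) mp_fps mp_fps_is_additive.
HB.instance Definition _ := GRing.isMonoidMorphism.Build (mpoly n K) (fps K n) mp_fps mp_fps_is_monoid.

Lemma mp_fpsC c : mp_fps (mpolyC n c) = @fps_const _ n c.
Proof. by apply/funext => m; rewrite /mp_fps mcoeffC /fps_const; case: eqP; rewrite (mulr1, mulr0). Qed.

Lemma mp_fpsX i : mp_fps (mpolyX K (mnm1 i)) = fps_X K i.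
Proof. by apply/funext => m; rewrite /mp_fps mcoeffX /fps_X eq_sym. Qed.

Lemma fps_const_is_additive : additive (@fps_const K n).
Proof. by move=> x y; rewrite -!mp_fpsC mpolyCB rmorphB. Qed.
Lemma fps_const_is_monoid : monoid_morphism (@fps_const K n).
Proof. by split=> // x y; rewrite -!mp_fpsC mpolyCM rmorphM. Qed.
HB.instance Definition _ := GRing.isZmodMorphism.Build K (fps K n) (@fps_const K n) fps_const_is_additive.
HB.instance Definition _ := GRing.isMonoidMorphism.Build K (fps K n) (@fps_const K n) fps_const_is_monoid.

Definition fps_coef0 f : K := f mnm0.
Lemma fps_coef0_is_additive : additive fps_coef0. Proof. by []. Qed.
Lemma fps_coef0_is_monoid : monoid_morphism fps_coef0.
Proof.
split=> [|f g]; first by rewrite /fps_coef0 fps1E eqxx.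
rewrite /fps_coef0 (@fps_mul_tr 1) ?mdeg0 // mcoeffM.
rewrite (big_pred1 (bm0, bm0)) /=.
  by rewrite !fps_trE mdeg0.
move=> [d1 d2]; rewrite inE xpair_eqE; cbn [fst snd].
apply/eqP/andP => [h|[/eqP h1 /eqP h2]].
  have {}h i : (d1 i + d2 i)%N = 0%N.
    by have := congr1 (fun m : multinom n => m i) h; rewrite /= mnmDE mnm0E => <-.
  split; apply/eqP; apply: val_inj => /=; apply/mnmP => i; rewrite mnm0E; have := h i; lia.
by rewrite h1 h2 /=; apply/mnmP => i; rewrite mnmDE !mnm0E.
Qed.
HB.instance Definition _ := GRing.isZmodMorphism.Build (fps K n) K fps_coef0 fps_coef0_is_additive.
HB.instance Definition _ := GRing.isMonoidMorphism.Build (fps K n) K fps_coef0 fps_coef0_is_monoid.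

HB.instance Definition _ := GRing.ComNzRing_hasMulInverse.Build (fps K n)
  (@classical_mulVx (fps K n)) (@classical_unitP (fps K n)) (@classical_inv_out (fps K n)).

Definition fps_d (i : 'I_n) f : fps K n :=
  fun m => f (mnm_add m (mnm1 i)) *+ (m i).+1.

Lemma fps_dD i f g : fps_d i (f + g) = fps_d i f + fps_d i g.
Proof. by apply/funext => m; rewrite fpsDE /fps_d fpsDE mulrnDl. Qed.

Lemma fps_d_mp i (P : mpoly n K) : fps_d i (mp_fps P) = mp_fps (mderiv i P).
Proof. by apply/funext => m; rewrite /mp_fps mcoeff_deriv. Qed.

Lemma fps_dM i f g : fps_d i (f * g) = fps_d i f * g + f * fps_d i g.
Proof.
apply/funext => m; pose b := (mdeg m).+2.
have h f0 d : (mdeg d <= mdeg m)%N ->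
    mcoeff d (mderiv i (fps_tr b f0)) = fps_d i f0 d.
  move=> dm; rewrite mcoeff_deriv /fps_d (@fps_tr_le _ _ (mdeg m).+1) //.
  by rewrite mdegD mdeg1 addn1 ltnS.
have h0 f0 d : (mdeg d <= mdeg m)%N -> mcoeff d (fps_tr b f0) = f0 d.
  by move=> dm; rewrite (@fps_tr_le _ _ (mdeg m)) // ltnW.
rewrite fpsDE {1}/fps_d (@fps_mulE (fps_tr b f) (fps_tr b g)); first last.
- by apply: fps_tr_le; rewrite mdegD mdeg1 addn1.
- by apply: fps_tr_le; rewrite mdegD mdeg1 addn1.
rewrite -mcoeff_deriv mderivM mcoeffD; congr (_ + _); apply/esym/fps_mulE => //.
- exact: h.
- exact: h0.
- exact: h0.
- exact: h.
Qed.

Lemma fps_dC i j f : fps_d i (fps_d j f) = fps_d j (fps_d i f).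
Proof.
apply/funext => m; rewrite /fps_d !mnmDE !mnm1E; case: (eqVneq i j) => [->//|ij].
rewrite !addn0 -!mulrnA mulnC; congr (f _ *+ _).
by apply/mnmP => l; rewrite !mnmDE; lia.
Qed.

Lemma fps_d_X i j : fps_d i (fps_X K j) = (i == j)%:R.
Proof.
rewrite -mp_fpsX fps_d_mp mderivX mnm1E eq_sym; case: eqP => [->|_].
  rewrite scale1r; have -> : mnm_sub (mnm1 j) (mnm1 j) = mnm0.
    by apply/mnmP => l; rewrite mnmBE mnm0E subnn.
  by rewrite mpolyX0 rmorph1.
by rewrite scale0r rmorph0.
Qed.

Lemma fps_d_const i c : fps_d i (@fps_const _ n c) = 0.
Proof. by rewrite -mp_fpsC fps_d_mp mderivC rmorph0. Qed.

(* A power series in characteristic 0 is determined by its constant term and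
   its derivatives. *)
Lemma fps_ind (f : fps K n -> fps K n -> Prop) :
  (forall x y : K, forall k, x *+ k.+1 = y *+ k.+1 -> x = y) ->
  (forall g h, f g h -> g mnm0 = h mnm0) ->
  (forall i g h, f g h -> f (fps_d i g) (fps_d i h)) ->
  forall g h, f g h -> g = h.
Proof.
move=> cK h0 hd g h fgh; apply/funext => m.
elim: {m}(mdeg m) {-2}m (erefl (mdeg m)) g h fgh => [|k IH] m mk g h fgh.
  have -> : m = mnm0 by apply/eqP; rewrite -mdeg_eq0 mk.
  exact: h0.
have [i mi] : exists i, (0 < m i)%N.
  apply/existsP; apply: contraPT (mk) => /existsPn hm.
  by rewrite mdegE big1 // => i _; apply/eqP; rewrite -leqn0 leqNgt hm.
have [m' em] : exists m', m = mnm_add m' (mnm1 i).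
  exists (mnm_sub m (mnm1 i)); apply/mnmP => l; rewrite mnmDE mnmBE mnm1E.
  by case: eqP => [<-|]; lia.
have := IH m' _ _ _ (hd i _ _ fgh); rewrite /fps_d -em; move/(_ _)/cK; apply.
by move: mk; rewrite em mdegD mdeg1; lia.
Qed.

End FpsBasics.

(** * Singling out one indeterminate *)

Section Peel.
Variables (K : comNzRingType) (n : nat) (j : 'I_n.+1).

Definition mins (i : nat) (d : multinom n) : multinom n.+1 :=
  Multinom (mktuple (fun l => if unlift j l is Some l' then d l' else i)).

Definition mdel (m : multinom n.+1) : multinom n := Multinom (mktuple (fun l => m (lift j l))).

Lemma mins_j i d : mins i d j = i.
Proof. by rewrite mnmE unlift_none. Qed.
Lemma mins_lift i d l : mins i d (lift j l) = d l.
Proof. by rewrite mnmE liftK. Qed.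
Lemma mins_del (m : multinom n.+1) : mins (m j) (mdel m) = m.
Proof. by apply/mnmP => l; rewrite mnmE; case: unliftP => [l' ->|->] //; rewrite mnmE. Qed.
Lemma mdel_ins i d : mdel (mins i d) = d.
Proof. by apply/mnmP => l; rewrite mnmE mins_lift. Qed.
Lemma mins_inj i i' d d' : mins i d = mins i' d' -> i = i' /\ d = d'.
Proof. by move=> h; split; [rewrite -(mins_j i d) h mins_j|rewrite -(mdel_ins i d) h mdel_ins]. Qed.
Lemma mdeg_mins i d : mdeg (mins i d) = (i + mdeg d)%N.
Proof.
rewrite !mdegE (bigD1_ord j) //= mins_j; congr (_ + _)%N.
by apply: eq_bigr => l _; rewrite mins_lift.
Qed.

Definition peel (a : fps K n.+1) : ser (fps K n) := fun i d => a (mins i d).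
Definition unpeel (a : ser (fps K n)) : fps K n.+1 := fun m => a (m j) (mdel m).

Lemma peelK : cancel peel unpeel.
Proof. by move=> a; apply/funext => m; rewrite /unpeel /peel mins_del. Qed.
Lemma unpeelK : cancel unpeel peel.
Proof. by move=> a; do 2!apply/funext => ?; rewrite /unpeel /peel mins_j mdel_ins. Qed.

(** [Phi] is the polynomial counterpart of [peel] and multiplicative by construction; once [PhiE]
    has matched the coefficients, the multiplicativity of [peel] is read on truncations. *)
Let X (l : 'I_n.+1) : {poly mpoly n K} :=
  if unlift j l is Some l' then (mpolyX K (mnm1 l'))%:P else 'X.
Let C : {rmorphism K -> {poly mpoly n K}} := (@polyC (mpoly n K)) \o (@mpolyC n K).
Let Phi : mpoly n.+1 K -> {poly mpoly n K} := mmap C X.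

Let Phi_mono m : mmap1 X m = 'X^(m j) * (mpolyX K (mdel m))%:P.
Proof.
rewrite /mmap1 (bigD1_ord j) //= /X unlift_none; congr (_ * _).
under eq_bigr => l _ do rewrite liftK -polyC_exp.
rewrite -rmorph_prod; congr (_%:P); rewrite mpolyXE_id.
by apply: eq_bigr => l _; rewrite mnmE.
Qed.

Let PhiE P i d : mcoeff d (Phi P)`_i = mcoeff (mins i d) P.
Proof.
rewrite /Phi /mmap coef_sum raddf_sum /=.
transitivity (\sum_(m <- msupp P) (if m == mins i d then mcoeff m P else 0)).
  apply: eq_bigr => m _; rewrite Phi_mono mulrA [_%:P * _]mulrC -mulrA -polyCM.
  rewrite coefXnM; case: ltnP => hi.
    rewrite mcoeff0; case: eqP => // e; move: hi; rewrite e mins_j ltnn //.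
  rewrite coefC; case: (eqVneq (i - m j)%N 0%N) => hij.
    rewrite mcoeffCM mcoeffX; have {hi hij} -> : i = m j by lia.
    have -> : (mdel m == d) = (m == mins (m j) d).
      apply/eqP/eqP => [<-|e]; first by rewrite mins_del.
      by rewrite e mdel_ins.
    by case: eqP => _; rewrite ?mulr1 ?mulr0.
  rewrite mcoeff0; case: eqP => // e; case/eqP: hij; rewrite e mins_j subnn //.
rewrite -big_mkcond /=; case: (boolP (mins i d \in msupp P)) => hP.
  rewrite (big_rem _ hP) /= eqxx big1_seq ?addr0 // => m /andP[/eqP ->].
  by rewrite mem_rem_uniqF.
rewrite (memN_msupp_eq0 hP) big1_seq // => m /andP[/eqP -> h].
by rewrite h in hP.
Qed.

Lemma peel_is_additive : additive peel. Proof. by []. Qed.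
Lemma peel_is_monoid : monoid_morphism peel.
Proof.
split=> [|a b]; apply/funext => i; apply/funext => d.
  rewrite /peel fps1E ser1E; case: (eqVneq i 0%N) => [->|i0]; last first.
    case: eqP => // e; case/eqP: i0.
    by have := congr1 (fun m : multinom n.+1 => m j) e; rewrite /= mins_j mnm0E.
  rewrite -[true%:R]/(1 : fps K n) fps1E; congr (_%:R); congr nat_of_bool.
  apply/eqP/eqP => [e|->].
    by rewrite -(mdel_ins 0 d) e; apply/mnmP => l; rewrite !mnmE.
  by apply/mnmP => l; rewrite !mnmE; case: unliftP => // *; rewrite mnm0E.
pose B := (mdeg (mins i d)).+1.
rewrite {1}/peel (@fps_mul_tr _ _ B) // -PhiE /Phi rmorphM -/(Phi _) -/(Phi _).
rewrite coefM raddf_sum serME fps_sumE /=; apply: eq_bigr => k _.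
apply/esym/fps_mulE => e he; rewrite PhiE (@fps_tr_le _ _ _ _ (mdeg (mins i d))) //.
  by rewrite !mdeg_mins leq_add // -ltnS.
by rewrite !mdeg_mins leq_add // leq_subr.
Qed.
HB.instance Definition _ := GRing.isZmodMorphism.Build (fps K n.+1) (ser (fps K n)) peel peel_is_additive.
HB.instance Definition _ := GRing.isMonoidMorphism.Build (fps K n.+1) (ser (fps K n)) peel peel_is_monoid.

Lemma unpeel_is_additive : additive unpeel. Proof. by []. Qed.
Lemma unpeel_is_monoid : monoid_morphism unpeel.
Proof.
split=> [|a b]; apply: (can_inj peelK); rewrite ?rmorph1 ?unpeelK // rmorphM /=.
by rewrite !unpeelK.
Qed.
HB.instance Definition _ := GRing.isZmodMorphism.Build (ser (fps K n)) (fps K n.+1) unpeel unpeel_is_additive.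
HB.instance Definition _ := GRing.isMonoidMorphism.Build (ser (fps K n)) (fps K n.+1) unpeel unpeel_is_monoid.

Lemma peel_inj : injective peel. Proof. exact: can_inj peelK. Qed.

Lemma peel_Xj : peel (fps_X K j) = serX _.
Proof.
apply/funext => i; apply/funext => d; rewrite /peel /fps_X /serX.
case: (eqVneq i 1%N) => [->|i1].
  rewrite -[true%:R]/(1 : fps K n) fps1E; congr (_%:R); congr nat_of_bool.
  apply/eqP/eqP => [e|->].
    by rewrite -(mdel_ins 1 d) e; apply/mnmP => l; rewrite !mnmE (negbTE (neq_lift _ _)).
  by apply/mnmP => l; rewrite !mnmE; case: unliftP => [l' ->|->]; rewrite ?mnm0E ?eqxx // (negbTE (neq_lift _ _)).
case: eqP => // e; case/eqP: i1.
by have := congr1 (fun m : multinom n.+1 => m j) e; rewrite /= mins_j mnm1E eqxx.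
Qed.

Let lift_eqF l : (lift j l == j) = false.
Proof. by rewrite eq_sym (negbTE (neq_lift _ _)). Qed.

Lemma peel_X l : peel (fps_X K (lift j l)) = serC (fps_X K l).
Proof.
apply/funext => i; apply/funext => d; rewrite /peel /fps_X /serC.
have E i' : (mins i' d == mnm1 (lift j l)) = (i' == 0%N) && (d == mnm1 l).
  apply/eqP/andP => [e|[/eqP -> /eqP ->]].
    split; first by rewrite -(mins_j i' d) e mnm1E lift_eqF.
    apply/eqP; rewrite -(mdel_ins i' d) e; apply/mnmP => x; rewrite !mnmE.
    by rewrite (inj_eq lift_inj).
  apply/mnmP => x; rewrite !mnmE; case: unliftP => [x' ->|->].
    by rewrite (inj_eq lift_inj) mnm1E.
  by rewrite lift_eqF.
by rewrite E; case: eqP.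
Qed.

Lemma peel_const c : peel (@fps_const _ _ c) = serC (@fps_const _ _ c).
Proof.
apply/funext => i; apply/funext => d; rewrite /peel /fps_const /serC.
have E i' : (mins i' d == mnm0) = (i' == 0%N) && (d == mnm0).
  apply/eqP/andP => [e|[/eqP -> /eqP ->]].
    split; first by rewrite -(mins_j i' d) e mnm0E.
    by apply/eqP; rewrite -(mdel_ins i' d) e; apply/mnmP => x; rewrite !mnmE.
  by apply/mnmP => x; rewrite !mnmE; case: unliftP => // *; rewrite mnm0E.
by rewrite E; case: eqP.
Qed.

Lemma peel_dj a i : peel (fps_d j a) i = peel a i.+1 *+ i.+1.
Proof.
apply/funext => d; rewrite fpsMnE /peel /fps_d mins_j; congr (a _ *+ _).
apply/mnmP => l; rewrite mnmDE mnm1E !mnmE; case: unliftP => [l' ->|->].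
  by rewrite (negbTE (neq_lift _ _)) addn0.
by rewrite eqxx addn1.
Qed.

Lemma peel_d l a i : peel (fps_d (lift j l) a) i = fps_d l (peel a i).
Proof.
apply/funext => d; rewrite /peel /fps_d mins_lift; congr (a _ *+ _).
apply/mnmP => x; rewrite mnmDE mnm1E !mnmE; case: unliftP => [x' ->|->].
  by rewrite mnmDE mnm1E (inj_eq lift_inj).
by rewrite lift_eqF addn0.
Qed.

End Peel.

(** With one indeterminate peeled off, the lowest coefficients of two nonzero series have a nonzero
    product by induction on the number of indeterminates. *)
Lemma fps_mulf_eq0 (K : idomainType) n : GRing.integral_domain_axiom (fps K n).
Proof.
elim: n => [|n IH] f g fg0.
  have E (a b : fps K 0) : (a == b) = (a mnm0 == b mnm0).
    apply/eqP/eqP => [->//|e]; apply/funext => m.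
    by have -> : m = mnm0 by apply/mnmP => -[].
  have : (f * g) mnm0 = 0 by rewrite fg0.
  by rewrite -[LHS]/(fps_coef0 (f * g)) rmorphM !E => /eqP; rewrite mulf_eq0.
have : peel ord0 f * peel ord0 g = 0 by rewrite -rmorphM fg0 rmorph0.
have inj := @peel_inj K n ord0.
rewrite -(inj_eq inj f) -(inj_eq inj g) !rmorph0.
move: (peel ord0 f) (peel ord0 g) => {fg0 inj}f {}g /eqP; apply: contraTT.
rewrite negb_or => /andP[/ser_neq0[a fa hf]].
case/ser_neq0 => b gb hg; have [e _] := ser_lowM hf hg.
apply/eqP => fg0; move/esym: e; rewrite fg0 ser0E => /IH.
by rewrite (negbTE fa) (negbTE gb).
Qed.
HB.instance Definition _ (K : idomainType) n :=
  GRing.ComUnitRing_isIntegral.Build (fps K n) (@fps_mulf_eq0 K n).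

(** * Derivations and Taylor expansions *)

Section Derivations.
Variable R : comNzRingType.

Definition derivation (d : R -> R) : Prop :=
  {morph d : x y / x + y} /\ (forall x y, d (x * y) = d x * y + x * d y).

Variable d : R -> R.
Hypothesis hd : derivation d.

Lemma derD : {morph d : x y / x + y}. Proof. by case: hd. Qed.
Lemma derM x y : d (x * y) = d x * y + x * d y. Proof. by case: hd. Qed.
Lemma der0 : d 0 = 0.
Proof. by apply: (addrI (d 0)); rewrite -derD !addr0. Qed.
Lemma derN : {morph d : x / - x}.
Proof. by move=> x; apply: (addrI (d x)); rewrite -derD !subrr der0. Qed.
Lemma derB : {morph d : x y / x - y}.
Proof. by move=> x y; rewrite derD derN. Qed.
Lemma der1 : d 1 = 0.
Proof. by apply: (addrI (d 1)); rewrite addr0 -{3}[1]mulr1 derM mulr1 mul1r. Qed.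
Lemma derMn x k : d (x *+ k) = d x *+ k.
Proof. by elim: k => [|k IH]; rewrite ?mulr0n ?der0 // !mulrS derD IH. Qed.
Lemma derX x k : d (x ^+ k) = x ^+ k.-1 * d x *+ k.
Proof.
elim: k => [|k IH]; first by rewrite expr0 der1 mulr0n.
rewrite exprS derM IH; case: k {IH} => [|k] /=; first by rewrite expr0; ring.
by rewrite mulrnAr mulrA -exprS mulrC -mulrS.
Qed.
Lemma der_sum I (s : seq I) (P : pred I) (F : I -> R) :
  d (\sum_(i <- s | P i) F i) = \sum_(i <- s | P i) d (F i).
Proof.
elim: s => [|i s IH]; first by rewrite !big_nil der0.
by rewrite !big_cons; case: (P i); rewrite ?derD IH.
Qed.

End Derivations.

Definition dsystem (n : nat) (R : comNzRingType) (d : 'I_n -> R -> R) : Prop :=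
  (forall i, derivation (d i)) /\ (forall i j x, d i (d j x) = d j (d i x)).

Lemma fps_dsystem (K : comNzRingType) n : dsystem (@fps_d K n).
Proof. by split=> [i|i j x]; [split=> ? ?; [exact: fps_dD|exact: fps_dM]|exact: fps_dC]. Qed.

Definition char0 (R : nzRingType) : Prop := forall n, n.+1%:R != 0 :> R.

Lemma char0_morph (F : fieldType) (R : nzRingType) (f : {rmorphism F -> R}) :
  char0 F -> char0 R.
Proof.
move=> h n; rewrite -(rmorph_nat f); apply/eqP => e.
by have := congr1 (fun x => f (n.+1%:R^-1) * x) e; rewrite mulr0 -rmorphM mulVf // rmorph1 => /eqP; rewrite oner_eq0.
Qed.

Section Taylor.
Variables (n : nat) (R : comNzRingType) (d : 'I_n -> R -> R).
Hypothesis hd : dsystem d.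

Definition dmon (m : multinom n) (x : R) : R :=
  foldr (fun i y => iter (m i) (d i) y) x (enum 'I_n).

Let iter_comm i j k x : iter k (d i) (d j x) = d j (iter k (d i) x).
Proof. by elim: k => //= k ->; case: hd => _ ->. Qed.

(** Since the derivations commute, the additional [d i] may be applied first; this is what turns a
    shift of the exponent into [taylor_d]. *)
Lemma dmonS m i x : dmon (mnm_add m (mnm1 i)) x = dmon m (d i x).
Proof.
rewrite /dmon; have : i \in enum 'I_n by rewrite mem_enum.
have := enum_uniq 'I_n; elim: (enum 'I_n) => // j s IH /= /andP[js us].
have notin s' : i \notin s' ->
    foldr (fun j y => iter (mnm_add m (mnm1 i) j) (d j) y) x s' =
    foldr (fun j y => iter (m j) (d j) y) x s'.
  elim: s' => //= l s' IH'; rewrite inE negb_or => /andP[il /IH' ->].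
  by rewrite mnmDE mnm1E (negbTE il) addn0.
have inside s' : foldr (fun j y => iter (m j) (d j) y) (d i x) s' =
    d i (foldr (fun j y => iter (m j) (d j) y) x s').
  by elim: s' => //= l s' ->; rewrite iter_comm.
rewrite inE => /orP[/eqP ij|/[dup] i_s /(IH us) ->].
  by subst j; rewrite notin // inside mnmDE mnm1E eqxx addn1 iterSr.
rewrite mnmDE mnm1E; case: eqP => [ij|_]; last by rewrite addn0.
by rewrite -ij i_s in js.
Qed.

Lemma dmon0 x : dmon mnm0 x = x.
Proof. by rewrite /dmon; elim: (enum 'I_n) => //= i s ->; rewrite mnm0E. Qed.

Variables (K : fieldType) (phi : {rmorphism R -> K}).
Hypothesis K0 : char0 K.

Definition mfact (m : multinom n) : nat := (\prod_i (m i)`!)%N.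

Lemma mfactS m i : mfact (mnm_add m (mnm1 i)) = ((m i).+1 * mfact m)%N.
Proof.
rewrite /mfact (bigD1 i) //= [in RHS](bigD1 i) //= mulnA mnmDE mnm1E eqxx addn1.
rewrite factS; congr (_ * _)%N; apply: eq_bigr => j ji.
by rewrite mnmDE mnm1E eq_sym (negbTE ji) addn0.
Qed.

(** The ring [R] plays the role of functions and [phi] that of evaluation at a point. In
    characteristic zero this series is determined by its constant term [phi x] and by compatibility
    with the derivations. *)
Definition taylor (x : R) : fps K n := fun m => phi (dmon m x) / (mfact m)%:R.

Lemma taylor0 x : taylor x mnm0 = phi x.
Proof. by rewrite /taylor dmon0 /mfact big1 ?divr1 // => i _; rewrite mnm0E. Qed.

Lemma taylor_d i x : fps_d i (taylor x) = taylor (d i x).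
Proof.
apply/funext => m; rewrite /fps_d /taylor dmonS mfactS natrM -[LHS]mulr_natr.
by rewrite invfM mulrA mulrAC -[_ * _ * _%:R]mulrA mulVf ?mulr1.
Qed.

Lemma dmonD m : {morph dmon m : x y / x + y}.
Proof.
move=> x y; rewrite /dmon; elim: (enum 'I_n) => //= i s ->.
by elim: (m i) => //= k ->; rewrite (derD (hd.1 i)).
Qed.

Lemma taylorD : {morph taylor : x y / x + y}.
Proof. by move=> x y; apply/funext => m; rewrite fpsDE /taylor dmonD rmorphD mulrDl. Qed.

Lemma taylor00 : taylor 0 = 0.
Proof. by apply: (addrI (taylor 0)); rewrite -taylorD !addr0. Qed.

(** Works as a coinduction principle: a relation which respects constant terms and is stable under
    all partial derivatives is contained in equality. *)
Lemma fps_char0_ind (f : fps K n -> fps K n -> Prop) :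
  (forall g h, f g h -> g mnm0 = h mnm0) ->
  (forall i g h, f g h -> f (fps_d i g) (fps_d i h)) ->
  forall g h, f g h -> g = h.
Proof.
apply: fps_ind => x y k e; apply: (mulIf (K0 k)).
by rewrite !mulr_natr.
Qed.

Lemma taylor_is_additive : additive taylor.
Proof.
move=> x y; apply: (addIr (taylor y)).
by rewrite -taylorD !subrK.
Qed.

Lemma taylor_is_monoid : monoid_morphism taylor.
Proof.
have [hder _] := hd; split.
  apply: (@fps_char0_ind (fun g h => g = h \/ (g = taylor 1 /\ h = 1))); last by right.
    by move=> g h [->|[-> ->]] //; rewrite taylor0 rmorph1 fps1E eqxx.
  move=> i g h [->|[-> ->]]; first by left.
  by left; rewrite taylor_d (der1 (hder i)) taylor00 -[1](@rmorph1 _ _ (@fps_const K n)) fps_d_const.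
(* A single product is not stable under derivation, but by Leibniz' rule finite sums of products
   are. *)
move=> x y; pose rel (g h : fps K n) := exists s : seq (R * R),
  g = taylor (\sum_(a <- s) a.1 * a.2) /\ h = \sum_(a <- s) taylor a.1 * taylor a.2.
apply: (@fps_char0_ind rel).
- move=> g h [s [-> ->]]; rewrite taylor0 rmorph_sum fps_sumE.
  apply: eq_bigr => a _; rewrite rmorphM -[RHS]/(fps_coef0 _) rmorphM.
  by rewrite -!taylor0.
- move=> i g h [s [-> ->]].
  exists (flatten [seq [:: (d i a.1, a.2); (a.1, d i a.2)] | a <- s]); split.
    rewrite taylor_d; congr taylor; elim: s => [|a s IH].
      by rewrite !big_nil (der0 (hder i)).
    by rewrite big_cons (derD (hder i)) IH (derM (hder i)) /= !big_cons /= addrA.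
  elim: s => [|a s IH] /=; first by rewrite !big_nil (der0 ((fps_dsystem K n).1 i)).
  by rewrite !big_cons fps_dD IH fps_dM !taylor_d /= addrA.
- by exists [:: (x, y)]; rewrite !big_seq1.
Qed.

Definition taylor_hom : {rmorphism R -> fps K n} := HB.pack taylor
  (GRing.isZmodMorphism.Build R (fps K n) taylor taylor_is_additive)
  (GRing.isMonoidMorphism.Build R (fps K n) taylor taylor_is_monoid).

End Taylor.

Lemma frac_numden (R : idomainType) (x : {fraction R}) :
  exists a b : R, b != 0 /\ x * FracField.tofrac b = FracField.tofrac a.
Proof.
elim/quotW: x => x; exists (fraction.frac x).1, (fraction.frac x).2.
split; first exact: denom_ratioP.
unlock FracField.tofrac; rewrite -[LHS]FracField.pi_mul.
apply/eqmodP => /=; rewrite FracField.equivfE /FracField.mulf !numden_Ratio;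
  by rewrite ?(oner_neq0, mul1r, mulr1) ?denom_ratioP // mulrC.
Qed.

Section FractionDerivation.
Variables (R : idomainType) (n : nat) (d : 'I_n -> R -> R).
Hypothesis hd : dsystem d.
Variables (F : fieldType) (tf : {rmorphism R -> F}).
Hypothesis tf_inj : injective tf.
Hypothesis tf_frac : forall x, exists a b : R, b != 0 /\ x * tf b = tf a.

Let num (x : F) : R := projT1 (cid (tf_frac x)).
Let den (x : F) : R := projT1 (cid (projT2 (cid (tf_frac x)))).
Let denP x : den x != 0 /\ x * tf (den x) = tf (num x).
Proof. exact: projT2 (cid (projT2 (cid (tf_frac x)))). Qed.

Definition frac_d i (x : F) : F :=
  (tf (d i (num x)) - x * tf (d i (den x))) / tf (den x).

Let tf0 b : b != 0 -> tf b != 0. Proof. by rewrite -(inj_eq tf_inj) rmorph0. Qed.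

(** Cross-multiplication of two fractions for [x], followed by differentiation, shows that the
    quotient rule does not depend on the fraction chosen in [frac_d]. *)
Lemma frac_dE i x a b : b != 0 -> x * tf b = tf a ->
  frac_d i x * tf b = tf (d i a) - x * tf (d i b).
Proof.
move=> b0 xb; have [c0 xc] := denP x; rewrite /frac_d; have [hder _] := hd.
move: (den x) (num x) c0 xc => c a' c0 xc.
have e : a * c = a' * b.
  by apply: tf_inj; rewrite !rmorphM -xb -xc; ring.
have := congr1 (fun y => tf (d i y)) e; rewrite !(derM (hder i)) !rmorphD !rmorphM -xb -xc => e'.
apply: (mulIf (tf0 c0)); rewrite -!mulrA [_^-1 * _]mulrC -!mulrA mulfV ?tf0 // mulr1.
apply/eqP; rewrite -subr_eq0; apply/eqP.
transitivity (tf (d i a') * tf b + x * tf c * tf (d i b)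
   - (tf (d i a) * tf c + x * tf b * tf (d i c))); first by ring.
by rewrite e' subrr.
Qed.

Lemma frac_d_tf i a : frac_d i (tf a) = tf (d i a).
Proof.
have := @frac_dE i (tf a) a 1 (oner_neq0 _); rewrite rmorph1 !mulr1 => -> //.
by rewrite (der1 (hd.1 i)) ?rmorph0 ?mulr0 ?subr0.
Qed.

Lemma frac_d_deriv i : derivation (frac_d i).
Proof.
have [hder _] := hd; split=> x y.
  have [c0 xc] := denP x; have [b0 yb] := denP y.
  have cb0 : den x * den y != 0 by rewrite mulf_neq0.
  apply: (mulIf (tf0 cb0)).
  rewrite (@frac_dE i _ (num x * den y + num y * den x)) //; last first.
    by rewrite rmorphD !rmorphM -xc -yb; ring.
  rewrite [RHS]mulrDl !rmorphM mulrA (frac_dE i c0 xc).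
  rewrite mulrCA (frac_dE i b0 yb) !(derD (hder i)) !(derM (hder i)) !rmorphD !rmorphM /=.
  by rewrite -xc -yb; ring.
have [c0 xc] := denP x; have [b0 yb] := denP y.
have cb0 : den x * den y != 0 by rewrite mulf_neq0.
apply: (mulIf (tf0 cb0)).
rewrite (@frac_dE i _ (num x * num y)) //; last first.
  by rewrite !rmorphM -xc -yb; ring.
rewrite !rmorphM [RHS](_ : _ = (frac_d i x * tf (den x)) * (y * tf (den y))
  + (x * tf (den x)) * (frac_d i y * tf (den y))); last by ring.
rewrite (frac_dE i c0 xc) (frac_dE i b0 yb) !(derM (hder i)) !rmorphD !rmorphM /=.
by rewrite -xc -yb; ring.
Qed.

Lemma frac_dsystem : dsystem frac_d.
Proof.
split=> [|i j x]; first exact: frac_d_deriv.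
have [b0 xb] := denP x; apply: (mulIf (tf0 b0)).
have Di := frac_d_deriv i; have Dj := frac_d_deriv j.
have h i' : frac_d i' x * tf (den x) = tf (d i' (num x)) - x * tf (d i' (den x)).
  exact: frac_dE.
(* The quotient rule for one derivation is differentiated by the other one, in both orders; the
   mixed terms agree. *)
have := congr1 (frac_d i) (h j); have := congr1 (frac_d j) (h i).
rewrite (derB Dj) (derB Di) !(derM Dj) !(derM Di) !frac_d_tf.
move=> /(canRL (addrK _)) -> /(canRL (addrK _)) ->.
rewrite (hd.2 i j) (hd.2 i j (den x)); ring.
Qed.

Lemma frac_dfield :
  exists (F : fieldType) (e : {rmorphism R -> F}) (d1 : 'I_n -> F -> F),
    [/\ dsystem d1, forall i x, d1 i (e x) = e (d i x) & injective e].
Proof. by exists F, tf, frac_d; split; [exact: frac_dsystem|exact: frac_d_tf|]. Qed.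

End FractionDerivation.

Lemma fraction_dfield (R : idomainType) n (d : 'I_n -> R -> R) : dsystem d ->
  exists (F : fieldType) (e : {rmorphism R -> F}) (d1 : 'I_n -> F -> F),
    [/\ dsystem d1, forall i x, d1 i (e x) = e (d i x) & injective e].
Proof.
move=> hd; have tf_inj : injective (@FracField.tofrac R).
  by move=> x y /eqP; rewrite tofrac_eq => /eqP.
exact: (frac_dfield hd tf_inj (@frac_numden R)).
Qed.

(** * Splitting fields with derivations *)

Section AdjoinRoot.
Variables (F : fieldType) (n : nat) (d : 'I_n -> F -> F).
Hypotheses (hd : dsystem d) (F0 : char0 F).

Lemma irreducible_divisor (p : {poly F}) : (1 < size p)%N ->
  exists2 g, irreducible_poly g & g %| p.
Proof.
elim: {p}(size p) {-2}p (leqnn (size p)) => [|k IH] p; first by case: size.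
move=> pk p1; have [irr|irr] := pselect (irreducible_poly p).
  by exists p.
have [q [q1 [qp nqp]]] : exists q : {poly F}, size q != 1%N /\ (q %| p /\ ~~ (q %= p)).
  apply: contrapT => h; apply: irr; split=> // q q1 qp.
  by apply: contrapT => /negP nqp; apply: h; exists q.
have p0 : p != 0 by rewrite -size_poly_gt0 ltnW.
have q0 : q != 0 by apply: contraTneq qp => ->; rewrite dvd0p.
have sq : (size q < size p)%N.
  by rewrite ltn_neqAle dvdp_leq // andbT dvdp_size_eqp.
have q2 : (1 < size q)%N by move: q0 q1; rewrite -size_poly_gt0; case: size => [|[]].
have [g ig gq] := IH q (leq_trans sq pk) q2.
by exists g => //; apply: dvdp_trans qp.
Qed.

(** In F[X]/(g) with g irreducible, the value [a i] of the derivation at the class z of X is forced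
    by D(g(z)) = 0, that is, (d g)(z) + g'(z) a = 0; characteristic zero gives g'(z) != 0. *)
Lemma adjoin_root (p : {poly F}) : (1 < size p)%N ->
  exists (F1 : fieldType) (e : {rmorphism F -> F1}) (d1 : 'I_n -> F1 -> F1) (z : F1),
    [/\ dsystem d1, forall i x, d1 i (e x) = e (d i x) & root (map_poly e p) z].
Proof.
move=> /irreducible_divisor[g ig gp].
have [L _ [z gz zL]] := irredp_FAdjoin ig.
pose e : {rmorphism F -> L} := in_alg L.
pose ev (q : {poly F}) : L := (map_poly e q).[z].
have evD q1 q2 : ev (q1 + q2) = ev q1 + ev q2 by rewrite /ev rmorphD hornerD.
have evM q1 q2 : ev (q1 * q2) = ev q1 * ev q2 by rewrite /ev rmorphM hornerM.
have evN q : ev (- q) = - ev q by rewrite /ev rmorphN hornerN.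
have evC c : ev c%:P = e c by rewrite /ev map_polyC hornerC.
have evg0 : ev g = 0 by apply/eqP: gz.
have ev0 q : ev q = 0 -> g %| q.
  move=> q0; apply: contrapT => /negP gq.
  have /Bezout_eq1_coprimepP[[u v] /= uv] : coprimep g q.
    apply: contraT; rewrite /coprimep => /(ig.2 _)/(_ (dvdp_gcdl _ _)) gq'.
    by case/negP: gq; rewrite -(eqp_dvdl _ gq') dvdp_gcdr.
  have := congr1 ev uv; rewrite evD !evM q0 mulr0 addr0 evg0 mulr0.
  by rewrite -[1]/(1%:P) evC rmorph1 => /eqP; rewrite eq_sym oner_eq0.
have surj x : exists q, x = ev q.
  have := memvf x; rewrite -zL.
  by case/Fadjoin1_polyP => q ->; exists q.
pose pd i (q : {poly F}) : {poly F} := map_poly (d i) q.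
have d0 i : d i 0 = 0 := der0 (hd.1 i).
have pdE i q j : (pd i q)`_j = d i q`_j by rewrite coef_map_id0.
have pdD i q1 q2 : pd i (q1 + q2) = pd i q1 + pd i q2.
  by apply/polyP => j; rewrite coefD !pdE coefD (derD (hd.1 i)).
have pdN i q : pd i (- q) = - pd i q.
  by apply/polyP => j; rewrite coefN !pdE coefN (derN (hd.1 i)).
have pdM i q1 q2 : pd i (q1 * q2) = pd i q1 * q2 + q1 * pd i q2.
  apply/polyP => j; rewrite coefD !coefM pdE coefM (der_sum (hd.1 i)) -big_split.
  by apply: eq_bigr => l _; rewrite !pdE (derM (hd.1 i)).
have pdC i c : pd i c%:P = (d i c)%:P.
  by apply/polyP => j; rewrite pdE !coefC; case: eqP.
have pd' i q : pd i q^`() = (pd i q)^`().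
  by apply/polyP => j; rewrite coef_deriv !pdE coef_deriv (derMn (hd.1 i)).
have pdpd i j q : pd i (pd j q) = pd j (pd i q).
  by apply/polyP => l; rewrite !pdE; case: hd => _ ->.
have g1 : (1 < size g)%N by case: ig.
have evg' : ev g^`() != 0.
  apply/eqP => /ev0; apply/negP; rewrite gtNdvdp //; last first.
    by apply: lt_size_deriv; rewrite -size_poly_gt0 ltnW.
  apply/eqP => /(congr1 (fun q : {poly F} => q`_(size g).-2)); rewrite coef_deriv coef0.
  case E : (size g) g1 => [|[|k]] // _; rewrite -[k.+2.-2.+1]/(k.+2.-1) -E => /eqP.
  rewrite -mulr_natr mulf_eq0 E (negbTE (F0 k)) orbF -E -lead_coefE lead_coef_eq0.
  by rewrite -size_poly_eq0 E.
pose a i : L := - ev (pd i g) / ev g^`().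
pose D0 i q := ev (pd i q) + ev q^`() * a i.
have D0g i : D0 i g = 0.
  by rewrite /D0 /a mulrCA mulfV // mulr1 subrr.
have D0D i q1 q2 : D0 i (q1 + q2) = D0 i q1 + D0 i q2.
  by rewrite /D0 pdD derivD !evD; ring.
have D0N i q : D0 i (- q) = - D0 i q by rewrite /D0 pdN derivN !evN; ring.
have D0M i q1 q2 : D0 i (q1 * q2) = D0 i q1 * ev q2 + ev q1 * D0 i q2.
  by rewrite /D0 pdM derivM !evD !evM; ring.
(* Two representatives differ by a multiple of [g], where both [ev] and [D0] vanish. *)
have D0w i q1 q2 : ev q1 = ev q2 -> D0 i q1 = D0 i q2.
  move=> e12; apply/eqP; rewrite -subr_eq0 -D0N -D0D.
  have : g %| q1 - q2 by apply: ev0; rewrite evD evN e12 subrr.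
  by case/dvdpP => r ->; rewrite D0M D0g evg0 !mulr0 addr0.
pose rep x := projT1 (cid (surj x)).
have repE x : ev (rep x) = x by rewrite /rep; case: cid.
pose D i x := D0 i (rep x).
have DE i q : D i (ev q) = D0 i q by apply: D0w; rewrite repE.
have Dder i : derivation (D i).
  split=> x y; rewrite -(repE x) -(repE y).
    by rewrite -evD !DE D0D.
  by rewrite -evM !DE D0M.
exists L, e, D, z; split.
- split=> // i j x.
  have key i' j' q : D i' (D j' (ev q)) = ev (pd i' (pd j' q)) + ev (pd j' q)^`() * a i'
      + (ev (pd i' q)^`() + ev q^`()^`() * a i') * a j' + ev q^`() * D i' (a j').
    rewrite DE {1}/D0 (derD (Dder _)) (derM (Dder _)) !DE /D0 pd'; ring.
  (* Commutation at the generator: apply the two derivations to g(z) = 0 in both orders and cancel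
     g'(z). *)
  have aa : D i (a j) = D j (a i).
    have : D i (D j (ev g)) = D j (D i (ev g)) by rewrite evg0 !(der0 (Dder _)).
    rewrite !key (pdpd i j) => h; apply: (mulfI evg').
    apply: (addrI (ev (pd j (pd i g)) + ev (pd j g)^`() * a i
      + (ev (pd i g)^`() + ev g^`()^`() * a i) * a j)); rewrite h; ring.
  by rewrite -(repE x) !key aa (pdpd i j); ring.
- by move=> i x; rewrite -evC DE /D0 pdC derivC -(polyC0 F) !evC rmorph0 mul0r addr0.
- by case/dvdpP: gp => q ->; rewrite rmorphM /= rootM gz orbT.
Qed.

End AdjoinRoot.

Section Splitting.
Variables (n : nat).

Lemma splitting_dfield (F : fieldType) (d : 'I_n -> F -> F) (p : {poly F}) :
  dsystem d -> char0 F -> p \is monic ->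
  exists (F1 : fieldType) (e : {rmorphism F -> F1}) (d1 : 'I_n -> F1 -> F1) (s : seq F1),
    [/\ dsystem d1, forall i x, d1 i (e x) = e (d i x) &
        map_poly e p = \prod_(a <- s) ('X - a%:P)].
Proof.
move: {2}(size p) (leqnn (size p)) => k.
elim: k F d p => [|k IH] F d p pk hd F0 pm.
  by move: pk (monic_neq0 pm); rewrite leqn0 size_poly_eq0 => ->.
have [p1|p1] := leqP (size p) 1.
  exists F, idfun, d, [::]; split=> //; rewrite big_nil map_poly_id //.
  have sp : size p = 1%N by move: (monic_neq0 pm) p1; rewrite -size_poly_eq0; case: size => [|[]].
  have /size_poly1P[c c0 pc] : size p == 1%N by rewrite sp.
  by move/monicP: pm; rewrite pc lead_coefC => ->.
have [F1 [e [d1 [z [hd1 ed1]]]]] := adjoin_root hd F0 p1.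
move=> /factor_theorem[q pq].
have pm1 : map_poly e p \is monic by rewrite map_monic.
have qm : q \is monic by move: pm1; rewrite pq monicMr ?monicXsubC.
have sq : (size q <= k)%N.
  have : size (map_poly e p) = (size q).+1.
    by rewrite pq size_Mmonic ?monic_neq0 ?monicXsubC // size_XsubC addnS addn1.
  by rewrite size_map_poly => sp; rewrite sp in pk.
have [F2 [e2 [d2 [s [hd2 ed2 qs]]]]] := IH F1 d1 q sq hd1 (char0_morph e F0) qm.
exists F2, (e2 \o e), d2, (rcons s (e2 z)); split=> //.
  by move=> i x /=; rewrite ed2 ed1.
by rewrite map_poly_comp /= pq rmorphM /= qs big_rcons /= map_polyXsubC; rewrite mulrC.
Qed.

End Splitting.

(** * Hensel factorization and the Puiseux theorem *)

Section HenselFactorization.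
Variable F : fieldType.
Implicit Types f g h : {poly ser F}.

(** Regards a polynomial over series as a series in t with polynomial coefficients, since Hensel's
    construction proceeds by powers of t. *)
Definition pcoef f : ser {poly F} := fun i => \poly_(j < size f) f`_j i.

Lemma pcoefE f i j : (pcoef f i)`_j = f`_j i.
Proof. by rewrite coef_poly; case: ltnP => // h; rewrite nth_default. Qed.

Lemma pcoef_inj : injective pcoef.
Proof.
move=> f g e; apply/polyP => j; apply/funext => i.
by rewrite -!pcoefE e.
Qed.

Lemma pcoefM f g : pcoef (f * g) = pcoef f * pcoef g.
Proof.
apply/funext => i; apply/polyP => j; rewrite pcoefE coefM ser_sumE serME coef_sum.
under eq_bigr => l _ do rewrite serME.
rewrite exchange_big; apply: eq_bigr => a _; rewrite coefM; apply: eq_bigr => l _.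
by rewrite !pcoefE.
Qed.

Lemma pcoef_ser0 f : map_poly (@ser0 F) f = pcoef f 0%N.
Proof. by apply/polyP => j; rewrite coef_map. Qed.

Lemma size_pcoef_monic f i : f \is monic -> (size (pcoef f i.+1) < size f)%N.
Proof.
move=> fm; have := monic_neq0 fm; rewrite -size_poly_eq0.
case E: (size f) => [//|k] _; rewrite ltnS; apply/leq_sizeP => j.
rewrite leq_eqVlt pcoefE => /orP[/eqP <-|kj]; last by rewrite nth_default ?E.
by move/monicP: fm; rewrite lead_coefE E /= => ->; rewrite ser1E.
Qed.

Lemma hensel f (g0 h0 : {poly F}) : f \is monic -> g0 \is monic -> h0 \is monic ->
  coprimep g0 h0 -> map_poly (@ser0 F) f = g0 * h0 ->
  exists g h : {poly ser F}, [/\ f = g * h, g \is monic, h \is monic,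
    map_poly (@ser0 F) g = g0 & map_poly (@ser0 F) h = h0].
Proof.
move=> fm gm hm cop f0; have [[u v] /= uv] := Bezout_eq1_coprimepP _ _ cop.
have sf : size f = (size g0 + size h0).-1.
  by rewrite -size_Mmonic ?monic_neq0 // -f0 size_map_poly_id0 // (monicP fm) rmorph1 oner_eq0.
(* What the factors of order i in t still have to produce: the coefficient of t^i in f less the
   products of terms of orders between 1 and i - 1. *)
pose r i (x : nat -> {poly F} * {poly F}) :=
  pcoef f i - \sum_(l < i.-1) (x l.+1).1 * (x (i.-1 - l)%N).2.
(* By Bezout, [v * r] solves h0 G = r modulo g0; reduction modulo g0 bounds the degree, and then
   [Hi] is an exact quotient. *)
pose Gi i x := (v * r i x) %% g0.
pose Hi i x := (r i x - h0 * Gi i x) %/ g0.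
pose St i x := if i is 0 then (g0, h0) else (Gi i x, Hi i x).
have [x xE] : exists x, forall i, x i = St i x.
  apply: (triangular_rec (0, 0)) => -[//|i] x y xy /=.
  have rxy : r i.+1 x = r i.+1 y.
    congr (_ - _); apply: eq_bigr => l _ /=; rewrite !xy //.
      by rewrite ltnS leq_subr.
    by rewrite ltnS.
  by rewrite /Hi /Gi rxy.
have x0 : x 0%N = (g0, h0) by rewrite xE.
have [g00 h00] : g0 != 0 /\ h0 != 0 by rewrite !monic_neq0.
have sg0 : (0 < size g0)%N by rewrite size_poly_gt0.
have sh0 : (0 < size h0)%N by rewrite size_poly_gt0.
(* The degree bounds and the equation are proved together, because the bound on [r] needs those of
   all earlier terms. *)
have key i : (size (x i.+1).1 < size g0)%N /\ (size (x i.+1).2 < size h0)%N /\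
    g0 * (x i.+1).2 + h0 * (x i.+1).1 = r i.+1 x.
  elim/ltn_ind: i => i IH.
  have sG : (size (x i.+1).1 < size g0)%N by rewrite xE /= ltn_modp.
  have e1 : (x i.+1).1 = (v * r i.+1 x) %% g0 by rewrite xE.
  have e2 : (x i.+1).2 = (r i.+1 x - h0 * (x i.+1).1) %/ g0 by rewrite e1 xE.
  have dv : g0 %| r i.+1 x - h0 * (x i.+1).1.
    apply/dvdpP; exists (r i.+1 x * u + h0 * ((v * r i.+1 x) %/ g0)).
    have e3 : (x i.+1).1 = v * r i.+1 x - (v * r i.+1 x) %/ g0 * g0.
      by rewrite {1}(divp_eq (v * r i.+1 x) g0) e1 addrAC subrr add0r.
    by rewrite e3 -{1}[r i.+1 x]mulr1 -uv; ring.
  have sr : (size (r i.+1 x) < size f)%N.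
    have sf0 : (0 < size f)%N by rewrite size_poly_gt0 monic_neq0.
    rewrite -(prednK sf0) ltnS /r (leq_trans (size_polyD _ _)) // geq_max size_polyN.
    rewrite -ltnS (prednK sf0) size_pcoef_monic //= (leq_trans (size_sum _ _ _)) //.
    apply/bigmax_leqP => l _; apply: leq_trans (size_polyMleq _ _) _.
    have [s1 _] := IH l (ltn_ord l).
    have [_ [s2 _]] := IH (i - l.+1)%N ltac:(have := ltn_ord l; lia).
    rewrite subnSK ?ltn_ord // in s2.
    by rewrite sf; lia.
  have e4 : g0 * (x i.+1).2 = r i.+1 x - h0 * (x i.+1).1.
    by rewrite e2 mulrC divpK.
  split=> //; split; last by rewrite e4 subrK.
  have [->|H0] := eqVneq (x i.+1).2 0; first by rewrite size_poly0.
  have := congr1 (fun p : {poly F} => size p) e4.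
  rewrite size_proper_mul ?mulf_neq0 ?lead_coef_eq0 // => e5.
  have : (size (r i.+1 x - h0 * (x i.+1).1)%R < size f)%N.
    rewrite (leq_ltn_trans (size_polyD _ _)) // gtn_max sr size_polyN /=.
    apply: leq_ltn_trans (size_polyMleq _ _) _; rewrite sf; lia.
  by rewrite -e5 sf; lia.
pose g : {poly ser F} := \poly_(j < size g0) ((fun i => (x i).1`_j) : ser F).
pose h : {poly ser F} := \poly_(j < size h0) ((fun i => (x i).2`_j) : ser F).
have s1 i : (size (x i).1 <= size g0)%N.
  by case: i => [|i]; [rewrite x0|have [/ltnW] := key i].
have s2 i : (size (x i).2 <= size h0)%N.
  by case: i => [|i]; [rewrite x0|have [_ [/ltnW]] := key i].
have pg : pcoef g = fun i => (x i).1.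
  apply/funext => i; apply/polyP => j; rewrite pcoefE coef_poly.
  by case: ltnP => // hj; rewrite ser0E nth_default // (leq_trans _ hj).
have ph : pcoef h = fun i => (x i).2.
  apply/funext => i; apply/polyP => j; rewrite pcoefE coef_poly.
  by case: ltnP => // hj; rewrite ser0E nth_default // (leq_trans _ hj).
have mon (y : nat -> {poly F}) (p : {poly ser F}) p0 : p0 \is monic -> y 0%N = p0 ->
    (forall i, (size (y i.+1) < size p0)%N) -> pcoef p = y -> (size p <= size p0)%N -> p \is monic.
  move=> p0m y0 ys py sp.
  have p0s : (0 < size p0)%N by rewrite size_poly_gt0 monic_neq0.
  have c1 : p`_(size p0).-1 = 1.
    apply/funext => i; rewrite -pcoefE py ser1E; case: i => [|i].
      by rewrite y0 -lead_coefE (monicP p0m).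
    by rewrite nth_default // -ltnS prednK.
  apply/monicP; rewrite lead_coefE; suff -> : size p = size p0 by [].
  apply/eqP; rewrite eqn_leq sp -(prednK p0s) ltnNge; apply/negP => /leq_sizeP/(_ _ (leqnn _)).
  by rewrite c1 => /eqP; rewrite oner_eq0.
exists g, h; split.
- apply: pcoef_inj; rewrite pcoefM pg ph; apply/funext => -[|i].
    by rewrite serM0 x0 /= -f0 pcoef_ser0.
  have [_ [_ e]] := key i.
  have -> : pcoef f i.+1 = g0 * (x i.+1).2 + h0 * (x i.+1).1 +
      \sum_(l < i) (x l.+1).1 * (x (i - l)%N).2 by rewrite e /r /= subrK.
  rewrite serME big_ord_recl big_ord_recr /= subn0 subnn x0 /=.
  rewrite [h0 * _]mulrC -addrA [X in _ + X]addrC; congr (_ + (_ + _)).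
- apply: (mon _ _ _ gm _ _ pg); rewrite ?x0 ?size_poly //.
  by move=> i; have [] := key i.
- apply: (mon _ _ _ hm _ _ ph); rewrite ?x0 ?size_poly //.
  by move=> i; have [_ []] := key i.
- by rewrite pcoef_ser0 pg x0.
- by rewrite pcoef_ser0 ph x0.
Qed.

End HenselFactorization.

Lemma size_map_monic (R S : comNzRingType) (e : {rmorphism R -> S}) (f : {poly R}) :
  f \is monic -> size (map_poly e f) = size f.
Proof. by move=> fm; rewrite size_map_poly_id0 // (monicP fm) rmorph1 oner_neq0. Qed.

Lemma prod_XsubC_shift (R : comNzRingType) (b : seq R) c :
  (\prod_(a <- b) ('X - a%:P)) \Po ('X + c%:P) = \prod_(a <- [seq a - c | a <- b]) ('X - a%:P).
Proof.
elim: b => [|a b IH]; first by rewrite !big_nil comp_polyC.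
rewrite big_cons comp_polyM IH /= big_cons comp_polyB comp_polyX comp_polyC.
by rewrite polyCB; congr (_ * _); ring.
Qed.

(** For [f] of degree [k] this is c^k f(z/c), written without division. *)
Definition scale_roots (R : comNzRingType) k (c : R) (f : {poly R}) : {poly R} :=
  \poly_(j < k.+1) (f`_j * c ^+ (k - j)).

Lemma scale_roots_prod (R : comNzRingType) (c : R) (b : seq R) :
  scale_roots (size b) c (\prod_(a <- b) ('X - a%:P)) =
  \prod_(a <- [seq c * a | a <- b]) ('X - a%:P).
Proof.
elim: b => [|a b IH] /=.
  apply/polyP => j; rewrite !big_nil coef_poly; case: j => [|j] /=; rewrite coef1 //.
  by rewrite expr0 mulr1.
have sb : size (\prod_(a <- b) ('X - a%:P)) = (size b).+1 by rewrite size_prod_XsubC.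
rewrite !big_cons -IH; move: (\prod_(a <- b) _) sb => f sf.
apply/polyP => j; rewrite !coefE !mulrBl !coefB !coefXM !coefCM.
case: j => [|j] /=; first by rewrite !coef_poly /= !subn0 exprS; ring.
rewrite !coefE !ltnS subSS; case: (ltngtP j (size b)) => jb.
- by rewrite -(subnSK jb) exprS; ring.
- by rewrite mulr0 subrr.
- by rewrite jb subnn expr0 (@nth_default _ _ _ (size b).+1) ?sf //; ring.
Qed.

Lemma prod_nseq (R : comNzRingType) (T : Type) m (x : T) (G : T -> R) :
  \prod_(a <- nseq m x) G a = G x ^+ m.
Proof. by elim: m => [|m IH] /=; rewrite ?big_nil ?expr0 // big_cons IH exprS. Qed.

Lemma sum_nseq (R : comNzRingType) m (x : R) : \sum_(a <- nseq m x) a = x *+ m.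
Proof. by elim: m => [|m IH] /=; rewrite ?big_nil ?mulr0n // big_cons IH mulrS. Qed.

Definition ser_ord (R : comNzRingType) (a : ser R) : nat :=
  if pselect (exists n, a n != 0) is left h then ex_minn h else 0%N.

Lemma ser_ordP (R : comNzRingType) (a : ser R) : a != 0 ->
  a (ser_ord a) != 0 /\ forall i, (i < ser_ord a)%N -> a i = 0.
Proof.
move=> /ser_neq0[l an _]; rewrite /ser_ord; case: pselect => [h|[]]; last by exists l.
case: ex_minnP => m am mmin; split=> // i im.
by apply: contraTeq im => ai; rewrite -leqNgt mmin.
Qed.

(** In degree i a Newton-Puiseux step ramifies by i! and leads to factors of smaller degree. The
    product of these factorials serves every polynomial of degree [k], whatever its coefficients. *)
Definition puiseux_index (k : nat) : nat := (\prod_(i < k) i.+1`!)%N.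

Lemma puiseux_index_gt0 k : (0 < puiseux_index k)%N.
Proof. by rewrite prodn_gt0 // => i; apply: fact_gt0. Qed.

Lemma puiseux_index_dvd k l : (k <= l)%N -> (puiseux_index k %| puiseux_index l)%N.
Proof.
move=> kl; rewrite /puiseux_index -(subnKC kl); elim: (l - k)%N => [|m IH].
  by rewrite addn0.
by rewrite addnS big_ord_recr dvdn_mulr.
Qed.

Section Puiseux.
Variable n : nat.

(** The field extension keeps the derivations, because derivatives of the Puiseux roots with respect
    to the remaining coordinates will be taken. *)
Definition puiseux_splits (F : fieldType) (d : 'I_n -> F -> F) (p : nat) (f : {poly ser F}) :=
  exists (F1 : fieldType) (e : {rmorphism F -> F1}) (d1 : 'I_n -> F1 -> F1) (b : seq (ser F1)),
    [/\ dsystem d1, forall i x, d1 i (e x) = e (d i x) &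
        map_poly (ser_ramp p.-1) (map_poly (ser_map e) f) = \prod_(a <- b) ('X - a%:P)].

Lemma ser_map_ramp (R S : comNzRingType) (e : {rmorphism R -> S}) p (a : ser R) :
  ser_map e (ser_ramp p a) = ser_ramp p (ser_map e a).
Proof.
apply/funext => i; rewrite /ser_map /ser_ramp /ser_ram.
by case: ifP => // _; rewrite rmorph0.
Qed.

Lemma ser_ramp_ramp (R : comNzRingType) p q (a : ser R) : (0 < p)%N -> (0 < q)%N ->
  ser_ramp p.-1 (ser_ramp q.-1 a) = ser_ramp (q * p).-1 a.
Proof.
move=> p0 q0; rewrite /ser_ramp !prednK ?muln_gt0 ?p0 ?q0 //.
apply/funext => i; rewrite /ser_ram; case: ifP => hp; last first.
  case: ifP => // hqp; case/idP: hp; exact: dvdn_trans (dvdn_mull q (dvdnn p)) hqp.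
rewrite dvdn_divRL //; case: ifP => // hq.
by rewrite -divnMA mulnC.
Qed.

Lemma ser_map_comp (R S T : comNzRingType) (e : {rmorphism R -> S}) (e' : {rmorphism S -> T}) (f : {poly ser R}) :
  map_poly (ser_map (e' \o e)) f = map_poly (ser_map e') (map_poly (ser_map e) f).
Proof. by rewrite -map_poly_comp. Qed.

Lemma puiseux_splits_ext (F F1 : fieldType) (e : {rmorphism F -> F1}) d d1 p f :
  (forall i x, d1 i (e x) = e (d i x)) ->
  @puiseux_splits F1 d1 p (map_poly (ser_map e) f) -> @puiseux_splits F d p f.
Proof.
move=> ed [F2 [e2 [d2 [b [hd2 ed2 fb]]]]]; exists F2, (e2 \o e), d2, b; split=> //.
  by move=> i x /=; rewrite ed2 ed.
by rewrite ser_map_comp.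
Qed.

Lemma puiseux_splits_shift (F : fieldType) d p (f : {poly ser F}) c :
  puiseux_splits d p (f \Po ('X - c%:P)) -> puiseux_splits d p f.
Proof.
move=> [F1 [e [d1 [b [hd ed fb]]]]].
exists F1, e, d1, [seq a - ser_ramp p.-1 (ser_map e c) | a <- b]; split=> //.
rewrite -prod_XsubC_shift -fb !map_comp_poly /= !map_polyXsubC -comp_polyA.
by rewrite comp_polyB comp_polyX comp_polyC addrK comp_polyXr.
Qed.

(* [f] is obtained from [g] by the substitution z = t^m z'. *)
Lemma puiseux_splits_scale (F : fieldType) d p q (f g : {poly ser F}) m :
  (0 < p)%N -> (0 < q)%N -> g \is monic ->
  map_poly (ser_ramp q.-1) f = scale_roots (size g).-1 (serX F ^+ m) g ->
  puiseux_splits d p g -> puiseux_splits d (q * p) f.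
Proof.
move=> p0 q0 gm fg [F1 [e [d1 [b [hd ed gb]]]]].
pose c := ser_ramp p.-1 (ser_map e (serX F ^+ m)).
exists F1, e, d1, [seq c * a | a <- b]; split=> //.
have -> : map_poly (ser_ramp (q * p).-1) (map_poly (ser_map e) f) =
    map_poly (ser_ramp p.-1) (map_poly (ser_map e) (map_poly (ser_ramp q.-1) f)).
  apply/polyP => j; rewrite !coef_map /= ser_map_ramp ser_ramp_ramp //.
have sg : (size g).-1 = size b.
  have : size (\prod_(a <- b) ('X - a%:P)) = (size b).+1 by rewrite size_prod_XsubC.
  by rewrite -gb !size_map_monic ?monic_map // => ->.
rewrite fg -scale_roots_prod -gb -sg; apply/polyP => j.
rewrite [LHS]coef_map (coef_map (ser_map e)) [in LHS]coef_poly [RHS]coef_poly /=.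
case: ltnP => _; last by rewrite !rmorph0.
rewrite (coef_map (ser_ramp _)) (coef_map (ser_map e)) /= rmorphM /= rmorphM /=.
by congr (_ * _); rewrite /c -[RHS]rmorphXn /= -[in RHS]rmorphXn.
Qed.

(** After a shift that makes the sum of the roots zero and a substitution given by the least slope
    of the Newton polygon, the polynomial reduced at t = 0 is not a power of a linear one; Hensel's
    lemma then lowers the degree. *)
Lemma puiseux (F : fieldType) (d : 'I_n -> F -> F) (f : {poly ser F}) k p :
  dsystem d -> char0 F -> f \is monic -> size f = k.+1 ->
  (0 < p)%N -> (puiseux_index k %| p)%N -> puiseux_splits d p f.
Proof.
elim/ltn_ind: k F d f p => k IH F d f p hd F0 fm sf p0 kp.
case: k => [|k] in IH sf kp *.
  exists F, idfun, d, [::]; split=> //; rewrite big_nil.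
  have /size_poly1P[c _ fc] : size f == 1%N by rewrite sf.
  by move/monicP: fm; rewrite fc lead_coefC => ->; rewrite !rmorph1.
(* The degree is [k.+1] here; this shift removes the coefficient of z^k. *)
pose c := serC (k.+1%:R^-1) * f`_k; apply: (@puiseux_splits_shift _ _ _ _ c).
have sX : size ('X - c%:P) = 2 by rewrite size_XsubC.
set f1 := f \Po _; have f1m : f1 \is monic.
  apply/monicP; rewrite lead_coef_comp ?sX // (monicP fm) lead_coefXsubC mul1r.
  by rewrite expr1n.
have sf1 : size f1 = k.+2 by rewrite size_comp_poly2 // sX.
have f1top : f1`_k.+1 = 1 by move/monicP: f1m; rewrite lead_coefE sf1.
have f1k : f1`_k = 0.
  have cX i : ('X - c%:P) ^+ i.+1 = \prod_(a <- nseq i.+1 c) ('X - a%:P).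
    by rewrite prod_nseq.
  have sXn i : size (('X - c%:P) ^+ i) = i.+1 by rewrite size_exp_XsubC.
  have fk1 : f`_k.+1 = 1 by move/monicP: fm; rewrite lead_coefE sf.
  rewrite /f1 comp_polyE sf !big_ord_recr /= !coefD coef_sum big1 => [|i _]; last first.
    by rewrite coefZ [X in _ * X]nth_default ?mulr0 // sXn.
  rewrite add0r !coefZ fk1 mul1r cX.
  have := @coefPn_prod_XsubC _ (nseq k.+1 c); rewrite size_nseq sum_nseq => -> //.
  have : lead_coef (('X - c%:P) ^+ k) = 1 by apply/monicP; rewrite monic_exp ?monicXsubC.
  rewrite lead_coefE sXn /= => ->; rewrite mulr1.
  apply/eqP; rewrite subr_eq0; apply/eqP.
  by apply/funext => i; rewrite serMnE /c serCM -[RHS]mulr_natr mulrAC mulVf ?mul1r.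
have [f1X|f1X] := eqVneq f1 'X^(k.+1).
  exists F, idfun, d, (nseq k.+1 0); split=> //.
  by rewrite prod_nseq f1X !map_polyXn subr0.
have [j1 hj1] : exists j : 'I_k.+1, f1`_j != 0.
  apply/existsP; apply: contraNT f1X => /existsPn h; apply/eqP/polyP => j.
  rewrite coefXn; case: (ltngtP j k.+1) => hj.
  - by have := h (Ordinal hj); rewrite negbK => /eqP.
  - by rewrite nth_default // sf1.
  - by rewrite hj.
(* [wt j] is [N] times the slope ord(f_j) / (k + 1 - j), an integer; the least one, [rho], is used
   in z = t^rho z' after t -> t^N. *)
pose N := (k.+1)`!; have N0 : (0 < N)%N by apply: fact_gt0.
pose wt (j : 'I_k.+1) := (ser_ord (f1`_j)%R * (N %/ (k.+1 - j)))%N.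
have Nd (j : 'I_k.+1) : (N %/ (k.+1 - j) * (k.+1 - j))%N = N.
  by rewrite divnK // dvdn_fact // subn_gt0 ltn_ord leq_subr.
have [j0 hj0 j0min] := @arg_minnP _ j1 (fun j => f1`_j != 0) wt hj1; set rho := wt j0.
pose a (j : nat) : ser F := ser_drop ((k.+1 - j) * rho) (ser_ramp N.-1 f1`_j).
have aE (j : 'I_k.+1) : ser_ramp N.-1 f1`_j = serX F ^+ ((k.+1 - j) * rho) * a j.
  apply: ser_divX => i hi; have [fj0|fj0] := eqVneq f1`_j 0.
    by rewrite fj0 rmorph0.
  rewrite /ser_ramp /ser_ram prednK //; case: ifP => // /dvdnP[l il].
  have [_ ->] // := ser_ordP fj0; rewrite il mulnK //.
  move: hi; rewrite il -[in (l * N)%N](Nd j); have := j0min j fj0; rewrite -/rho /wt.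
  have := Nd j; have := ltn_ord j; set u := (N %/ _)%N; set v := (k.+1 - j)%N.
  move=> _ uv h1 h2; have u0 : (0 < u)%N by move: N0; rewrite -uv muln_gt0 => /andP[].
  have v0 : (0 < v)%N by move: N0; rewrite -uv muln_gt0 => /andP[].
  have : (l * (u * v) < v * (ser_ord (f1`_j)%R * u))%N.
    by apply: leq_trans h2 _; rewrite leq_mul2l h1 orbT.
  by rewrite mulnA mulnC ltn_pmul2l // ltn_pmul2r.
pose g : {poly ser F} := \poly_(j < k.+2) (if j == k.+1 then 1 else a j).
have sg : size g = k.+2 by rewrite size_poly_eq //= eqxx oner_neq0.
have gm : g \is monic by apply/monicP; rewrite lead_coefE sg /= coef_poly ltnSn eqxx.
have Np : (N %| p)%N.
  by apply: dvdn_trans kp; rewrite /puiseux_index big_ord_recr /= dvdn_mull.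
have p0' : (0 < p %/ N)%N by rewrite divn_gt0 // dvdn_leq.
have kp' : (puiseux_index k %| p %/ N)%N.
  by rewrite dvdn_divRL // -/N; move: kp; rewrite /puiseux_index big_ord_recr.
rewrite -(divnK Np) mulnC; apply: (@puiseux_splits_scale _ _ _ _ _ g rho) => //.
  rewrite sg; apply/polyP => j; rewrite coef_map /scale_roots coef_poly /= coef_poly ltnS.
  case: (ltngtP j k.+1) => hj.
  - have hj' : (j < k.+1)%N by []. rewrite (aE (Ordinal hj')) /= -exprM mulnC.
    by rewrite mulrC.
  - by rewrite nth_default ?sf1 // rmorph0.
  - by rewrite hj f1top rmorph1 subnn expr0 mulr1.
(* At t = 0 the coefficient of z^k is still missing, while the one at the index [j0] of least slope
   survives. *)
have g0k : (map_poly (@ser0 F) g)`_k = 0.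
  rewrite coef_map coef_poly /= ltnW // ltn_eqF // /a f1k rmorph0 //.
have g0j : (map_poly (@ser0 F) g)`_j0 != 0.
  have jk := ltn_ord j0; rewrite coef_map coef_poly (leq_trans jk (leqnSn _)) (ltn_eqF jk).
  rewrite /= /ser0 /a /ser_drop.
  rewrite add0n /rho /wt mulnCA [((k.+1 - _) * _)%N]mulnC Nd /ser_ramp prednK // ser_ramE //.
  by case: (ser_ordP hj0).
have g0m : map_poly (@ser0 F) g \is monic by rewrite monic_map.
have sg0 : size (map_poly (@ser0 F) g) = k.+2 by rewrite size_map_monic.
have [|F1 [e [d1 [z [hd1 ed1 rz]]]]] := @adjoin_root F n d hd F0 (map_poly (@ser0 F) g).
  by rewrite sg0.
apply: (puiseux_splits_ext ed1); set G := map_poly (ser_map e) g.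
have F10 := char0_morph e F0.
have Gm : G \is monic by rewrite monic_map.
have G0 : map_poly (@ser0 F1) G = map_poly e (map_poly (@ser0 F) g).
  by apply/polyP => j; rewrite !coef_map.
have [m [q nq Gq]] := multiplicity_XsubC (map_poly e (map_poly (@ser0 F) g)) z.
have eg0m : map_poly e (map_poly (@ser0 F) g) \is monic by rewrite monic_map.
have {}nq : ~~ root q z by move: nq; rewrite monic_neq0.
have qm : q \is monic by move: eg0m; rewrite Gq monicMr // monic_exp ?monicXsubC.
have sq0 : (0 < size q)%N by rewrite size_poly_gt0 monic_neq0.
have sGq : (size q + m)%N = k.+2.
  move: sg0; rewrite -(size_map_monic e g0m) Gq size_Mmonic ?monic_neq0 //.
    by rewrite size_exp_XsubC addnS.
  by rewrite monic_exp ?monicXsubC.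
have m0 : (0 < m)%N.
  rewrite lt0n; apply: contra nq => /eqP m0; move: rz.
  by rewrite Gq m0 expr0 mulr1.
(* A root of full multiplicity would have to be zero, the sum of the roots being zero, and then the
   coefficient at [j0] would vanish. *)
have sq1 : (1 < size q)%N.
  rewrite ltn_neqAle sq0 andbT eq_sym; apply/negP => /eqP sq1.
  have q1 : q = 1.
    have /size_poly1P[x _ qx] : size q == 1%N by rewrite sq1.
    by move/monicP: qm; rewrite qx lead_coefC => ->.
  have mk : m = k.+1 by move: sGq; rewrite sq1 add1n => -[].
  move: Gq; rewrite q1 mul1r mk => Gq.
  have z0 : z = 0.
    have : e (map_poly (@ser0 F) g)`_k = (('X - z%:P) ^+ k.+1)`_k by rewrite -coef_map Gq.
    rewrite g0k rmorph0.
    have -> : ('X - z%:P) ^+ k.+1 = \prod_(a <- nseq k.+1 z) ('X - a%:P).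
      by rewrite prod_nseq.
    have := @coefPn_prod_XsubC _ (nseq k.+1 z); rewrite size_nseq sum_nseq => -> //.
    move=> /esym/eqP; rewrite oppr_eq0.
    by rewrite -mulr_natr mulf_eq0 (negbTE (F10 k)) orbF => /eqP.
  move: g0j; rewrite -(fmorph_eq0 e) -coef_map Gq z0 subr0 coefXn.
  by rewrite ltn_eqF ?ltn_ord // eqxx.
have cop : coprimep (('X - z%:P) ^+ m) q by rewrite coprimep_expl // coprimep_sym coprimep_XsubC.
have [G1 [H1 [GE G1m H1m G10 H10]]] := hensel Gm (monic_exp m (monicXsubC z)) qm cop
  (etrans G0 (etrans Gq (mulrC _ _))).
have sG1 : size G1 = m.+1 by rewrite -(size_map_monic (@ser0 F1) G1m) G10 size_exp_XsubC.
have sH1 : size H1 = (size q).-1.+1 by rewrite prednK // -(size_map_monic (@ser0 F1) H1m) H10.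
have mk : (m <= k)%N by rewrite -(leq_add2l 2) -[(2 + k)%N]/(k.+2) -sGq leq_add2r.
have qk : ((size q).-1 <= k)%N.
  have : (size q + 1 <= k.+2)%N by rewrite -sGq leq_add2l.
  by rewrite addn1 ltnS; case: (size q) sq0.
have [F2 [e2 [d2 [b2 [hd2 ed2 Gb]]]]] := IH m mk F1 d1 G1 (p %/ N)%N hd1 F10 G1m sG1 p0'
  (dvdn_trans (puiseux_index_dvd mk) kp').
have sH2 : size (map_poly (ser_map e2) H1) = (size q).-1.+1 by rewrite size_map_monic.
(* The second factor is split over the extension which splits the first, so that both sets of roots
   lie in one field. *)
have [F3 [e3 [d3 [b3 [hd3 ed3 Hb]]]]] := IH _ qk F2 d2 (map_poly (ser_map e2) H1) (p %/ N)%N hd2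
  (char0_morph e2 F10) (monic_map _ H1m) sH2 p0' (dvdn_trans (puiseux_index_dvd qk) kp').
exists F3, (e3 \o e2), d3, ([seq ser_map e3 a | a <- b2] ++ b3); split=> //.
  by move=> i x /=; rewrite ed3 ed2.
rewrite GE !rmorphM /= big_cat big_map -Hb !ser_map_comp; congr (_ * _).
have -> : map_poly (ser_ramp (p %/ N).-1) (map_poly (ser_map e3) (map_poly (ser_map e2) G1)) =
    map_poly (ser_map e3) (map_poly (ser_ramp (p %/ N).-1) (map_poly (ser_map e2) G1)).
  by apply/polyP => j; rewrite !coef_map /= -ser_map_ramp.
rewrite Gb rmorph_prod; apply: eq_bigr => x _.
by rewrite /= map_polyXsubC.
Qed.

End Puiseux.

(** * Power sums and Hankel determinants *)

Section NewtonIdentities.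
Variable R : comNzRingType.
Implicit Types (s : seq R).

(** The reciprocal polynomial, whose logarithmic derivative generates the power sums. *)
Definition recip_prod s : {poly R} := \prod_(b <- s) (1 - b *: 'X).

Lemma size_recip_prod s : (size (recip_prod s) <= (size s).+1)%N.
Proof.
elim: s => [|b s IH]; first by rewrite /recip_prod big_nil size_poly1.
rewrite /recip_prod big_cons; apply: leq_trans (size_polyMleq _ _) _.
have h : (size (1 - b *: 'X : {poly R})%R <= 2)%N.
  rewrite (leq_trans (size_polyD _ _)) // geq_max size_poly1 size_polyN /=.
  by rewrite (leq_trans (size_scale_leq _ _)) // size_polyX.
by have := leq_sub2r 1 (leq_add h IH); rewrite !subn1.
Qed.

Lemma recip_prodE s l : (l <= size s)%N ->
  (recip_prod s)`_l = (\prod_(b <- s) ('X - b%:P))`_(size s - l).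
Proof.
elim: s l => [|b s IH] l; first by rewrite leqn0 /recip_prod !big_nil => /eqP ->.
rewrite /recip_prod !big_cons -/(recip_prod s) !mulrBl mul1r -scalerAl.
rewrite !coefB coefZ !coefXM coefCM /=; case: l => [|l] hl.
  rewrite /= mulr0 subr0 subn0 /= IH // subn0 [X in _ - b * X]nth_default ?mulr0 ?subr0 //.
  by rewrite size_prod_XsubC.
rewrite subSS /=; move: hl; rewrite ltnS leq_eqVlt => /orP[/eqP ->|hl].
  by rewrite subnn /= (IH (size s)) // subnn [X in X - _]nth_default // size_recip_prod.
by rewrite !IH // ?(ltnW hl) // -(subnSK hl) /=.
Qed.

(** This is the coefficient of X^l in P Q + X P' = 0, where P is [recip_prod s] and Q the generating
    series of the power sums. Truncation of Q at [N] keeps the computation among polynomials, modulo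
    X^(N+1). *)
Lemma newton_identity s l :
  l%:R * (recip_prod s)`_l + \sum_(j < l) (recip_prod s)`_(l - j.+1) * \sum_(b <- s) b ^+ j.+1 = 0.
Proof.
pose N := l; pose Q s : {poly R} := \sum_(j < N) (\sum_(b <- s) b ^+ j.+1) *: 'X^(j.+1).
have key : exists r, recip_prod s * Q s + 'X * (recip_prod s)^`() = 'X^(N.+1) * r.
  elim: s => [|b s [r IH]].
    exists 0; rewrite /recip_prod big_nil mul1r derivC !mulr0 addr0 /Q big1 // => i _.
    by rewrite big_nil scale0r.
  exists ((1 - b *: 'X) * r - b ^+ N.+1 *: recip_prod s).
  have QE : Q (b :: s) = Q s + \sum_(j < N) b ^+ j.+1 *: 'X^(j.+1).
    by rewrite /Q -big_split; apply: eq_bigr => j _; rewrite big_cons addrC scalerDl.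
  have bE : (1 - b *: 'X) * (\sum_(j < N) b ^+ j.+1 *: 'X^(j.+1)) =
      b *: 'X - b ^+ N.+1 *: 'X^(N.+1) :> {poly R}.
    elim: (N) => [|m IHm]; first by rewrite big_ord0 mulr0 !expr1 subrr.
    rewrite big_ord_recr mulrDr /= IHm mulrBl mul1r -scalerAl -scalerAr scalerA -!exprS.
    by rewrite addrA subrK.
  have -> : recip_prod (b :: s) = (1 - b *: 'X) * recip_prod s by rewrite /recip_prod big_cons.
  rewrite QE derivM derivB derivC derivZ derivX sub0r.
  transitivity ((1 - b *: 'X) * (recip_prod s * Q s + 'X * (recip_prod s)^`())
    + recip_prod s * ((1 - b *: 'X) * (\sum_(j < N) b ^+ j.+1 *: 'X^(j.+1)) - b *: 'X)).
    by rewrite -!mul_polyC; ring.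
  by rewrite IH bE -!mul_polyC; ring.
case: key => r /(congr1 (fun p : {poly R} => p`_l)).
rewrite coefD coefXnM ltnSn => e.
have E1 : (recip_prod s * Q s)`_l =
    \sum_(j < l) (recip_prod s)`_(l - j.+1) * \sum_(b <- s) b ^+ j.+1.
  rewrite mulrC coefM big_ord_recl /= [X in X * _]coef_sum big1 ?mul0r ?add0r.
    apply: eq_bigr => j _; rewrite /bump /= add1n mulrC; congr (_ * _).
    rewrite coef_sum (bigD1 (Ordinal (ltn_ord j))) //= coefZ coefXn eqxx mulr1.
    rewrite [X in _ + X]big1 ?addr0 // => i ij; rewrite coefZ coefXn eqSS.
    by rewrite -(inj_eq val_inj) eq_sym in ij; rewrite (negbTE ij) mulr0.
  by move=> i _; rewrite coefZ coefXn mulr0.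
have E2 : ('X * (recip_prod s)^`())`_l = l%:R * (recip_prod s)`_l.
  rewrite coefXM; case: (l) => [|m]; first by rewrite mul0r.
  by rewrite /= coef_deriv mulr_natl.
by rewrite addrC -E1 -E2 e.
Qed.

(* The power sums of the roots, expressed by the coefficients
   [a l] of [X^(k - l)]. *)
Fixpoint psum_seq (k : nat) (a : nat -> R) (l : nat) : seq R :=
  if l is l'.+1 then
    let s := psum_seq k a l' in
    rcons s (- (l%:R * a l + \sum_(j < l') a (l - j.+1)%N * s`_j.+1))
  else [:: k%:R].

Definition psum k a l : R := (psum_seq k a l)`_l.

Lemma size_psum_seq k a l : size (psum_seq k a l) = l.+1.
Proof. by elim: l => //= l IH; rewrite size_rcons IH. Qed.

Lemma psum_seqE k a l j : (j <= l)%N -> (psum_seq k a l)`_j = psum k a j.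
Proof.
elim: l => [|l IH]; first by rewrite leqn0 => /eqP ->.
rewrite leq_eqVlt => /orP[/eqP -> //|jl].
by rewrite /= nth_rcons size_psum_seq jl IH.
Qed.

Lemma psum0 k a : psum k a 0 = k%:R. Proof. by []. Qed.

Lemma psumS k a l :
  psum k a l.+1 = - (l.+1%:R * a l.+1 + \sum_(j < l) a (l - j)%N * psum k a j.+1).
Proof.
rewrite /psum /= nth_rcons size_psum_seq ltnn eqxx; congr (- (_ + _)).
by apply: eq_bigr => j _; rewrite subSS psum_seqE // ltn_ord.
Qed.

Definition rcoefs k (f : {poly R}) l := if (l <= k)%N then f`_(k - l) else 0.

Lemma psum_prod s l :
  psum (size s) (rcoefs (size s) (\prod_(b <- s) ('X - b%:P))) l = \sum_(b <- s) b ^+ l.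
Proof.
set a := rcoefs _ _; have aE j : a j = (recip_prod s)`_j.
  rewrite /a /rcoefs; case: leqP => h; first by rewrite recip_prodE.
  by rewrite nth_default // (leq_trans (size_recip_prod _)).
elim/ltn_ind: l => -[|l] IH.
  by rewrite psum0 -sum1_size natr_sum; apply: eq_bigr => b _; rewrite expr0.
rewrite psumS; have := newton_identity s l.+1.
rewrite big_ord_recr /= subnn -aE.
have -> : (recip_prod s)`_0 = 1.
  by rewrite recip_prodE // subn0 -[RHS](monicP (monic_prod_XsubC s xpredT id)) lead_coefE size_prod_XsubC.
rewrite mul1r addrA addrC => /eqP; rewrite addr_eq0 => /eqP ->.
congr (- (_ + _)); apply: eq_bigr => j _; rewrite subSS -aE IH // ltnS ltn_ord //.
Qed.

End NewtonIdentities.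

Lemma psum_morph (R S : comNzRingType) (T : {rmorphism R -> S}) k a l :
  T (psum k a l) = psum k (T \o a) l.
Proof.
elim/ltn_ind: l => -[|l] IH; first by rewrite !psum0 rmorph_nat.
rewrite !psumS rmorphN rmorphD rmorphM rmorph_nat rmorph_sum; congr (- (_ + _)).
by apply: eq_bigr => j _; rewrite rmorphM IH // ltnS ltn_ord.
Qed.

(** Where the positive integers are invertible, Newton's identities express the coefficients by the
    power sums. This is how integrality of elements of [s] over [B] will be obtained. *)
Lemma coefs_in_image (B L : comNzRingType) (i : {rmorphism B -> L}) (s : seq L) :
  (forall l, exists u : B, l.+1%:R * u = 1) ->
  (forall l, exists c : B, i c = \sum_(b <- s) b ^+ l.+1) ->
  exists2 g : {poly B}, g \is monic & map_poly i g = \prod_(b <- s) ('X - b%:P).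
Proof.
move=> inv ps; have rc l : exists c : B, i c = (recip_prod s)`_l.
  elim/ltn_ind: l => -[|l] IH.
    exists 1; rewrite rmorph1 recip_prodE // subn0.
    by rewrite -[LHS](monicP (monic_prod_XsubC s xpredT id)) lead_coefE size_prod_XsubC.
  have [u ul] := inv l.
  pose cf j : B := if (j < l.+1)%N =P true is ReflectT h then projT1 (cid (IH j h)) else 0.
  have cfE j : (j < l.+1)%N -> i (cf j) = (recip_prod s)`_j.
    by move=> jl; rewrite /cf; case: eqP => // h; case: cid.
  exists (- u * \sum_(j < l.+1) cf (l - j)%N * projT1 (cid (ps j))).
  have := newton_identity s l.+1; rewrite addrC => /eqP; rewrite addr_eq0 => /eqP e.
  rewrite rmorphM rmorphN rmorph_sum /=.
  under eq_bigr => j _.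
    rewrite rmorphM cfE ?ltnS ?leq_subr //; case: cid => /= ? ->; rewrite -(subSS j l); over.
  transitivity (- i u * - (l.+1%:R * (recip_prod s)`_l.+1)); first by rewrite -e.
  by rewrite mulrN mulNr opprK mulrA -(rmorph_nat i) -rmorphM [u * _]mulrC ul rmorph1 mul1r.
pose c l := projT1 (cid (rc l)).
have cE l : i (c l) = (recip_prod s)`_l by rewrite /c; case: cid.
pose g : {poly B} := 'X^(size s) + \poly_(l < size s) c (size s - l)%N.
have sz : (size (\poly_(l < size s) c (size s - l)%N)%R < (size ('X^(size s) : {poly B})%R))%N.
  by rewrite size_polyXn ltnS size_poly.
exists g; first by rewrite monicE lead_coefDl // lead_coefXn.
have gE l : g`_l = if (l < size s)%N then c (size s - l)%N else (l == size s)%:R.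
  rewrite coefD coefXn coef_poly; case: ltngtP => //= _; rewrite ?addr0 //.
  exact: add0r.
apply/polyP => l; transitivity (i g`_l); first exact: coef_map.
rewrite gE; case: ltngtP => [ls|ls|->].
- by rewrite cE recip_prodE ?leq_subr // subKn // ltnW.
- by rewrite nth_default ?size_prod_XsubC //; exact: rmorph0.
transitivity (1 : L); first exact: rmorph1.
by rewrite -[LHS](monicP (monic_prod_XsubC s xpredT id)) lead_coefE size_prod_XsubC.
Qed.

Lemma map_horner_coef (R S : comNzRingType) (T : {rmorphism R -> S}) (q : {poly R}) x :
  (map_poly T q).[x] = \sum_(j < size q) T q`_j * x ^+ j.
Proof.
rewrite (@horner_coef_wide _ (size q)) ?size_poly //.
by apply: eq_bigr => j _; rewrite (@coef_map _ _ T).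
Qed.

Lemma der_map_horner (R S : comNzRingType) (T : {rmorphism R -> S}) d e
  (q : {poly R}) x : derivation d -> derivation e -> (forall a, e (T a) = T (d a)) ->
  e (map_poly T q).[x] =
  (map_poly T (\poly_(j < size q) d q`_j)).[x] + (map_poly T q^`()).[x] * e x.
Proof.
move=> hd he eT; pose D (q : {poly R}) : {poly R} := \poly_(j < size q) d q`_j.
have DE r j : (D r)`_j = d r`_j.
  rewrite coef_poly; case: ltnP => // h; by rewrite nth_default // (der0 hd).
rewrite -/(D q); elim/poly_ind: q => [|q c IH].
  have -> : D 0 = 0 by apply/polyP => j; rewrite DE !coef0 (der0 hd).
  by rewrite deriv0 !rmorph0 !horner0 (der0 he) mul0r addr0.
have -> : D (q * 'X + c%:P) = D q * 'X + (d c)%:P.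
  apply/polyP => j; rewrite DE !coefD !coefMX !coefC (derD hd) DE.
  by case: eqP => _ //; rewrite (der0 hd).
rewrite derivD derivM derivX derivC mulr1 addr0.
rewrite !(rmorphD (map_poly T)) !(rmorphM (map_poly T)) /= !map_polyX !map_polyC /=.
rewrite !(hornerD, hornerMX, hornerC) (derD he) (derM he) IH eT; ring.
Qed.

Section UniversalFormula.
Variables (O : comNzRingType) (I : Type) (d : I -> O -> O) (k s : nat) (f : {poly O}).
Hypothesis hd : forall i, derivation (d i).
Hypothesis nat_unit : forall l, exists u : O, l.+1%:R * u = 1.

Definition hankel_mx n : 'M[O]_n := \matrix_(i, j) psum k (rcoefs k f) (i + j).
Definition hankel n : O := \det (hankel_mx n).

(** A place where [f] splits with at most [s] distinct roots and to which the derivations extend.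
    The formulas below produce their data in [O] before a place is given, so that places of
    different nature share them. *)
Record rootctx (R : idomainType) (T : {rmorphism O -> R}) (e : I -> R -> R)
    (bs : seq R) : Prop := Rootctx {
  ctx_char0 : char0 R;
  ctx_der : forall i, derivation (e i);
  ctx_comm : forall i a, e i (T a) = T (d i a);
  ctx_size : size bs = k;
  ctx_roots : map_poly T f = \prod_(b <- bs) ('X - b%:P);
  ctx_undup : (size (undup bs) <= s)%N
}.

Section Context.
Variables (R : idomainType) (T : {rmorphism O -> R}) (bs : seq R).
Hypothesis R0 : char0 R.
Hypothesis sz : size bs = k.
Hypothesis fE : map_poly T f = \prod_(b <- bs) ('X - b%:P).

Lemma psum_roots l : T (psum k (rcoefs k f) l) = \sum_(b <- bs) b ^+ l.
Proof.
rewrite psum_morph -(psum_prod bs l) sz -fE; apply: (@congr1 _ _ (fun a => psum k a l)).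
apply/funext => j /=; rewrite /rcoefs; case: ifP => _; last by rewrite rmorph0.
by rewrite (@coef_map _ _ T).
Qed.

(* Test against the polynomial vanishing at all distinct roots but one. *)
Lemma distinct_roots_dual (y : R -> R) n : (size (undup bs) <= n)%N ->
  (forall c, (c < n)%N -> \sum_(b <- bs) b ^+ c * y b = 0) ->
  forall b, b \in bs -> y b = 0.
Proof.
move=> un hy b bbs; pose g := \prod_(u <- rem b (undup bs)) ('X - u%:P).
have bu : b \in undup bs by rewrite mem_undup.
have szg : (size g <= n)%N.
  rewrite size_prod_XsubC size_rem // (leq_trans _ un) // prednK //.
  by case: (undup bs) bu.
have : \sum_(c <- bs) g.[c] * y c = 0.
  under eq_bigr => c _ do rewrite (horner_coef_wide _ szg) mulr_suml.
  rewrite exchange_big big1 //= => j _; under eq_bigr => c _ do rewrite -mulrA.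
  by rewrite -mulr_sumr hy ?mulr0.
have gE c : c \in bs -> c != b -> g.[c] = 0.
  move=> cbs cb; apply/eqP; rewrite -[_ == 0]/(root g c) root_prod_XsubC.
  by rewrite mem_rem_uniq ?undup_uniq // inE cb /= mem_undup.
have gb : g.[b] != 0.
  rewrite -[_ == 0]/(root g b) root_prod_XsubC mem_rem_uniq ?undup_uniq //.
  by rewrite inE eqxx.
rewrite (bigID (pred1 b)) /= [X in _ + X]big1_seq => [|c /andP[cb cbs]]; last first.
  by rewrite gE // mul0r.
rewrite addr0 (eq_bigr (fun=> g.[b] * y b)) => [|c /eqP -> //].
rewrite big_const_seq iter_addr addr0 => /eqP; rewrite -mulr_natr !mulf_eq0 (negbTE gb) /=.
have : (0 < count (pred1 b) bs)%N by rewrite -has_count has_pred1.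
by case: count => // m _; rewrite (negbTE (R0 m)) orbF => /eqP.
Qed.

(** A kernel vector is a polynomial of degree below the number of distinct roots, and by
    [distinct_roots_dual] it vanishes at all of them. *)
Lemma hankel_distinct : T (hankel (size (undup bs))) != 0.
Proof.
set n := size _; rewrite /hankel -det_map_mx; apply/negP => /det0P[v v0 vH].
pose g : {poly R} := \poly_(j < n) (if insub j is Some i then v 0 i else 0).
have gE x : g.[x] = \sum_(j < n) v 0 j * x ^+ j.
  rewrite horner_poly; apply: eq_bigr => j _.
  by case: insubP => [i _ /val_inj -> //|]; rewrite ltn_ord.
have g0 b : b \in bs -> g.[b] = 0.
  apply: (@distinct_roots_dual (fun b => g.[b]) n) => // c cn.
  have e := congr1 (fun M : 'rV_n => M 0 (Ordinal cn)) vH; rewrite !mxE in e.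
  rewrite -[RHS]e.
  under eq_bigr => x _ do rewrite gE mulr_sumr.
  rewrite exchange_big; apply: eq_bigr => j _; rewrite !mxE psum_roots mulr_sumr.
  by apply: eq_bigr => x _; rewrite exprD mulrCA [x ^+ c * _]mulrC.
have gz : g = 0.
  apply: (@roots_geq_poly_eq0 _ g (undup bs)); rewrite ?undup_uniq //.
    by apply/allP => b; rewrite mem_undup => /g0 /eqP.
  exact: size_poly.
case/eqP: v0; apply/rowP => j; rewrite mxE.
have := congr1 (fun p : {poly R} => p`_j) gz; rewrite coef_poly ltn_ord coef0.
by case: insubP => [i _ /val_inj -> //|]; rewrite ltn_ord.
Qed.

End Context.

Let inv l : O := projT1 (cid (nat_unit l)).
Let invP l : l.+1%:R * inv l = 1. Proof. by rewrite /inv; case: cid. Qed.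

Let Dl := hankel s.

(** Cramer's rule for the polynomial q of degree below [s] with q(b) = [Dl] times the derivative of
    b at every root b: the moments of the derivatives are known, since differentiating a power sum
    gives d(p_(c+1)) / (c+1) = sum of b^c d(b). *)
Definition root_der_poly i : {poly O} :=
  \poly_(a < s) (if insub a is Some a' then
    (\adj (hankel_mx s) *m \col_(c < s) (inv c * d i (psum k (rcoefs k f) c.+1))) a' 0
  else 0).

Lemma root_derE R T e bs i b : @rootctx R T e bs -> b \in bs ->
  T Dl * e i b = (map_poly T (root_der_poly i)).[b].
Proof.
move=> [R0 he eT sz fE un] bbs; apply/eqP; rewrite -subr_eq0; apply/eqP.
apply: (distinct_roots_dual R0 (y := fun b => T Dl * e i b - (map_poly T (root_der_poly i)).[b]) un) bbs => c cs.
pose V := \adj (hankel_mx s) *m \col_(c < s) (inv c * d i (psum k (rcoefs k f) c.+1)).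
have qE x : (map_poly T (root_der_poly i)).[x] = \sum_(a < s) T (V a 0) * x ^+ a.
  rewrite (@horner_coef_wide _ s); last first.
    by rewrite (leq_trans (size_poly _ _)) // size_poly.
  apply: eq_bigr => a _; rewrite (@coef_map _ _ T) coef_poly ltn_ord.
  by case: insubP => [j _ /val_inj -> //|]; rewrite ltn_ord.
have HV : hankel_mx s *m V = Dl *: \col_(c < s) (inv c * d i (psum k (rcoefs k f) c.+1)).
  by rewrite mulmxA mul_mx_adj mul_scalar_mx.
under eq_bigr => x _ do rewrite mulrBr qE.
rewrite sumrB; apply/eqP; rewrite subr_eq0; apply/eqP.
have -> : \sum_(x <- bs) x ^+ c * (\sum_(a < s) T (V a 0) * x ^+ a) =
    T ((hankel_mx s *m V) (Ordinal cs) 0).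
  rewrite mxE rmorph_sum; under eq_bigr => x _ do rewrite mulr_sumr.
  rewrite exchange_big; apply: eq_bigr => a _.
  rewrite rmorphM [hankel_mx s _ _]mxE (psum_roots sz fE) mulr_suml.
  by apply: eq_bigr => x _; rewrite exprD; ring.
rewrite HV !mxE rmorphM /=; under eq_bigr => x _ do rewrite mulrCA.
rewrite -mulr_sumr; congr (_ * _); apply: (mulfI (R0 c)).
rewrite rmorphM mulrA -(rmorph_nat T) -rmorphM invP rmorph1 mul1r -eT (psum_roots sz fE).
rewrite (der_sum (he i)) mulr_sumr; apply: eq_bigr => x _.
by rewrite (derX (he i)) /= rmorph_nat mulr_natl.
Qed.

Definition word_der (X : Type) (e : I -> X -> X) (ws : seq I) (x : X) : X :=
  foldr (fun i y => e i y) x ws.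

(** Differentiating D^M x = q(b) brings in the derivative of b, expressed by [root_derE] after
    multiplication by D, and a term with D^(M-1) x, which the same multiplication turns into a
    polynomial in b. *)
Lemma word_derE ws : exists (M : nat) (q : {poly O}),
  forall R T e bs, @rootctx R T e bs -> forall b, b \in bs ->
  T Dl ^+ M * word_der e ws b = (map_poly T q).[b].
Proof.
elim: ws => [|i ws [M [q IH]]].
  by exists 0, 'X => R T e bs _ b _; rewrite expr0 mul1r map_polyX hornerX.
exists M.+2, (Dl%:P * (Dl%:P * (\poly_(j < size q) d i q`_j) + q^`() * root_der_poly i
   - (M%:R * d i Dl)%:P * q)) => R T e bs ctx b bbs /=.
have [R0 he eT sz fE un] := ctx; set X := word_der e ws b.
have e1 := IH _ _ _ _ ctx _ bbs; rewrite -/X in e1.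
have := congr1 (e i) e1; rewrite (der_map_horner q b (hd i) (he i) (eT i)).
rewrite (derM (he i)) (derX (he i)) eT => e2.
rewrite !(rmorphB, rmorphD, rmorphM) /= !map_polyC /= !(hornerM, hornerD, hornerN, hornerC).
rewrite -(root_derE i ctx bbs) -e1.
have e3 : T Dl ^+ M * e i X = (map_poly T (\poly_(j < size q) d i q`_j)).[b]
   + (map_poly T q^`()).[b] * e i b - T Dl ^+ M.-1 * T (d i Dl) *+ M * X.
  by rewrite -e2; ring.
have e4 : T Dl * (T Dl ^+ M.-1 * T (d i Dl) *+ M * X) = M%:R * T (d i Dl) * (T Dl ^+ M * X).
  case: (M) => [|m]; first by rewrite mulr0n !mul0r mulr0.
  by rewrite /= -mulr_natl exprS; ring.
rewrite rmorph_nat -/X.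
transitivity (T Dl * T Dl * (T Dl ^+ M * e i X)); first by rewrite !exprS; ring.
by rewrite e3 mulrBr -[T Dl * T Dl * (_ *+ M * X)]mulrA e4; ring.
Qed.

(** Summation over the roots replaces powers of b by power sums, so that the right-hand side comes
    from an element of [O] which no longer depends on the place. *)
Lemma word_der_psum ws r : exists (M : nat) (N : O),
  forall R T e bs, @rootctx R T e bs ->
  T Dl ^+ M * \sum_(b <- bs) word_der e ws b ^+ r = T N.
Proof.
have [M [q qE]] := word_derE ws; exists (M * r)%N.
exists (\sum_(j < size (q ^+ r)) (q ^+ r)`_j * psum k (rcoefs k f) j) => R T e bs ctx.
have [_ _ _ sz fE _] := ctx; rewrite mulr_sumr big_seq exprM.
under eq_bigr => b bbs do rewrite -exprMn (qE _ _ _ _ ctx _ bbs).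
rewrite -big_seq rmorph_sum; under [RHS]eq_bigr => j _.
  rewrite rmorphM (psum_roots sz fE) mulr_sumr; over.
rewrite exchange_big; apply: eq_bigr => b _ /=.
by rewrite -horner_exp -rmorphXn map_horner_coef.
Qed.

End UniversalFormula.

(** * Homomorphisms to algebraically closed fields *)

Section Ideals.
Variable O : comNzRingType.
Implicit Types (I J : set O) (x y h : O).

Definition idealr I : Prop :=
  [/\ I 0, forall x y, I x -> I y -> I (x + y) & forall x y, I y -> I (x * y)].

Lemma idealrN I x : idealr I -> I x -> I (- x).
Proof. by case=> _ _ m /(m (-1)); rewrite mulN1r. Qed.

Lemma idealrB I x y : idealr I -> I x -> I y -> I (x - y).
Proof. by move=> hI Ix /(idealrN hI); case: hI => _ a _; exact: a. Qed.

Lemma idealr_trans I x y : idealr I -> I (x - y) -> I y -> I x.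
Proof. by case=> _ a _ h1 h2; rewrite -[x](subrK y); exact: a. Qed.

Lemma idealr_sum I (T : Type) (s : seq T) (F : T -> O) :
  idealr I -> (forall t, I (F t)) -> I (\sum_(t <- s) F t).
Proof.
by case=> z a _ h; elim: s => [|t s IH]; rewrite ?big_nil // big_cons; exact: a.
Qed.

Lemma horner_sub_dvd (p : {poly O}) x y : exists q, p.[x] - p.[y] = q * (x - y).
Proof.
have /factor_theorem [q qE] : root (p - (p.[y])%:P) y.
  by rewrite rootE hornerD hornerN hornerC subrr.
exists q.[x]; have := congr1 (horner^~ x) qE.
by rewrite /= hornerD hornerN hornerC hornerM hornerXsubC.
Qed.

(* Zorn's lemma gives an ideal maximal among those which avoid the powers of
   [h]; the last clause is what maximality means. *)
Lemma avoiding_ideal h I0 : idealr I0 -> (forall i, ~ I0 (h ^+ i)) ->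
  exists J, [/\ idealr J, (I0 `<=` J)%classic, forall i, ~ J (h ^+ i) &
    forall x, ~ J x -> exists i g, J (h ^+ i - x * g)].
Proof.
move=> hI0 avI0; pose P A := idealr (A `|` I0)%classic /\ forall i, ~ (A `|` I0)%classic (h ^+ i).
have [F FP Ftot|A [[hA avA] Amax]] := @Zorn_bigcup O P.
  have two x y : ((\bigcup_(X in F) X) `|` I0)%classic x ->
      ((\bigcup_(X in F) X) `|` I0)%classic y ->
      exists2 Z, P Z & [/\ (Z `|` I0)%classic x, (Z `|` I0)%classic y &
        (Z `<=` \bigcup_(X in F) X)%classic].
    have P0 : P set0 by rewrite /P set0U.
    move=> [[X FX Xx]|Ix] [[Y FY Yy]|Iy].
    - have [XY|YX] := Ftot _ _ FX FY.
        by exists Y; [exact: FP|split; [left; exact: XY|left|exact: bigcup_sup]].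
      by exists X; [exact: FP|split; [left|left; exact: YX|exact: bigcup_sup]].
    - by exists X; [exact: FP|split; [left|right|exact: bigcup_sup]].
    - by exists Y; [exact: FP|split; [right|left|exact: bigcup_sup]].
    - by exists set0 => //; split; [right|right|exact: sub0set].
  split; first split.
  - by right; case: hI0.
  - move=> x y hx hy; have [Z [[_ a _] _] [Zx Zy ZF]] := two x y hx hy.
    by case: (a _ _ Zx Zy) => [/ZF|]; [left|right].
  - move=> x y hy; have [Z [[_ _ m] _] [_ Zy ZF]] := two y y hy hy.
    by case: (m x _ Zy) => [/ZF|]; [left|right].
  - by move=> i hi; have [Z [_ av] [Zi _ _]] := two _ _ hi hi; exact: (av i).
exists (A `|` I0)%classic; split => //.
move=> x Jx; set J := (A `|` I0)%classic in hA avA Jx *; apply/not_existsP => no.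
pose J' : set O := fun y => exists g, J (y - x * g).
have JJ' : (J `<=` J')%classic by move=> y Jy; exists 0; rewrite mulr0 subr0.
have J'U : (J' `|` I0 = J')%classic.
  by apply/seteqP; split=> y; [case=> // Iy; apply: JJ'; right|left].
apply: (Amax J'); first split.
- by move=> y Ay; apply: JJ'; left.
- move=> sub; apply: Jx; left; apply: sub; exists 1.
  by rewrite mulr1 subrr; case: hA.
rewrite /P J'U; split; last by move=> i [g hg]; apply: (no i); exists g.
case: hA => z a m; split; first by exists 0; rewrite mulr0 subr0.
- move=> y1 y2 [g1 h1] [g2 h2]; exists (g1 + g2).
  by rewrite mulrDr opprD addrACA; exact: a.
- by move=> y1 y2 [g hg]; exists (y1 * g); rewrite mulrCA -mulrBr; exact: m.
Qed.

Lemma avoiding_ideal_prime h J : idealr J -> (forall i, ~ J (h ^+ i)) ->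
  (forall x, ~ J x -> exists i g, J (h ^+ i - x * g)) ->
  forall x y, J (x * y) -> J x \/ J y.
Proof.
move=> hJ av mx x y Jxy; have [?|nx] := pselect (J x); first by left.
have [?|ny] := pselect (J y); first by right.
have [i [g hg]] := mx _ nx; have [j [g' hg']] := mx _ ny.
exfalso; apply: (av (i + j)%N); case: hJ => _ a m.
have -> : h ^+ (i + j) = h ^+ j * (h ^+ i - x * g) + (x * g * (h ^+ j - y * g') + g * g' * (x * y)).
  by rewrite exprD; ring.
by apply: (a); [exact: m|apply: (a); exact: m].
Qed.

Lemma prime_ideal_prod J (T : Type) (s : seq T) (F : T -> O) : idealr J -> ~ J 1 ->
  (forall x y, J (x * y) -> J x \/ J y) -> J (\prod_(t <- s) F t) ->
  exists t, J (F t).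
Proof.
move=> hJ J1 pr; elim: s => [|t s IH]; first by rewrite big_nil.
by rewrite big_cons => /pr [?|/IH //]; exists t.
Qed.

End Ideals.

Lemma residue_hom (K : fieldType) (O : comNzRingType) (cst : {rmorphism K -> O}) (J : set O) :
  idealr J -> ~ J 1 -> (forall y, exists al, J (y - cst al)) ->
  exists phi : {rmorphism O -> K}, forall y, J (y - cst (phi y)).
Proof.
move=> hJ J1 ex; have [_ a m] := hJ.
have inj al : J (cst al) -> al = 0.
  move=> h; apply/eqP; apply/negP => /negP al0; apply: J1.
  by rewrite -(rmorph1 cst) -(mulVf al0) rmorphM; exact: m.
pose phi y := projT1 (cid (ex y)).
have phiP y : J (y - cst (phi y)) by rewrite /phi; case: cid.
have uniq y al : J (y - cst al) -> phi y = al.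
  move=> h; apply/eqP; rewrite -subr_eq0; apply/eqP/inj.
  have -> : cst (phi y - al) = (y - cst al) - (y - cst (phi y)) by rewrite rmorphB; ring.
  exact: idealrB.
have phi_add : zmod_morphism phi.
  move=> x y; apply: uniq; rewrite rmorphB.
  have -> : x - y - (cst (phi x) - cst (phi y)) = (x - cst (phi x)) - (y - cst (phi y)) by ring.
  exact: idealrB.
have phi_mul : monoid_morphism phi.
  split; first by apply: uniq; rewrite rmorph1 subrr; case: hJ.
  move=> x y; apply: uniq; rewrite rmorphM.
  have -> : x * y - cst (phi x) * cst (phi y) =
    y * (x - cst (phi x)) + cst (phi x) * (y - cst (phi y)) by ring.
  by apply: a; exact: m.
pose F : {rmorphism O -> K} := HB.pack phi
  (GRing.isZmodMorphism.Build O K phi phi_add) (GRing.isMonoidMorphism.Build O K phi phi_mul).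
by exists F.
Qed.

Lemma closed_poly_roots (K : closedFieldType) (p : {poly K}) : p \is monic ->
  exists s : seq K, p = \prod_(z <- s) ('X - z%:P).
Proof.
by move=> pm; have [s ->] := closed_field_poly_normal p; exists s; rewrite (monicP pm) scale1r.
Qed.

(* The residue field of a maximal ideal of an integral extension of a local
   ring with algebraically closed residue field. *)
Lemma integral_residue_hom (K : closedFieldType) (B C : comNzRingType)
    (i : {rmorphism B -> C}) (e : {rmorphism B -> K}) (c : {rmorphism K -> B}) :
  cancel c e -> (forall b, e b != 0 -> exists b', b * b' = 1) ->
  (forall y, exists2 g, g \is monic & root (map_poly i g) y) ->
  exists phi : {rmorphism C -> K}, forall b, phi (i b) = e b.
Proof.
move=> cK un int.
(* Avoiding the powers of 1 means being proper, so [J] will be a maximal ideal. *)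
have I0 : idealr [set 0 : C].
  by split=> [//|x y -> ->|x y ->] /=; rewrite ?addr0 ?mulr0.
have [j|J [hJ _ av mx]] := @avoiding_ideal C 1 _ I0; first by rewrite expr1n => /eqP; rewrite oner_eq0.
have pr := avoiding_ideal_prime hJ av mx.
have J1 : ~ J 1 by have := av 0; rewrite expr0.
have [J0 a m] := hJ.
have kerJ b : J (i b) -> e b = 0.
  move=> h; apply/eqP/negP => /negP /un [b' bb']; apply: J1.
  by rewrite -(rmorph1 i) -bb' rmorphM mulrC; exact: m.
(* Lying over. Otherwise 1 - (i b) g is in [J] for some g. The integral equation of g, scaled by
   [b], gives a monic polynomial [G] vanishing at (i b) g, hence G(1) is in [J]; but [e] turns [G]
   into X^d, so that e(G(1)) = 1, against [kerJ]. *)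
have eJ b : e b = 0 -> J (i b).
  move=> eb; have [//|/mx [l [g]]] := pselect (J (i b)); rewrite expr1n => hg.
  have [p pm /rootP rt] := int g; pose d := (size p).-1.
  have szp : size p = d.+1 by rewrite prednK // size_poly_gt0 monic_neq0.
  pose G : {poly B} := \poly_(j < d.+1) (p`_j * b ^+ (d - j)).
  have GE y : (map_poly i G).[y] = \sum_(j < d.+1) i (p`_j * b ^+ (d - j)) * y ^+ j.
    rewrite (@horner_coef_wide _ d.+1); last by rewrite (leq_trans (size_poly _ _)) // size_poly.
    by apply: eq_bigr => j _; rewrite (@coef_map _ _ i) coef_poly ltn_ord.
  have G0 : (map_poly i G).[i b * g] = 0.
    transitivity (i b ^+ d * (map_poly i p).[g]); last by rewrite rt mulr0.
    rewrite GE map_horner_coef szp mulr_sumr; apply: eq_bigr => j _.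
    have jd : (j <= d)%N by rewrite -ltnS.
    have -> : i b ^+ d = i b ^+ (d - j) * i b ^+ j by rewrite -exprD subnK.
    by rewrite exprMn rmorphM rmorphXn; ring.
  have [q qE] := horner_sub_dvd (map_poly i G) 1 (i b * g).
  have : J (i G.[1]).
    by rewrite -horner_map rmorph1 -[_.[1]](subr0) -G0 qE; exact: m.
  move=> /kerJ /eqP; rewrite -horner_map rmorph1.
  rewrite (_ : map_poly e G = 'X^d) ?hornerXn ?expr1n ?oner_eq0 //.
  apply/polyP => j; rewrite (@coef_map _ _ e) coef_poly coefXn.
  case: (ltnP j d.+1) => [|jd] /=; last by rewrite rmorph0 gtn_eqF.
  rewrite ltnS leq_eqVlt => /orP[/eqP ->|jd].
    by rewrite eqxx subnn expr0 mulr1 -[p`_d]/(lead_coef p) (monicP pm) rmorph1.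
  by rewrite rmorphM rmorphXn eb expr0n subn_eq0 leqNgt jd mulr0 ltn_eqF.
(* Modulo [J] the integral equation of [y] has coefficients in the algebraically closed field K;
   since [J] is prime, one of the linear factors lies in it. *)
have [phi phiP] : exists phi : {rmorphism C -> K}, forall y, J (y - (i \o c) (phi y)).
  apply: residue_hom => // y; have [p pm /rootP rt] := int y.
  have [s sE] := closed_poly_roots (monic_map e pm).
  have [t Jt] : exists t, J (y - i (c t)).
    apply: (prime_ideal_prod (s := s)) => //.
    have <- : (map_poly i (map_poly c (map_poly e p))).[y] = \prod_(t <- s) (y - i (c t)).
      rewrite sE !rmorph_prod horner_prod; apply: eq_bigr => t _.
      by rewrite !rmorphB /= !map_polyX !map_polyC /= hornerXsubC.
    apply: (idealr_trans hJ (y := 0)) => //; rewrite -{1}rt -hornerN -hornerD -rmorphB.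
    rewrite map_horner_coef; apply: idealr_sum => // j.
    rewrite mulrC; apply: (m); apply: eJ.
    by rewrite coefB (@coef_map _ _ c) (@coef_map _ _ e) rmorphB cK subrr.
  by exists t.
exists phi => b; apply/eqP; rewrite -subr_eq0; apply/eqP.
rewrite -[LHS]opprK; apply/eqP; rewrite oppr_eq0; apply/eqP.
have -> : - (phi (i b) - e b) = e (b - c (phi (i b))) by rewrite rmorphB cK opprB.
by apply: kerJ; rewrite rmorphB; exact: phiP.
Qed.

(* The nullstellensatz for algebras of countable dimension: for [a] in the
   algebra, uncountably many inverses of [a - la] would be linearly dependent. *)
Lemma nullstellensatz (K : closedFieldType) (O : comNzRingType)
    (cst : {rmorphism K -> O}) (e : nat -> O) (I : set O) (h : O) :
  ~ countable [set: K]%classic ->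
  (forall x, exists N (c : 'I_N -> K), x = \sum_j cst (c j) * e j) ->
  idealr I -> (forall i, ~ I (h ^+ i)) ->
  exists kap : {rmorphism O -> K},
    [/\ forall c, kap (cst c) = c, forall x, I x -> kap x = 0 & kap h != 0].
Proof.
move=> Kunc span hI av; have [J [hJ IJ avJ mx]] := avoiding_ideal hI av.
have pr := avoiding_ideal_prime hJ avJ mx.
have J1 : ~ J 1 by have := avJ 0; rewrite expr0.
have [J0 ad m] := hJ.
have inj al : J (cst al) -> al = 0.
  move=> Jal; apply/eqP; apply/negP => /negP al0; apply: J1.
  by rewrite -(rmorph1 cst) -(mulVf al0) rmorphM; exact: m.
have rat a : exists al, J (a - cst al).
  apply/not_existsP => no; apply: Kunc.
  have inv la : exists ig : nat * O, J (h ^+ ig.1 - (a - cst la) * ig.2).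
    by have [i [g hg]] := mx _ (no la); exists (i, g).
  pose ig la := projT1 (cid (inv la)).
  have igP la : J (h ^+ (ig la).1 - (a - cst la) * (ig la).2) by rewrite /ig; case: cid.
  pose N la := projT1 (cid (span (ig la).2)).
  have NP la : exists c : 'I_(N la) -> K, (ig la).2 = \sum_j cst (c j) * e j.
    by rewrite /N; case: cid.
  (* The scalars are sorted by the exponent of [h] and by the number of spanning elements used. If
     all classes were finite, K would be countable; an infinite class contains more inverses than
     the dimension of the span they lie in. *)
  pose fib (x : nat * nat) : set K := [set la | ((ig la).1, N la) = x]%classic.
  have -> : [set: K]%classic = (\bigcup_(x in [set: nat * nat]) fib x)%classic.
    by apply/seteqP; split=> // la _; exists ((ig la).1, N la).
  apply: bigcup_countable => [|x _]; first exact: countableP.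
  apply: finite_set_countable; apply: contrapT => inf.
  have [S SA] := infinite_set_fset x.2.+1 inf => szS.
  pose s := take x.2.+1 (finmap.enum_fset S).
  have ss : size s = x.2.+1 by rewrite size_takel.
  have us : uniq s by rewrite take_uniq // finmap.fset_uniq.
  have sfib la : la \in s -> (ig la).1 = x.1 /\ N la = x.2.
    by move=> /mem_take laS; have <- : ((ig la).1, N la) = x by exact: (SA la laS).
  have coef la : exists c : 'I_x.2 -> K, la \in s -> (ig la).2 = \sum_j cst (c j) * e j.
    have [las|_] := boolP (la \in s); last by exists (fun=> 0).
    by have [_ <-] := sfib _ las; have [c cE] := NP la; exists c.
  pose cf la := projT1 (cid (coef la)).
  have cfE la : la \in s -> (ig la).2 = \sum_j cst (cf la j) * e j.
    by rewrite /cf; case: cid.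
  pose M : 'M[K]_(x.2.+1, x.2) := \matrix_(l, j) cf s`_l j.
  have [v v0 vM] : exists2 v : 'rV[K]_x.2.+1, v != 0 & v *m M = 0.
    have : kermx M != 0 by rewrite -mxrank_eq0 mxrank_ker subn_eq0 -ltnNge ltnS rank_leq_col.
    by case/rowV0Pn => v /sub_kermxP; exists v.
  have sl (l : 'I_x.2.+1) : s`_l \in s by rewrite mem_nth // ss.
  (* Clearing denominators in the relation between the inverses of a - s_l leads to the polynomial
     [q]; it is nonzero because at s_l only the l-th summand survives. *)
  pose pl l : {poly K} := \prod_(u < x.2.+1 | u != l) ('X - (s`_u)%:P).
  pose q := \sum_l v 0 l *: pl l.
  have dep : \sum_l cst (v 0 l) * (ig s`_l).2 = 0.
    under eq_bigr => l _ do rewrite (cfE _ (sl l)) mulr_sumr.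
    rewrite exchange_big big1 //= => j _.
    under eq_bigr => l _ do rewrite mulrA -rmorphM.
    rewrite -mulr_suml -rmorph_sum /=.
    have := congr1 (fun A : 'rV_x.2 => A 0 j) vM; rewrite !mxE => vE.
    have -> : \sum_(l < x.2.+1) v 0 l * cf s`_l j = 0.
      by rewrite -[RHS]vE; apply: eq_bigr => l _; rewrite mxE.
    by rewrite rmorph0 mul0r.
  have plE l : (map_poly cst (pl l)).[a] = \prod_(u < x.2.+1 | u != l) (a - cst s`_u).
    rewrite rmorph_prod horner_prod; apply: eq_bigr => u _.
    by rewrite rmorphB /= map_polyX map_polyC /= hornerXsubC.
  have Jq : J (h ^+ x.1 * (map_poly cst q).[a]).
    pose Pi := \prod_(u < x.2.+1) (a - cst s`_u).
    have qE : (map_poly cst q).[a] = \sum_l cst (v 0 l) * (map_poly cst (pl l)).[a].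
      rewrite rmorph_sum horner_sum; apply: eq_bigr => l _.
      by rewrite /= map_polyZ hornerZ.
    have -> : h ^+ x.1 * (map_poly cst q).[a] = \sum_l (h ^+ x.1 *
        (cst (v 0 l) * (map_poly cst (pl l)).[a]) - Pi * (cst (v 0 l) * (ig s`_l).2)).
      by rewrite sumrB -!mulr_sumr dep mulr0 subr0 qE.
    apply: idealr_sum => // l.
    have -> : Pi = (a - cst s`_l) * (map_poly cst (pl l)).[a] by rewrite plE /Pi (bigD1 l).
    rewrite -(sfib _ (sl l)).1.
    set g := (ig s`_l).2; set P := horner _ _.
    have -> : h ^+ (ig s`_l).1 * (cst (v 0 l) * P) - (a - cst s`_l) * P * (cst (v 0 l) * g) =
      cst (v 0 l) * P * (h ^+ (ig s`_l).1 - (a - cst s`_l) * g) by ring.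
    exact/m/igP.
  have [/avJ //|{}Jq] := pr _ _ Jq.
  have q0 : q != 0.
    apply/eqP => q0; case/eqP: v0; apply/rowP => l; rewrite mxE.
    have := congr1 (horner^~ s`_l) q0; rewrite /= horner0 horner_sum (bigD1 l) //= big1 => [|u ul].
      rewrite addr0 hornerZ horner_prod => /eqP; rewrite mulf_eq0 => /orP[/eqP //|].
      rewrite prodf_seq_eq0 => /hasP[u _ /andP[ul]]; rewrite hornerXsubC subr_eq0 nth_uniq ?ss //.
      by move=> /eqP /val_inj e'; rewrite e' eqxx in ul.
    by rewrite hornerZ horner_prod (bigD1 l) 1?eq_sym //= hornerXsubC subrr mul0r mulr0.
  have [r rE] := closed_field_poly_normal q.
  move: Jq; rewrite rE map_polyZ hornerZ rmorph_prod horner_prod => /pr [/inj /eqP|].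
    by rewrite lead_coef_eq0 (negbTE q0).
  move/(prime_ideal_prod hJ J1 pr) => [nu]; rewrite rmorphB /= map_polyX map_polyC /= hornerXsubC.
  exact: no.
have [kap kapP] := residue_hom hJ J1 rat.
have u y al : J (y - cst al) -> kap y = al.
  move=> hy; apply/eqP; rewrite -subr_eq0; apply/eqP/inj; rewrite rmorphB.
  have -> : cst (kap y) - cst al = (y - cst al) - (y - cst (kap y)) by ring.
  exact: idealrB.
exists kap; split=> [c|x Ix|].
- by apply: u; rewrite subrr.
- by apply: u; rewrite rmorph0 subr0; exact: IJ.
apply/eqP => k0; apply: (avJ 1); rewrite expr1.
by have := kapP h; rewrite k0 rmorph0 subr0.
Qed.

(** * Substitution and Weierstrass division *)

Section LowTerms.
Variables (K : comNzRingType) (n : nat).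
Implicit Types (f g : fps K n) (m : multinom n).

Definition fps_low a f := forall m, (mdeg m < a)%N -> f m = 0.

Lemma fps_lowM a b f g : fps_low a f -> fps_low b g -> fps_low (a + b) (f * g).
Proof.
move=> hf hg m hm; rewrite /GRing.mul /= /fps_mul big1 // => d /eqP md.
have := congr1 (fun x : multinom n => mdeg x) md; rewrite /= mdegD => e.
have [d1|d1] := ltnP (mdeg d.1) a; first by rewrite hf // mul0r.
rewrite hg ?mulr0 // -(ltn_add2l a); apply: leq_ltn_trans hm.
by rewrite [leqRHS]e leq_add2r.
Qed.

Lemma fps_lowX a f k : fps_low a f -> fps_low (k * a) (f ^+ k).
Proof.
move=> hf; elim: k => [|k IH]; first by move=> m; rewrite mul0n ltn0.
by rewrite exprS mulSn; exact: fps_lowM.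
Qed.

Lemma fps_low1 f : f mnm0 = 0 -> fps_low 1 f.
Proof. by move=> f0 m; rewrite ltnS leqn0 mdeg_eq0 => /eqP ->. Qed.

Lemma fps_constM c f m : (@fps_const K n c * f) m = c * f m.
Proof.
rewrite (@fps_mulE _ _ (mpolyC n c) (fps_tr (mdeg m).+1 f)).
- by rewrite mcoeffCM fps_trE ltnSn.
- by move=> d _; rewrite mcoeffC /fps_const eq_sym; case: eqP; rewrite ?mulr1 ?mulr0.
- by apply: fps_tr_le.
Qed.

Definition fps_mono m : fps K n := fun m' => (m' == m)%:R.

Lemma fps_monoE m : fps_mono m = mp_fps (mpolyX K m).
Proof. by apply/funext => m'; rewrite /mp_fps mcoeffX eq_sym. Qed.

Lemma fps_monoM m m' : fps_mono m * fps_mono m' = fps_mono (mnm_add m m').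
Proof. by rewrite !fps_monoE -rmorphM -mpolyXD. Qed.

Lemma fps_mono0 : fps_mono mnm0 = 1.
Proof. by rewrite fps_monoE mpolyX0 rmorph1. Qed.

Lemma fps_monoX m k : fps_mono m ^+ k = fps_mono (mnm_muln m k).
Proof. by rewrite !fps_monoE -rmorphXn -mpolyXn. Qed.

End LowTerms.

Section Substitution.
Variables (K : comNzRingType) (n n' : nat) (v : 'I_n -> fps K n').
Hypothesis v0 : forall i, v i mnm0 = 0.

Lemma mmap1_low d : fps_low (mdeg d) (mmap1 v d : fps K n').
Proof.
rewrite mdegE /mmap1; apply: (big_rec2 (fun (a : nat) (x : fps K n') => fps_low a x)) => //= i a x _ hx.
apply: fps_lowM => //; rewrite -[X in fps_low X]muln1; exact/fps_lowX/fps_low1.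
Qed.

Lemma mmap_low a (P : mpoly n K) : (forall d, (mdeg d < a)%N -> mcoeff d P = 0) ->
  fps_low a (mmap (@fps_const K n') v P).
Proof.
move=> hP m ma; rewrite /mmap fps_sumE big1_seq // => d /andP[_ dP].
rewrite fps_constM; have [da|ad] := ltnP (mdeg d) a; first by rewrite hP // mul0r.
by rewrite mmap1_low ?mulr0 // (leq_trans ma).
Qed.

(** As the substituted series have no constant term, a coefficient of the result depends only on
    terms of no greater degree, so any polynomial agreeing with [c] up to that degree computes
    it. *)
Lemma fps_substE (P : mpoly n K) (c : fps K n) m :
  (forall d, (mdeg d <= mdeg m)%N -> mcoeff d P = c d) ->
  fps_subst v c m = mmap (@fps_const K n') v P m.
Proof.
move=> hP; have -> : fps_subst v c m =
    (mmap (@fps_const K n') v (fps_tr (mdeg m).+1 c)) m.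
  rewrite /fps_tr raddf_sum fps_sumE; apply: eq_bigr => d _.
  by rewrite /= -mul_mpolyC rmorphM /= mmapC mmapX fps_constM.
apply/eqP; rewrite -subr_eq0 -fpsBE -raddfB; apply/eqP.
apply: (@mmap_low (mdeg m).+1) => // d hd.
by rewrite mcoeffB fps_trE hd hP // subrr.
Qed.

Lemma fps_subst_is_additive : additive (fps_subst v).
Proof.
move=> f g; apply/funext => m; pose T := @fps_tr K n (mdeg m).+1.
rewrite fpsBE (@fps_substE (T f - T g)) => [|d hd]; last by rewrite mcoeffB !fps_trE ltnS hd.
rewrite raddfB /= fpsBE -(@fps_substE (T f) f) => [|d hd]; last by rewrite fps_trE ltnS hd.
by rewrite -(@fps_substE (T g) g) // => d hd; rewrite fps_trE ltnS hd.
Qed.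

Lemma fps_substC c : fps_subst v (@fps_const K n c) = @fps_const K n' c.
Proof.
apply/funext => m; rewrite (@fps_substE (mpolyC n c)) ?mmapC // => d _.
by rewrite mcoeffC /fps_const eq_sym; case: eqP; rewrite ?mulr1 ?mulr0.
Qed.

Lemma fps_substX i : fps_subst v (fps_X K i) = v i.
Proof.
apply/funext => m; rewrite (@fps_substE (mpolyX K (mnm1 i))) => [|d _].
  by rewrite mmapX mmap1U.
by rewrite mcoeffX eq_sym.
Qed.

Lemma fps_subst_is_monoid : monoid_morphism (fps_subst v).
Proof.
split=> [|f g]; first exact: fps_substC.
apply/funext => m; pose T := @fps_tr K n (mdeg m).+1.
have TE h d : (mdeg d <= mdeg m)%N -> mcoeff d (T h) = h d by move=> hd; rewrite fps_trE ltnS hd.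
rewrite (@fps_substE (T f * T g)) => [|d hd]; last first.
  by rewrite -(@fps_mulE _ _ _ _ f g) // => d' hd'; rewrite TE // (leq_trans hd').
rewrite rmorphM /=; set A := mmap _ _ (T f); set B := mmap _ _ (T g).
have AE d : (mdeg d <= mdeg m)%N -> A d = fps_subst v f d.
  by move=> hd; rewrite (@fps_substE (T f)) // => d' hd'; rewrite TE // (leq_trans hd').
have BE d : (mdeg d <= mdeg m)%N -> B d = fps_subst v g d.
  by move=> hd; rewrite (@fps_substE (T g)) // => d' hd'; rewrite TE // (leq_trans hd').
rewrite /GRing.mul /= /fps_mul; apply: eq_bigr => d _.
by rewrite AE ?BE // -ltnS bmdeg.
Qed.

Definition fps_subst_hom : {rmorphism fps K n -> fps K n'} := HB.pack (fps_subst v)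
  (GRing.isZmodMorphism.Build _ _ _ fps_subst_is_additive)
  (GRing.isMonoidMorphism.Build _ _ _ fps_subst_is_monoid).

End Substitution.

Section MonomialSubstitution.
Variables (K : comNzRingType) (n n' : nat) (v : 'I_n -> fps K n') (u : 'I_n -> multinom n').
Hypothesis vu : forall i, v i = fps_mono K (u i).

(** A monomial substitution with injective exponent map only moves coefficients around, as the
    lemmas below make precise. *)
Definition mexp (d : multinom n) : multinom n' :=
  \big[mnm_add/mnm0]_i mnm_muln (u i) (d i).

Lemma mexpE d j : mexp d j = (\sum_i d i * u i j)%N.
Proof. by rewrite /mexp mnm_sumE; apply: eq_bigr => i _; rewrite mulmnE mulnC. Qed.

Lemma mmap1_mono d : mmap1 v d = fps_mono K (mexp d).
Proof.
rewrite /mmap1 /mexp; apply: (big_rec2 (fun (a : fps K n') x => a = fps_mono K x)).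
  by rewrite fps_mono0.
by move=> i a x _ ->; rewrite vu fps_monoX fps_monoM.
Qed.

Hypothesis u0 : forall i, u i != mnm0.
Hypothesis inj : injective mexp.

Lemma mdeg_mexp d : (mdeg d <= mdeg (mexp d))%N.
Proof.
rewrite /mexp (big_morph _ (@mdegD n') (@mdeg0 n')) mdegE; apply: leq_sum => i _.
have : (0 < mdeg (u i))%N by rewrite lt0n mdeg_eq0.
by rewrite mdegMn => h; rewrite leq_pmull.
Qed.

Lemma fps_subst_mexp c d : fps_subst v c (mexp d) = c d.
Proof.
rewrite /fps_subst; have hd : (mdeg d < (mdeg (mexp d)).+1)%N by rewrite ltnS mdeg_mexp.
rewrite (bigD1 (BMultinom hd)) //= mmap1_mono /fps_mono eqxx mulr1 big1 ?addr0 // => d' dd'.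
rewrite mmap1_mono /fps_mono (inj_eq inj) eq_sym; rewrite -(inj_eq val_inj) /= in dd'.
by rewrite (negbTE dd') mulr0.
Qed.

Lemma fps_subst_out c m : (forall d, mexp d != m) -> fps_subst v c m = 0.
Proof.
by move=> h; rewrite /fps_subst big1 // => d _; rewrite mmap1_mono /fps_mono eq_sym (negbTE (h d)) mulr0.
Qed.

Lemma fps_subst_mono_inj : injective (fps_subst v).
Proof.
by move=> a b e; apply/funext => d; rewrite -(fps_subst_mexp a) e fps_subst_mexp.
Qed.

End MonomialSubstitution.

Section ChainRule.
Variables (K : comNzRingType) (n n' : nat) (v : 'I_n -> fps K n').
Hypothesis v0 : forall i, v i mnm0 = 0.
Let S : {rmorphism fps K n -> fps K n'} := fps_subst_hom v0.

Let S0 : fps_subst v 0 = 0 := rmorph0 S.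
Let S1 : fps_subst v 1 = 1 := rmorph1 S.
Let dn i : derivation (@fps_d K n i) := (fps_dsystem K n).1 i.
Let dn' i : derivation (@fps_d K n' i) := (fps_dsystem K n').1 i.

Let chain i c := fps_d i (S c) = \sum_l S (fps_d l c) * fps_d i (v l).

Let chainM i a b : chain i a -> chain i b -> chain i (a * b).
Proof.
rewrite /chain => ha hb; rewrite rmorphM (derM (dn' i)) ha hb mulr_suml mulr_sumr -big_split.
by apply: eq_bigr => l _; rewrite (derM (dn l)) rmorphD !rmorphM /=; ring.
Qed.

Let chain_mp i P : chain i (mp_fps P).
Proof.
have hD a b : chain i a -> chain i b -> chain i (a + b).
  rewrite /chain => ha hb; rewrite rmorphD (derD (dn' i)) ha hb -big_split.
  by apply: eq_bigr => l _; rewrite (derD (dn l)) rmorphD mulrDl.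
have hC c : chain i (@fps_const K n c).
  rewrite /chain /= fps_substC // fps_d_const big1 // => l _.
  by rewrite fps_d_const S0 mul0r.
have hX l : chain i (fps_X K l).
  rewrite /chain /= fps_substX // (bigD1 l) //= big1 => [|l' ll'].
    by rewrite fps_d_X eqxx S1 mul1r addr0.
  by rewrite fps_d_X (negbTE ll') S0 mul0r.
elim/mpolyind: P => [|c m P _ _ IH].
  by rewrite rmorph0; have := hC 0; rewrite rmorph0.
rewrite rmorphD /= -mul_mpolyC rmorphM /= mp_fpsC; apply: (hD) => //; apply: chainM => //.
rewrite mpolyXE_id rmorph_prod /=; elim/big_rec: _ => [|l x _ hx].
  by have := hC 1; rewrite rmorph1.
apply: chainM => //; rewrite rmorphXn /= mp_fpsX; elim: (m l) => [|k IHk].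
  by rewrite expr0; have := hC 1; rewrite rmorph1.
by rewrite exprS; exact: chainM.
Qed.

Lemma fps_subst_low a c : fps_low a c -> fps_low a (fps_subst v c).
Proof.
move=> hc m ma; rewrite (@fps_substE _ _ _ _ v0 0) ?raddf0 // => d hd.
by rewrite mcoeff0 hc // (leq_ltn_trans hd).
Qed.

Lemma fps_low_d a i (f : fps K n) : fps_low a.+1 f -> fps_low a (fps_d i f).
Proof. by move=> hf m ma; rewrite /fps_d hf ?mul0rn // mdegD mdeg1 addn1. Qed.

Lemma fps_subst_d i c :
  fps_d i (fps_subst v c) = \sum_l fps_subst v (fps_d l c) * fps_d i (v l).
Proof.
(* The chain rule is known for polynomials. Truncating one degree higher than [m] leaves a remainder
   whose derivatives still do not reach [m]. *)
apply/funext => m; pose P := fps_tr (mdeg m).+2 c; pose r := c - mp_fps P.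
have rlow : fps_low (mdeg m).+2 r.
  by move=> d hd; rewrite /r fpsBE /mp_fps fps_trE hd subrr.
have cE : c = mp_fps P + r by rewrite addrC subrK.
rewrite -[fps_subst v]/(S : _ -> _) [in LHS]cE rmorphD (derD (dn' i)) chain_mp fpsDE.
rewrite (_ : fps_d i (S r) m = 0) ?addr0; last first.
  by rewrite /fps_d /= (fps_subst_low rlow) ?mul0rn // mdegD mdeg1 addn1.
rewrite !fps_sumE; apply: eq_bigr => l _.
rewrite [in RHS]cE (derD (dn l)) rmorphD mulrDl fpsDE -[LHS]addr0; congr (_ + _).
have L := fps_lowM (fps_subst_low (fps_low_d l rlow)) (fun m' (h : (mdeg m' < 0)%N) => False_ind _ (notF h)).
by symmetry; apply: (L (fps_d i (v l))); rewrite addn0.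
Qed.

End ChainRule.

Lemma fps_subst_coef0 (K : comNzRingType) n n' (v : 'I_n -> fps K n') c :
  (forall i, v i mnm0 = 0) -> fps_subst v c mnm0 = c mnm0.
Proof.
move=> v0; rewrite (@fps_substE _ _ _ _ v0 (mpolyC n (c mnm0))) => [|d].
  by rewrite mmapC /= /fps_const eqxx.
by rewrite mdeg0 leqn0 mdeg_eq0 => /eqP ->; rewrite mcoeffC eqxx mulr1.
Qed.

Lemma fps_coef0M (K : comNzRingType) n (f g : fps K n) : (f * g) mnm0 = f mnm0 * g mnm0.
Proof. exact: (rmorphM (@fps_coef0 K n)). Qed.

Lemma fps_X_coef0 (K : comNzRingType) n (i : 'I_n) : fps_X K i mnm0 = 0.
Proof.
by rewrite /fps_X; case: eqP => // /(congr1 (fun m : multinom n => m i)); rewrite mnm0E mnm1E eqxx.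
Qed.

Lemma fps_subst_comp (K : fieldType) (K0 : char0 K) n n1 n2 (v : 'I_n -> fps K n1)
    (v' : 'I_n1 -> fps K n2) c :
  (forall i, v i mnm0 = 0) -> (forall i, v' i mnm0 = 0) ->
  fps_subst v' (fps_subst v c) = fps_subst (fun i => fps_subst v' (v i)) c.
Proof.
move=> v0 v0'; have low0 i : fps_subst v' (v i) mnm0 = 0.
  by apply: (@fps_subst_low _ _ _ _ v0' 1); [exact: fps_low1|rewrite mdeg0].
have subS (F : 'I_n -> fps K n1) : fps_subst v' (\sum_k F k) = \sum_k fps_subst v' (F k).
  exact: (rmorph_sum (fps_subst_hom v0')).
have subM x y : fps_subst v' (x * y) = fps_subst v' x * fps_subst v' y.
  exact: (rmorphM (fps_subst_hom v0')).
(* The chain rule multiplies by derivatives of the inner series; the second components of the pairs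
   absorb these factors and make the relation stable. *)
pose rel (g h : fps K n2) := exists s : seq (fps K n * fps K n2),
  g = \sum_(a <- s) fps_subst v' (fps_subst v a.1) * a.2 /\
  h = \sum_(a <- s) fps_subst (fun i => fps_subst v' (v i)) a.1 * a.2.
apply: (@fps_char0_ind _ _ K0 rel).
- move=> g h [s [-> ->]]; rewrite !fps_sumE; apply: eq_bigr => a _.
  by rewrite !fps_coef0M !fps_subst_coef0.
- move=> i g h [s [-> ->]].
  exists (flatten [seq (a.1, fps_d i a.2) ::
    [seq (fps_d l a.1, fps_d i (fps_subst v' (v l)) * a.2) | l <- index_enum (ordinal n)] | a <- s]).
  elim: s => [|a s [IH1 IH2]] /=.
    by rewrite !big_nil (der0 ((fps_dsystem K n2).1 i)).
  rewrite !big_cons !big_cat /= !fps_dD -IH1 -IH2 !fps_dM !big_map /=.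
  rewrite !addrA; split; congr (_ + _); rewrite addrC; congr (_ + _).
    transitivity ((\sum_k fps_subst v' (fps_subst v (fps_d k a.1)) *
        fps_d i (fps_subst v' (v k))) * a.2); last first.
      by rewrite mulr_suml; apply: eq_bigr => k _; rewrite mulrA.
    congr (_ * _); rewrite fps_subst_d //.
    under eq_bigr => l _ do rewrite (fps_subst_d v0) subS mulr_suml.
    rewrite exchange_big; apply: eq_bigr => k _ /=; rewrite (fps_subst_d v0') mulr_sumr.
    by apply: eq_bigr => l _; rewrite subM mulrA.
  by rewrite fps_subst_d // mulr_suml; apply: eq_bigr => l _; rewrite mulrA.
by exists [:: (c, 1)]; rewrite !big_seq1 !mulr1.
Qed.

Lemma fps_subst_id (K : fieldType) (K0 : char0 K) n (c : fps K n) :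
  fps_subst (@fps_X K n) c = c.
Proof.
have X0 := @fps_X_coef0 K n.
apply: (@fps_char0_ind _ _ K0 (fun g h => g = fps_subst (@fps_X K n) h)) => // [g h ->|i g h ->].
  by rewrite fps_subst_coef0.
rewrite fps_subst_d // (bigD1 i) //= big1 => [|l li]; first by rewrite fps_d_X eqxx mulr1 addr0.
by rewrite fps_d_X eq_sym (negbTE li) mulr0.
Qed.

Section WeierstrassDivision.
Variables (K : comNzRingType) (n : nat) (j : 'I_n.+1) (e : nat).
Implicit Types f g h Q : fps K n.+1.

(* The weight for which [Xj ^ e] is the initial form of a series regular of
   order [e] in [Xj]. *)
Definition wdeg (m : multinom n.+1) : nat := (e.+1 * mdeg (mdel j m) + m j)%N.

Lemma wdegD m m' : wdeg (mnm_add m m') = (wdeg m + wdeg m')%N.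
Proof.
rewrite /wdeg; have -> : mdel j (mnm_add m m') = mnm_add (mdel j m) (mdel j m').
  by apply/mnmP => l; rewrite !(mnmE, mnmDE).
by rewrite mdegD mnmDE; lia.
Qed.

Definition wlow a f := forall m, (wdeg m < a)%N -> f m = 0.

Lemma wlowM a b f g : wlow a f -> wlow b g -> wlow (a + b) (f * g).
Proof.
move=> hf hg m hm; rewrite /GRing.mul /= /fps_mul big1 // => d /eqP md.
have := congr1 wdeg md; rewrite /= wdegD => eq.
have [d1|d1] := ltnP (wdeg d.1) a; first by rewrite hf // mul0r.
rewrite hg ?mulr0 // -(ltn_add2l a); apply: leq_ltn_trans hm.
by rewrite [leqRHS]eq leq_add2r.
Qed.

Lemma wlowD a f g : wlow a f -> wlow a g -> wlow a (f + g).
Proof. by move=> hf hg m hm; rewrite fpsDE hf ?hg ?addr0. Qed.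

Lemma wlowN a f : wlow a f -> wlow a (- f).
Proof. by move=> hf m hm; rewrite fpsNE hf ?oppr0. Qed.

Lemma wlow_le a b f : (a <= b)%N -> wlow b f -> wlow a f.
Proof. by move=> ab hf m hm; rewrite hf // (leq_trans hm). Qed.

(** Drops the terms of degree below [e] in the distinguished variable and divides the others by its
    [e]-th power. *)
Definition wtau f : fps K n.+1 := unpeel j (ser_drop e (peel j f)).

Lemma wtauE f m : wtau f m = f (mins j (m j + e) (mdel j m)).
Proof. by []. Qed.

Lemma wtauB f g : wtau (f - g) = wtau f - wtau g.
Proof. by []. Qed.

Lemma wdeg_mins i d : wdeg (mins j i d) = (e.+1 * mdeg d + i)%N.
Proof. by rewrite /wdeg mdel_ins mins_j. Qed.

Lemma wtau_low a f : wlow (a + e) f -> wlow a (wtau f).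
Proof.
move=> hf m hm; rewrite wtauE hf // wdeg_mins addnA ltn_add2r; exact: hm.
Qed.

Variable h : fps K n.+1.
Hypothesis hlow : wlow e.+1 h.

Lemma wtau_lowM a f : wlow a f -> wlow a.+1 (wtau (f * h)).
Proof. by move=> hf; apply: wtau_low; rewrite addSnnS; exact: wlowM. Qed.

(** The quotient is a fixed point of Q -> wtau (g - Q h), which is contracting: [h] raises the
    weight by more than [e], and [wtau] lowers it by at most [e]. *)
Lemma weierstrass_fix g : exists Q, Q = wtau (g - Q * h).
Proof.
pose Phi Q := wtau (g - Q * h).
have PhiB Q Q' : Phi Q - Phi Q' = - wtau ((Q - Q') * h).
  by rewrite /Phi -wtauB -[RHS]/(wtau (- ((Q - Q') * h))); congr wtau; ring.
pose q k := iter k Phi 0.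
have q1 k : wlow k (q k.+1 - q k).
  elim: k => [|k IH]; first by move=> m; rewrite ltn0.
  by rewrite [X in wlow _ X]PhiB; apply/wlowN/wtau_lowM.
have qle k l : wlow k (q (l + k)%N - q k).
  elim: l => [|l IH]; first by rewrite add0n subrr => m.
  rewrite addSn -(subrK (q (l + k)%N) (q _)) -addrA; apply: wlowD => //.
  by apply: wlow_le (q1 _); rewrite leq_addl.
pose Q : fps K n.+1 := fun m => q (wdeg m).+1 m.
have Qq k : wlow k (Q - q k).
  move=> m mk; rewrite fpsBE /Q -(subnK mk); apply/eqP; rewrite subr_eq0 eq_sym -subr_eq0; apply/eqP.
  by rewrite -fpsBE qle.
exists Q; apply/funext => m; apply/eqP; rewrite -subr_eq0 -fpsBE; apply/eqP.
have -> : Q - wtau (g - Q * h) = (Q - q (wdeg m).+1) + (Phi (q (wdeg m)) - Phi Q).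
  by rewrite (_ : q (wdeg m).+1 = Phi (q (wdeg m))) // addrA subrK.
apply: (wlowD (a := (wdeg m).+1)) => //; rewrite PhiB; apply/wlowN/wtau_lowM.
by rewrite -opprB; exact/wlowN.
Qed.

Lemma peel_XjM k f i : peel j (fps_X K j ^+ k * f) i = if (k <= i)%N then peel j f (i - k)%N else 0.
Proof. by rewrite rmorphM rmorphXn /= peel_Xj serX_expM. Qed.

Lemma weierstrass_fixP g Q : Q = wtau (g - Q * h) <->
  forall i, (e <= i)%N -> peel j (g - (fps_X K j ^+ e + h) * Q) i = 0.
Proof.
have E i : (e <= i)%N -> peel j (g - (fps_X K j ^+ e + h) * Q) i =
    peel j (wtau (g - Q * h)) (i - e)%N - peel j Q (i - e)%N.
  move=> ei; have -> : g - (fps_X K j ^+ e + h) * Q = (g - Q * h) - fps_X K j ^+ e * Q by ring.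
  rewrite rmorphB serBE /= peel_XjM ei.
  by rewrite /wtau unpeelK /ser_drop subnK.
split=> [QE i ei|hQ]; first by rewrite E // -QE subrr.
apply: (@peel_inj _ _ j); apply/funext => i; apply/eqP; rewrite eq_sym -subr_eq0.
by have := hQ (i + e)%N (leq_addl _ _); rewrite E ?leq_addl // addnK => ->.
Qed.

Lemma weierstrass_uniq g Q Q' : Q = wtau (g - Q * h) -> Q' = wtau (g - Q' * h) -> Q = Q'.
Proof.
move=> QE QE'; have D : Q - Q' = - wtau ((Q - Q') * h).
  rewrite {1}QE {1}QE' -wtauB -[RHS]/(wtau (- ((Q - Q') * h))); congr wtau; ring.
have low k : wlow k (Q - Q').
  by elim: k => [m|k IH]; rewrite ?ltn0 // D; exact/wlowN/wtau_lowM.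
apply/eqP; rewrite -subr_eq0; apply/eqP/funext => m.
by apply: (low (wdeg m).+1).
Qed.

End WeierstrassDivision.

Lemma leibniz_vanish (R S : comNzRingType) (d : R -> R) (phi : {rmorphism R -> S}) a C D :
  derivation d -> (forall b, (b <= a)%N -> phi (iter b d C) = 0) -> phi (iter a d (C * D)) = 0.
Proof.
move=> hd; have iterD k x y : iter k d (x + y) = iter k d x + iter k d y.
  by elim: k => //= k ->; rewrite (derD hd).
elim: a C D => [|a IH] C D h; first by rewrite /= rmorphM (h 0%N) // mul0r.
rewrite iterSr (derM hd) iterD rmorphD !IH ?addr0 // => b ba; first by apply: h; exact: leqW.
by rewrite -iterSr; apply: h.
Qed.

Lemma power_vanish (R S : comNzRingType) (d : R -> R) (phi : {rmorphism R -> S}) e a x y :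
  derivation d -> phi x = 0 -> (a < e)%N -> phi (iter a d (x ^+ e * y)) = 0.
Proof.
move=> hd x0; elim: a e y => [|a IH] [|e] y // ae.
  by rewrite /= rmorphM rmorphXn x0 expr0n mul0r.
rewrite iterSr (derM hd) (derX hd) /=.
have -> : x ^+ e * d x *+ e.+1 * y + x ^+ e.+1 * d y =
    x ^+ e * (d x *+ e.+1 * y + x * d y) by rewrite exprSr -(mulr_natr (x ^+ e * d x)) -(mulr_natr (d x)); ring.
exact: IH.
Qed.

Section Multiplicities.
Variable F : fieldType.
Hypothesis F0 : char0 F.
Implicit Types (p : {poly F}) (s : seq F).

Lemma derivs_dvdp p rho k : (forall a, (a < k)%N -> (p^`(a)).[rho] = 0) ->
  ('X - rho%:P) ^+ k %| p.
Proof.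
elim: k p => [|k IH] p h; first by rewrite expr0 dvd1p.
have /factor_theorem [q pE] : root p rho by rewrite rootE (h 0%N).
have dE a : p^`(a.+1) = q^`(a.+1) * ('X - rho%:P) + q^`(a) *+ a.+1.
  elim: a => [|a IHa]; first by rewrite derivn0 !derivn1 pE derivM derivXsubC mulr1.
  rewrite derivnS IHa derivD derivM derivXsubC mulr1 derivMn -!derivnS.
  by rewrite -addrA -mulrS.
rewrite pE exprSr dvdp_mul2r ?polyXsubC_eq0 //; apply: IH => a ak.
have := h a.+1 ak; rewrite dE hornerD hornerM hornerXsubC subrr mulr0 add0r hornerMn => /eqP.
by rewrite -mulr_natr mulf_eq0 (negbTE (F0 a)) orbF => /eqP.
Qed.

Let coprime_pow rho rho' k p : rho != rho' ->
  (('X - rho%:P) ^+ k %| ('X - rho'%:P) * p) = (('X - rho%:P) ^+ k %| p).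
Proof.
move=> h; rewrite Gauss_dvdpr //; apply: coprimep_expl.
by rewrite coprimep_XsubC root_XsubC eq_sym.
Qed.

Lemma count_dvdp p s : (forall rho, rho \in s -> ('X - rho%:P) ^+ (count_mem rho s) %| p) ->
  \prod_(rho <- s) ('X - rho%:P) %| p.
Proof.
elim: s p => [|rho s IH] p h; first by rewrite big_nil dvd1p.
have /dvdpP [q pE] : 'X - rho%:P %| p.
  apply: dvdp_trans (h rho _); rewrite ?mem_head //=.
  by rewrite eqxx add1n exprS dvdp_mulIl.
rewrite big_cons pE [q * _]mulrC dvdp_mul2l ?polyXsubC_eq0 //; apply: IH => rho' rs.
have := h rho'; rewrite inE rs orbT /= pE [q * _]mulrC => /(_ isT).
have [<-|ne] := eqVneq rho rho'; last by rewrite add0n coprime_pow // eq_sym.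
by rewrite add1n exprS dvdp_mul2l ?polyXsubC_eq0.
Qed.

Lemma dvdp_count rho s k : ('X - rho%:P) ^+ k %| \prod_(a <- s) ('X - a%:P) ->
  (k <= count_mem rho s)%N.
Proof.
elim: s k => [|a s IH] k.
  rewrite big_nil dvdp1; case: k => // k; rewrite size_exp_XsubC //.
rewrite big_cons /=; have [->|ne] := eqVneq a rho.
  case: k => // k; rewrite exprS dvdp_mul2l ?polyXsubC_eq0 //.
  by move=> /IH; rewrite add1n ltnS.
by rewrite coprime_pow 1?eq_sym // add0n; exact: IH.
Qed.

End Multiplicities.

(* Divisibility by a distinguished polynomial [P], tested at its roots [s] in a
   field; [Rg] is a ring of power series in one more variable than [A]. *)
Section RootTest.
Variables (A Rg : comNzRingType) (pf : {rmorphism {poly A} -> Rg}) (D : Rg -> Rg).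
Hypothesis hD : derivation D.
Hypothesis Dpf : forall p, D (pf p) = pf p^`().
Variables (F : fieldType) (ev : {rmorphism A -> F}) (P : {poly A}) (s : seq F).
Hypothesis F0 : char0 F.
Hypothesis PE : map_poly ev P = \prod_(rho <- s) ('X - rho%:P).
Variables (rho : F) (J : {rmorphism Rg -> F}).
Hypothesis JE : forall p, J (pf p) = (map_poly ev p).[rho].
Variables (c U V : Rg).
Hypotheses (cU : pf P = c * U) (cV : c = pf P * V).

Let JDpf a p : J (iter a D (pf p)) = ((map_poly ev p)^`(a)).[rho].
Proof.
have -> : iter a D (pf p) = pf p^`(a) by elim: a => [|a IHa] //; rewrite iterS IHa Dpf derivnS.
by rewrite JE derivn_map.
Qed.

Let JP a : (a < count_mem rho s)%N -> J (iter a D (pf P)) = 0.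
Proof.
rewrite JDpf PE => h; have : ('X - rho%:P) ^+ (count_mem rho s) %| \prod_(a <- s) ('X - a%:P).
  elim: (s) => [|x t IH]; first by rewrite dvd1p.
  rewrite big_cons /=; have [->|_] := eqVneq x rho.
    by rewrite add1n exprS dvdp_mul2l ?polyXsubC_eq0.
  by rewrite add0n dvdp_mull.
case/dvdpP => q ->; rewrite mulrC.
pose d := (fun x : {poly F} => x^`()).
have hd : derivation d by split=> x y; rewrite /d ?derivD ?derivM.
have -> (x : {poly F}) : x^`(a) = iter a d x by elim: (a) => //= k <-; rewrite -derivnS.
apply: (@power_vanish _ _ d (horner_eval rho) (count_mem rho s) a ('X - rho%:P) q hd _ h).
by rewrite /= /horner_eval hornerXsubC subrr.
Qed.

Lemma root_test_vanish a : (a < count_mem rho s)%N -> J (iter a D c) = 0.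
Proof.
move=> h; rewrite cV; apply: leibniz_vanish => // b ba.
by apply: JP; exact: leq_ltn_trans ba h.
Qed.

(** Since P = c U, vanishing of all derivatives of [c] would give the root a multiplicity in [P]
    exceeding its count in [s]. *)
Lemma root_test_nonzero : exists a, J (iter a D c) != 0.
Proof.
have [//|no] := pselect (exists a, J (iter a D c) != 0).
have c0 a : J (iter a D c) = 0 by apply/eqP/negP => /negP h; apply: no; exists a.
have : ('X - rho%:P) ^+ (count_mem rho s).+1 %| map_poly ev P.
  by apply: derivs_dvdp => // a _; rewrite -JDpf cU; exact: leibniz_vanish.
by rewrite PE => /dvdp_count; rewrite ltnn.
Qed.

(** [c] vanishes at the root to the order of its multiplicity, so the remainder does as soon as
    w^(size s) N does: either [w] vanishes there, and its power is large enough, or [N] has the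
    required order itself. *)
Lemma root_test_dvd w N q r : w ^+ size s * N = c * q + pf r ->
  J w = 0 \/ (forall a, (a < count_mem rho s)%N -> J (iter a D N) = 0) ->
  ('X - rho%:P) ^+ (count_mem rho s) %| map_poly ev r.
Proof.
move=> e h; apply: derivs_dvdp => // a ha; rewrite -JDpf.
have -> : pf r = w ^+ size s * N + c * (- q) by rewrite e mulrN addrAC subrr add0r.
have iterD k x y : iter k D (x + y) = iter k D x + iter k D y.
  by elim: k => //= k ->; rewrite (derD hD).
rewrite iterD rmorphD [X in _ + X]leibniz_vanish // ?addr0; last first.
  by move=> b ba; apply: root_test_vanish; exact: leq_ltn_trans ba ha.
case: h => [w0|hN]; first by apply: power_vanish => //; rewrite (leq_trans ha) // count_size.
rewrite mulrC; apply: leibniz_vanish => // b ba; apply: hN; exact: leq_ltn_trans ba ha.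
Qed.

End RootTest.

Section FormalWeierstrass.
Variables (n : nat) (j : 'I_n.+1).

Definition poly_fps (K : comNzRingType) (p : {poly fps K n}) : fps K n.+1 :=
  unpeel j (fun i => p`_i).

Lemma peel_poly_fps (K : comNzRingType) (p : {poly fps K n}) i : peel j (poly_fps p) i = p`_i.
Proof. by rewrite unpeelK. Qed.

Lemma poly_fps_is_additive (K : comNzRingType) : additive (@poly_fps K).
Proof.
move=> p q; apply: (@peel_inj _ _ j); apply/funext => i.
by rewrite rmorphB serBE /= !peel_poly_fps coefB.
Qed.

Lemma poly_fps_is_monoid (K : comNzRingType) : monoid_morphism (@poly_fps K).
Proof.
split=> [|p q]; apply: (@peel_inj _ _ j); apply/funext => i.
  by rewrite peel_poly_fps rmorph1 coef1 ser1E.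
rewrite peel_poly_fps rmorphM coefM serME; apply: eq_bigr => l _ /=.
by rewrite !peel_poly_fps.
Qed.

HB.instance Definition _ K := GRing.isZmodMorphism.Build {poly fps K n} (fps K n.+1)
  (@poly_fps K) (@poly_fps_is_additive K).
HB.instance Definition _ K := GRing.isMonoidMorphism.Build {poly fps K n} (fps K n.+1)
  (@poly_fps K) (@poly_fps_is_monoid K).

Lemma poly_fps_d (K : comNzRingType) (p : {poly fps K n}) : fps_d j (poly_fps p) = poly_fps p^`().
Proof.
apply: (@peel_inj _ _ j); apply/funext => i.
by rewrite peel_dj !unpeelK coef_deriv.
Qed.

Lemma poly_fps_low (K : comNzRingType) e (f : fps K n.+1) :
  (forall i, (e <= i)%N -> peel j f i = 0) ->
  exists2 r : {poly fps K n}, (size r <= e)%N & f = poly_fps r.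
Proof.
move=> h; exists (\poly_(i < e) peel j f i); first exact: size_poly.
apply: (@peel_inj _ _ j); rewrite unpeelK; apply/funext => i; rewrite coef_poly.
by case: ltnP => // /h.
Qed.

Section Division.
Variables (K : comNzRingType) (e : nat) (c : fps K n.+1).
Hypothesis clow : wlow j e e.+1 (c - fps_X K j ^+ e).

Let cE : c = fps_X K j ^+ e + (c - fps_X K j ^+ e). Proof. by rewrite addrC subrK. Qed.

Lemma weierstrass_division g : exists q (r : {poly fps K n}),
  g = c * q + poly_fps r /\ (size r <= e)%N.
Proof.
have [q /(weierstrass_fixP) qE] := weierstrass_fix clow g.
have [|r sr rE] := @poly_fps_low _ e (g - c * q).
  by move=> i ei; rewrite {1}cE; exact: qE.
by exists q, r; rewrite -rE addrC subrK.
Qed.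

Lemma weierstrass_division_uniq q (r : {poly fps K n}) :
  c * q + poly_fps r = 0 -> (size r <= e)%N -> q = 0 /\ r = 0.
Proof.
move=> h sr; have r0 i : (e <= i)%N -> r`_i = 0 by move=> ei; rewrite nth_default // (leq_trans sr).
have q0 : q = 0.
  apply: (weierstrass_uniq clow (g := 0)); apply/weierstrass_fixP => i ei.
    rewrite -cE; have -> : 0 - c * q = poly_fps r by rewrite -h addrAC subrr add0r.
    by rewrite peel_poly_fps r0.
  by rewrite mulr0 subrr.
split=> //; apply/polyP => i; move: h; rewrite q0 mulr0 add0r => /(congr1 (peel j)).
by rewrite unpeelK => /(congr1 (fun x : ser _ => x i)); rewrite coef0.
Qed.

(** Division of the [e]-th power of the distinguished variable by [c]; comparing the coefficients of
    that power shows that the quotient has constant term 1 and hence is a unit factor. *)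
Lemma weierstrass_polynomial : exists (P : {poly fps K n}) q,
  [/\ P \is monic, size P = e.+1, poly_fps P = c * q & q mnm0 = 1].
Proof.
have [q [r [E sr]]] := weierstrass_division (fps_X K j ^+ e).
have sz : (size (- r)%R < size ('X^e : {poly fps K n})%R)%N by rewrite size_polyXn size_polyN ltnS.
exists ('X^e - r), q; split.
- by rewrite monicE lead_coefDl // lead_coefXn.
- by rewrite size_polyDl // size_polyXn.
- rewrite rmorphB; apply/eqP; rewrite subr_eq -E; apply/eqP.
  apply: (@peel_inj _ _ j); apply/funext => i; rewrite peel_poly_fps rmorphXn /= peel_Xj.
  by rewrite coefXn serX_expE.
have e1 : poly_fps ('X^e - r) (mins j e mnm0) = 1.
  rewrite -[LHS]/(peel j _ e mnm0) peel_poly_fps coefB coefXn eqxx nth_default //.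
  by rewrite subr0 -[true%:R]/(1 : fps K n) fps1E eqxx.
have e2 : poly_fps ('X^e - r) = c * q.
  rewrite rmorphB; apply/eqP; rewrite subr_eq -E; apply/eqP.
  apply: (@peel_inj _ _ j); apply/funext => i; rewrite peel_poly_fps rmorphXn /= peel_Xj.
  by rewrite coefXn serX_expE.
rewrite -e1 e2 cE mulrDl fpsDE -[q mnm0]addr0; congr (_ + _).
  rewrite -[RHS]/(peel j (fps_X K j ^+ e * q) e mnm0) peel_XjM leqnn subnn.
  by rewrite /peel; congr q; apply/mnmP => l; rewrite !mnmE; case: unliftP => // *; rewrite mnm0E.
have := wlowM clow (fun m (h : (wdeg j e m < 0)%N) => False_ind (q m = 0) (notF h)).
by move=> L; symmetry; apply: L; rewrite wdeg_mins mdeg0 muln0 add0n addn0.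
Qed.

End Division.
End FormalWeierstrass.

Lemma mins00 n (j : 'I_n.+1) : mins j 0 mnm0 = mnm0.
Proof. by apply/mnmP => l; rewrite !mnmE; case: unliftP => // *; rewrite mnm0E. Qed.

Lemma wlow_axis (K : comNzRingType) n (j : 'I_n.+1) e (f : fps K n.+1) :
  (forall i, (i <= e)%N -> f (mins j i mnm0) = 0) -> wlow j e e.+1 f.
Proof.
move=> h m; rewrite /wdeg => hm; have m0 : mdel j m = mnm0.
  apply/eqP; rewrite -mdeg_eq0 -leqn0 leqNgt; apply/negP => d0.
  by move: hm; rewrite ltnNge (leq_trans _ (leq_addr _ _)) // leq_pmulr.
by rewrite -(mins_del j m) m0 h // -ltnS (leq_ltn_trans _ hm) // leq_addl.
Qed.

Lemma fps_unitP (K : fieldType) n (f : fps K n) : f mnm0 != 0 -> exists g, f * g = 1.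
Proof.
elim: n f => [|n IH] f f0.
  exists (@fps_const K 0 (f mnm0)^-1); apply/funext => m.
  have -> : m = mnm0 by apply/mnmP => -[].
  by rewrite fps_coef0M fps1E /fps_const eqxx divff.
have [|u uE] := IH (peel ord0 f 0%N); first by rewrite /peel mins00.
pose a := peel ord0 f; pose G (i : nat) (g : nat -> fps K n) : fps K n :=
  u * ((i == 0%N)%:R - \sum_(l < i) a (i - l)%N * g l).
have [|g gE] := @triangular_rec _ 0 G.
  move=> i x y h; rewrite /G; congr (_ * (_ - _)); apply: eq_bigr => l _.
  by rewrite h.
exists (unpeel ord0 g); apply: (@peel_inj _ _ ord0); apply/funext => i.
rewrite rmorphM rmorph1 /= unpeelK mulrC serME ser1E big_ord_recr /= subnn.
rewrite [g i]gE /G mulrAC [u * _]mulrC uE mul1r addrC.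
by under eq_bigr => l _ do rewrite mulrC; rewrite subrK.
Qed.

Lemma fps_const_unit (K : fieldType) n (c : K) : c != 0 ->
  @fps_const K n c * @fps_const K n c^-1 = 1.
Proof. by move=> c0; rewrite -rmorphM divff // rmorph1. Qed.

Section RootEvaluation.
Variables (K F : fieldType) (n e : nat) (j : 'I_n.+1) (c : fps K n.+1).
Hypothesis clow : wlow j e e.+1 (c - fps_X K j ^+ e).
Variables (P : {poly fps K n}) (U : fps K n.+1).
Hypotheses (Pm : P \is monic) (Psz : size P = e.+1) (PE : poly_fps j P = c * U).
Variables (ev : {rmorphism fps K n -> F}) (rho : F).
Hypothesis Prho : (map_poly ev P).[rho] = 0.

(** By Weierstrass division, series modulo [c] are polynomials modulo [P]. So a series can be
    evaluated at a root of [P] in any field, where convergence makes no sense. *)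
Lemma root_evaluation : exists J : {rmorphism fps K n.+1 -> F},
  forall p, J (poly_fps j p) = (map_poly ev p).[rho].
Proof.
have ex g : exists r : {poly fps K n}, (size r <= e)%N /\ exists q, g = c * q + poly_fps j r.
  by have [q [r [E sr]]] := weierstrass_division clow g; exists r; split => //; exists q.
pose rem g := projT1 (cid (ex g)).
have remP g : (size (rem g) <= e)%N /\ exists q, g = c * q + poly_fps j (rem g).
  by rewrite /rem; case: cid.
have uniq g q r : g = c * q + poly_fps j r -> (size r <= e)%N -> rem g = r.
  move=> E sr; have [sg [q' E']] := remP g; apply/eqP; rewrite -subr_eq0; apply/eqP.
  apply: (weierstrass_division_uniq clow (q := q' - q) _ _).2; last first.
    by rewrite (leq_trans (size_polyD _ _)) // geq_max sg size_polyN.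
  rewrite rmorphB /=; have := E; rewrite {1}E' => /eqP; rewrite -subr_eq0 => /eqP <-; ring.
pose J g := (map_poly ev (rem g)).[rho].
have JE p : J (poly_fps j p) = (map_poly ev p).[rho].
  have E := Pdiv.RingMonic.rdivp_eq Pm p.
  rewrite /J (uniq _ (U * poly_fps j (Pdiv.Ring.rdivp p P)) (Pdiv.Ring.rmodp p P)).
  - rewrite [in RHS]E rmorphD rmorphM hornerD hornerM Prho mulr0 add0r //.
  - by rewrite {1}E rmorphD rmorphM /= PE; ring.
  - by rewrite -ltnS -Psz Pdiv.Ring.ltn_rmodpN0 // monic_neq0.
have J_add : zmod_morphism J.
  move=> g g'; have [sg [q E]] := remP g; have [sg' [q' E']] := remP g'.
  rewrite /J (uniq (g - g') (q - q') (rem g - rem g')).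
  - by rewrite rmorphB hornerD hornerN.
  - by rewrite {1}E {1}E' rmorphB /=; ring.
  - by rewrite (leq_trans (size_polyD _ _)) // geq_max sg size_polyN.
have J_mul : monoid_morphism J.
  split; first by rewrite -[1](rmorph1 (@poly_fps n j K)) JE rmorph1 hornerC.
  move=> g g'; have [sg [q E]] := remP g; have [sg' [q' E']] := remP g'.
  have [s'' [q'' E'']] := remP (poly_fps j (rem g * rem g')).
  rewrite /J (uniq (g * g') (q * g' + q' * poly_fps j (rem g) + q'') (rem (poly_fps j (rem g * rem g')))) //.
    by rewrite -[LHS]/(J _) JE rmorphM hornerM.
  transitivity (c * (q * g' + q' * poly_fps j (rem g)) + poly_fps j (rem g * rem g')).
    rewrite rmorphM /=; set a := poly_fps j _ in E *; set b := poly_fps j _ in E' *.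
    have ag : a * g' = a * (c * q' + b) by rewrite -E'.
    by rewrite {1}E mulrDl ag; ring.
  by rewrite {1}E''; ring.
pose H : {rmorphism fps K n.+1 -> F} := HB.pack J
  (GRing.isZmodMorphism.Build _ _ J J_add) (GRing.isMonoidMorphism.Build _ _ J J_mul).
by exists H.
Qed.

End RootEvaluation.

(** * Linear changes of coordinates making a series regular in one variable *)

Section Regularisation.
Variables (K : fieldType).
Hypothesis K0 : char0 K.

Lemma digits_inj n B (f g : 'I_n -> nat) : (forall i, f i < B)%N -> (forall i, g i < B)%N ->
  (\sum_i f i * B ^ i = \sum_i g i * B ^ i)%N -> f =1 g.
Proof.
elim: n f g => [|n IH] f g fB gB; first by move=> _ [].
have B0 : (0 < B)%N by apply: leq_ltn_trans (fB ord0).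
have E (h : 'I_n.+1 -> nat) : (\sum_i h i * B ^ i)%N = (h ord0 + (\sum_i h (lift ord0 i) * B ^ i) * B)%N.
  rewrite big_ord_recl expn0 muln1 big_distrl; congr (_ + _)%N.
  by apply: eq_bigr => i _; rewrite lift0 /= expnSr mulnA.
rewrite !E => e; have e0 : f ord0 = g ord0.
  by have := congr1 (modn^~ B) e; rewrite /= ![(_ + _ * B)%N]addnC !modnMDl !modn_small.
move: e; rewrite e0 => /addnI /eqP; rewrite eqn_pmul2r // => /eqP /IH h i.
by case: (unliftP ord0 i) => [l ->|->] //; apply: h.
Qed.

Lemma nonroot (q : {poly K}) : q != 0 -> exists2 t : K, t != 0 & q.[t] != 0.
Proof.
move=> q0; pose s : seq K := [seq i.+1%:R | i <- iota 0 (size q)].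
have us : uniq s.
  rewrite map_inj_in_uniq ?iota_uniq // => a b _ _ /eqP.
  wlog ab : a b / (a <= b)%N.
    by move=> h; have [/h//|/ltnW /h] := leqP a b; rewrite eq_sym => h' /h' ->.
  rewrite eq_sym -subr_eq0 -natrB ?ltnS // subSS; case E : (b - a)%N => [|k].
    by move=> _; apply/eqP; rewrite eqn_leq ab -subn_eq0 E.
  by rewrite (negbTE (K0 k)).
have [t ts qt] : exists2 t, t \in s & ~~ root q t.
  apply/hasP; rewrite has_predC; apply/negP => al.
  have := max_poly_roots q0 al us; by rewrite size_map size_iota ltnn.
by exists t => //; case/mapP: ts => i _ ->; exact: K0.
Qed.

Variables (n : nat) (j : 'I_n.+1).

(** The change of coordinates for which differentiation along [la] becomes differentiation in the
    distinguished variable, see [shear_d]. *)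
Definition shear (la : 'I_n.+1 -> K) (i : 'I_n.+1) : fps K n.+1 :=
  (if i == j then 0 else fps_X K i) + @fps_const K n.+1 (la i) * fps_X K j.

Lemma shear_coef0 la i : shear la i mnm0 = 0.
Proof. by rewrite /shear fpsDE fps_coef0M !fps_X_coef0 mulr0 addr0; case: eqP; rewrite // fps_X_coef0. Qed.

Lemma shear_d la i : fps_d j (shear la i) = @fps_const K n.+1 (la i).
Proof.
rewrite fps_dD fps_dM fps_d_const fps_d_X eqxx mul0r add0r mulr1.
case: eqP => [_|/eqP ij]; first by rewrite (der0 ((fps_dsystem K n.+1).1 j)) add0r.
by rewrite fps_d_X eq_sym (negbTE ij) add0r.
Qed.

Lemma shearK la : la j != 0 -> exists2 v, forall i, v i mnm0 = 0 & forall c,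
  fps_subst v (fps_subst (shear la) c) = c /\ fps_subst (shear la) (fps_subst v c) = c.
Proof.
move=> lj; pose v (i : 'I_n.+1) : fps K n.+1 :=
  (if i == j then @fps_const K n.+1 (la j)^-1 * fps_X K j
   else fps_X K i - @fps_const K n.+1 (la i / la j) * fps_X K j).
have v0 i : v i mnm0 = 0.
  by rewrite /v; case: eqP => _; rewrite ?fpsBE fps_coef0M !fps_X_coef0 mulr0 ?subr0.
have s0 := shear_coef0 la; exists v => // c.
have cc a b (f : fps K n.+1) : @fps_const K n.+1 a * (@fps_const K n.+1 b * f) = @fps_const K n.+1 (a * b) * f.
  by rewrite mulrA -rmorphM.
rewrite !fps_subst_comp //; split.
  rewrite (_ : (fun i => _) = @fps_X K n.+1) ?fps_subst_id //; apply/funext => i.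
  rewrite -[LHS]/(fps_subst_hom v0 (shear la i)) rmorphD rmorphM /= fps_substC // fps_substX //.
  rewrite {2}/v eqxx cc; case: eqP => [->|ij].
    have -> : fps_subst v 0 = 0 by exact: (rmorph0 (fps_subst_hom v0)).
    by rewrite add0r divff // rmorph1 mul1r.
  rewrite fps_substX // /v; case: eqP => // _; exact: subrK.
rewrite (_ : (fun i => _) = @fps_X K n.+1) ?fps_subst_id //; apply/funext => i.
have sj : shear la j = @fps_const K n.+1 (la j) * fps_X K j by rewrite /shear eqxx add0r.
rewrite -[LHS]/(fps_subst_hom s0 (v i)) /v; case: eqP => [->|ij].
  by rewrite rmorphM /= fps_substC // fps_substX // sj cc mulVf // rmorph1 mul1r.
rewrite rmorphB rmorphM /= fps_substC // !fps_substX // sj cc divfK //.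
by rewrite /shear; case: eqP => // _; exact: addrK.
Qed.

(** On the line of direction [la] the part of degree E of [c] becomes [q.[t]] times a power of the
    variable. With la_i = t^(B^i) and B = E + 1, distinct monomials of degree E give distinct powers
    of t by uniqueness of digits, so [q] is nonzero. *)
Lemma shear_regular (c : fps K n.+1) : c != 0 -> exists (la : 'I_n.+1 -> K) e u,
  [/\ la j != 0, u != 0 & wlow j e e.+1 (@fps_const K n.+1 u * fps_subst (shear la) c - fps_X K j ^+ e)].
Proof.
move=> c0; have [d0 cd0] : exists d, c d != 0.
  by apply: contrapT => h; case/eqP: c0; apply/funext => d; apply: contrapT => /eqP hd; apply: h; exists d.
pose E := mdeg d0; pose B := E.+1.
pose N (d : multinom n.+1) := (\sum_i d i * B ^ i)%N.
pose q : {poly K} := \sum_(d : bmultinom n.+1 E.+1 | mdeg d == E) c d *: 'X^(N d).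
have q0 : q != 0.
  apply/eqP => /(congr1 (fun p : {poly K} => p`_(N d0))); rewrite coef0 coef_sum => /eqP.
  have hd0 : (mdeg d0 < E.+1)%N by [].
  rewrite (bigD1 (BMultinom hd0)) //= coefZ coefXn eqxx mulr1 big1 ?addr0; first exact/negP.
  move=> d /andP[/eqP dE dd0]; rewrite coefZ coefXn; case: eqP => [NN|]; last by rewrite mulr0.
  have small (m : multinom n.+1) : mdeg m = E -> forall i, (m i < B)%N.
    by move=> mE i; rewrite ltnS -mE mdegE (bigD1 i) //= leq_addr.
  have := digits_inj (small _ (erefl : mdeg d0 = E)) (small _ dE) NN.
  by move=> /mnmP e; case/eqP: dd0; apply: val_inj.
have [t t0 qt] := nonroot q0; pose la (i : 'I_n.+1) := t ^+ (B ^ i)%N.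
have la0 i : la i != 0 by rewrite expf_neq0.
have s0 := shear_coef0 la.
pose ax : {rmorphism fps K n.+1 -> ser K} := ser_map (@fps_coef0 K n) \o peel j.
have axs i : ax (shear la i) = serC (la i) * serX K.
  rewrite /shear rmorphD rmorphM /= peel_const peel_Xj.
  have -> : ser_map (@fps_coef0 K n) (serC (@fps_const K n (la i))) = serC (la i).
    by apply/funext => -[|k] //; rewrite /ser_map /serC /= /fps_coef0 /fps_const eqxx.
  have -> : ser_map (@fps_coef0 K n) (serX _) = serX K.
    by apply/funext => k; rewrite /ser_map /serX rmorph_nat.
  case: eqP => [_|/eqP ij]; first by rewrite !rmorph0 add0r.
  have [l ->|e] := unliftP j i; last by rewrite e eqxx in ij.
  rewrite peel_X; have -> : ser_map (@fps_coef0 K n) (serC (fps_X K l)) = 0; last by rewrite add0r.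
  by apply/funext => -[|k] //; exact: fps_X_coef0.
have axE : ax (fps_subst (shear la) c) E = q.[t].
  rewrite /= /ser_map /fps_coef0 /peel /fps_subst mdeg_mins mdeg0 addn0.
  rewrite horner_sum [RHS]big_mkcond /=; apply: eq_bigr => d _.
  transitivity (c d * ax (mmap1 (shear la) d) E); first by [].
  rewrite /mmap1 rmorph_prod.
  under eq_bigr => i _ do rewrite rmorphXn axs exprMn -rmorphXn /la -exprM.
  have -> : \prod_(i < n.+1) (serC (t ^+ (B ^ i * d i)%N) * serX K ^+ d i) = serC (t ^+ N d) * serX K ^+ mdeg d.
    rewrite big_split; congr (_ * _); last by rewrite /= prodrXr mdegE.
    have -> : N d = (\sum_(i < n.+1) B ^ i * d i)%N by apply: eq_bigr => i _; rewrite mulnC.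
    by rewrite -prodrXr (rmorph_prod (@serC K)).
  rewrite serCM serX_expE eq_sym.
  by case: eqP => _; rewrite ?mulr0 // mulr1 hornerZ hornerXn.
have : ax (fps_subst (shear la) c) != 0.
  by apply/eqP => h; case/eqP: qt; rewrite -axE h.
case/ser_neq0 => e ae alow; exists la, e, (ax (fps_subst (shear la) c) e)^-1.
split; rewrite ?invr_eq0 //; apply: wlow_axis => i ie.
rewrite fpsBE fps_constM -[fps_subst _ _ _]/(ax (fps_subst (shear la) c) i).
rewrite -[(fps_X K j ^+ e) _]/(ax (fps_X K j ^+ e) i) rmorphXn /= peel_Xj.
have -> : ser_map (@fps_coef0 K n) (serX _) = serX K.
  by apply/funext => k; rewrite /ser_map /serX rmorph_nat.
rewrite serX_expE; move: ie; rewrite leq_eqVlt => /orP[/eqP ->|ie].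
  by rewrite eqxx mulVf // subrr.
by have := alow _ ie; rewrite /= => ->; rewrite mulr0 ltn_eqF // subrr.
Qed.

End Regularisation.

(** * Divisibility tested at points *)

Section Points.
Variables (K : fieldType) (n : nat) (O : comNzRingType) (d : 'I_n -> O -> O).
Hypotheses (hd : dsystem d) (K0 : char0 K).
Variables (iota : {rmorphism O -> fps K n}) (w : O) (pts : {rmorphism O -> K} -> Prop).

Definition points_dense : Prop :=
  forall s, iota s != 0 -> exists2 kap, pts kap & kap (w * s) != 0.

(** Nothing is asked at points where [w] vanishes or where [c] expands to zero; the power of [w] in
    the conclusion pays for the former. *)
Definition points_divide : Prop := forall c N, iota c != 0 ->
  (forall kap, pts kap -> kap w != 0 -> taylor_hom hd kap K0 c != 0 ->
     exists S, taylor_hom hd kap K0 N = taylor_hom hd kap K0 c * S) ->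
  exists m Q, iota (w ^+ m * N) = iota c * Q.

End Points.

Lemma fps0_divide (K : fieldType) (O : comNzRingType) (d : 'I_0 -> O -> O) (hd : dsystem d)
    (K0 : char0 K) (iota : {rmorphism O -> fps K 0}) w pts : points_divide hd K0 iota w pts.
Proof.
move=> c N c0 _; have [|g cg] := @fps_unitP K 0 (iota c).
  apply: contraNneq c0 => h; apply/eqP/funext => m.
  by have -> : m = mnm0 by apply/mnmP => -[].
by exists 0, (g * iota N); rewrite expr0 mul1r mulrA cg mul1r.
Qed.

Section AlgebraicPoints.
Variables (K : closedFieldType) (n : nat) (O : comNzRingType) (d : 'I_n -> O -> O).
Hypotheses (hd : dsystem d) (K0 : char0 K) (Kunc : ~ countable [set: K]%classic).
Variables (iota : {rmorphism O -> fps K n}) (w : O) (cst : {rmorphism K -> O}) (e : nat -> O).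
Hypothesis iota_inj : injective iota.
Hypothesis iota_d : forall i x, iota (d i x) = fps_d i (iota x).
Hypothesis iota_cst : forall a, iota (cst a) = @fps_const K n a.
Hypothesis span : forall x, exists N (c : 'I_N -> K), x = \sum_j cst (c j) * e j.
Hypothesis w0 : iota w != 0.

Definition algebraic_point (kap : {rmorphism O -> K}) : Prop := forall a, kap (cst a) = a.

Lemma algebraic_points_dense : points_dense iota w algebraic_point.
Proof.
move=> s s0; have [||kap [kc _ kh]] := @nullstellensatz K O cst e [set 0]%classic (w * s) Kunc span.
- by split=> [//|x y -> ->|x y ->] /=; rewrite ?addr0 ?mulr0.
- move=> i /= /eqP; rewrite -(inj_eq iota_inj) rmorph0 rmorphXn rmorphM.
  by rewrite expf_eq0 mulf_eq0 (negbTE w0) (negbTE s0) andbF.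
by exists kap.
Qed.

Lemma cst_d i a : d i (cst a) = 0.
Proof. by apply: iota_inj; rewrite iota_d iota_cst fps_d_const rmorph0. Qed.

Lemma taylor_cst kap a : algebraic_point kap -> taylor_hom hd kap K0 (cst a) = @fps_const K n a.
Proof.
move=> hk; apply: (@fps_char0_ind _ _ K0 (fun g h =>
    (g = taylor_hom hd kap K0 (cst a) /\ h = @fps_const K n a) \/ g = h)); last by left.
  by move=> g h [[-> ->]|->] //; rewrite /= taylor0 hk /fps_const eqxx.
move=> i g h [[-> ->]|->]; right => //.
by rewrite [LHS]taylor_d // cst_d fps_d_const; exact: (rmorph0 (taylor_hom hd kap K0)).
Qed.

End AlgebraicPoints.

(** The remainder of w^m N by the regularised [c] is tested at the roots of the Weierstrass
    polynomial in a splitting field. A root where the test fails is a point of the algebra with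
    values in a large field; the nullstellensatz specialises it to a K-point at which the hypothesis
    is contradicted. *)
Lemma algebraic_points_divide (K : closedFieldType) n (O : comNzRingType) (d : 'I_n -> O -> O)
    (hd : dsystem d) (K0 : char0 K) (iota : {rmorphism O -> fps K n}) (w : O)
    (cst : {rmorphism K -> O}) (e : nat -> O) :
  ~ countable [set: K]%classic -> injective iota ->
  (forall i x, iota (d i x) = fps_d i (iota x)) ->
  (forall a, iota (cst a) = @fps_const K n a) ->
  (forall x, exists N (c : 'I_N -> K), x = \sum_j cst (c j) * e j) ->
  points_divide hd K0 iota w (algebraic_point cst).
Proof.
move=> Kunc inj id_ ic span; case: n d hd iota inj id_ ic => [|n] d hd iota inj id_ ic.
  exact: fps0_divide.
move=> c N c0 hdiv; pose j : 'I_n.+1 := ord0.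
have [la [m [u [lj u0 clow]]]] := shear_regular K0 j c0.
have s0 := shear_coef0 j la; pose psi := fps_subst_hom s0.
set c1 := _ * _ in clow.
have [P [q [Pm Psz PE q0]]] := weierstrass_polynomial clow.
have [|V qV] := @fps_unitP K n.+1 q; first by rewrite q0 oner_eq0.
have c1P : c1 = poly_fps j P * V by rewrite PE -mulrA qV mulr1.
have [F0 [e0 [d0 [hd0 _ inj0]]]] := fraction_dfield (fps_dsystem K n).
have F00 : char0 F0.
  exact: (char0_morph (e0 \o (@fps_const K n) : {rmorphism K -> F0}) K0).
have [F [e1 [d1 [s [_ _ sE]]]]] := splitting_dfield hd0 F00 (monic_map e0 Pm).
pose ev : {rmorphism fps K n -> F} := e1 \o e0.
have ev_inj : injective ev by move=> x y /fmorph_inj /inj0.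
have F1 : char0 F by exact: (char0_morph (e1 : {rmorphism F0 -> F}) F00).
have {}sE : map_poly ev P = \prod_(rho <- s) ('X - rho%:P) by rewrite -sE map_poly_comp.
have sz : size s = m.
  by have := congr1 (fun p : {poly F} => size p) sE; rewrite size_prod_XsubC size_map_monic // Psz => -[].
pose D := @fps_d K n.+1 j; pose dla x := \sum_l cst (la l) * d l x.
have hD : derivation D := (fps_dsystem K n.+1).1 j.
have Dpsi x : D (psi (iota x)) = psi (iota (dla x)).
  pose ps : {rmorphism O -> fps K n.+1} := psi \o iota.
  transitivity (\sum_l ps (cst (la l)) * ps (d l x)).
    rewrite /D /= fps_subst_d //; apply: eq_bigr => l _.
    by rewrite shear_d ic id_ fps_substC // mulrC.
  by rewrite -[RHS]/(ps (dla x)) rmorph_sum; apply: eq_bigr => l _; rewrite rmorphM.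
have iterD a x : iter a D (psi (iota x)) = psi (iota (iter a dla x)).
  by elim: a => [|a IH] //; rewrite iterS IH Dpsi.
(* No root of [P] has multiplicity above its degree [m], so this power of [w] is enough at all roots
   where [w] vanishes. *)
have [q1 [r [E sr]]] := weierstrass_division clow (psi (iota w) ^+ m * psi (iota N)).
have hdla : derivation dla.
  split=> x y; rewrite /dla.
    by rewrite -big_split; apply: eq_bigr => l _; rewrite (derD (hd.1 l)) mulrDr.
  rewrite mulr_suml mulr_sumr -big_split; apply: eq_bigr => l _.
  by rewrite (derM (hd.1 l)) mulrDr mulrA [cst _ * (x * _)]mulrCA.
have r0 : r = 0.
  suff h : map_poly ev r = 0.
    apply/polyP => i; have := congr1 (fun p : {poly F} => p`_i) h.
    by rewrite (@coef_map _ _ ev) !coef0 -(rmorph0 ev) => /ev_inj.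
  suff h : \prod_(rho <- s) ('X - rho%:P) %| map_poly ev r.
    apply: contraTeq h => h; rewrite gtNdvdp // size_prod_XsubC sz ltnS.
    exact: leq_trans (size_poly _ _) sr.
  apply: count_dvdp => rho rs.
  have Prho : (map_poly ev P).[rho] = 0.
    by apply/rootP; rewrite sE root_prod_XsubC.
  have [J JE] := root_evaluation clow Pm Psz PE Prho.
  have Dpf p : D (poly_fps j p) = poly_fps j p^`() by exact: poly_fps_d.
  rewrite -sz in E; apply: (root_test_dvd hD Dpf F1 sE JE c1P E).
  have [|Jw] := eqVneq (J (psi (iota w))) 0; [by left|right => a ha].
  apply/eqP/negP => /negP JN.
  have [a' Ja'] := root_test_nonzero hD Dpf F1 sE JE PE.
  pose J' : {rmorphism O -> F} := J \o psi \o iota.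
  have JD a0 x : J' (iter a0 dla x) = J (iter a0 D (psi (iota x))) by rewrite iterD.
  have Jc b : J (iter b D c1) = J (@fps_const K n.+1 u) * J' (iter b dla c).
    rewrite JD -rmorphM; congr (J _); elim: b => [//|b IH]; rewrite !iterS IH.
    by rewrite (derM hD) [D (fps_const _)]fps_d_const mul0r add0r.
  have Ju : J (@fps_const K n.+1 u) != 0.
    apply/eqP => Ju; have := rmorph1 J.
    by rewrite -(fps_const_unit n.+1 u0) rmorphM Ju mul0r => /eqP; rewrite eq_sym oner_eq0.
  (* The K-point must keep nonzero [w], the derivative of [N] that violates the test, and one
     derivative of [c], so that [c] does not expand to zero. Relations killed by [J'] persist, so
     [c] still vanishes there to order greater than [a] along [la]. *)
  pose h := w * iter a dla N * iter a' dla c.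
  have [||kap [kc kI kh]] := @nullstellensatz K O cst e [set x | J' x = 0]%classic h Kunc span.
  - split=> [|x y /= hx hy|x y /= hy]; first exact: (rmorph0 J').
      by rewrite -[LHS]/(J' _) rmorphD /= hx hy addr0.
    by rewrite -[LHS]/(J' _) rmorphM /= hy mulr0.
  - move=> i /= /eqP; rewrite -[X in X == 0]/(J' _) rmorphXn expf_eq0 => /andP[_].
    rewrite /h !rmorphM !mulf_eq0 !JD -orbA => /or3P[|| ].
    + exact/negP.
    + exact/negP.
    + rewrite -JD => /eqP e'; move: Ja'; rewrite Jc e' mulr0 eqxx //.
  move: kh; rewrite /h !rmorphM !mulf_eq0 !negb_or -andbA => /and3P[kw kN kc'].
  pose Th := taylor_hom hd kap K0; pose Dla (g : fps K n.+1) := \sum_l @fps_const K n.+1 (la l) * fps_d l g.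
  have hDla : derivation Dla.
    split=> x y; rewrite /Dla.
      by rewrite -big_split; apply: eq_bigr => l _; rewrite fps_dD mulrDr.
    rewrite mulr_suml mulr_sumr -big_split; apply: eq_bigr => l _.
    by rewrite fps_dM mulrDr mulrA [@fps_const _ _ _ * (x * _)]mulrCA.
  have ThD a0 x : fps_coef0 (iter a0 Dla (Th x)) = kap (iter a0 dla x).
    have -> : iter a0 Dla (Th x) = Th (iter a0 dla x).
      elim: a0 => //= a0 ->; rewrite /Dla /dla -[RHS]/(Th _) rmorph_sum; apply: eq_bigr => l _.
      by rewrite rmorphM (taylor_cst hd K0 inj id_ ic _ kc) /= taylor_d.
    by rewrite /fps_coef0 /= taylor0.
  have Thc : Th c != 0.
    apply: contraNneq kc' => Thc; rewrite -ThD Thc.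
    have -> : iter a' Dla 0 = 0 by elim: (a') => //= k ->; exact: (der0 hDla).
    by rewrite rmorph0.
  have [S SE] := hdiv kap kc kw Thc.
  have : fps_coef0 (iter a Dla (Th c * S)) = 0.
    apply: (leibniz_vanish (phi := @fps_coef0 K n.+1)) => // b ba.
    rewrite [LHS]ThD; apply: kI => /=.
    have := root_test_vanish hD Dpf sE JE c1P (leq_ltn_trans ba ha).
    by rewrite Jc => /eqP; rewrite mulf_eq0 (negbTE Ju) => /eqP.
  by rewrite -[Th c * S]SE [LHS]ThD => e0'; rewrite e0' eqxx in kN.
have [v v0 vK] := shearK K0 lj.
exists m, (@fps_const K n.+1 u * fps_subst v q1).
have := congr1 (fps_subst_hom v0) E; rewrite r0 rmorph0 addr0.
rewrite /c1 !(rmorphM (fps_subst_hom v0)) (rmorphXn (fps_subst_hom v0)) /= fps_substC // !(vK _).1.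
by rewrite rmorphM rmorphXn /= => ->; rewrite mulrCA mulrA.
Qed.

(** * Divisibility by the coordinates *)

Section VariableDivisors.
Variables (K : idomainType).

Definition X_dvd n (l : 'I_n) (f : fps K n) := exists g, f = fps_X K l * g.

Lemma X_dvdP n (l : 'I_n.+1) (f : fps K n.+1) : X_dvd l f <-> peel l f 0%N = 0.
Proof.
split=> [[g ->]|h]; first by rewrite rmorphM /= peel_Xj serM0 [serX _ _]/(0 : fps K n) mul0r.
exists (unpeel l (ser_drop 1 (peel l f))); apply: (@peel_inj _ _ l); rewrite rmorphM /= peel_Xj unpeelK.
by rewrite {1}(@ser_divX _ 1 (peel l f)) ?expr1 // => -[|].
Qed.

Lemma X_dvd_prime n (l : 'I_n) (f g : fps K n) : X_dvd l (f * g) -> ~ X_dvd l f -> X_dvd l g.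
Proof.
case: n l f g => [[]//|n] l f g; rewrite !X_dvdP rmorphM serM0 => /eqP.
by rewrite mulf_eq0 => /orP[|/eqP //] /eqP.
Qed.

Lemma X_dvd_primeX n (l : 'I_n) (f g : fps K n) k : X_dvd l (f ^+ k * g) -> ~ X_dvd l f -> X_dvd l g.
Proof.
move=> h nf; elim: k g h => [|k IH] g; first by rewrite expr0 mul1r.
by rewrite exprSr -mulrA => /IH /X_dvd_prime; apply.
Qed.

Lemma X_dvdD n (l : 'I_n) (f g : fps K n) : X_dvd l f -> X_dvd l g -> X_dvd l (f + g).
Proof. by move=> [a ->] [b ->]; exists (a + b); rewrite mulrDr. Qed.

Lemma X_dvdM n (l : 'I_n) (f g : fps K n) : X_dvd l g -> X_dvd l (f * g).
Proof. by move=> [b ->]; exists (f * b); rewrite mulrCA. Qed.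

Lemma fps_X_neq0 n (l : 'I_n) : fps_X K l != 0.
Proof.
by apply/eqP => /(congr1 (fun f : fps K n => f (mnm1 l))) /eqP; rewrite /fps_X eqxx oner_eq0.
Qed.

Lemma fps_X_mul_coef n (l : 'I_n) (g : fps K n) m : (fps_X K l * g) m != 0 ->
  exists2 m', mdeg m = (mdeg m').+1 & g m' != 0.
Proof.
case: n l g m => [[]//|n] l g m.
have -> : (fps_X K l * g) m = peel l (fps_X K l * g) (m l) (mdel l m) by rewrite /peel mins_del.
rewrite rmorphM /= peel_Xj -[serX _]expr1 serX_expM; case: ltnP => hl; rewrite ?eqxx //.
move=> h; exists (mins l (m l - 1) (mdel l m)); last exact: h.
by rewrite -{1}(mins_del l m) !mdeg_mins; lia.
Qed.

Definition Xs n (ls : seq 'I_n) : fps K n := \prod_(l <- ls) fps_X K l.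

Lemma Xs_neq0 n (ls : seq 'I_n) : Xs ls != 0.
Proof. by rewrite prodf_seq_neq0; apply/allP => l _; rewrite fps_X_neq0. Qed.

(** Each coordinate split off lowers the degree of a chosen monomial with nonzero coefficient, so
    the process stops. *)
Lemma Xs_part n (W : pred 'I_n) (c : fps K n) : c != 0 ->
  exists ls c', [/\ all W ls, c = Xs ls * c' & forall l, W l -> ~ X_dvd l c'].
Proof.
move=> c0; have [m cm] : exists m, c m != 0.
  by apply: contrapT => h; case/eqP: c0; apply/funext => d; apply: contrapT => /eqP hd; apply: h; exists d.
elim: {m}(mdeg m) {-2}m (erefl (mdeg m)) c cm {c0} => [|k IH] m mk c cm.
  exists [::], c; rewrite /Xs big_nil mul1r; split=> // l _ [g cE]; case/eqP: cm.
  have -> : m = mnm0 by apply/eqP; rewrite -mdeg_eq0 mk.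
  by rewrite cE fps_coef0M fps_X_coef0 mul0r.
have [[l [Wl [g cE]]]|no] := pselect (exists l, W l /\ X_dvd l c); last first.
  by exists [::], c; rewrite /Xs big_nil mul1r; split=> // l Wl h; apply: no; exists l.
have [m' mm' gm'] : exists2 m', mdeg m = (mdeg m').+1 & g m' != 0 by apply: (@fps_X_mul_coef _ l); rewrite -cE.
have mk' : mdeg m' = k by move: mk; rewrite mm' => -[].
have [ls [c' [Wls gE pr]]] := IH m' mk' g gm'.
by exists (l :: ls), c'; split; rewrite /= ?Wl // cE gE /Xs big_cons mulrA.
Qed.

End VariableDivisors.

Definition ser_eqmod (R : comNzRingType) (j : nat) (f g : ser R) := forall i, (i < j)%N -> f i = g i.

Lemma ser_eqmodMl (R : comNzRingType) j (h f g : ser R) :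
  ser_eqmod j f g -> ser_eqmod j (h * f) (h * g).
Proof.
move=> e i ij; rewrite !serME; apply: eq_bigr => l _; rewrite e //.
by apply: leq_ltn_trans ij; exact: leq_subr.
Qed.

Lemma ser_eqmod_cancel (R : idomainType) j (h f g : ser R) :
  h 0%N != 0 -> ser_eqmod j (h * f) (h * g) -> ser_eqmod j f g.
Proof.
move=> h0 e; elim/ltn_ind => i IH ij; have := e i ij; rewrite !serME !big_ord_recl !subn0 /=.
rewrite (eq_bigr (fun l : 'I_i => h (bump 0 l) * g (i - bump 0 l)%N)) => [/addIr /(mulfI h0) //|l _].
by rewrite IH // /bump /= add1n; have := ltn_ord l; lia.
Qed.

(** The ring need not contain an inverse of the constant term of [P]. Its [j]-th power as a factor
    keeps the quotient modulo t^j over the same ring, where its coefficients can be tested at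
    points. *)
Lemma pseudo_division (R : comNzRingType) (P N : ser R) j :
  exists A, ser_eqmod j (serC (P 0%N) ^+ j * N) (P * A).
Proof.
suff [A [Q E]] : exists A Q, serC (P 0%N) ^+ j * N = P * A + serX R ^+ j * Q.
  by exists A => i ij; rewrite E serDE serX_expM leqNgt ij addr0.
elim: j => [|j [A [Q E]]]; first by exists 0, N; rewrite !expr0 mulr0 add0r.
pose Z := serC (P 0%N) * Q - P * serC (Q 0%N).
have ZE : Z = serX R ^+ 1 * ser_drop 1 Z.
  apply: ser_divX => -[|] // _; rewrite /Z serBE serCM mulrC [P * _]mulrC serCM mulrC subrr //.
exists (serC (P 0%N) * A + serX R ^+ j * serC (Q 0%N)), (ser_drop 1 Z).
have -> : serX R ^+ j.+1 * ser_drop 1 Z = serX R ^+ j * Z by rewrite exprSr -mulrA -(expr1 (serX R)) -ZE.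
by rewrite exprS -mulrA E /Z; ring.
Qed.

Section SeriesDivision.
Variables (K : fieldType) (n : nat) (O : comNzRingType) (d : 'I_n -> O -> O).
Hypotheses (hd : dsystem d) (K0 : char0 K).
Variables (iota : {rmorphism O -> fps K n}) (W : pred 'I_n) (w : O) (pts : {rmorphism O -> K} -> Prop).
Hypothesis wE : iota w = \prod_(l | W l) fps_X K l.
Hypothesis dense : points_dense iota w pts.
Hypothesis divide : points_divide hd K0 iota w pts.
Hypothesis iota_inj : injective iota.

Let Th kap : {rmorphism O -> fps K n} := taylor_hom hd kap K0.

Lemma points_zero s : (forall kap, pts kap -> kap w != 0 -> Th kap s = 0) -> s = 0.
Proof.
move=> h; apply/eqP/negP => /negP s0; have [|kap pk] := dense (s := s).
  by rewrite -(rmorph0 iota) (inj_eq iota_inj).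
rewrite rmorphM mulf_eq0 negb_or => /andP[kw /eqP ks]; apply: ks.
by have := congr1 (fun f : fps K n => f mnm0) (h kap pk kw); rewrite /= taylor0.
Qed.

Lemma w_Xs m : exists2 ls, all W ls & iota w ^+ m = Xs K ls.
Proof.
elim: m => [|m [ls Wl E]]; first by exists [::]; rewrite // /Xs big_nil expr0.
exists ([seq l <- index_enum (ordinal n) | W l] ++ ls).
  by rewrite all_cat Wl andbT; apply/allP => l; rewrite mem_filter => /andP[].
by rewrite exprS E wE /Xs big_cat big_filter.
Qed.

Lemma Xs_dvd_w ls : all W ls -> exists y, iota w ^+ size ls = Xs K ls * y.
Proof.
elim: ls => [|l ls IH] /=; first by exists 1; rewrite /Xs big_nil mulr1.
move=> /andP[Wl /IH [y E]]; exists (y * \prod_(l' | W l' && (l' != l)) fps_X K l').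
by rewrite exprS E /Xs big_cons wE (bigD1 l) //=; ring.
Qed.

(** A Gauss lemma in the variable t: as the constant term of [P] is not divisible by the prime X_l,
    the coefficients of [Q] are divisible by it one after the other. *)
Lemma Xs_cancel j (P N Q : ser (fps K n)) ls : all W ls ->
  (forall l, W l -> ~ X_dvd l (P 0%N)) -> P 0%N != 0 ->
  ser_eqmod j (P * Q) (serC (Xs K ls) * N) ->
  exists Q', ser_eqmod j (P * Q') N.
Proof.
move=> Wls pr P0; elim: ls Q Wls => [|l ls IH] Q /=.
  by move=> _; rewrite /Xs big_nil rmorph1 mul1r; exists Q.
move=> /andP[Wl Wls] E.
have dv i : (i < j)%N -> X_dvd l (Q i).
  elim/ltn_ind: i => i IHi ij; apply: (@X_dvd_prime _ _ _ (P 0%N)); last exact: pr.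
  have := E i ij; rewrite serME big_ord_recl subn0 /= serCM /Xs big_cons => e.
  have -> : P 0%N * Q i = fps_X K l * (Xs K ls * N i) +
      (- 1) * \sum_(i0 < i) P (bump 0 i0) * Q (i - bump 0 i0)%N.
    by rewrite mulrA -e mulN1r addrK.
  apply: X_dvdD; first by exists (Xs K ls * N i).
  apply: X_dvdM; elim/big_rec: _ => [|i0 x _ hx]; first by exists 0; rewrite mulr0.
  apply: X_dvdD => //; apply/X_dvdM/IHi; rewrite /bump /=; have := ltn_ord i0; lia.
pose Q1 : ser (fps K n) := fun i => if (i < j)%N =P true is ReflectT h then projT1 (cid (dv i h)) else 0.
have Q1E i : (i < j)%N -> Q i = fps_X K l * Q1 i.
  by move=> ij; rewrite /Q1; case: eqP => // h; case: cid.
apply: (IH Q1) => //; apply: (@ser_eqmod_cancel _ _ (serC (fps_X K l))); first exact: fps_X_neq0.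
move=> i ij; rewrite mulrCA [in RHS]mulrA -rmorphM -/(Xs K _) /=.
transitivity ((P * Q) i); last by rewrite E // /Xs big_cons.
by apply: (ser_eqmodMl P) ij => i' hi'; rewrite serCM Q1E.
Qed.

(** The quotient is constructed modulo each t^j. The coefficients of a pseudo-quotient are divisible
    by a power of [P 0] at the points, hence formally up to a factor w^m with m depending on j;
    [Xs_cancel] removes this factor for each j separately, as the constant term of [De3] contains no
    coordinate of [W]. *)
Lemma series_divide M E (De : ser O) (De3 : ser (fps K n)) ls (N : ser O) :
  all W ls -> (forall i, iota (De i) = Xs K ls * De3 i) ->
  (forall l, W l -> ~ X_dvd l (De3 0%N)) -> De3 0%N != 0 ->
  (forall kap, pts kap -> kap w != 0 -> exists S : ser (fps K n),
     ser_map (Th kap) N = ser_map (Th kap) De ^+ M * serX _ ^+ E * S) ->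
  exists S, ser_map iota N = De3 ^+ M * serX _ ^+ E * S.
Proof.
move=> Wls DeE pr D30 hdiv.
have NE : N = serX O ^+ E * ser_drop E N.
  apply: ser_divX => i iE; apply: points_zero => kap pk kw; have [S SE] := hdiv kap pk kw.
  have := congr1 (fun f : ser (fps K n) => f i) SE.
  by rewrite mulrAC mulrC serX_expM leqNgt iE.
set N1 := ser_drop E N in NE; pose P := De ^+ M.
have X_map (R : comNzRingType) (g : {rmorphism O -> R}) : ser_map g (serX O) = serX R.
  by apply/funext => i; rewrite /ser_map /serX rmorph_nat.
have Xinj (R : idomainType) (a b : ser R) : serX R ^+ E * a = serX R ^+ E * b -> a = b.
  by apply: mulfI; rewrite expf_neq0 //; apply/eqP => /(congr1 (fun f : ser R => f 1%N)) /eqP; rewrite [_ == _]oner_eq0.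
have {}hdiv kap : pts kap -> kap w != 0 -> exists S : ser (fps K n),
     ser_map (Th kap) N1 = ser_map (Th kap) P * S.
  move=> pk kw; have [S SE] := hdiv kap pk kw; exists S; apply: Xinj.
  transitivity (ser_map (Th kap) N); first by rewrite NE rmorphM rmorphXn /= X_map.
  by rewrite SE /P rmorphXn /=; ring.
pose P3 := De3 ^+ M; have P0E : P 0%N = De 0%N ^+ M by exact: (rmorphXn (@ser0 O)).
have P30E : P3 0%N = De3 0%N ^+ M by exact: (rmorphXn (@ser0 (fps K n))).
have iP : ser_map iota P = serC (Xs K ls ^+ M) * P3.
  rewrite /P /P3 rmorphXn [serC _]rmorphXn -exprMn; congr (_ ^+ M).
  by apply/funext => i; rewrite serCM -DeE.
have iP0 : iota (P 0%N) != 0 by rewrite P0E rmorphXn DeE expf_neq0 // mulf_neq0 // Xs_neq0.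
have P30 : P3 0%N != 0 by rewrite P30E expf_neq0.
have AC1 (R : comNzRingType) (x y z t : R) : x * (y * (z * t)) = z * y * (x * t) by ring.
have step j : exists Q, ser_eqmod j (P3 * Q) (ser_map iota N1).
  have [A AE] := pseudo_division P N1 j.
  have coefA i : (i < j)%N -> exists m Q, iota (w ^+ m * A i) = iota (P 0%N ^+ j) * Q.
    move=> ij; apply: divide; first by rewrite rmorphXn expf_neq0.
    move=> kap pk kw; rewrite rmorphXn expf_eq0 negb_and => Pj.
    have ThP0 : Th kap (P 0%N) != 0 by move: Pj; rewrite -leqNgt leqNgt (leq_ltn_trans _ ij).
    have [S SE] := hdiv kap pk kw; exists (S i); symmetry.
    have : ser_eqmod j (ser_map (Th kap) P * (serC (Th kap (P 0%N) ^+ j) * S)) (ser_map (Th kap) P * ser_map (Th kap) A).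
      move=> i' hi'; rewrite -rmorphM -[RHS]/(Th kap ((P * A) i')) -AE // mulrCA -SE.
      rewrite -[_ ^+ j](rmorphXn (Th kap)) serCM -rmorphM /=.
      by rewrite -(rmorphXn (@serC O)) serCM.
    move=> /ser_eqmod_cancel -/(_ ThP0 i ij); rewrite serCM -(rmorphXn (Th kap)) //.
  have [m hm] : exists m, forall i, (i < j)%N -> exists Q, iota (w ^+ m * A i) = iota (P 0%N ^+ j) * Q.
    suff : forall j', (j' <= j)%N -> exists m, forall i, (i < j')%N ->
        exists Q, iota (w ^+ m * A i) = iota (P 0%N ^+ j) * Q by move=> /(_ j (leqnn j)).
    elim=> [|j' IH] hj; first by exists 0%N.
    have [m1 hm1] := IH (ltnW hj); have [m2 [Q2 hQ2]] := coefA j' hj.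
    exists (m1 + m2)%N => i; rewrite ltnS leq_eqVlt => /orP[/eqP ->|ij].
      exists (iota w ^+ m1 * Q2).
      by rewrite exprD -mulrA rmorphM hQ2 rmorphXn /= mulrCA.
    have [Q1 hQ1] := hm1 i ij; exists (iota w ^+ m2 * Q1).
    by rewrite addnC exprD -mulrA rmorphM hQ1 rmorphXn /= mulrCA.
  pose Q : ser (fps K n) := fun i => if (i < j)%N =P true is ReflectT h then projT1 (cid (hm i h)) else 0.
  have QE i : (i < j)%N -> iota (w ^+ m * A i) = iota (P 0%N ^+ j) * Q i.
    by move=> ij; rewrite /Q; case: eqP => // h; case: cid.
  have [lm Wlm wm] := w_Xs m.
  apply: (@Xs_cancel j P3 (ser_map iota N1) (serC (Xs K ls ^+ M) * Q) lm) => //.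
    move=> l Wl h; apply: (pr l Wl); rewrite -[De3 0%N]mulr1; apply: X_dvdM.
    by apply: (@X_dvd_primeX _ _ l (De3 0%N) 1 M); [rewrite mulr1 -P30E|exact: pr].
  apply: (@ser_eqmod_cancel _ _ (serC (iota (P 0%N ^+ j)))); first by rewrite rmorphXn expf_neq0.
  have E1 : ser_eqmod j (serC (iota (P 0%N ^+ j)) * Q) (serC (iota w ^+ m) * ser_map iota A).
    by move=> i ij; rewrite !serCM -QE // rmorphM rmorphXn.
  have E2 : ser_eqmod j (ser_map iota P * ser_map iota A) (serC (iota (P 0%N ^+ j)) * ser_map iota N1).
    move=> i ij; rewrite -rmorphM -[LHS]/(iota ((P * A) i)) -AE //.
    by rewrite -(rmorphXn (@serC O)) serCM serCM -rmorphM.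
  move=> i ij; rewrite -wm.
  transitivity ((ser_map iota P * (serC (iota (P 0%N ^+ j)) * Q)) i); first by rewrite iP AC1.
  rewrite (ser_eqmodMl (ser_map iota P) E1) //.
  transitivity ((serC (iota w ^+ m) * (ser_map iota P * ser_map iota A)) i); first by rewrite [in RHS]mulrCA.
  by rewrite (ser_eqmodMl (serC (iota w ^+ m)) E2) // mulrCA.
pose Qs j := projT1 (cid (step j)).
have QsE j : ser_eqmod j (P3 * Qs j) (ser_map iota N1) by rewrite /Qs; case: cid.
(* Quotients modulo t^j are unique, because [P3 0] is cancellable, hence they are compatible and the
   diagonal is a common lift. *)
pose S : ser (fps K n) := fun i => Qs i.+1 i.
have SQ j : ser_eqmod j S (Qs j).
  move=> i ij; apply: (@ser_eqmod_cancel _ i.+1 P3 (Qs i.+1) (Qs j) P30 _ i (ltnSn i)) => l li.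
  by rewrite QsE // QsE // (leq_trans li).
have E1 : ser_map iota N1 = P3 * S.
  by apply/funext => i; rewrite -(QsE i.+1) //; apply: ser_eqmodMl (ltnSn i) => l hl; rewrite (SQ i.+1 l hl).
by exists S; rewrite NE rmorphM rmorphXn /= X_map E1 /P3; ring.
Qed.

End SeriesDivision.

(** * Splitting over formal power series *)

Section SeriesDerivations.
Variables (n : nat) (j : 'I_n.+1).

(** The partial derivatives seen through [peel]: index [j] is the variable of the series, the others
    act on coefficients. *)
Definition ser_der (R : comNzRingType) (d : 'I_n -> R -> R) (i : 'I_n.+1) (f : ser R) : ser R :=
  fun m => if unlift j i is Some l then d l (f m) else f m.+1 *+ m.+1.

Lemma ser_der_derivation (R : comNzRingType) (d : 'I_n -> R -> R) i :
  (forall l, derivation (d l)) -> derivation (ser_der d i).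
Proof.
move=> hd; rewrite /ser_der; case: (unlift j i) => [l|].
  split=> f g; apply/funext => m; first by rewrite serDE (derD (hd l)).
  rewrite serME (der_sum (hd l)) serDE !serME -big_split; apply: eq_bigr => i' _.
  by rewrite (derM (hd l)).
split=> f g; apply/funext => m; first by rewrite !serDE mulrnDl.
rewrite serDE !serME -sumrMnl.
have E (i' : 'I_m.+2) : f i' * g (m.+1 - i')%N *+ m.+1 =
    f i' *+ i' * g (m.+1 - i')%N + f i' * (g (m.+1 - i')%N *+ (m.+1 - i')).
  by rewrite mulrnAl mulrnAr -mulrnDr subnKC // -ltnS.
rewrite (eq_bigr _ (fun i' _ => E i')) big_split /=; congr (_ + _).
  rewrite big_ord_recl mulr0n mul0r add0r; apply: eq_bigr => i' _.
  by rewrite lift0 subSS.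
rewrite big_ord_recr /= subnn mulr0n mulr0 addr0; apply: eq_bigr => i' _.
by rewrite subSn // -ltnS.
Qed.

Lemma peel_der (K : comNzRingType) i (f : fps K n.+1) :
  peel j (fps_d i f) = ser_der (@fps_d K n) i (peel j f).
Proof.
apply/funext => m; rewrite /ser_der; case: unliftP => [l ->|->]; first exact: peel_d.
exact: peel_dj.
Qed.

Lemma ser_map_der (R S : comNzRingType) (g : {rmorphism R -> S}) d e i f :
  (forall l x, e l (g x) = g (d l x)) -> ser_der e i (ser_map g f) = ser_map g (ser_der d i f).
Proof.
move=> eg; apply/funext => m; rewrite /ser_der /ser_map; case: (unlift j i) => [l|].
  by rewrite eg.
by rewrite rmorphMn.
Qed.

End SeriesDerivations.

(** Bundling the closure proof allows a subring found in the course of a proof to become a ring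
    type. *)
Record subring_set (R : comNzRingType) := SubringSet {
  subring_pred : {pred R};
  subring_predP : subring_closed subring_pred
}.

HB.instance Definition _ (R : comNzRingType) (S : subring_set R) :=
  GRing.isSubringClosed.Build R (subring_pred S) (subring_predP S).

Definition subring_of (R : comNzRingType) (S : subring_set R) := {x : R | x \in subring_pred S}.

HB.instance Definition _ (R : comNzRingType) (S : subring_set R) :=
  SubType.copy (subring_of S) {x : R | x \in subring_pred S}.
HB.instance Definition _ (R : comNzRingType) (S : subring_set R) :=
  [Choice of subring_of S by <:].
HB.instance Definition _ (R : comNzRingType) (S : subring_set R) :=
  [SubChoice_isSubComNzRing of subring_of S by <:].

(** * Elements all of whose derivatives are integral *)

Section IntegralWords.
Variables (B : comNzRingType) (L : fieldType) (e : {rmorphism B -> L}) (I : Type) (d : I -> L -> L).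
Hypothesis hd : forall i, derivation (d i).
Hypothesis de : forall i b, exists b', d i (e b) = e b'.

(** Integrality is required for all iterated derivatives, which makes the set stable under the
    derivations; stability is what a Taylor homomorphism on it requires. *)
Definition integral_words : {pred L} :=
  fun x => `[< forall ws, integralOver e (word_der d ws x) >].

Lemma word_derB ws x y : word_der d ws (x - y) = word_der d ws x - word_der d ws y.
Proof. by elim: ws => //= i ws ->; rewrite (derB (hd i)). Qed.

Lemma integral_words_img b : e b \in integral_words.
Proof.
  apply/asboolP => ws; suff [b' ->] : exists b', word_der d ws (e b) = e b' by exact: integral_id.
  elim: ws => [|i ws [b' /= ->]]; first by exists b.
  by have [b'' ->] := de i b'; exists b''.
Qed.

Lemma integral_words_subring : subring_closed integral_words.
Proof.
split; first by rewrite -(rmorph1 e) integral_words_img.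
  move=> x y /asboolP hx /asboolP hy; apply/asboolP => ws.
  by rewrite word_derB; apply: integral_sub.
move=> x y /asboolP hx /asboolP hy; apply/asboolP => ws.
(* Leibniz' rule distributes the letters of [ws] over both factors, so the induction must allow
   derivatives of [x] and [y] from the start. *)
suff : forall ws1 ws2, integralOver e (word_der d ws (word_der d ws1 x * word_der d ws2 y)).
  by move=> /(_ [::] [::]).
elim/last_ind: ws => [|ws i IH] ws1 ws2; first exact: integral_mul.
rewrite /word_der foldr_rcons (derM (hd i)) -/(word_der _ _ _).
have add u v : word_der d ws (u + v) = word_der d ws u + word_der d ws v.
  by elim: (ws) => //= i' ws' ->; rewrite (derD (hd i')).
rewrite add; apply: integral_add; first exact: (IH (i :: ws1) ws2).
exact: (IH ws1 (i :: ws2)).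
Qed.

End IntegralWords.

(** * Splitting once the leading Hankel determinant is in good position *)

Section Core.
Variables (K : closedFieldType) (n : nat) (O : comNzRingType) (d : 'I_n -> O -> O).
Hypotheses (hd : dsystem d) (K0 : char0 K).
Variables (iota : {rmorphism O -> fps K n}) (cst : {rmorphism K -> O}).
Hypothesis iota_inj : injective iota.
Hypothesis iota_d : forall i x, iota (d i x) = fps_d i (iota x).
Variables (W : pred 'I_n) (w : O) (pts : {rmorphism O -> K} -> Prop).
Hypothesis wE : iota w = \prod_(l | W l) fps_X K l.
Hypothesis dense : points_dense iota w pts.
Hypothesis divide : points_divide hd K0 iota w pts.

Definition total_map : {rmorphism ser O -> fps K n.+1} := unpeel ord0 \o ser_map iota.

Lemma total_map_inj : injective total_map.
Proof.
move=> a b /= /(congr1 (peel ord0)); rewrite !unpeelK => e; apply/funext => i.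
by apply: iota_inj; exact: (congr1 (fun f : ser (fps K n) => f i) e).
Qed.

Lemma total_map_d i a : fps_d i (total_map a) = total_map (ser_der ord0 d i a).
Proof.
apply: (@peel_inj _ _ ord0); rewrite peel_der /= !unpeelK.
by apply: ser_map_der => l x; rewrite iota_d.
Qed.

Variables (k s : nat) (h : {poly ser O}).
Hypotheses (hm : h \is monic) (hsz : size h = k.+1).
Let hk := hankel k h.
Hypothesis hankel0 : forall s', (s' <= k)%N -> (s < s')%N -> hk s' = 0.
Hypothesis hankel_s : hk s != 0.
Variables (al be E : nat) (De : ser O) (De3 : ser (fps K n)) (ls : seq 'I_n).
Hypothesis De_eq : serC w ^+ al * hk s = serC w ^+ be * serX O ^+ E * De.
Hypothesis Wls : all W ls.
Hypothesis DeE : forall i, iota (De i) = Xs K ls * De3 i.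
Hypothesis De3_prime : forall l, W l -> ~ X_dvd l (De3 0%N).
Hypothesis De30 : De3 0%N != 0.
Hypothesis point_splits : forall kap, pts kap -> kap w != 0 -> exists bs,
  map_poly (ser_map (taylor_hom hd kap K0)) h = \prod_(b <- bs) ('X - b%:P).
Hypothesis axis_splits : forall l, W l -> exists (F : fieldType) (g : {rmorphism fps K n -> F})
   (dF : 'I_n -> F -> F) (bs : seq (ser F)),
  [/\ forall i, derivation (dF i), forall i x, dF i (g x) = g (fps_d i x), injective g &
   map_poly (ser_map g) (map_poly (peel (lift ord0 l)) (map_poly total_map h)) =
     \prod_(b <- bs) ('X - b%:P)].

Let D := ser_der ord0 d.
Let hD i : derivation (D i). Proof. by apply: ser_der_derivation; exact: hd.1. Qed.

Let nat_unit l : exists u : ser O, l.+1%:R * u = 1.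
Proof.
exists (serC (cst (l.+1%:R^-1))); rewrite -(rmorph_nat (@serC O)) -(rmorph_nat cst) -rmorphM -rmorphM.
by rewrite divff ?K0 // !rmorph1.
Qed.

(** The Hankel determinants of order above [s] vanish, so by [hankel_distinct] there are at most [s]
    distinct roots wherever [h] splits. *)
Lemma context (R : idomainType) (T : {rmorphism ser O -> R}) e bs :
  char0 R -> (forall i, derivation (e i)) -> (forall i a, e i (T a) = T (D i a)) ->
  map_poly T h = \prod_(b <- bs) ('X - b%:P) -> rootctx D k s h T e bs.
Proof.
move=> R0 he eT hE; have sz : size bs = k.
  have := congr1 (fun p : {poly R} => size p) hE; rewrite size_prod_XsubC size_map_monic // hsz.
  by case.
split=> //; rewrite leqNgt; apply/negP => hs; have := hankel_distinct R0 sz hE.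
by rewrite -/hk hankel0 ?rmorph0 ?eqxx // -sz; exact: size_undup.
Qed.

Theorem core_splits : exists bs, map_poly total_map h = \prod_(b <- bs) ('X - b%:P).
Proof.
pose B := fps K n.+1.
have [F0 [e0 [d0 [hd0 ed0 inj0]]]] := fraction_dfield (fps_dsystem K n.+1).
have F00 : char0 F0 by exact: (char0_morph (e0 \o (@fps_const K n.+1) : {rmorphism K -> F0}) K0).
have [L [e1 [dL [bs [hdL edL hL]]]]] := splitting_dfield hd0 F00 (monic_map e0 (monic_map total_map hm)).
pose e : {rmorphism B -> L} := e1 \o e0.
have e_inj : injective e by move=> x y /fmorph_inj /inj0.
have L0 : char0 L by exact: (char0_morph (e1 : {rmorphism F0 -> L}) F00).
have ed i x : dL i (e x) = e (fps_d i x) by rewrite /e /= edL ed0.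
have {}hL : map_poly e (map_poly total_map h) = \prod_(b <- bs) ('X - b%:P).
  by rewrite -hL; apply/polyP => i; rewrite !coef_map.
have ctxL : rootctx D k s h (e \o total_map) dL bs.
  apply: context => //; first by move=> i; exact: hdL.1.
    by move=> i a; rewrite -[RHS]/(e (total_map (D i a))) -total_map_d -ed.
  by rewrite -hL; apply/polyP => i; rewrite !coef_map.
clearbody e; clear e1 edL.
pose v := total_map (serC w).
pose Xs1 (ls1 : seq 'I_n) : B := \prod_(l <- ls1) fps_X K (lift ord0 l).
have Xs1E ls1 : unpeel ord0 (serC (Xs K ls1)) = Xs1 ls1.
  pose uc : {rmorphism fps K n -> B} := unpeel ord0 \o @serC (fps K n).
  rewrite -[LHS]/(uc _) /Xs rmorph_prod; apply: eq_bigr => l _.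
  by rewrite /uc /= -(peel_X K ord0 l) peelK.
(* Suppose a monomial in [w] times the power sum lies in B. Along w_l = 0 the same universal
   identity identifies the power sum with one formed from Puiseux roots, a power series in w_l.
   Hence [S] is divisible by w_l, and the factors of the monomial can be cancelled one by one. *)
have poles ws r ls1 S : all W ls1 -> e (Xs1 ls1) * \sum_(b <- bs) word_der dL ws b ^+ r = e S ->
    exists S', e S' = \sum_(b <- bs) word_der dL ws b ^+ r.
  have [M [N UN]] := word_der_psum k s h hD nat_unit ws r.
  set Sg := \sum_(b <- bs) _; have UL := UN _ _ _ _ ctxL; rewrite -/hk -/Sg in UL.
  elim: ls1 S => [|l ls1 IH] S /=; first by rewrite /Xs1 big_nil rmorph1 mul1r; exists S.
  move=> /andP[Wl Wls1] eS; pose j1 := lift ord0 l.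
  suff [S1 SE] : X_dvd j1 S.
    apply: (IH S1) => //; apply: (@mulfI _ (e (fps_X K j1))).
      by rewrite -(rmorph0 e) (inj_eq e_inj) fps_X_neq0.
    by rewrite mulrA -!rmorphM -SE -eS /Xs1 big_cons.
  have [F [g [dF [b2 [hdF gd g_inj hF]]]]] := axis_splits Wl.
  pose T2 : {rmorphism B -> ser F} := ser_map g \o peel j1.
  have T2_inj : injective T2.
    move=> x y /= e'; apply: (@peel_inj _ _ j1); apply/funext => i; apply: g_inj.
    exact: (congr1 (fun f : ser F => f i) e').
  have SF0 : char0 (ser F).
    exact: (char0_morph (@serC F \o (g \o @fps_const K n) : {rmorphism K -> ser F}) K0).
  have ctx2 : rootctx D k s h (T2 \o total_map) (ser_der j1 dF) b2.
    apply: context => //; first by move=> i; exact: ser_der_derivation.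
      move=> i a; rewrite -[RHS]/(T2 (total_map (D i a))) -total_map_d /=.
      by rewrite (ser_map_der j1 i _ gd) peel_der.
    by rewrite -hF -!map_poly_comp.
  have U2 := UN _ _ _ _ ctx2; rewrite -/hk in U2; set Sg2 := \sum_(b <- b2) _ in U2.
  pose DB := total_map (hk s); pose NB := total_map N.
  have DB0 : DB != 0 by rewrite -(rmorph0 total_map) (inj_eq total_map_inj).
  have EB : DB ^+ M * S = NB * Xs1 (l :: ls1).
    have UL1 : e DB ^+ M * Sg = e NB by exact: UL.
    by apply: e_inj; rewrite rmorphM rmorphXn -eS mulrCA UL1 [RHS]rmorphM mulrC.
  have T2S : T2 S = Sg2 * T2 (Xs1 (l :: ls1)).
    apply: (@mulfI _ (T2 DB ^+ M)); first by rewrite expf_neq0 // -(rmorph0 T2) (inj_eq T2_inj).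
    by rewrite -rmorphXn -rmorphM EB rmorphM mulrA -[T2 NB]U2 rmorphXn.
  apply/X_dvdP/g_inj; rewrite rmorph0 -[LHS]/(T2 S 0%N) T2S serM0 /Xs1 big_cons rmorphM serM0.
  rewrite [X in _ * (X * _)](_ : _ = 0) ?mul0r ?mulr0 //= peel_Xj /ser_map.
  exact: rmorph0.
have AC1 (R : comNzRingType) (x y z t : R) : x * y * z * t = z * y * (x * t) by ring.
have psum_in_B ws r : exists S, e S = \sum_(b <- bs) word_der dL ws b ^+ r.
  have [M [N UN]] := word_der_psum k s h hD nat_unit ws r.
  (* [De_eq] holds only after multiplication by a power of [w]; the numerator receives the M-th
     power of that factor to match. *)
  pose N2 := serC w ^+ (al * M) * N.
  have De_eqM : serC w ^+ (al * M) * hk s ^+ M = serC w ^+ (be * M) * serX O ^+ (E * M) * De ^+ M.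
    by rewrite !exprM -!exprMn De_eq.
  have [S3 S3E] : exists S, ser_map iota N2 = De3 ^+ M * serX _ ^+ (E * M) * S.
    apply: (series_divide wE dense divide iota_inj Wls DeE De3_prime De30) => kap pk kw.
    have [bk hbk] := point_splits pk kw; pose Th := taylor_hom hd kap K0.
    have SR0 : char0 (ser (fps K n)).
      exact: (char0_morph (@serC (fps K n) \o @fps_const K n : {rmorphism K -> ser (fps K n)}) K0).
    have ctxk : rootctx D k s h (ser_map Th) (ser_der ord0 (@fps_d K n)) bk.
      apply: context => //; first by move=> i; apply: ser_der_derivation; exact: (fps_dsystem K n).1.
      by move=> i a; apply: ser_map_der => l x; exact: taylor_d.
    have Uk := UN _ _ _ _ ctxk; rewrite -/hk in Uk; set Sk := \sum_(b <- bk) _ in Uk.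
    exists (ser_map Th (serC w) ^+ (be * M) * Sk).
    have X_map : ser_map Th (serX O) = serX (fps K n).
      by apply/funext => i; rewrite /ser_map /serX rmorph_nat.
    pose TT : {rmorphism ser O -> ser (fps K n)} := ser_map Th.
    have E2 : TT (serC w) ^+ (al * M) * TT (hk s) ^+ M =
        TT (serC w) ^+ (be * M) * TT (serX O) ^+ (E * M) * TT De ^+ M.
      by have := congr1 TT De_eqM; rewrite !(rmorphM TT) !(rmorphXn TT).
    have Uk1 : TT (hk s) ^+ M * Sk = TT N by exact: Uk.
    rewrite -[LHS]/(TT N2) /N2 (rmorphM TT) (rmorphXn TT) -Uk1 mulrA E2 [TT (serX O)]X_map.
    exact: AC1.
  have [lw Wlw lwE] := w_Xs wE (be * M).
  apply: (poles ws r (lw ++ flatten (nseq M ls)) (unpeel ord0 S3)).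
    rewrite all_cat Wlw; apply/allP => l /flattenP[x]; rewrite mem_nseq => /andP[_ /eqP ->].
    exact: (allP Wls).
  have Xs1_flat : Xs1 (lw ++ flatten (nseq M ls)) = v ^+ (be * M) * Xs1 ls ^+ M.
    rewrite /Xs1 big_cat; congr (_ * _).
      have -> : v = unpeel ord0 (serC (iota w)).
        congr (unpeel _ _); apply/funext => -[|i] //.
        exact: (rmorph0 iota).
      rewrite -/(Xs1 lw) -Xs1E -lwE.
      exact: (rmorphXn (unpeel ord0 \o @serC (fps K n) : {rmorphism fps K n -> B})).
    elim: (M) => [|m IHm]; first by rewrite big_nil expr0.
    by rewrite (_ : nseq m.+1 ls = ls :: nseq m ls) // [flatten _]/(ls ++ flatten _) big_cat exprS -IHm.
  have UL := UN _ _ _ _ ctxL; rewrite -/hk in UL; set Sg := \sum_(b <- bs) _ in UL *.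
  pose t := total_map (serX O); pose D3 := unpeel ord0 De3.
  have tU : t = unpeel ord0 (serX (fps K n)).
    by apply: (congr1 (unpeel ord0)); apply/funext => i; rewrite /serX -(rmorph_nat iota).
  have tE : t = fps_X K ord0 by rewrite tU -[RHS](peelK ord0) peel_Xj.
  pose up : {rmorphism ser (fps K n) -> B} := unpeel ord0.
  have DeB : total_map De = Xs1 ls * D3.
    rewrite -Xs1E -[D3]/(up De3) -[unpeel ord0 _]/(up _) -(rmorphM up).
    by apply: (congr1 (unpeel ord0)); apply/funext => i; rewrite serCM; exact: DeE.
  have N2B : total_map N2 = D3 ^+ M * t ^+ (E * M) * unpeel ord0 S3.
    transitivity (up (De3 ^+ M * serX _ ^+ (E * M) * S3)); first by rewrite -S3E.
    by rewrite !(rmorphM up) !(rmorphXn up) tU.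
  have nz : e (D3 ^+ M * t ^+ (E * M)) != 0.
    rewrite -(rmorph0 e) (inj_eq e_inj) mulf_neq0 // expf_neq0 //; last by rewrite tE fps_X_neq0.
    apply: contra_neq De30 => D30; have : De3 = 0 by rewrite -[De3](unpeelK ord0) -/D3 D30 rmorph0.
    by move=> ->.
  have UL1 : e (total_map (hk s)) ^+ M * Sg = e (total_map N) by exact: UL.
  have E3 : v ^+ (al * M) * total_map (hk s) ^+ M = v ^+ (be * M) * t ^+ (E * M) * (Xs1 ls * D3) ^+ M.
    by have := congr1 total_map De_eqM; rewrite !(rmorphM total_map) !(rmorphXn total_map) DeB.
  apply: (mulfI nz); rewrite -[RHS](rmorphM e) -N2B /N2 (rmorphM total_map) (rmorphXn total_map) -/v.
  rewrite [RHS](rmorphM e) -UL1 !mulrA -(rmorphXn e) -!(rmorphM e) E3 Xs1_flat; congr (e _ * _).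
  by rewrite exprMn; ring.
have integral b ws : b \in bs -> integralOver e (word_der dL ws b).
  move=> bbs; have [|l|g gm gE] := @coefs_in_image _ _ e [seq word_der dL ws b | b <- bs].
  - move=> l; exists (@fps_const K n.+1 l.+1%:R^-1).
    by rewrite -(rmorph_nat (@fps_const K n.+1)) -rmorphM divff ?K0 // rmorph1.
  - by have [S SE] := psum_in_B ws l.+1; exists S; rewrite SE big_map.
  - exists g => //; rewrite gE root_prod_XsubC; exact: map_f.
have de i b : exists b', dL i (e b) = e b' by exists (fps_d i b).
(* A ring with derivations which contains B and the roots; it carries a Taylor homomorphism as soon
   as it has a homomorphism to K. *)
pose CS := SubringSet (integral_words_subring (fun i => hdL.1 i) de).
pose C := subring_of CS.
have dC_in i (x : C) : dL i (val x) \in subring_pred CS.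
  apply/asboolP => ws; have /asboolP hx := valP x.
  by have := hx (rcons ws i); rewrite /word_der foldr_rcons.
pose dC i (x : C) : C := exist _ (dL i (val x)) (dC_in i x).
have hdC : dsystem dC.
  split=> [i|i j x]; last by apply: val_inj; exact: hdL.2.
  by split=> x y; apply: val_inj; rewrite /= ?(derD (hdL.1 i)) ?(derM (hdL.1 i)).
pose iB b : C := exist _ (e b) (integral_words_img de b).
have iB_add : zmod_morphism iB by move=> x y; apply: val_inj; rewrite /= rmorphB.
have iB_mul : monoid_morphism iB.
  by split=> [|x y]; apply: val_inj; rewrite /= ?rmorph1 ?rmorphM.
pose iBm : {rmorphism B -> C} := HB.pack iB
  (GRing.isZmodMorphism.Build B C iB iB_add) (GRing.isMonoidMorphism.Build B C iB iB_mul).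
pose vC : {rmorphism C -> L} := val.
have vi q : map_poly vC (map_poly iBm q) = map_poly e q.
  by apply/polyP => l; rewrite (@coef_map _ _ vC) (@coef_map _ _ iBm) (@coef_map _ _ e).
have [phi phiE] : exists phi : {rmorphism C -> K}, forall b, phi (iBm b) = fps_coef0 b.
  apply: (@integral_residue_hom K B C iBm (@fps_coef0 K n.+1) (@fps_const K n.+1)).
  - by move=> c; rewrite /= /fps_coef0 /fps_const eqxx.
  - by move=> b; exact: fps_unitP.
  - move=> y; have /asboolP /(_ [::]) [g gm rg] := valP y; exists g => //.
    apply/rootP/val_inj; rewrite -[LHS]/(vC _) -(horner_map vC) vi (rootP rg).
    exact/esym/(rmorph0 vC).
pose Ty := taylor_hom hdC phi K0.
(* On B the Taylor map preserves constant terms and commutes with derivatives, hence is the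
   identity: the coefficients of [h] are not changed when its roots are mapped to series. *)
have TyB b : Ty (iBm b) = b.
  apply: (@fps_char0_ind _ _ K0 (fun g h => g = Ty (iBm h))) => // [g h' ->|i g h' ->].
    by rewrite /= taylor0 phiE.
  rewrite /= taylor_d //; congr (taylor _ _ _); apply: val_inj => /=; exact: ed.
have bsC : exists bC : seq C, bs = [seq val x | x <- bC].
  have allC : all (mem (subring_pred CS)) bs.
    by apply/allP => b bbs; apply/asboolP => ws; exact: integral.
  elim: (bs) allC => [|b t IH] /=; first by exists [::].
  by move=> /andP[hb /IH [bC ->]]; exists (exist _ b hb :: bC).
case: bsC => bC bsE; exists [seq Ty x | x <- bC].
have hC : map_poly iBm (map_poly total_map h) = \prod_(b <- bC) ('X - b%:P).
  apply: (map_inj_poly (f := vC) val_inj (rmorph0 vC)).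
  rewrite vi hL bsE big_map rmorph_prod; apply: eq_bigr => b _.
  exact/esym/(map_polyXsubC vC).
rewrite big_map; transitivity (map_poly Ty (map_poly iBm (map_poly total_map h))).
  apply/polyP => i; rewrite (@coef_map _ _ Ty) (@coef_map _ _ iBm); exact/esym/TyB.
rewrite hC rmorph_prod; apply: eq_bigr => b _.
exact: (map_polyXsubC Ty).
Qed.

End Core.

Lemma hankel_map (O R : comNzRingType) (T : {rmorphism O -> R}) k f s :
  T (hankel k f s) = hankel k (map_poly T f) s.
Proof.
rewrite /hankel -det_map_mx; congr (\det _); apply/matrixP => i j; rewrite !mxE psum_morph.
apply: (congr1 (fun a => psum k a (i + j))); apply/funext => l /=.
rewrite /rcoefs; case: ifP => _; last by rewrite rmorph0.
by rewrite (@coef_map _ _ T).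
Qed.

Lemma psum_scale (R : comNzRingType) k (c : R) a l :
  psum k (fun i => c ^+ i * a i) l = c ^+ l * psum k a l.
Proof.
elim/ltn_ind: l => -[|l] IH; first by rewrite !psum0 expr0 mul1r.
rewrite !psumS mulrN mulrDr; congr (- (_ + _)); first by rewrite mulrCA.
rewrite mulr_sumr; apply: eq_bigr => j _; rewrite IH ?ltnS ?ltn_ord //.
have -> : c ^+ l.+1 = c ^+ (l - j)%N * c ^+ j.+1.
  by rewrite -exprD addnS subnK // ltnW.
by ring.
Qed.

(** The entry with indices i, j is multiplied by c^(i+j), so the matrix is multiplied on both sides
    by the diagonal matrix of powers of [c]. *)
Lemma hankel_scale_roots (R : comNzRingType) k (c : R) g s :
  exists N, hankel k (scale_roots k c g) s = c ^+ N * hankel k g s.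
Proof.
pose v : 'rV[R]_s := \row_i c ^+ i; exists ((\sum_(i < s) i) + (\sum_(i < s) i))%N.
have -> : hankel k (scale_roots k c g) s = \det (diag_mx v *m hankel_mx k g s *m diag_mx v).
  congr (\det _); apply/matrixP => i j; rewrite mul_mx_diag mxE mul_diag_mx !mxE.
  rewrite mulrAC -exprD -psum_scale.
  apply: (congr1 (fun a => psum k a (i + j))); apply/funext => l /=.
  rewrite /rcoefs /scale_roots; case: leqP => lk; last by rewrite mulr0.
  by rewrite coef_poly ltnS leq_subr subKn // mulrC.
rewrite !det_mulmx det_diag mulrAC exprD; congr (_ * _ * _).
all: by rewrite -prodrXr; apply: eq_bigr => i _; rewrite mxE.
Qed.

Lemma scale_roots_map (R S : comNzRingType) k (c : R) g (T : {rmorphism R -> S}) :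
  map_poly T (scale_roots k c g) = scale_roots k (T c) (map_poly T g).
Proof.
apply/polyP => i; rewrite (@coef_map _ _ T) /scale_roots [in LHS]coef_poly [RHS]coef_poly.
case: ifP => _; last exact: (rmorph0 T).
rewrite (@coef_map _ _ T); transitivity (T (g`_i * c ^+ (k - i))); first by [].
by rewrite (rmorphM T) (rmorphXn T).
Qed.

(** * Series in the p-th powers of some indeterminates *)

Section Tame.
Variables (K : comNzRingType) (n : nat) (W : pred 'I_n) (p : nat).

Definition tame (f : fps K n) := forall m, f m != 0 -> forall i, W i -> (p %| m i)%N.

Lemma tameM f g : tame f -> tame g -> tame (f * g).
Proof.
move=> hf hg m; rewrite /GRing.mul /= /fps_mul => h i Wi.
have [d /eqP md hd] : exists2 d : bmultinom n (mdeg m).+1 * bmultinom n (mdeg m).+1,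
    m == mnm_add d.1 d.2 & f d.1 * g d.2 != 0.
  apply: contrapT => no; case/eqP: h; rewrite big1 // => d md.
  by apply: contrapT => /eqP hd; apply: no; exists d.
have f1 : f d.1 != 0 by apply: contraNneq hd => ->; rewrite mul0r.
have g2 : g d.2 != 0 by apply: contraNneq hd => ->; rewrite mulr0.
have -> : m i = (d.1 i + d.2 i)%N by have := congr1 (fun x : multinom n => x i) md; rewrite /= mnmDE.
by rewrite dvdn_add // ?(hf _ f1) ?(hg _ g2).
Qed.

Lemma tame1 : tame 1.
Proof.
move=> m; rewrite fps1E; case: (eqVneq m mnm0) => [-> _ i _|_]; last by rewrite eqxx.
by rewrite mnm0E dvdn0.
Qed.

Lemma tameX f k : tame f -> tame (f ^+ k).
Proof. by move=> hf; elim: k => [|k IH]; rewrite ?expr0 ?exprS; [exact: tame1|exact: tameM]. Qed.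

Lemma tame_mono (m : multinom n) : (forall i, W i -> (p %| m i)%N) -> tame (fps_mono K m).
Proof. by move=> h m'; rewrite /fps_mono; case: (eqVneq m' m) => [-> //|_]; rewrite eqxx. Qed.

Lemma tame_w a : (p %| a)%N -> tame ((\prod_(l | W l) fps_X K l) ^+ a).
Proof.
move=> /dvdnP[b ->]; rewrite mulnC exprM; apply: tameX; rewrite -prodrXl.
elim/big_rec: _ => [|l x _ hx]; first exact: tame1.
apply: tameM => //; rewrite -[fps_X K l]/(fps_mono K (mnm1 l)) fps_monoX; apply: tame_mono => i _.
by rewrite mulmnE dvdn_mull.
Qed.

End Tame.

Section Scaling.
Variables (K : closedFieldType) (n : nat) (O : comNzRingType) (d : 'I_n -> O -> O).
Hypotheses (hd : dsystem d) (K0 : char0 K).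
Variables (iota : {rmorphism O -> fps K n}) (cst : {rmorphism K -> O}).
Hypothesis iota_inj : injective iota.
Hypothesis iota_d : forall i x, iota (d i x) = fps_d i (iota x).
Variables (W : pred 'I_n) (w : O) (pts : {rmorphism O -> K} -> Prop).
Hypothesis wE : iota w = \prod_(l | W l) fps_X K l.
Hypothesis dense : points_dense iota w pts.
Hypothesis divide : points_divide hd K0 iota w pts.
Variables (k p : nat) (f : {poly ser O}).
Hypotheses (fm : f \is monic) (fsz : size f = k.+1).
Hypotheses (p0 : (0 < p)%N) (kp : (puiseux_index k %| p)%N).
Hypothesis f_tame : forall l m, tame W p (iota (f`_l m)).
Hypothesis f_low : forall l m, (m < k - l)%N -> f`_l m = 0.
Hypothesis point_splits : forall kap, pts kap -> kap w != 0 -> exists bs,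
  map_poly (ser_map (taylor_hom hd kap K0)) f = \prod_(b <- bs) ('X - b%:P).

(** This is w^(-ak) f(w^a t, w^a z); by [f_low] the truncated subtraction is exact wherever the
    coefficient is nonzero. *)
Definition scaled a : {poly ser O} :=
  \poly_(l < k.+1) ((fun m => w ^+ (a * (m - (k - l))) * f`_l m) : ser O).

Let iw0 : iota w != 0.
Proof. by rewrite wE prodf_seq_neq0; apply/allP => l _; rewrite fps_X_neq0 implybT. Qed.

Let fk : f`_k = 1. Proof. by rewrite -(monicP fm) lead_coefE fsz. Qed.

Lemma scaled_top a : (scaled a)`_k = 1.
Proof.
rewrite coef_poly ltnSn subnn fk; apply/funext => m; rewrite subn0 ser1E.
by case: eqP => [->|_]; rewrite ?muln0 ?expr0 ?mulr1 ?mulr0.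
Qed.

Lemma size_scaled a : size (scaled a) = k.+1.
Proof.
apply/eqP; rewrite eqn_leq size_poly /= ltnNge; apply/negP => h.
by have := scaled_top a; rewrite nth_default // => /eqP; rewrite eq_sym oner_eq0.
Qed.

Lemma scaled_monic a : scaled a \is monic.
Proof. by rewrite monicE lead_coefE size_scaled scaled_top. Qed.

Lemma scaledE a : map_poly (ser_scale (w ^+ a)) f = scale_roots k (serC (w ^+ a)) (scaled a).
Proof.
apply/polyP => l; rewrite (@coef_map _ _ (ser_scale (w ^+ a))) coef_poly.
case: (ltnP l k.+1) => lk /=; last by rewrite nth_default ?fsz // rmorph0.
rewrite coef_poly lk; apply/funext => m; rewrite mulrC -(rmorphXn (@serC O)) serCM /ser_scale.
have [mk|mk] := ltnP m (k - l); first by rewrite f_low // !mulr0.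
by rewrite mulrA -!exprM -exprD; congr (_ ^+ _ * _); nia.
Qed.

Let dom (x y : ser O) : x * y = 0 -> x = 0 \/ y = 0.
Proof.
move=> /(congr1 (total_map iota)); rewrite rmorphM rmorph0 => /eqP; rewrite mulf_eq0.
by rewrite -(rmorph0 (total_map iota)) !(inj_eq (total_map_inj iota_inj)) => /orP[] /eqP ->; [left|right].
Qed.

Let serCw0 : serC w != 0.
Proof.
apply/eqP => /(congr1 (fun g : ser O => g 0%N)) h; case/eqP: iw0.
have w0 : w = 0 by exact: h.
by rewrite w0 (rmorph0 iota).
Qed.

Let serCwM a x : serC w ^+ a * x = 0 -> x = 0.
Proof.
elim: a x => [|a IH] x; first by rewrite mul1r.
by rewrite exprSr -mulrA => /IH /dom[/eqP|//]; rewrite (negbTE serCw0).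
Qed.

(** As [p] divides [a], all exponents of w_l remain multiples of [p]: in the coordinate T = w_l the
    polynomial is [h0] in T^p, and the uniform exponent of [puiseux] splits it without further
    ramification. *)
Lemma scaled_axis_splits a l : (p %| a)%N -> W l -> exists (F : fieldType) (g : {rmorphism fps K n -> F})
   (dF : 'I_n -> F -> F) (bs : seq (ser F)),
  [/\ forall i, derivation (dF i), forall i x, dF i (g x) = g (fps_d i x), injective g &
   map_poly (ser_map g) (map_poly (peel (lift ord0 l)) (map_poly (total_map iota) (scaled a))) =
     \prod_(b <- bs) ('X - b%:P)].
Proof.
move=> pa Wl; have [F0 [e0 [d0 [hd0 ed0 inj0]]]] := fraction_dfield (fps_dsystem K n).
have F00 : char0 F0 by exact: (char0_morph (e0 \o (@fps_const K n) : {rmorphism K -> F0}) K0).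
pose T : {rmorphism ser O -> ser F0} := ser_map e0 \o (peel (lift ord0 l) \o total_map iota).
pose h0 : {poly ser F0} := \poly_(i < k.+1) ((fun m => T (scaled a)`_i (m * p)%N) : ser F0).
have Ttame i m : ~~ (p %| m)%N -> T (scaled a)`_i m = 0.
  move=> pm; rewrite /T /= /ser_map -[RHS](rmorph0 e0); congr (e0 _); apply/funext => mon.
  rewrite [LHS]/(iota ((scaled a)`_i (mins (lift ord0 l) m mon ord0)) (mdel ord0 (mins (lift ord0 l) m mon))).
  set m0 := mins _ _ _ _; set m1 := mdel _ _.
  have m1l : m1 l = m by rewrite /m1 mnmE mins_j.
  apply/eqP; apply: contraNT pm => nz; rewrite -m1l.
  have : tame W p (iota ((scaled a)`_i m0)); last by move=> /(_ m1 nz l Wl).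
  rewrite coef_poly; case: ifP => _; last first.
    by rewrite (rmorph0 iota) => m2; rewrite fps0E eqxx.
  rewrite rmorphM rmorphXn; apply: tameM; last exact: f_tame.
  by rewrite wE; apply: tame_w; rewrite dvdn_mulr.
have hT : map_poly T (scaled a) = map_poly (ser_ramp p.-1) h0.
  apply/polyP => i; rewrite (@coef_map _ _ T) (@coef_map _ _ (ser_ramp p.-1)) [h0`_i]coef_poly.
  case: ltnP => ik; last first.
    rewrite nth_default ?size_scaled //; transitivity (0 : ser F0); first exact: (rmorph0 T).
    exact/esym/rmorph0.
  apply/funext => m; rewrite /= /ser_ramp /ser_ram prednK //; case: ifP => pm; last first.
    exact: (Ttame i m (negbT pm)).
  by rewrite divnK.
have h0k : h0`_k = 1.
  rewrite coef_poly ltnSn scaled_top rmorph1; apply/funext => m; rewrite !ser1E muln_eq0.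
  by rewrite (gtn_eqF p0) orbF.
have h0s : size h0 = k.+1.
  apply/eqP; rewrite eqn_leq size_poly /= ltnNge; apply/negP => h.
  by have := h0k; rewrite nth_default // => /eqP; rewrite eq_sym oner_eq0.
have h0m : h0 \is monic by rewrite monicE lead_coefE h0s h0k.
have [F1 [e1 [d1 [bs [hd1 ed1 hb]]]]] := puiseux hd0 F00 h0m h0s p0 kp.
exists F1, (e1 \o e0), d1, bs; split.
- exact: hd1.1.
- by move=> i x /=; rewrite ed1 ed0.
- by move=> x y /fmorph_inj /inj0.
rewrite -hb; transitivity (map_poly (ser_map e1) (map_poly T (scaled a))).
  by apply/polyP => i; rewrite !coef_map.
by rewrite hT; apply/polyP => i; rewrite !coef_map /= ser_map_ramp.
Qed.

(** At a point with w != 0 the expansion of [w] is a unit, so that t can be rescaled in the roots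
    and the roots divided by w^a. *)
Lemma scaled_point_splits a kap : pts kap -> kap w != 0 -> exists bs,
  map_poly (ser_map (taylor_hom hd kap K0)) (scaled a) = \prod_(b <- bs) ('X - b%:P).
Proof.
move=> pk kw; have [bs bE] := point_splits pk kw; set Th := taylor_hom hd kap K0 in bE *.
have [|g wg] := @fps_unitP K n (Th w); first by rewrite /= taylor0.
pose T : {rmorphism ser O -> ser (fps K n)} := ser_map Th.
have szb : size bs = k.
  have := congr1 (fun q : {poly ser (fps K n)} => size q) bE.
  by rewrite size_prod_XsubC size_map_monic // fsz => -[].
pose v : ser (fps K n) := serC (g ^+ a).
exists [seq v * x | x <- [seq ser_scale (Th w ^+ a) b | b <- bs]].
rewrite -scale_roots_prod size_map szb.
have -> : \prod_(b <- [seq ser_scale (Th w ^+ a) b | b <- bs]) ('X - b%:P) =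
    scale_roots k (T (serC (w ^+ a))) (map_poly T (scaled a)).
  transitivity (map_poly T (map_poly (ser_scale (w ^+ a)) f)).
    transitivity (map_poly (ser_scale (Th w ^+ a)) (map_poly T f)).
      rewrite [map_poly T f]bE big_map rmorph_prod; apply: eq_bigr => b _.
      exact/esym/(map_polyXsubC (ser_scale (Th w ^+ a))).
    apply/polyP => i; rewrite !coef_map; apply/funext => m.
    by rewrite -[RHS]/(Th ((w ^+ a) ^+ m * f`_i m)) rmorphM !rmorphXn.
  by rewrite scaledE (scale_roots_map k (serC (w ^+ a)) (scaled a) T).
apply/polyP => i; rewrite [RHS]coef_poly; case: ltnP => ik; last first.
  by rewrite (@coef_map _ _ T) nth_default ?size_scaled //; exact: (rmorph0 T).
rewrite [X in _ = X * _]coef_poly ik -mulrA -exprMn (_ : T (serC (w ^+ a)) * v = 1) ?expr1n ?mulr1 //.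
have -> : T (serC (w ^+ a)) = serC (Th w ^+ a).
  apply/funext => -[|m]; first exact: (rmorphXn Th).
  exact: (rmorph0 Th).
by rewrite /v -rmorphM -exprMn wg expr1n rmorph1.
Qed.

Theorem scaled_splits : exists a0, forall a, (a0 <= a)%N -> (p %| a)%N ->
  exists bs, map_poly (total_map iota) (scaled a) = \prod_(b <- bs) ('X - b%:P).
Proof.
pose P s := (s <= k)%N && (hankel k f s != 0).
have exP : exists s, P s by exists 0; rewrite /P /hankel det_mx00 oner_eq0.
have Pk s : P s -> (s <= k)%N by case/andP.
case: (ex_maxnP exP Pk) => s /andP[sk /ser_neq0 [E DE0 Dlow]] smax.
set De0 := hankel k f s in DE0 Dlow.
have [|ls [c [Wls DEc cpr]]] := @Xs_part K n W (iota (De0 E)).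
  by rewrite -(rmorph0 iota) (inj_eq iota_inj).
(* Relative to the leading coefficient, the coefficient of t^(E+i) in the determinant gains w^(ai).
   For [a] at least [size ls] this power contains the monomial [Xs K ls] of the leading coefficient,
   which therefore divides the whole of [De]. *)
exists (size ls) => a la pa.
have rel s' : exists N, serC w ^+ (a * N) * hankel k (scaled a) s' = ser_scale (w ^+ a) (hankel k f s').
  have [N NE] := hankel_scale_roots k (serC (w ^+ a)) (scaled a) s'; exists N.
  by rewrite (hankel_map (ser_scale (w ^+ a))) scaledE NE exprM (rmorphXn (@serC O)).
have [y yE] := Xs_dvd_w wE Wls.
pose De : ser O := fun i => w ^+ (a * i) * De0 (E + i)%N.
(* Index 0 is treated apart: there the subtraction in the exponent is truncated, and the quotient is
   the factor [c] of the leading coefficient. *)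
pose De3 : ser (fps K n) := fun i =>
  if i == 0%N then c else y * iota w ^+ (a * i - size ls) * iota (De0 (E + i)%N).
have [N NE] := rel s.
have De_eq : serC w ^+ (a * N) * hankel k (scaled a) s = serC w ^+ (a * E) * serX O ^+ E * De.
  rewrite NE -/De0 -mulrA; apply/funext => m; rewrite -(rmorphXn (@serC O)) serCM serX_expM /ser_scale.
  case: leqP => hm; last by rewrite Dlow // !mulr0.
  by rewrite /De mulrA -exprD -exprM subnKC //; congr (_ ^+ _ * _); nia.
apply: (core_splits cst iota_inj iota_d wE dense divide (s := s) (scaled_monic a)
  (size_scaled a) _ _ De_eq Wls (De3 := De3)).
- move=> s' sk' ss'; have [N' N'E] := rel s'; apply: (@serCwM (a * N')).
  rewrite N'E (_ : hankel k f s' = 0) ?rmorph0 //; apply/eqP/negP => /negP h.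
  by have := smax s'; rewrite /P sk' h => /(_ isT); rewrite leqNgt ss'.
- apply/eqP => h0; move: NE; rewrite h0 mulr0 => /(congr1 (fun g : ser O => g E)) /esym.
  rewrite /ser_scale ser0E => /(congr1 iota) /eqP; rewrite rmorphM !rmorphXn rmorph0 mulf_eq0 !expf_eq0.
  by rewrite (negbTE iw0) !andbF /= -(rmorph0 iota) (inj_eq iota_inj) (negbTE DE0).
- move=> i; rewrite /De /De3 rmorphM rmorphXn; case: eqP => [->|/eqP i0].
    by rewrite muln0 expr0 mul1r addn0.
  rewrite !mulrA -yE -exprD subnKC // (leq_trans la) // leq_pmulr // lt0n //.
- exact: cpr.
- by rewrite /De3 /=; apply: contraNneq DE0 => c0; rewrite -(inj_eq iota_inj) DEc c0 mulr0 rmorph0.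
- exact: scaled_point_splits.
- by move=> l; exact: scaled_axis_splits.
Qed.

End Scaling.

(** * Strict transforms *)

Section XDegree.
Variables (K : comNzRingType) (n : nat) (X : pred 'I_n).
Implicit Types c : fps K n.

Definition xdeg (m : multinom n) : nat := (\sum_(i | X i) m i)%N.

Lemma xdegD m m' : xdeg (mnm_add m m') = (xdeg m + xdeg m')%N.
Proof. by rewrite /xdeg -big_split; apply: eq_bigr => i _; rewrite mnmDE. Qed.

Lemma xdeg0 : xdeg mnm0 = 0%N.
Proof. by rewrite /xdeg big1 // => i _; rewrite mnm0E. Qed.

(* The substitution [x -> t x]: the coefficient of [t ^ m] is the part of
   degree [m] in the indeterminates of [X]. *)
Definition xhom c : ser (fps K n) := fun m d => if xdeg d == m then c d else 0.
Definition unxhom (G : ser (fps K n)) : fps K n := fun d => G (xdeg d) d.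

Lemma xhomK c : unxhom (xhom c) = c.
Proof. by apply/funext => d; rewrite /unxhom /xhom eqxx. Qed.

Lemma unxhomK (G : ser (fps K n)) :
  (forall m d, G m d != 0 -> xdeg d = m) -> xhom (unxhom G) = G.
Proof.
move=> h; apply/funext => m; apply/funext => d; rewrite /xhom /unxhom; case: eqP => [->//|dm].
by apply/esym/eqP; apply: contrapT => /negP /h.
Qed.

Lemma xhom_inj : injective xhom. Proof. exact: can_inj xhomK. Qed.

Lemma xhom_is_additive : additive xhom.
Proof.
move=> a b; apply/funext => m; apply/funext => d; rewrite serBE fpsBE /xhom fpsBE.
by case: eqP => // _; rewrite subr0.
Qed.

Lemma xhom_is_monoid : monoid_morphism xhom.
Proof.
split=> [|a b]; apply/funext => m; apply/funext => d.
  rewrite /xhom ser1E fps1E; case: (eqVneq d mnm0) => [->|d0].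
    by rewrite xdeg0; case: m => [|m]; [rewrite !eqxx !mulr1n fps1E eqxx|].
  by case: m => [|m]; case: ifP => _ //; rewrite eqxx mulr1n fps1E (negbTE d0).
rewrite serME fps_sumE /xhom {1}/GRing.mul /= /fps_mul.
transitivity (\sum_(i < m.+1) \sum_(e : bmultinom n (mdeg d).+1 * bmultinom n (mdeg d).+1 | d == mnm_add e.1 e.2)
   (if xdeg e.1 == i then a e.1 else 0) * (if xdeg e.2 == (m - i)%N then b e.2 else 0)); last by [].
rewrite exchange_big /=; have inner (e1 e2 : multinom n) : d == mnm_add e1 e2 ->
    \sum_(i < m.+1) (if xdeg e1 == i then a e1 else 0) * (if xdeg e2 == (m - i)%N then b e2 else 0)
    = if xdeg d == m then a e1 * b e2 else 0.
  move=> /eqP ->; rewrite xdegD; have [h|h] := leqP (xdeg e1) m; last first.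
    rewrite gtn_eqF ?(leq_trans h) ?leq_addr // big1 // => i _.
    by rewrite gtn_eqF ?mul0r // (leq_trans _ h) // ltnS -ltnS.
  have h' : (xdeg e1 < m.+1)%N by [].
  rewrite (bigD1 (Ordinal h')) //= eqxx big1 ?addr0 => [|i ih].
    have -> : (xdeg e1 + xdeg e2 == m) = (xdeg e2 == (m - xdeg e1)%N).
      by rewrite -[in LHS](subnKC h) eqn_add2l.
    by case: eqP => _; rewrite ?mulr0.
  case: eqP => [e|]; last by rewrite mul0r.
  by case/eqP: ih; apply: val_inj.
rewrite [RHS](eq_bigr (fun e : bmultinom n (mdeg d).+1 * bmultinom n (mdeg d).+1 =>
   if xdeg d == m then a e.1 * b e.2 else 0)) => [|e he]; last exact: (inner e.1 e.2).
by case: ifP => _ //; rewrite big1.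
Qed.

HB.instance Definition _ := GRing.isZmodMorphism.Build (fps K n) (ser (fps K n)) xhom xhom_is_additive.
HB.instance Definition _ := GRing.isMonoidMorphism.Build (fps K n) (ser (fps K n)) xhom xhom_is_monoid.

Definition xfree c := xhom c = serC c.

Lemma xfreeM a b : xfree a -> xfree b -> xfree (a * b).
Proof.
rewrite /xfree => ha hb; transitivity (xhom a * xhom b); first exact: (rmorphM xhom).
by rewrite ha hb; apply/esym; exact: (rmorphM (@serC (fps K n))).
Qed.

Lemma xfree1 : xfree 1. Proof. by rewrite /xfree !rmorph1. Qed.

Lemma xfreeX a e : xfree a -> xfree (a ^+ e).
Proof. by move=> ha; elim: e => [|e IH]; rewrite ?expr0 ?exprS; [exact: xfree1|exact: xfreeM]. Qed.

Lemma xfree_X i : ~~ X i -> xfree (fps_X K i).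
Proof.
move=> Xi; apply/funext => m; apply/funext => d; rewrite /xhom /serC /fps_X.
have x0 : xdeg (mnm1 i) = 0%N.
  by rewrite /xdeg big1 // => l Xl; rewrite mnm1E; case: eqP => // e; rewrite e Xl in Xi.
case: (eqVneq d (mnm1 i)) => [->|di]; first by rewrite x0; case: m => [|m]; rewrite /= ?eqxx.
by case: m => [|m]; rewrite /= ?(negbTE di); case: ifP.
Qed.

(* [U ^ (-i) c(U x)], which makes sense when [c] has order at least [i] in the
   indeterminates of [X]. *)
Definition xdiv (U : fps K n) (i : nat) c : fps K n :=
  unxhom (fun m => U ^+ (m - i) * xhom c m).

Lemma xhom_xdiv U i c m : xfree U -> xhom (xdiv U i c) m = U ^+ (m - i) * xhom c m.
Proof.
move=> hU; rewrite /xdiv unxhomK // => {}m d; have : xfree (U ^+ (m - i)) by exact: xfreeX.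
move: (U ^+ _) => V hV; rewrite {1}/GRing.mul /= /fps_mul => h.
have [e /eqP de he] : exists2 e : bmultinom n (mdeg d).+1 * bmultinom n (mdeg d).+1,
    d == mnm_add e.1 e.2 & V e.1 * xhom c m e.2 != 0.
  apply: contrapT => no; case/eqP: h; rewrite big1 // => e de.
  by apply: contrapT => /eqP hd; apply: no; exists e.
have := congr1 xdeg de; rewrite /= xdegD => ->.
have V0 : V e.1 != 0 by apply: contraNneq he => ->; rewrite mul0r.
have c0 : xhom c m e.2 != 0 by apply: contraNneq he => ->; rewrite mulr0.
have -> : xdeg e.2 = m by apply/eqP; move: c0; rewrite /xhom; case: ifP; rewrite ?eqxx.
suff -> : xdeg e.1 = 0%N by [].
move: V0; have := congr1 (fun g : ser (fps K n) => g (xdeg e.1) e.1) hV.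
by rewrite /xhom eqxx /serC => ->; case: (xdeg e.1) => //= x; rewrite fps0E eqxx.
Qed.

End XDegree.

Section EulerDerivation.
Variables (K : fieldType) (n : nat) (X : pred 'I_n).
Hypothesis K0 : char0 K.

Definition hom_map : {rmorphism fps K n -> fps K n.+1} := unpeel ord0 \o @xhom K n X.

Lemma hom_map_inj : injective hom_map.
Proof.
by move=> a b /= /(congr1 (peel ord0)); rewrite !unpeelK => /xhom_inj.
Qed.

Let wt (m : multinom n.+1) : K := (xdeg X (mdel ord0 m))%:R - (m ord0)%:R.
(** The derivation given by the sum of x_i d/dx_i over [X], minus t d/dt; every monomial is an
    eigenvector. It detects the series obtained by x -> t x. *)
Definition euler (f : fps K n.+1) : fps K n.+1 := fun m => wt m * f m.

Lemma euler_derivation : derivation euler.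
Proof.
split=> f g; apply/funext => m; first by rewrite /euler !fpsDE mulrDr.
rewrite fpsDE /euler {1 2 3}/GRing.mul /= /fps_mul.
rewrite -[X in X = _]/(wt m * _) mulr_sumr -big_split; apply: eq_bigr => e /eqP me.
have wtD : wt m = wt e.1 + wt e.2.
  have -> : wt m = wt (mnm_add e.1 e.2) by congr wt. rewrite /wt; have -> : mdel ord0 (mnm_add e.1 e.2) = mnm_add (mdel ord0 e.1) (mdel ord0 e.2).
    by apply/mnmP => l; rewrite !(mnmE, mnmDE).
  by rewrite xdegD mnmDE !natrD; ring.
have -> : forall x y : K, Algebra.Algebra_add__canonical__Monoid_ComLaw K x y = x + y by [].
by rewrite wtD; ring.
Qed.

Lemma euler_hom_map c : euler (hom_map c) = 0.
Proof.
apply/funext => m; rewrite /euler /= /unpeel /xhom; case: eqP => [e|_]; last by rewrite mulr0.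
by rewrite /wt e subrr mul0r.
Qed.

Lemma euler_eq0 f : euler f = 0 -> exists c, f = hom_map c.
Proof.
move=> h; exists (unxhom X (peel ord0 f)); rewrite /= unxhomK ?peelK // => m d hd.
have := congr1 (fun g : fps K n.+1 => g (mins ord0 m d)) h; rewrite /euler fps0E => /eqP.
rewrite mulf_eq0 (negbTE (_ : f (mins ord0 m d) != 0)) ?orbF; last exact: hd.
rewrite /wt mdel_ins mins_j subr_eq0; move: (xdeg X d) => x {h hd} /eqP xm.
wlog le : x m xm / (x <= m)%N.
  by move=> H; have [/H|/ltnW /H] := leqP x m; [exact|move=> /(_ (esym xm))].
apply/eqP; rewrite eqn_leq le /= -subn_eq0; case E : (m - x)%N => [//|j].
by have := K0 j; rewrite -E natrB // xm subrr eqxx.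
Qed.

End EulerDerivation.

(** Differentiating P(b) = 0 gives P'(b) D(b) = 0; when P'(b) = 0 the same argument applies to P',
    of smaller degree and nonzero in characteristic zero. *)
Lemma root_of_constants (R : idomainType) (D : R -> R) (P : {poly R}) b :
  char0 R -> derivation D -> (forall l, D P`_l = 0) -> P != 0 -> root P b -> D b = 0.
Proof.
move=> R0 hD; elim: {P}(size P) {-2}P (leqnn (size P)) => [|s IH] P sP cP P0 Pb.
  by move: P0; rewrite -size_poly_leq0 sP.
have [e|ne] := eqVneq (P^`()).[b] 0; last first.
  have := der_map_horner (T := idfun) P b hD hD (fun=> erefl).
  have -> : \poly_(j < size P) D P`_j = 0 by apply/polyP => j; rewrite coef_poly cP coef0; case: ifP.
  rewrite !(@map_poly_id _ idfun) // (rootP Pb) (der0 hD) horner0 add0r => /esym /eqP.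
  by rewrite mulf_eq0 (negbTE ne) => /eqP.
have P1 : (1 < size P)%N.
  rewrite ltnNge; apply/negP => h; move: Pb P0; rewrite (size1_polyC h) rootC polyC_eq0.
  by move=> ->.
apply: (IH P^`()) => //.
- by rewrite -ltnS (leq_trans (lt_size_deriv P0)).
- by move=> l; rewrite coef_deriv (derMn hD) cP mul0rn.
- apply/eqP => /(congr1 (fun q : {poly R} => q`_(size P).-2)); rewrite coef0 coef_deriv.
  rewrite prednK ?ltn_predRL // -lead_coefE -mulr_natr => /eqP; rewrite mulf_eq0 lead_coef_eq0 (negbTE P0) /=.
  by case: (size P) P1 => [|[|m]] // _; rewrite (negbTE (R0 m)).
- exact/eqP.
Qed.

Section MonomialXDegree.
Variables (K : comNzRingType) (n : nat) (X : pred 'I_n).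
Implicit Types c : fps K n.

Lemma fps_mono_mulE u c d :
  (fps_mono K u * c) d = \sum_(e : bmultinom n (mdeg d).+1) c e * (d == mnm_add u e)%:R.
Proof.
rewrite -[fps_mono K u * c]/(fps_mul _ _) /fps_mul.
rewrite (eq_bigl (fun e : bmultinom n (mdeg d).+1 * bmultinom n (mdeg d).+1 =>
  predT e.1 && (d == mnm_add e.1 e.2))) //.
rewrite -(pair_big_dep predT (fun i j : bmultinom n (mdeg d).+1 => d == mnm_add i j)
  (fun i j : bmultinom n (mdeg d).+1 => fps_mono K u i * c j)) (exchange_big_dep predT) //=.
apply: eq_bigr => e _; rewrite big_mkcond /=.
have [du|du] := ltnP (mdeg u) (mdeg d).+1.
  rewrite (bigD1 (BMultinom du)) //= big1 ?addr0 => [|i iu].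
    by rewrite /fps_mono eqxx mul1r; case: ifP; rewrite ?mulr1 ?mulr0.
  rewrite /fps_mono; case: (eqVneq (val i) u) => [iu'|_]; last by rewrite mul0r if_same.
  by case/eqP: iu; apply: val_inj.
have -> : (d == mnm_add u e) = false.
  by apply/negP => /eqP h; move: du; rewrite h mdegD ltnNge leq_addr.
rewrite mulr0 big1 // => i _; rewrite /fps_mono; case: (eqVneq (val i) u) => [iu|_]; last by rewrite mul0r if_same.
by have := bmdeg i; rewrite iu ltnNge du.
Qed.

Lemma fps_mono_mul u c e : (fps_mono K u * c) (mnm_add u e) = c e.
Proof.
rewrite fps_mono_mulE; have he : (mdeg e < (mdeg (mnm_add u e)).+1)%N by rewrite mdegD ltnS leq_addl.
rewrite (bigD1 (BMultinom he)) //= eqxx mulr1 big1 ?addr0 // => i ie.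
rewrite (inj_eq (@addmI _ u)); case: (eqVneq e i) => [ei|_]; last by rewrite mulr0.
by case/eqP: ie; apply: val_inj.
Qed.

Lemma xhom_subst_mono v (u : 'I_n -> multinom n) c m :
  (forall i, v i = fps_mono K (u i)) -> (forall i, u i != mnm0) -> injective (mexp u) ->
  (forall e, xdeg X (mexp u e) = xdeg X e) ->
  xhom X (fps_subst v c) m = fps_subst v (xhom X c m).
Proof.
move=> vu u0 inj xu; apply/funext => d; rewrite /xhom.
have [[e <-]|no] := pselect (exists e, mexp u e = d).
  by rewrite xu !(fps_subst_mexp vu u0 inj).
have out e : mexp u e != d by apply/eqP => h; apply: no; exists e.
by rewrite !(fps_subst_out vu) // if_same.
Qed.

Lemma xhom_mul U c m : xfree X U -> xhom X (U * c) m = U * xhom X c m.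
Proof.
move=> hU; transitivity ((xhom X U * xhom X c) m).
  by congr (_ m); exact: (rmorphM (xhom X)).
by rewrite hU serCM.
Qed.

End MonomialXDegree.

Section StrictTransforms.
Variables (K : fieldType) (r q k : nat).
Local Notation n := (r + q + k.-1)%N.
Let X : pred 'I_n := fun i => (r + q <= i)%N.
Implicit Types F : {poly fps K n}.

Lemma w_xfree j : xfree X (@w_ K r q k j).
Proof. by apply: xfree_X; rewrite /X -ltnNge /= (leq_trans (ltn_ord j)) // leq_addr. Qed.

Lemma root_chart_mono p i : @root_chart K r q k p i =
  fps_mono K (mnm_muln (mnm1 i) (if (i < r)%N then p else 1%N)).
Proof.
rewrite /root_chart -fps_monoX; case: ifP => _; last by rewrite expr1.
by congr (_ ^+ p).
Qed.

Lemma root_mexpE p d l : mexp (fun i : 'I_n => mnm_muln (mnm1 i) (if (i < r)%N then p else 1%N)) d l =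
  (d l * (if (l < r)%N then p else 1))%N.
Proof.
rewrite mexpE (bigD1 l) //= big1 => [|i il]; last by rewrite mulmnE mnm1E (negbTE il) mul0n muln0.
by rewrite mulmnE mnm1E eqxx mul1n addn0.
Qed.

Section Root.
Variable p : nat.
Hypothesis p0 : (0 < p)%N.
Let u (i : 'I_n) := mnm_muln (mnm1 i) (if (i < r)%N then p else 1%N).

Let mexp_inj : injective (mexp u).
Proof.
move=> d e de; apply/mnmP => l; have := congr1 (fun m : multinom n => m l) de.
by rewrite !root_mexpE => /eqP; rewrite eqn_pmul2r; [move/eqP|case: ifP].
Qed.

Let u0 i : u i != mnm0.
Proof.
apply/eqP => /mnmP /(_ i) /eqP; rewrite mulmnE mnm1E eqxx mul1n mnm0E.
by case: ifP => _ //; rewrite (gtn_eqF p0).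
Qed.

Lemma root_chart_coef0 i : @root_chart K r q k p i mnm0 = 0.
Proof. by rewrite root_chart_mono /fps_mono eq_sym (negbTE (u0 i)). Qed.

Definition root_hom : {rmorphism fps K n -> fps K n} := fps_subst_hom root_chart_coef0.

Lemma root_hom_inj : injective root_hom.
Proof. exact: (fps_subst_mono_inj (root_chart_mono p) u0 mexp_inj). Qed.

Lemma xhom_root c m : xhom X (root_hom c) m = root_hom (xhom X c m).
Proof.
apply: (xhom_subst_mono _ _ (root_chart_mono p) u0 mexp_inj) => e.
apply: eq_bigr => i Xi; rewrite root_mexpE ifF ?muln1 //.
by apply/negbTE; rewrite -leqNgt (leq_trans _ Xi) // leq_addr.
Qed.

Lemma root_tame c : tame (fun i : 'I_n => (i < r)%N) p (root_hom c).
Proof.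
move=> m hm i Wi; apply: contrapT => pm; case/eqP: hm.
apply: (fps_subst_out (root_chart_mono p)) => d; apply/eqP => dm; apply: pm.
by rewrite -dm root_mexpE Wi dvdn_mull.
Qed.

Lemma root_w j : root_hom (@w_ K r q k j) = @w_ K r q k j ^+ p.
Proof. rewrite /w_ [LHS](fps_substX root_chart_coef0) /root_chart /= ltn_ord //. Qed.

End Root.

Section Blowup.
Variable j : 'I_r.
Let jj : 'I_n := lshift k.-1 (lshift q j).
Let u (i : 'I_n) := if X i then mnm_add (mnm1 jj) (mnm1 i) else mnm1 i.

Let Xjj : ~~ X jj.
Proof. by rewrite /X -ltnNge /= (leq_trans (ltn_ord j)) // leq_addr. Qed.

Let chart_mono i : @blowup_chart K r q k j i = fps_mono K (u i).
Proof.
rewrite /blowup_chart /u /X; case: fintype.splitP => [l il|l il]; rewrite il.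
  by rewrite leqNgt ltn_ord /=.
rewrite leq_addr -fps_monoM /w_ /x_ -/jj; congr (_ * _); congr fps_X.
exact: val_inj.
Qed.

Let u0 i : u i != mnm0.
Proof.
rewrite /u -mdeg_eq0; case: ifP => _; rewrite ?mdegD mdeg1 //.
Qed.

Let mexpE d : mexp u d = mnm_add (mnm_muln (mnm1 jj) (xdeg X d)) d.
Proof.
apply/mnmP => l; rewrite mexpE mnmDE mulmnE mnm1E.
transitivity (\sum_i ((if X i then d i * (jj == l) else 0) + d i * (i == l)))%N.
  by apply: eq_bigr => i _; rewrite /u; case: ifP => _; rewrite ?mnmDE !mnm1E ?mulnDr.
rewrite big_split /= -big_mkcond /= -big_distrl /= mulnC; congr (_ + _)%N.
rewrite (bigD1 l) //= eqxx muln1 big1 ?addn0 // => i /negbTE ->.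
by rewrite muln0.
Qed.

Let xdeg_mexp d : xdeg X (mexp u d) = xdeg X d.
Proof.
rewrite mexpE xdegD {1}/xdeg big1 ?add0n // => i Xi; rewrite mulmnE mnm1E.
by case: eqP => // e; move: Xjj; rewrite e Xi.
Qed.

Let mexp_inj : injective (mexp u).
Proof.
move=> d e de; have := congr1 (xdeg X) de; rewrite !xdeg_mexp => de'.
by move: de; rewrite !mexpE de' => /addmI.
Qed.

Lemma blowup_chart_coef0 i : @blowup_chart K r q k j i mnm0 = 0.
Proof. by rewrite chart_mono /fps_mono eq_sym (negbTE (u0 i)). Qed.

Lemma xhom_blowup c m :
  xhom X (fps_subst (@blowup_chart K r q k j) c) m = @w_ K r q k j ^+ m * xhom X c m.
Proof.
have -> : @w_ K r q k j ^+ m = fps_mono K (mnm_muln (mnm1 jj) m) by rewrite -fps_monoX.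
apply/funext => d; rewrite {1}/xhom.
have [[e <-]|no] := pselect (exists e, mexp u e = d).
  rewrite xdeg_mexp (fps_subst_mexp chart_mono u0 mexp_inj) mexpE.
  case: (eqVneq (xdeg X e) m) => [<-|em]; first by rewrite fps_mono_mul /xhom eqxx.
  rewrite fps_mono_mulE big1 // => e' _; rewrite /xhom.
  case: (eqVneq (xdeg X e') m) => [e'm|_]; last by rewrite mul0r.
  case: eqP => [/(congr1 (xdeg X))|_]; last by rewrite mulr0.
  have x0 a : xdeg X (mnm_muln (mnm1 jj) a) = 0%N.
    rewrite /xdeg big1 // => i Xi; rewrite mulmnE mnm1E.
    by case: eqP => // e0; move: Xjj; rewrite e0 Xi.
  by rewrite !xdegD !x0 !add0n e'm => /eqP; rewrite (negbTE em).
have out e : mexp u e != d by apply/eqP => h; apply: no; exists e.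
rewrite (fps_subst_out chart_mono) // if_same fps_mono_mulE big1 // => e _; rewrite /xhom.
case: (eqVneq (xdeg X e) m) => [em|_]; last by rewrite mul0r.
by have := out e; rewrite mexpE em eq_sym => /negbTE ->; rewrite mulr0.
Qed.

(** The coefficient of z^l becomes w_j^(l-k) F_l(w_j x), a power series when F_l has order at least
    k - l in x. *)
Definition strict F : {poly fps K n} :=
  \poly_(l < k.+1) xdiv X (@w_ K r q k j) (k - l) F`_l.

Lemma strict_xhom F l m : size F = k.+1 -> 
  xhom X (strict F)`_l m = @w_ K r q k j ^+ (m - (k - l)) * xhom X F`_l m.
Proof.
move=> sF; rewrite coef_poly; case: ltnP => lk; first by rewrite xhom_xdiv //; exact: w_xfree.
by rewrite nth_default ?sF // (rmorph0 (xhom X)) ser0E mulr0.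
Qed.

Lemma strict_top F : F \is monic -> size F = k.+1 -> (strict F)`_k = 1.
Proof.
move=> Fm Fs; have Fk : F`_k = 1 by rewrite -(monicP Fm) lead_coefE Fs.
apply: (@xhom_inj _ _ X); apply/funext => m; rewrite strict_xhom // Fk (rmorph1 (xhom X)) ser1E.
by case: m => [|m]; rewrite ?sub0n ?expr0 ?mul1r ?mulr0.
Qed.

Lemma strict_size F : F \is monic -> size F = k.+1 -> size (strict F) = k.+1.
Proof.
move=> Fm Fs; apply/eqP; rewrite eqn_leq size_poly /= ltnNge; apply/negP => h.
by have := strict_top Fm Fs; rewrite nth_default // => /eqP; rewrite eq_sym oner_eq0.
Qed.

Lemma strict_monic F : F \is monic -> size F = k.+1 -> strict F \is monic.
Proof. by move=> Fm Fs; rewrite monicE lead_coefE strict_size // strict_top. Qed.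

(** By the condition on orders the pullback contains the exceptional factor [k] times, and a monic
    polynomial contains no further one. *)
Lemma strict_transformP F : F \is monic -> size F = k.+1 ->
  (forall l m, (m < k - l)%N -> xhom X F`_l m = 0) -> strict_transform j F (strict F).
Proof.
move=> Fm Fs low; split; last first.
  case=> G /(congr1 (fun P : {poly fps K n} => P`_k mnm0)); rewrite strict_top // coefCM fps_coef0M.
  by rewrite [w_ _ _ _](@fps_X_coef0 K n) mul0r fps1E eqxx => /eqP; rewrite oner_eq0.
exists k; apply/polyP => l; rewrite coefCM.
pose B := fps_subst_hom blowup_chart_coef0.
have -> : (blowup_pullback j F)`_l = @w_ K r q k j ^+ l * B F`_l.
  rewrite /blowup_pullback -[map_poly _ F]/(map_poly B F) comp_polyE coef_sum.
  rewrite (eq_bigr (fun i : 'I_(size (map_poly B F)) => (map_poly B F)`_i * @w_ K r q k j ^+ i * (l == i)%:R)); last first.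
    by move=> i _; rewrite exprMn -rmorphXn /= coefZ coefCM coefXn mulrA.
  have [ls|ls] := ltnP l (size (map_poly B F)).
    rewrite (bigD1 (Ordinal ls)) //= eqxx mulr1 big1 ?addr0 => [|i il].
      by rewrite (@coef_map _ _ B) mulrC.
    by case: eqP => [li|]; rewrite ?mulr0 //; case/eqP: il; apply: val_inj.
  rewrite big1 => [|i _]; last by rewrite gtn_eqF ?mulr0 // (leq_trans (ltn_ord i)).
  by rewrite -(@coef_map _ _ B) nth_default // mulr0.
have wX e : xfree X (@w_ K r q k j ^+ e) by apply: xfreeX; exact: w_xfree.
apply: (@xhom_inj _ _ X); apply/funext => m; rewrite !xhom_mul // xhom_blowup strict_xhom //.
have [mk|mk] := ltnP m (k - l); first by rewrite low // !mulr0.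
have [lk|lk] := ltnP k l; first by rewrite nth_default ?Fs // (rmorph0 (xhom X)) !mulr0.
by rewrite !mulrA -!exprD; congr (_ ^+ _ * _); lia.
Qed.

End Blowup.

Lemma strict_transforms_exist js F : F \is monic -> size F = k.+1 ->
  (forall l m, (m < k - l)%N -> xhom X F`_l m = 0) -> exists F',
  [/\ strict_transforms js F F', F' \is monic, size F' = k.+1 &
    forall l m, xhom X F'`_l m = (\prod_(j <- js) @w_ K r q k j) ^+ (m - (k - l)) * xhom X F`_l m].
Proof.
elim: js F => [|j js IH] F Fm Fs low.
  by exists F; split=> // l m; rewrite big_nil expr1n mul1r.
have [||l m h|F' [tr F'm F's F'E]] := IH (strict j F); first exact: strict_monic.
- exact: strict_size.
- by rewrite strict_xhom // low // mulr0.
exists F'; split=> //; first by exists (strict j F) => //; exact: strict_transformP.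
by move=> l m; rewrite F'E strict_xhom // big_cons exprMn mulrA (mulrC (w_ K j ^+ _)).
Qed.

End StrictTransforms.

Lemma prod_XsubC_eqXn (R : idomainType) (bs : seq R) m :
  \prod_(b <- bs) ('X - b%:P) = 'X^m -> forall b, b \in bs -> b = 0.
Proof.
move=> h b; rewrite -root_prod_XsubC h /root hornerXn expf_eq0 => /andP[_ /eqP //].
Qed.

Lemma prod_XsubC0 (R : comNzRingType) (bs : seq R) :
  (forall b, b \in bs -> b = 0) -> \prod_(b <- bs) ('X - b%:P) = 'X^(size bs) :> {poly R}.
Proof.
elim: bs => [|b bs IH] h; first by rewrite big_nil expr0.
rewrite big_cons (h b) ?mem_head // subr0 exprS IH // => c cb; apply: h.
by rewrite inE cb orbT.
Qed.

(** * The order of the coefficients in x *)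

Section OrderOfPoints.
Variables (K : closedFieldType) (n k : nat) (K0 : char0 K).
Variables (O : comNzRingType) (d : 'I_n -> O -> O) (hd : dsystem d).
Variables (iota : {rmorphism O -> fps K n}).
Hypothesis iota_inj : injective iota.
Variables (w : O) (pts : {rmorphism O -> K} -> Prop).
Hypothesis dense : points_dense iota w pts.
Variable f : {poly ser O}.
Hypotheses (fm : f \is monic) (fs : size f = k.+1).
Hypothesis point_splits : forall kap, pts kap -> kap w != 0 -> exists2 bs,
  map_poly (ser_map (taylor_hom hd kap K0)) f = \prod_(b <- bs) ('X - b%:P) &
  forall b, b \in bs -> b 0%N mnm0 = 0.

Let th kap := taylor_hom hd kap K0.

Let size_bs kap bs :
  map_poly (ser_map (th kap)) f = \prod_(b <- bs) ('X - b%:P) -> size bs = k.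
Proof.
move=> /(congr1 (fun q : {poly ser (fps K n)} => size q)).
by rewrite size_prod_XsubC size_map_monic // fs => -[].
Qed.

Let low0 l : (l < k)%N -> f`_l 0%N = 0.
Proof.
move=> lk; apply/eqP; rewrite -(inj_eq iota_inj) (rmorph0 iota); apply/negP => /negP /dense [kap pk].
rewrite rmorphM mulf_eq0 negb_or => /andP[kw /eqP ks]; apply: ks.
have [bs bE b0] := point_splits pk kw; have sb := size_bs bE.
  pose T : {rmorphism ser (fps K n) -> K} := @fps_coef0 K n \o @ser0 _.
  have : map_poly T (map_poly (ser_map (th kap)) f) = 'X^k.
    rewrite bE rmorph_prod /= (eq_bigr (fun b => 'X - (T b)%:P)) => [|b _]; last exact: (map_polyXsubC T).
    rewrite -(big_map T predT (fun b => 'X - b%:P)) prod_XsubC0 ?size_map ?sb // => c /mapP[b bb ->].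
    exact: b0.
  move=> /(congr1 (fun P : {poly K} => P`_l)); rewrite (@coef_map _ _ T) (@coef_map _ _ (ser_map (th kap))).
rewrite coefXn (ltn_eqF lk) => hz; rewrite -[RHS]hz.
by rewrite /T /= /ser0 /ser_map /fps_coef0 /th /= taylor0.
Qed.

(** The hypothesis says only that the roots vanish at the point itself. By density [low0] deduces f
    = z^k at t = 0, so that at each point the roots vanish at t = 0 as series and t can be taken out
    of all of them. *)
Lemma order_of_points l m : (m < k - l)%N -> f`_l m = 0.
Proof.
move=> mk; have lk : (l < k)%N by lia.
apply: (@points_zero _ _ _ _ hd K0 iota w pts dense iota_inj) => kap pk kw.
have [bs bE b0] := point_splits pk kw; have sb := size_bs bE.
have b00 b : b \in bs -> b 0%N = 0.
  have hz : map_poly (@ser0 (fps K n)) (map_poly (ser_map (th kap)) f) = 'X^k.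
    apply/polyP => i; rewrite (@coef_map _ _ (@ser0 (fps K n))) (@coef_map _ _ (ser_map (th kap))) coefXn.
    case: (ltngtP i k) => [ik|ik|->].
    - by rewrite /= /ser_map /ser0 low0 // (rmorph0 (th kap)).
    - by rewrite nth_default ?fs //; exact: (rmorph0 (th kap)).
    - by have -> : f`_k = 1; [rewrite -(monicP fm) lead_coefE fs|exact: (rmorph1 (th kap))].
  move: hz; rewrite bE rmorph_prod /= (eq_bigr (fun b : ser (fps K n) => 'X - (ser0 b)%:P)) => [|c _]; last exact: (map_polyXsubC (@ser0 (fps K n))).
  rewrite -(big_map (@ser0 _) predT (fun b => 'X - b%:P)) => /prod_XsubC_eqXn h bb.
  exact/h/map_f.
have [cs csE] : exists cs, bs = [seq serX _ * c | c <- cs].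
  elim: (bs) b00 => [|b bs' IH] h; first by exists [::].
  have [c bE'] : exists c, b = serX _ ^+ 1 * c.
    by exists (ser_drop 1 b); apply: ser_divX => -[|//] _; apply: h; rewrite mem_head.
  have [|cs ->] := IH; last by exists (c :: cs); rewrite /= bE' expr1.
  by move=> x xb; apply: h; rewrite inE xb orbT.
have := congr1 (fun P : {poly ser (fps K n)} => P`_l m) bE.
rewrite (@coef_map _ _ (ser_map (th kap))) csE -scale_roots_prod => fE.
rewrite -[LHS]/(ser_map (th kap) f`_l m) [LHS]fE coef_poly.
have -> : size cs = k by rewrite -sb csE size_map.
by rewrite ltnS (ltnW lk) mulrC serX_expM leqNgt mk.
Qed.

End OrderOfPoints.

(** * From splitting at points to splitting after blowings-up *)

Section SplitAfterBlowups.
Variables (K : closedFieldType) (r q k : nat).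
Hypothesis K0 : char0 K.
Local Notation n := (r + q + k.-1)%N.
Let X : pred 'I_n := fun i => (r + q <= i)%N.
Let W : pred 'I_n := fun i => (i < r)%N.
Let p := puiseux_index k.
Let p0 : (0 < p)%N := puiseux_index_gt0 k.
Let rt := @root_hom K r q k p p0.

Variables (O : comNzRingType) (d : 'I_n -> O -> O) (hd : dsystem d).
Variables (iota : {rmorphism O -> fps K n}) (cst : {rmorphism K -> O}).
Hypothesis iota_inj : injective iota.
Hypothesis iota_d : forall i x, iota (d i x) = fps_d i (iota x).
Variables (w : O) (pts : {rmorphism O -> K} -> Prop).
Hypothesis wE : iota w = \prod_(l | W l) fps_X K l.
Hypothesis dense : points_dense iota w pts.
Hypothesis divide : points_divide hd K0 iota w pts.
Variables (F : {poly fps K n}) (f : {poly ser O}).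
Hypotheses (Fm : F \is monic) (Fs : size F = k.+1).
Hypotheses (fm : f \is monic) (fs : size f = k.+1).
Hypothesis fF : forall l m, iota (f`_l m) = xhom X (rt F`_l) m.
Hypothesis point_splits : forall kap, pts kap -> kap w != 0 -> exists2 bs,
  map_poly (ser_map (taylor_hom hd kap K0)) f = \prod_(b <- bs) ('X - b%:P) &
  forall b, b \in bs -> b 0%N mnm0 = 0.

Let low l m : (m < k - l)%N -> f`_l m = 0.
Proof. exact: (order_of_points iota_inj dense fm fs point_splits). Qed.

Lemma splits_of_points : splits_after_blowups F.
Proof.
have Flow l m : (m < k - l)%N -> xhom X F`_l m = 0.
  move=> h; have : rt (xhom X F`_l m) = 0.
    by rewrite -xhom_root -fF low // (rmorph0 iota).
  by move=> h0; apply: (@root_hom_inj K r q k p p0); rewrite [LHS]h0 [RHS](rmorph0 rt).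
have tm l m : tame W p (iota (f`_l m)) by rewrite fF xhom_root; exact: root_tame.
have ps kap : pts kap -> kap w != 0 -> exists bs,
    map_poly (ser_map (taylor_hom hd kap K0)) f = \prod_(b <- bs) ('X - b%:P).
  by move=> pk kw; have [bs bE _] := point_splits pk kw; exists bs.
have [a0 /(_ (p * a0)%N)] := scaled_splits cst iota_inj iota_d wE dense divide fm fs p0 (dvdnn _) tm low ps.
rewrite leq_pmull // dvdn_mulr // => /(_ isT isT) [bs bE].
(* Each w_j is blown up [a0] times; since [rt] sends w_j to its p-th power, this is the scaling with
   exponent [p * a0], a multiple of [p]. *)
pose js := flatten (nseq a0 (enum 'I_r)).
have jsE : rt (\prod_(j <- js) @w_ K r q k j) = iota w ^+ (p * a0).
  have rn : (r <= n)%N by rewrite -addnA leq_addr.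
  rewrite wE (big_ord_narrow rn) exprM /js big_flatten big_nseq iter_mulr mulr1 (rmorphXn rt); congr (_ ^+ _).
  rewrite -prodrXl big_enum (rmorph_prod rt); apply: eq_bigr => j _; rewrite root_w; rewrite /w_; suff -> : lshift k.-1 (lshift q j) = widen_ord rn j by []. 
  exact: val_inj.
have [F' [tr F'm F's F'E]] := strict_transforms_exist js Fm Fs Flow.
exists js, F'; split=> //; exists p => //.
pose h := hom_map K X.
have hE : map_poly h (map_poly rt F') = \prod_(b <- bs) ('X - b%:P).
  rewrite -bE; apply/polyP => l; rewrite (@coef_map _ _ h) (@coef_map _ _ rt) (@coef_map _ _ (total_map iota)).
  rewrite /= /h /=; congr (unpeel ord0 _); apply/funext => m.
  rewrite xhom_root F'E rmorphM rmorphXn jsE /ser_map coef_poly.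
  case: ltnP => lk; last by rewrite nth_default ?Fs // (rmorph0 (xhom X)) (rmorph0 rt) mulr0 (rmorph0 iota).
  by rewrite [RHS]rmorphM rmorphXn -exprM fF xhom_root.
(* The coefficients have been homogenised by x -> t x and are killed by the Euler derivation; so are
   the roots, which therefore come from series not involving t. *)
have ex b : b \in bs -> exists c, b = h c.
  move=> bb; apply: euler_eq0 => //.
  apply: (@root_of_constants _ _ (map_poly h (map_poly rt F')) b) => //.
  - exact: (char0_morph (@fps_const K n.+1) K0).
  - exact: euler_derivation.
  - by move=> l; rewrite (@coef_map _ _ h) euler_hom_map.
  - by rewrite hE monic_neq0 // monic_prod_XsubC.
  - by rewrite hE root_prod_XsubC.
have [cs csE] : exists cs, bs = map h cs.
  elim: bs ex {bE hE} => [|b bs IH] ex; first by exists [::].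
  have [c ->] := ex b (mem_head _ _); have [|cs ->] := IH; last by exists (c :: cs).
  by move=> x xb; apply: ex; rewrite inE xb orbT.
have scs : size cs = k.
  have := congr1 (fun P : {poly fps K n.+1} => size P) hE.
  rewrite size_prod_XsubC csE size_map size_map_monic ?monic_map // size_map_monic // F's.
  by case.
exists (fun i : 'I_k => - nth 0 cs i).
apply: (@map_inj_poly _ _ h) => [||]; first exact: hom_map_inj.
  exact: (rmorph0 h).
rewrite [LHS]hE csE big_map rmorph_prod (big_nth 0) scs big_mkord; apply: eq_bigr => i _.
by rewrite rmorphD /= map_polyX map_polyC /= rmorphN polyCN.
Qed.

End SplitAfterBlowups.

Definition monic_of k (R : comNzRingType) (c : 'I_k -> R) : {poly R} :=
  'X^k + \sum_(i < k) (c i)%:P * 'X^(k - i.+1).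

Lemma monic_of_size k (R : comNzRingType) (c : 'I_k -> R) :
  size (monic_of c) = k.+1 /\ monic_of c \is monic.
Proof.
have lt : (size (\sum_(i < k) (c i)%:P * 'X^(k - i.+1))%R < size ('X^k : {poly R}))%N.
  rewrite size_polyXn ltnS (leq_trans (size_sum _ _ _)) //; apply/bigmax_leqP => i _.
  rewrite (leq_trans (size_polyMleq _ _)) // size_polyXn; have := size_polyC_leq1 (c i).
  have := ltn_ord i; lia.
by rewrite monicE /monic_of size_polyDl // lead_coefDl // size_polyXn lead_coefXn.
Qed.

Lemma map_monic_of k (R T : comNzRingType) (e : {rmorphism R -> T}) (c : 'I_k -> R) :
  map_poly e (monic_of c) = monic_of (e \o c).
Proof.
rewrite rmorphD /= (map_polyXn e) rmorph_sum; congr (_ + _); apply: eq_bigr => i _.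
by rewrite rmorphM /= (map_polyXn e) (map_polyC e).
Qed.

Section HomogenisationSubstitution.
Variables (K : comNzRingType) (n : nat) (X : pred 'I_n).
Let u (i : 'I_n) : multinom n.+1 := mins ord0 (X i) (mnm1 i).

Let mexpE e : mexp u e = mins ord0 (xdeg X e) e.
Proof.
apply/mnmP => l; rewrite mexpE; case: (unliftP ord0 l) => [l' ->|->].
  rewrite mins_lift (bigD1 l') //= mins_lift mnm1E eqxx muln1 big1 ?addn0 // => i il.
  by rewrite mins_lift mnm1E (negbTE il) muln0.
rewrite mins_j /xdeg [RHS]big_mkcond; apply: eq_bigr => i _; rewrite mins_j.
by case: (X i); rewrite ?muln1 ?muln0.
Qed.

Definition hom_chart i : fps K n.+1 := fps_mono K (u i).

Let u0 i : u i != mnm0.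
Proof. by rewrite -mdeg_eq0 mdeg_mins mdeg1 addn1. Qed.

Lemma hom_chart0 i : hom_chart i mnm0 = 0.
Proof. by rewrite /hom_chart /fps_mono eq_sym (negbTE (u0 i)). Qed.

(** Presenting x -> t x as a monomial substitution makes composition and the chain rule available
    for it. *)
Lemma hom_chart_subst c : unpeel ord0 (xhom X c) = fps_subst hom_chart c.
Proof.
have inj : injective (mexp u) by move=> a b; rewrite !mexpE => /mins_inj[].
apply/funext => m; rewrite /unpeel /xhom; case: eqP => [xm|xm].
  have -> : m = mexp u (mdel ord0 m) by rewrite mexpE xm mins_del.
  by rewrite (fps_subst_mexp (fun _ => erefl) u0 inj) mexpE mdel_ins.
rewrite (fps_subst_out (fun _ => erefl)) // => e; apply/eqP => em; apply: xm.
by rewrite -em mexpE mdel_ins mins_j.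
Qed.

End HomogenisationSubstitution.

(** * Rings of functions closed under derivatives and homogeneous parts *)

Section ClosedSubring.
Variables (K : closedFieldType) (r q k : nat).
Hypothesis K0 : char0 K.
Local Notation n := (r + q + k.-1)%N.
Let X : pred 'I_n := fun i => (r + q <= i)%N.
Let W : pred 'I_n := fun i => (i < r)%N.
Let p := puiseux_index k.
Let p0 : (0 < p)%N := puiseux_index_gt0 k.
Let rt := @root_hom K r q k p p0.

(** The part of degree [m] in x of c(w^p, u, x); these parts are the coefficients in t after x -> t
    x, and have to belong to the ring of functions. *)
Definition root_component m (c : fps K n) : fps K n := xhom X (rt c) m.

Variable S : subring_set (fps K n).
Local Notation O := (subring_of S).
Hypothesis S_const : forall a, @fps_const K n a \in subring_pred S.
Hypothesis S_X : forall i, fps_X K i \in subring_pred S.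
Hypothesis S_d : forall i c, c \in subring_pred S -> fps_d i c \in subring_pred S.
Hypothesis S_root : forall m c, c \in subring_pred S -> root_component m c \in subring_pred S.

Let iota : {rmorphism O -> fps K n} := (val : O -> fps K n).
Let iota_inj : injective iota. Proof. exact: val_inj. Qed.

Definition sub_d i (x : O) : O := exist _ (fps_d i (val x)) (S_d i (valP x)).

Lemma sub_dsystem : dsystem sub_d.
Proof.
by split=> [i|i j x]; [split=> x y|]; apply: val_inj; rewrite /= ?fps_dD ?fps_dM ?(fps_dC i j).
Qed.

Definition sub_const (a : K) : O := exist _ (@fps_const K n a) (S_const a).
Lemma sub_const_is_additive : additive sub_const.
Proof. by move=> a b; apply: val_inj; exact: (rmorphB (@fps_const K n)). Qed.
Lemma sub_const_is_monoid : monoid_morphism sub_const.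
Proof. by split=> [|a b]; apply: val_inj; [|exact: (rmorphM (@fps_const K n))]. Qed.
Definition sub_cst : {rmorphism K -> O} := HB.pack sub_const
  (GRing.isZmodMorphism.Build _ _ _ sub_const_is_additive)
  (GRing.isMonoidMorphism.Build _ _ _ sub_const_is_monoid).

Definition sub_X i : O := exist _ (fps_X K i) (S_X i).
Definition sub_w : O := \prod_(l | W l) sub_X l.

Lemma sub_wE : iota sub_w = \prod_(l | W l) fps_X K l.
Proof. by rewrite (rmorph_prod iota). Qed.

Definition sub_lift (x : O) : ser O := fun m => exist _ (root_component m (val x)) (S_root m (valP x)).

Lemma total_lift x : total_map iota (sub_lift x) = hom_map K X (rt (val x)).
Proof. by []. Qed.

Let T_inj := total_map_inj iota_inj.

Lemma sub_lift_is_additive : additive sub_lift.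
Proof.
move=> a b; apply: T_inj; rewrite (rmorphB (total_map iota)) !total_lift (rmorphB iota).
by rewrite (rmorphB rt) (rmorphB (hom_map K X)).
Qed.
Lemma sub_lift_is_monoid : monoid_morphism sub_lift.
Proof.
split=> [|a b]; apply: T_inj.
  by rewrite (rmorph1 (total_map iota)) total_lift (rmorph1 iota) (rmorph1 rt) (rmorph1 (hom_map K X)).
rewrite (rmorphM (total_map iota)) !total_lift (rmorphM iota).
by rewrite (rmorphM rt) (rmorphM (hom_map K X)).
Qed.
Definition lift_hom : {rmorphism O -> ser O} := HB.pack sub_lift
  (GRing.isZmodMorphism.Build _ _ _ sub_lift_is_additive)
  (GRing.isMonoidMorphism.Build _ _ _ sub_lift_is_monoid).

(* The point below [kap] under [(w, u, x) |-> (w ^ p, u, 0)]. *)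
Definition below (kap : {rmorphism O -> K}) : {rmorphism O -> K} :=
  kap \o (@ser0 O \o lift_hom).

Let D := ser_der ord0 sub_d.
Let hd := sub_dsystem.

Let rho i : fps K n.+1 := total_map iota (lift_hom (sub_X i)).

Lemma lift_subst x : total_map iota (lift_hom x) = fps_subst rho (iota x).
Proof.
have rt0 := @root_chart_coef0 K r q k p p0.
rewrite [LHS]total_lift [LHS]hom_chart_subst /rt [LHS](fps_subst_comp K0 _ rt0 (@hom_chart0 _ _ X)).
congr (fps_subst _ _); apply/funext => i; rewrite -(fps_substX rt0 i) -hom_chart_subst.
by [].
Qed.

Let rho0 i : rho i mnm0 = 0.
Proof.
have rt0 := @root_chart_coef0 K r q k p p0.
rewrite /rho total_lift [Y in Y mnm0]hom_chart_subst (fps_subst_coef0 _ (@hom_chart0 K n X)).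
by rewrite [LHS](fps_subst_coef0 _ rt0); exact: fps_X_coef0.
Qed.

Let D_total j y : fps_d j (total_map iota y) = total_map iota (D j y).
Proof. exact: total_map_d. Qed.

Lemma lift_d j x : D j (lift_hom x) = \sum_i lift_hom (sub_d i x) * D j (lift_hom (sub_X i)).
Proof.
apply: T_inj; rewrite -D_total lift_subst (fps_subst_d rho0) (rmorph_sum (total_map iota)); apply: eq_bigr => i _.
by rewrite (rmorphM (total_map iota)) lift_subst -D_total.
Qed.

Section Point.
Variable kap : {rmorphism O -> K}.
Let th := taylor_hom hd kap K0.
Let th' := taylor_hom hd (below kap) K0.
Let A : {rmorphism O -> fps K n.+1} := unpeel ord0 \o (ser_map th \o lift_hom).

Definition point_chart i : fps K n.+1 := A (sub_X i) - @fps_const K n.+1 (A (sub_X i) mnm0).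

Lemma point_chart0 i : point_chart i mnm0 = 0.
Proof. by rewrite /point_chart fpsBE /fps_const eqxx subrr. Qed.

Let thd j (y : ser O) : fps_d j (unpeel ord0 (ser_map th y)) = unpeel ord0 (ser_map th (D j y)).
Proof.
apply: (@peel_inj _ _ ord0); rewrite peel_der !unpeelK; apply: ser_map_der => i x.
exact: taylor_d.
Qed.

(** Expanding f(w^p, u, t x) at [kap] amounts to substituting the displacement [point_chart] in the
    expansion at the image point. By the chain rule, sums of such terms with arbitrary multipliers
    form a relation stable under derivatives. *)
Lemma subst_taylor x : A x = fps_subst point_chart (th' x).
Proof.
pose B := fps_subst_hom point_chart0.
apply: (@fps_char0_ind _ _ K0 (fun g h => exists s : seq (O * fps K n.+1),
  g = \sum_(y <- s) A y.1 * y.2 /\ h = \sum_(y <- s) B (th' y.1) * y.2)).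
- move=> g h [s [-> ->]]; rewrite !fps_sumE; apply: eq_bigr => y _; rewrite !fps_coef0M; congr (_ * _).
  rewrite [RHS](fps_subst_coef0 _ point_chart0) [RHS]taylor0 /= /unpeel /ser_map mnm0E.
  have -> : mdel ord0 mnm0 = mnm0 :> multinom n by apply/mnmP => l; rewrite mnmE !mnm0E.
  exact: taylor0.
- move=> j g h [s [-> ->]].
  exists (flatten [seq (y.1, fps_d j y.2) :: [seq (sub_d i y.1, y.2 * fps_d j (point_chart i)) | i <- index_enum (ordinal n)] | y <- s]).
  rewrite !big_flatten /= !big_map; split; rewrite (der_sum ((fps_dsystem K n.+1).1 j)); apply: eq_bigr => y _;
    rewrite big_cons big_map /= fps_dM addrC; congr (_ + _).
    rewrite [fps_d j (A y.1)]thd lift_d.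
    pose E : {rmorphism ser O -> fps K n.+1} := unpeel ord0 \o ser_map th.
    rewrite -[unpeel _ _]/(E _) (rmorph_sum E) mulr_suml; apply: eq_bigr => i _; rewrite (rmorphM E).
    have -> : E (D j (lift_hom (sub_X i))) = fps_d j (point_chart i).
      by rewrite /point_chart (derB ((fps_dsystem K n.+1).1 j)) fps_d_const subr0 [RHS]thd.
    by rewrite -mulrA [_ * y.2]mulrC.
  rewrite [fps_d j _](fps_subst_d point_chart0) mulr_suml; apply: eq_bigr => i _.
  have AC (a b c : fps K n.+1) : a * b * c = a * (c * b) by rewrite -mulrA (mulrC b).
  by rewrite (taylor_d hd (below kap) K0) AC.
- by exists [:: (x, 1)]; rewrite !big_seq1 !mulr1.
Qed.

End Point.

Variable pts : {rmorphism O -> K} -> Prop.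
Hypothesis dense : points_dense iota sub_w pts.
Hypothesis divide : points_divide hd K0 iota sub_w pts.

(** The common end of the two cases, which have to provide density and the divisibility test. A
    formal splitting at the image point is pulled back along [point_chart], and the constant terms
    of its roots remain zero. *)
Theorem splits_of_closed_subring (c : 'I_k -> O) :
  (forall kap, pts kap -> kap sub_w != 0 ->
     splits_formally (monic_of (taylor_hom hd (below kap) K0 \o c))) ->
  splits_after_blowups (monic_of (val \o c)).
Proof.
move=> h; have [Fs Fm] := monic_of_size (val \o c); have [fs fm] := monic_of_size (lift_hom \o c).
apply: (splits_of_points (K0 := K0) (hd := hd) sub_cst iota_inj _ sub_wE dense divide Fm Fs fm fs) => //.
  move=> l m; have := congr1 (fun P : {poly fps K n} => P`_l) (map_monic_of iota c).
  have := congr1 (fun P : {poly ser O} => P`_l) (map_monic_of lift_hom c).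
  rewrite (@coef_map _ _ lift_hom) (@coef_map _ _ iota) => <- <-.
  by [].
move=> kap pk kw; have [b b0 bE] := h kap pk kw.
pose B : {rmorphism fps K n -> ser (fps K n)} := peel ord0 \o fps_subst_hom (point_chart0 kap).
have AB x : ser_map (taylor_hom hd kap K0) (lift_hom x) = B (taylor_hom hd (below kap) K0 x).
  by rewrite /B /= -subst_taylor /= unpeelK.
exists [seq - B (b i) | i <- index_enum (ordinal k)].
  rewrite big_map map_monic_of.
  transitivity (map_poly B (monic_of (taylor_hom hd (below kap) K0 \o c))).
    by rewrite map_monic_of; congr monic_of; apply/funext => i; exact: AB.
  rewrite bE rmorph_prod; apply: eq_bigr => i _.
  by rewrite rmorphD /= (map_polyX B) (map_polyC B) polyCN opprK.
move=> x /mapP[i _ ->]; rewrite -[LHS]/(- (B (b i) 0%N mnm0)); apply/eqP; rewrite oppr_eq0.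
rewrite /B /= /peel (_ : mins ord0 0 mnm0 = mnm0); last first.
  by apply/mnmP => l; rewrite mnmE !mnm0E; case: unliftP => [l' _|_]; rewrite ?mnm0E.
by rewrite (fps_subst_coef0 _ (point_chart0 kap)) b0.
Qed.

End ClosedSubring.

(** * The étale case *)

Lemma fps_eq_d (K : fieldType) (K0 : char0 K) n (f g : fps K n) :
  f mnm0 = g mnm0 -> (forall i, fps_d i f = fps_d i g) -> f = g.
Proof.
move=> h0 hd; apply: (@fps_char0_ind _ _ K0 (fun a b => a = b \/ (a = f /\ b = g))); last by right.
  by move=> a b [->|[-> ->]].
by move=> i a b [->|[-> ->]]; left.
Qed.

Lemma rmorph_mmap (R S T : comNzRingType) n (e : {rmorphism S -> T}) (f : R -> S)
    (h : 'I_n -> S) (P : mpoly n R) : e (mmap f h P) = mmap (e \o f) (e \o h) P.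
Proof.
rewrite /mmap rmorph_sum; apply: eq_bigr => m _; rewrite rmorphM; congr (_ * _).
by rewrite /mmap1 rmorph_prod; apply: eq_bigr => i _; rewrite rmorphXn.
Qed.

Lemma mpoly_ring_ind (K : comNzRingType) m (Q : mpoly m K -> Prop) :
  (forall c, Q (mpolyC m c)) -> (forall i, Q (mpolyX K (mnm1 i))) ->
  (forall a b, Q a -> Q b -> Q (a + b)) -> (forall a b, Q a -> Q b -> Q (a * b)) ->
  forall a, Q a.
Proof.
move=> QC QX QD QM a; rewrite [a]mpolyE; elim/big_ind: _ => [|x y|e _]; first by rewrite -mpolyC0.
- exact: QD.
- rewrite -mul_mpolyC; apply: (QM _ _ (QC _)); rewrite mpolyXE_id.
  elim/big_ind: _ => [|x y|i _]; [by rewrite -mpolyC1|exact: QM|].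
  by elim: (e i) => [|l IH]; [rewrite expr0 -mpolyC1|rewrite exprS; apply: QM].
Qed.

Section EtaleUniqueness.
Variables (K : fieldType) (n m : nat) (s t : 'I_m -> fps K n).
Hypothesis st : forall i, s i mnm0 = t i mnm0.
Let C := @fps_const K n.
Let v i := s i mnm0.

(** A divided difference: the cofactors [Q i] specialise at the point to the partial derivatives. *)
Lemma mmap_difference P : exists Q : 'I_m -> fps K n,
  [/\ mmap C s P - mmap C t P = \sum_i (s i - t i) * Q i,
   forall i, Q i mnm0 = meval v (mderiv i P) &
   mmap C s P mnm0 = meval v P /\ mmap C t P mnm0 = meval v P].
Proof.
elim/mpoly_ring_ind: P => [c|i|a b [Qa [Ea Ha [sa ta]]] [Qb [Eb Hb [sb tb]]]|a b [Qa [Ea Ha [sa ta]]] [Qb [Eb Hb [sb tb]]]].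
- exists (fun _ => 0); split; first by rewrite !mmapC subrr big1 // => i _; rewrite mulr0.
    by move=> i; rewrite mderivC meval0.
  have EC (u : 'I_m -> fps K n) : mmap C u (mpolyC m c) mnm0 = c.
    have -> : mmap C u (mpolyC m c) = C c by exact: mmapC.
    by rewrite /C /fps_const; case: eqP.
  by rewrite !EC mevalC.
- exists (fun l => (l == i)%:R); split.
  + rewrite !mmapX !mmap1U (bigD1 i) //= eqxx mulr1 big1 ?addr0 // => l /negbTE ->.
    by rewrite mulr0.
  + move=> l; rewrite mderivX mnm1E eq_sym; case: eqP => [->|_]; last by rewrite mulr0n scale0r meval0.
    have -> : mnm_sub (mnm1 l) (mnm1 l) = mnm0 by apply/mnmP => j; rewrite mnmBE mnm0E subnn.
    rewrite scale1r mevalX [LHS]fps1E eqxx big1 // => j _; by rewrite mnm0E expr0.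
  + by rewrite !mmapX !mmap1U mevalXU -st.
- exists (fun i => Qa i + Qb i); split.
  + by rewrite !mmapD opprD addrACA Ea Eb -big_split; apply: eq_bigr => i _; rewrite mulrDr.
  + by move=> i; rewrite fpsDE Ha Hb mderivD mevalD.
  + by rewrite !mmapD !fpsDE mevalD sa sb ta tb.
- have cM (c d : K) : C c * C d = C (c * d) by rewrite -(rmorphM (@fps_const K n)).
  have mM (u : 'I_m -> fps K n) : mmap C u (a * b) = mmap C u a * mmap C u b.
    exact: (rmorphM (mmap (@fps_const K n) u)).
  exists (fun i => Qa i * mmap C s b + mmap C t a * Qb i); split.
  + have -> : mmap C s (a * b) - mmap C t (a * b) =
       (mmap C s a - mmap C t a) * mmap C s b + mmap C t a * (mmap C s b - mmap C t b).
      by rewrite !mM mulrBl mulrBr addrA subrK.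
    rewrite Ea Eb mulr_suml mulr_sumr -big_split; apply: eq_bigr => i _ /=.
    by rewrite mulrDr mulrA (mulrCA (mmap C t a)).
  + by move=> i; rewrite fpsDE !fps_coef0M Ha Hb sb ta mderivM mevalD !mevalM.
  + by rewrite !mM !fps_coef0M mevalM sa sb ta tb.
Qed.

End EtaleUniqueness.

(** The difference of two solutions is annihilated by a matrix of divided differences whose constant
    term is the Jacobian matrix; its determinant is nonzero and series form a domain. *)
Lemma etale_unique (K : fieldType) n (U : etale_nbhd K n) (v : 'rV[K]_(n + etale_dim U))
    (n' : nat) (s t : 'I_(n + etale_dim U) -> fps K n') : etale_point v ->
  (forall i, s i mnm0 = v 0 i) -> (forall i, t i mnm0 = v 0 i) ->
  (forall i, s (lshift _ i) = t (lshift _ i)) ->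
  (forall l, mmap (@fps_const K n') s (etale_eqs U l) = 0) ->
  (forall l, mmap (@fps_const K n') t (etale_eqs U l) = 0) -> s = t.
Proof.
move=> pv sv tv stl s0 t0; have st i : s i mnm0 = t i mnm0 by rewrite sv tv.
have /choice [Q HQ] l := mmap_difference st (etale_eqs U l).
pose M : 'M[fps K n']_(etale_dim U) := \matrix_(l, j) Q l (rshift n j).
pose z : 'cV[fps K n']_(etale_dim U) := \col_j (s (rshift n j) - t (rshift n j)).
have Mz : M *m z = 0.
  apply/matrixP => l j; rewrite !mxE; have [E _ _] := HQ l.
  rewrite s0 t0 subrr big_split_ord /= big1 ?add0r in E => [|i _]; last by rewrite stl subrr mul0r.
  by rewrite [RHS]E; apply: eq_bigr => i _; rewrite !mxE mulrC.
have dM : \det M != 0.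
  apply/eqP => /(congr1 (@fps_coef0 K n')); rewrite (rmorph0 (@fps_coef0 K n')) -det_map_mx.
  have := etale_jacobian (e := U) pv; set A := (X in \det X != 0); move/eqP => dA; rewrite (_ : map_mx _ _ = A) //.
  apply/matrixP => l j; transitivity (Q l (rshift n j) mnm0); first by rewrite !mxE.
  have [_ -> _] := HQ l; rewrite mxE.
  by apply: meval_eq => i; rewrite sv.
have z0 : \det M *: z = 0.
  by rewrite -mul_scalar_mx -mul_adj_mx -mulmxA Mz mulmx0.
apply/funext => i; case: (split_ordP i) => j ->; first exact: stl.
have /eqP := congr1 (fun A : 'cV_ _ => A j 0) z0; rewrite !mxE mulf_eq0 (negbTE dM) subr_eq0.
by move/eqP.
Qed.

(** * Countably generated algebras of series *)

Section GeneratedSubring.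
Variables (K : fieldType) (n : nat) (G : countType) (gen : G -> fps K n).
Let C := @fps_const K n.
Let C0 : C 0 = 0 := rmorph0 (@fps_const K n).
Let C1 : C 1 = 1 := rmorph1 (@fps_const K n).

Definition gen_mono (s : seq G) : fps K n := \prod_(g <- s) gen g.
(** Words in countably many generators are coded by integers, which gives the countable dimension
    required by the nullstellensatz; an integer coding no word contributes 0. *)
Definition gen_enum (j : nat) : fps K n := if unpickle j is Some s then gen_mono s else 0.

Definition gen_span : {pred fps K n} := fun f => `[< exists L : seq (K * seq G),
  f = \sum_(x <- L) C x.1 * gen_mono x.2 >].

Lemma gen_spanP f : reflect (exists L : seq (K * seq G), f = \sum_(x <- L) C x.1 * gen_mono x.2)
  (f \in gen_span).
Proof. exact: asboolP. Qed.

Lemma gen_spanD f g : f \in gen_span -> g \in gen_span -> f + g \in gen_span.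
Proof.
move=> /gen_spanP[L ->] /gen_spanP[L' ->]; apply/gen_spanP; exists (L ++ L').
by rewrite big_cat.
Qed.

Lemma gen_span_term a s : C a * gen_mono s \in gen_span.
Proof. by apply/gen_spanP; exists [:: (a, s)]; rewrite big_seq1. Qed.

Lemma gen_span_const a : C a \in gen_span.
Proof. by have := gen_span_term a [::]; rewrite /gen_mono big_nil mulr1. Qed.

Lemma gen_span_gen g : gen g \in gen_span.
Proof.
by have := gen_span_term 1 [:: g]; rewrite /gen_mono big_seq1 C1 mul1r.
Qed.

Lemma gen_span_sum I (s : seq I) (F : I -> fps K n) :
  (forall i, F i \in gen_span) -> \sum_(i <- s) F i \in gen_span.
Proof.
move=> h; elim: s => [|i s IH]; rewrite ?big_nil ?big_cons; last exact: gen_spanD.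
by rewrite -C0; exact: gen_span_const.
Qed.

Lemma gen_spanM f g : f \in gen_span -> g \in gen_span -> f * g \in gen_span.
Proof.
move=> /gen_spanP[L ->] /gen_spanP[L' ->]; rewrite mulr_suml; apply: gen_span_sum => x.
rewrite mulr_sumr; apply: gen_span_sum => y; rewrite mulrACA -(rmorphM (@fps_const K n)).
by rewrite /gen_mono -big_cat; exact: gen_span_term.
Qed.

Lemma gen_spanN f : f \in gen_span -> - f \in gen_span.
Proof.
have -> : - f = C (-1) * f by rewrite /C rmorphN rmorph1 mulN1r.
by move=> h; apply: gen_spanM => //; exact: gen_span_const.
Qed.

Lemma gen_span_subring : subring_closed gen_span.
Proof.
split=> [|f g hf hg|f g hf hg]; last exact: gen_spanM.
  by rewrite -C1; exact: gen_span_const.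
by apply: gen_spanD => //; exact: gen_spanN.
Qed.

Lemma gen_span_ind (Q : fps K n -> Prop) :
  (forall a, Q (C a)) -> (forall g, Q (gen g)) -> (forall f g, Q f -> Q g -> Q (f + g)) ->
  (forall f g, f \in gen_span -> g \in gen_span -> Q f -> Q g -> Q (f * g)) ->
  forall f, f \in gen_span -> Q f.
Proof.
move=> QC Qg QD QM f /gen_spanP[L ->]; elim: L => [|[a s] L IH]; rewrite ?big_nil ?big_cons.
  by rewrite -C0; exact: QC.
apply: QD => //; rewrite /=; have : gen_mono s \in gen_span /\ Q (gen_mono s).
  rewrite /gen_mono; elim: s => [|g s [h Qs]]; rewrite ?big_nil ?big_cons.
    by rewrite -C1; split; [exact: gen_span_const|exact: QC].
  split; first by apply: gen_spanM => //; exact: gen_span_gen.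
  by apply: QM => //; exact: gen_span_gen.
by case=> h Qs; apply: QM => //; exact: gen_span_const.
Qed.

Lemma gen_enum_span j : gen_enum j \in gen_span.
Proof.
rewrite /gen_enum; case: unpickle => [s|]; last by rewrite -C0; exact: gen_span_const.
by have := gen_span_term 1 s; rewrite C1 mul1r.
Qed.

Lemma gen_span_enum f : f \in gen_span ->
  exists N (c : 'I_N -> K), f = \sum_j C (c j) * gen_enum j.
Proof.
move=> /gen_spanP[L ->]; pose N := (\max_(x <- L) pickle x.2).+1.
exists N, (fun j : 'I_N => \sum_(x <- L | pickle x.2 == j :> nat) x.1).
under [RHS]eq_bigr => j _ do rewrite /C (rmorph_sum (@fps_const K n)) mulr_suml big_mkcond /=.
rewrite exchange_big /= big_seq [RHS]big_seq; apply: eq_bigr => x xL.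
have xN : (pickle x.2 < N)%N by rewrite ltnS; exact: (@leq_bigmax_seq _ _ _ (fun x : K * seq G => pickle x.2) _ xL).
rewrite (bigD1 (Ordinal xN)) //= eqxx /gen_enum pickleK big1 ?addr0 // => j jx.
by case: eqP => // e; case/eqP: jx; apply: val_inj.
Qed.

End GeneratedSubring.

Section ClosedSubringPoints.
Variables (K : closedFieldType) (r q k : nat).
Hypothesis K0 : char0 K.
Local Notation n := (r + q + k.-1)%N.
Variable S : subring_set (fps K n).
Local Notation O := (subring_of S).
Hypothesis S_const : forall a, @fps_const K n a \in subring_pred S.
Hypothesis S_X : forall i, fps_X K i \in subring_pred S.
Hypothesis S_d : forall i c, c \in subring_pred S -> fps_d i c \in subring_pred S.
Hypothesis S_root : forall m c, c \in subring_pred S -> @root_component K r q k m c \in subring_pred S.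

Lemma taylor_X kap i : taylor_hom (sub_dsystem S_d) kap K0 (sub_X S_X i) =
  @fps_const K n (kap (sub_X S_X i)) + fps_X K i.
Proof.
apply: (fps_eq_d K0) => [|j]; first by rewrite [LHS]taylor0 fpsDE fps_X_coef0 addr0 /fps_const eqxx.
rewrite fps_dD fps_d_const add0r fps_d_X; rewrite [LHS](taylor_d (sub_dsystem S_d) kap K0).
have -> : sub_d S_d j (sub_X S_X i) = (j == i)%:R.
  by apply: val_inj; rewrite /= fps_d_X; case: (j == i).
exact: (rmorph_nat (taylor_hom (sub_dsystem S_d) kap K0)).
Qed.

Lemma root_component0_X i : @root_component K r q k 0 (fps_X K i) =
  if (r + q <= i)%N then 0 else if (i < r)%N then fps_X K i ^+ puiseux_index k else fps_X K i.
Proof.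
have rt0 := @root_chart_coef0 K r q k _ (puiseux_index_gt0 k).
rewrite /root_component [X in xhom _ X](fps_substX rt0) /root_chart.
case: (boolP (r + q <= i)%N) => hi.
  have ir : (i < r)%N = false by apply/negbTE; rewrite -leqNgt; exact: leq_trans (leq_addr _ _) hi.
  rewrite ir; apply/funext => d; rewrite /xhom /fps_X; case: (eqVneq d (mnm1 i)) => [->|_]; last by rewrite if_same.
  rewrite (_ : xdeg _ _ = 1%N) // /xdeg (bigD1 i) //= mnm1E eqxx big1 // => l /andP[_ li].
  by rewrite mnm1E eq_sym (negbTE li).
have fr : xfree (fun i : 'I_n => (r + q <= i)%N) (fps_X K i) by exact: xfree_X.
by case: ifP => _; [have -> := xfreeX (puiseux_index k) fr|rewrite fr].
Qed.

Lemma below_X kap i : below S_root kap (sub_X S_X i) =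
  if (r + q <= i)%N then 0
  else if (i < r)%N then kap (sub_X S_X i) ^+ puiseux_index k else kap (sub_X S_X i).
Proof.
rewrite /below /= /ser0; pose iota : {rmorphism O -> fps K n} := (val : O -> fps K n).
have -> : sub_lift S_root (sub_X S_X i) 0%N = if (r + q <= i)%N then 0
    else if (i < r)%N then sub_X S_X i ^+ puiseux_index k else sub_X S_X i.
  by apply: val_inj; rewrite /= root_component0_X; case: ifP => // _; case: ifP => // _; rewrite -[RHS]/(iota _) (rmorphXn iota).
by case: ifP => _; rewrite ?rmorph0 //; case: ifP => _; rewrite ?rmorphXn.
Qed.

Lemma below_const (kap : {rmorphism O -> K}) a : kap (sub_cst S_const a) = a -> below S_root kap (sub_cst S_const a) = a.
Proof.
move=> ha; rewrite -[RHS]ha /below /= /ser0; congr (kap _); apply: val_inj => /=.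
rewrite /root_component [X in xhom _ X](fps_substC (@root_chart_coef0 K r q k _ (puiseux_index_gt0 k))).
apply/funext => d; rewrite /xhom /fps_const; case: (eqVneq d mnm0) => [->|_]; last by rewrite if_same.
by rewrite xdeg0.
Qed.

End ClosedSubringPoints.

Lemma root_componentM (K : closedFieldType) r q k m (f g : fps K (r + q + k.-1)) :
  @root_component K r q k m (f * g) = \sum_(i < m.+1) @root_component K r q k i f * @root_component K r q k (m - i) g.
Proof.
rewrite /root_component (rmorphM (@root_hom K r q k _ (puiseux_index_gt0 k))); set X := fun i : 'I__ => _.
by rewrite (rmorphM (xhom X)) serME.
Qed.

Section EtaleInstance.
Variables (K : closedFieldType) (r q k : nat).
Hypotheses (K0 : char0 K) (Kunc : ~ countable [set: K]%classic).
Local Notation n := (r + q + k.-1)%N.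
Variables (U : etale_nbhd K n) (a : 'I_k -> mpoly (n + etale_dim U) K).
Let N := (n + etale_dim U)%N.
Variable tau : 'I_N -> fps K n.
Hypothesis tauX : forall i : 'I_n, tau (lshift _ i) = fps_X K i.
Hypothesis tau_eq : forall l, mmap (@fps_const K n) tau (etale_eqs U l) = 0.

Let op (o : 'I_n + nat) (f : fps K n) : fps K n :=
  match o with inl i => fps_d i f | inr m => @root_component K r q k m f end.
(** One generator for each word of operations applied to a coordinate function: this closes the
    algebra under derivatives and homogeneous parts while keeping the generators countable. *)
Let gen (g : 'I_N * seq ('I_n + nat)) : fps K n := foldr op (tau g.1) g.2.
Let S := SubringSet (gen_span_subring gen).
Local Notation O := (subring_of S).

Let S_const c : @fps_const K n c \in subring_pred S. Proof. exact: gen_span_const. Qed.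
Let S_tau i : tau i \in subring_pred S. Proof. exact: (gen_span_gen gen (i, [::])). Qed.
Let S_X i : fps_X K i \in subring_pred S. Proof. by rewrite -tauX; exact: S_tau. Qed.
Let S0 : (0 : fps K n) \in subring_pred S.
Proof. by rewrite -(rmorph0 (@fps_const K n)); exact: S_const. Qed.
Let S_op o f : f \in subring_pred S -> op o f \in subring_pred S.
Proof.
move=> Sf; move: f Sf o; apply: (gen_span_ind (Q := fun f => forall o, op o f \in subring_pred S)).
- move=> c [i|m] /=; first by rewrite fps_d_const; exact: S0.
  rewrite /root_component [X in xhom _ X](fps_substC (@root_chart_coef0 K r q k _ (puiseux_index_gt0 k))).
  have [->|m0] := eqVneq m 0%N.
    rewrite (_ : xhom _ _ _ = fps_const c) //; apply/funext => d; rewrite /xhom /fps_const.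
    by case: (eqVneq d mnm0) => [->|_]; rewrite ?xdeg0 // if_same.
  rewrite (_ : xhom _ _ _ = 0); first exact: S0.
   apply/funext => d; rewrite /xhom /fps_const.
  by case: (eqVneq d mnm0) => [->|_]; rewrite ?if_same // xdeg0 eq_sym (negbTE m0).
- by move=> [i w] o; exact: (gen_span_gen gen (i, o :: w)).
- move=> f g Hf Hg [i|m] /=; first by rewrite fps_dD; apply: gen_spanD; [exact: (Hf (inl i))|exact: (Hg (inl i))].
  rewrite /root_component (rmorphD (@root_hom K r q k _ (puiseux_index_gt0 k))) rmorphD.
  by apply: gen_spanD; [exact: (Hf (inr m))|exact: (Hg (inr m))].
- move=> f g Sf Sg Hf Hg [i|m] /=.
    by rewrite fps_dM; apply: gen_spanD; apply: gen_spanM => //; [exact: (Hf (inl i))|exact: (Hg (inl i))].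
  rewrite root_componentM; apply: gen_span_sum => i.
  by apply: gen_spanM; [exact: (Hf (inr (i : nat)))|exact: (Hg (inr (m - i)%N))].
Qed.
Let S_d i f : f \in subring_pred S -> fps_d i f \in subring_pred S. Proof. exact: (S_op (inl i)). Qed.
Let S_root m f : f \in subring_pred S -> @root_component K r q k m f \in subring_pred S.
Proof. exact: (S_op (inr m)). Qed.

Let cst := sub_cst S_const.
Let tauO i : O := exist _ (tau i) (S_tau i).
Let e j : O := exist _ (gen_enum gen j) (gen_enum_span gen j).
Let iota : {rmorphism O -> fps K n} := (val : O -> fps K n).
Let hd := sub_dsystem S_d.

Let span x : exists M (c : 'I_M -> K), x = \sum_j cst (c j) * e j.
Proof.
have [M [c h]] := gen_span_enum (valP x); exists M, c; apply: val_inj; rewrite [LHS]h.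
rewrite [RHS](rmorph_sum iota); apply: eq_bigr => j _; exact/esym/(rmorphM iota).
Qed.

Let val_mmap P : iota (mmap cst tauO P) = mmap (@fps_const K n) tau P.
Proof. exact: (rmorph_mmap iota). Qed.

Lemma etale_splits :
  (forall v : 'rV[K]_N, etale_point v -> x_part (lsubmx v) = 0 ->
    \prod_j w_part (lsubmx v) 0 j != 0 ->
    exists2 F, expands_to (etale_expansion v) a F & splits_formally F) ->
  splits_after_blowups (monic_of (fun i => mmap (@fps_const K n) tau (a i))).
Proof.
move=> split_at; pose w := sub_w S_X.
have w0 : iota w != 0.
  by rewrite sub_wE prodf_seq_neq0; apply/allP => l _; rewrite fps_X_neq0 implybT.
have dense := @algebraic_points_dense K n O Kunc iota w cst e val_inj span w0.
have divide : points_divide hd K0 iota w (algebraic_point cst).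
  exact: (@algebraic_points_divide K n O _ hd K0 iota w cst e Kunc val_inj).
have -> : (fun i => mmap (@fps_const K n) tau (a i)) = val \o (fun i => mmap cst tauO (a i)).
  by apply/funext => i; exact/esym/val_mmap.
apply: (splits_of_closed_subring S_const (S_root := S_root) dense divide) => kap pk kw.
set kap' := below S_root kap; pose th := taylor_hom hd kap' K0.
have pk' : algebraic_point cst kap' by move=> c; apply: below_const; exact: pk.
(* The values of all coordinate functions give the K-point of the étale neighbourhood at which the
   hypothesis is used. *)
pose v : 'rV[K]_N := \row_i kap' (tauO i).
have vE P : kap' (mmap cst tauO P) = meval (v 0) P.
  rewrite rmorph_mmap /meval; apply: eq_bigr => m _; congr (_ * _); first exact: pk'.
  by apply: eq_bigr => i _; rewrite /= mxE.
have mO0 l : mmap cst tauO (etale_eqs U l) = 0.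
  by apply: val_inj; rewrite [LHS]val_mmap tau_eq.
have pv : etale_point v by move=> l; rewrite -vE mO0 rmorph0.
have tauOX i : tauO (lshift _ i) = sub_X S_X i by apply: val_inj; exact: tauX.
have vX i : v 0 (lshift _ i) = kap' (sub_X S_X i) by rewrite mxE tauOX.
have xv : x_part (lsubmx v) = 0.
  apply/rowP => i; rewrite /x_part [LHS]mxE [LHS]mxE vX [LHS]below_X leq_addr.
  by rewrite mxE.
have wv : \prod_j w_part (lsubmx v) 0 j != 0.
  rewrite prodf_seq_neq0; apply/allP => j _; apply/implyP => _.
  rewrite /w_part [X in X != 0]mxE [X in X != 0]mxE [X in X != 0]mxE vX; set l := lshift _ (lshift _ j).
  have lr : (l < r)%N by exact: ltn_ord j.
  rewrite [kap' _]below_X lr ifF; last by apply/negbTE; rewrite -ltnNge (leq_trans lr) ?leq_addr.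
  rewrite expf_neq0 //; apply: contraNneq kw => kl.
  by rewrite /sub_w (rmorph_prod kap) (bigD1 l) //= kl mul0r.
have [F [c cE ->] spl] := split_at v pv xv wv.
suff -> : th \o (fun i => mmap cst tauO (a i)) = c by [].
apply/funext => i; have [t [tX t0 t_eq ->]] := cE i; rewrite [LHS]rmorph_mmap.
have thc : th \o cst = @fps_const K n.
  by apply/funext => b; apply: (taylor_cst hd K0 (iota := iota)) => //; exact: val_inj.
(* Both families solve the étale equations at [v] with the same first n components. *)
have tht : th \o tauO = t.
  apply: (etale_unique (U := U) pv).
  - by move=> j; rewrite /= taylor0 mxE.
  - move=> j; case: (split_ordP j) => j' ->; last exact: t0.
    by rewrite tX fpsDE fps_X_coef0 addr0 /fps_const eqxx.
  - by move=> j; rewrite tX vX -[LHS]/(th (tauO _)) tauOX; exact: taylor_X.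
  - by move=> l; rewrite -thc -rmorph_mmap mO0 rmorph0.
  - exact: t_eq.
by rewrite thc tht.
Qed.

End EtaleInstance.

Theorem etale_theorem (K : closedFieldType) (r q k : nat) (K0 : char0 K)
    (Kunc : ~ countable [set: K]%classic) (U : etale_nbhd K (r + q + k.-1))
    (a : 'I_k -> mpoly (r + q + k.-1 + etale_dim U) K) (F : {poly fps K (r + q + k.-1)}) :
  expands_to (etale_expansion (etale_origin U)) a F ->
  (forall v : 'rV[K]_(r + q + k.-1 + etale_dim U),
        etale_point v -> x_part (lsubmx v) = 0 ->
        \prod_j w_part (lsubmx v) 0 j != 0 ->
        exists2 F, expands_to (etale_expansion v) a F & splits_formally F) ->
  (0 < k)%N -> splits_after_blowups F.
Proof.
move=> [c cE ->] {F} split_at; case: k U a c cE split_at => [//|k'] U a c cE split_at _.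
have v0 i : etale_origin U 0 (lshift _ i) = 0.
  by have := congr1 (fun A : 'rV_ _ => A 0 i) (etale_origin0 U); rewrite !mxE.
(* The expansion of each coefficient comes with its own solution [tau]; one index is needed to fix a
   solution, and [etale_unique] identifies it with the others. *)
have [t [tX t0 t_eq _]] := cE ord0.
have tX' i : t (lshift _ i) = fps_X K i by rewrite tX v0 (rmorph0 (@fps_const K _)) add0r.
have [] : c = fun i => mmap (@fps_const K _) t (a i).
  apply/funext => i; have [s [sX s0 s_eq ->]] := cE i; congr (mmap _ _ (a i)).
  have pv : etale_point (etale_origin U) by exact: etale_originP.
  apply: (etale_unique pv) => //.
  - by move=> j; case: (split_ordP j) => j' ->; rewrite ?s0 // sX fpsDE fps_X_coef0 addr0 /fps_const eqxx.
  - by move=> j; case: (split_ordP j) => j' ->; rewrite ?t0 // tX fpsDE fps_X_coef0 addr0 /fps_const eqxx.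
  - by move=> j; rewrite sX tX.
by move=> ->; exact: (etale_splits K0 Kunc tX' t_eq split_at).
Qed.

(** * Convergent power series *)

Import numFieldNormedType.Exports.

Section ComplexModulus.
Variable R : realType.
Local Notation C := (R[i]).
Implicit Types z : C.

(** The norm of [R[i]] has values in [R[i]]; estimates are carried out in the ordered field [R]. *)
Definition modulus z : R := complex.Re `|z|.

Lemma modulusE z : `|z| = (modulus z)%:C%C.
Proof. by rewrite /modulus normc_def. Qed.

Lemma modulus_ge0 z : 0 <= modulus z.
Proof. by rewrite -ler0c -modulusE normr_ge0. Qed.

Lemma modulusM z z' : modulus (z * z') = modulus z * modulus z'.
Proof.
by have := normrM z z'; rewrite !modulusE -(rmorphM (real_complex R)) => /(congr1 (@complex.Re R)).
Qed.

Lemma modulusD z z' : modulus (z + z') <= modulus z + modulus z'.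
Proof. by rewrite -lecR rmorphD /= -!modulusE ler_normD. Qed.

Lemma modulus0 : modulus 0 = 0. Proof. by rewrite /modulus normr0. Qed.
Lemma modulus1 : modulus 1 = 1. Proof. by rewrite /modulus normr1. Qed.
Lemma modulusN z : modulus (- z) = modulus z. Proof. by rewrite /modulus normrN. Qed.

Lemma modulusX z n : modulus (z ^+ n) = modulus z ^+ n.
Proof. by elim: n => [|n IH]; rewrite ?expr0 ?modulus1 // !exprS modulusM IH. Qed.

Lemma modulus_eq0 z : (modulus z == 0) = (z == 0).
Proof.
apply/eqP/eqP => [h|->]; last exact: modulus0.
by apply/eqP; rewrite -normr_eq0 modulusE h.
Qed.

Lemma modulus_sum I (s : seq I) (P : pred I) (F : I -> C) :
  modulus (\sum_(i <- s | P i) F i) <= \sum_(i <- s | P i) modulus (F i).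
Proof.
elim/big_rec2: _ => [|i x y _ h]; first by rewrite modulus0.
exact: le_trans (modulusD _ _) (lerD _ _).
Qed.

Lemma modulus_real (x : R) : 0 <= x -> modulus (x%:C%C) = x.
Proof. by move=> x0; rewrite /modulus ger0_norm ?ler0c. Qed.

Lemma modulus_nat n : modulus n%:R = n%:R.
Proof. by rewrite -(modulus_real (ler0n R n)) rmorph_nat. Qed.

Lemma Re_le_modulus z : `|complex.Re z| <= modulus z.
Proof. by rewrite -lecR -modulusE normc_ge_Re. Qed.

Lemma Im_le_modulus z : `|complex.Im z| <= modulus z.
Proof.
rewrite /modulus normc_def /= -sqrtr_sqr ler_sqrt ?addr_ge0 ?sqr_ge0 //.
by rewrite lerDr sqr_ge0.
Qed.

Lemma modulus_le z : modulus z <= `|complex.Re z| + `|complex.Im z|.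
Proof.
rewrite /modulus normc_def /= -(ger0_norm (addr_ge0 (normr_ge0 _) (normr_ge0 _))) -sqrtr_sqr.
rewrite ler_sqrt ?sqr_ge0 // sqrrD !real_normK ?num_real //.
by rewrite -subr_ge0 (_ : _ - _ = `|complex.Re z| * `|complex.Im z| *+ 2) ?mulrn_wge0 ?mulr_ge0 //; ring.
Qed.

Definition sums (G : nat -> C) z : Prop := forall e : R, 0 < e ->
  exists N0, forall N, (N0 <= N)%N -> modulus (\sum_(i < N) G i - z) < e.

Definition abs_bounded (G : nat -> C) (M : R) : Prop :=
  forall N, \sum_(i < N) modulus (G i) <= M.

Lemma le_of_lt_eps (x y : R) : (forall e, 0 < e -> x < y + e) -> x <= y.
Proof.
move=> h; rewrite leNgt; apply/negP => yx; have := h (x - y); rewrite subr_gt0 => /(_ yx).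
by rewrite addrC subrK ltxx.
Qed.

Lemma modulus_eps z : (forall e, 0 < e -> modulus z < e) -> z = 0.
Proof.
move=> h; apply/eqP; rewrite -modulus_eq0 eq_le modulus_ge0 andbT.
by apply: le_of_lt_eps => e /h; rewrite add0r.
Qed.

Lemma sums_uniq G z z' : sums G z -> sums G z' -> z = z'.
Proof.
move=> hz hz'; apply/eqP; rewrite -subr_eq0; apply/eqP/modulus_eps => e e0.
have e2 : 0 < e / 2 by rewrite divr_gt0.
have [N h] := hz _ e2; have [N' h'] := hz' _ e2; set L := maxn N N'.
rewrite (_ : z - z' = - (\sum_(i < L) G i - z) + (\sum_(i < L) G i - z')); last by ring.
rewrite (le_lt_trans (modulusD _ _)) // modulusN [e]splitr ltrD //.
  by apply: h; rewrite leq_maxl.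
by apply: h'; rewrite leq_maxr.
Qed.

Lemma sumsD G H z z' : sums G z -> sums H z' -> sums (fun i => G i + H i) (z + z').
Proof.
move=> hz hz' e e0; have e2 : 0 < e / 2 by rewrite divr_gt0.
have [N h] := hz _ e2; have [N' h'] := hz' _ e2; exists (maxn N N') => L; rewrite geq_max => /andP[NL NL'].
rewrite big_split /= opprD addrACA (le_lt_trans (modulusD _ _)) // [e]splitr ltrD //.
  exact: h.
exact: h'.
Qed.

Lemma sumsN G z : sums G z -> sums (fun i => - G i) (- z).
Proof.
move=> hz e /hz[N h]; exists N => L /h; rewrite -modulusN opprB.
by rewrite (_ : _ - - z = z - \sum_(i < L) G i) // sumrN; ring.
Qed.

Lemma sums_le G z M : sums G z -> (forall N, modulus (\sum_(i < N) G i) <= M) -> modulus z <= M.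
Proof.
move=> hz hM; apply: le_of_lt_eps => e /hz[N /(_ N (leqnn _)) h].
rewrite (_ : z = \sum_(i < N) G i - (\sum_(i < N) G i - z)); last by ring.
by rewrite (le_lt_trans (modulusD _ _)) // modulusN ler_ltD.
Qed.

(** The real and imaginary parts form absolutely convergent series, to which completeness of [R]
    applies. *)
Lemma abs_sums G M : abs_bounded G M -> exists z, sums G z.
Proof.
move=> hM.
have cv (u : nat -> R) : (forall i, `|u i| <= modulus (G i)) ->
    exists l, forall e, 0 < e -> exists N0, forall N, (N0 <= N)%N -> `|\sum_(i < N) u i - l| < e.
  move=> hu; have cu : cvgn (series u).
    apply: normed_cvg; apply: nondecreasing_is_cvgn.
      by apply: nondecreasing_series => i _ _; exact: normr_ge0.
    exists M => _ [N _ <-]; apply: le_trans (hM N); rewrite -[leLHS]/(\sum_(0 <= i < N) `|u i|) big_mkord.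
    by apply: ler_sum => i _; exact: hu.
  exists (limn (series u)) => e e0.
  have [N0 _ h] := (cvgrPdist_lt _ _).1 cu e e0; exists N0 => N NN; have := h N NN.
  by rewrite -[series u N]/(\sum_(0 <= i < N) u i) big_mkord distrC.
have [a ha] := cv (fun i => complex.Re (G i)) (fun i => Re_le_modulus _).
have [b hb] := cv (fun i => complex.Im (G i)) (fun i => Im_le_modulus _).
exists (a +i* b)%C => e e0; have e2 : 0 < e / 2 by rewrite divr_gt0.
have [N h] := ha _ e2; have [N' h'] := hb _ e2; exists (maxn N N') => L; rewrite geq_max => /andP[NL NL'].
have RS (s : nat) : complex.Re (\sum_(i < s) G i) = \sum_(i < s) complex.Re (G i).
  by apply: (big_morph (@complex.Re R)) => [[? ?] [? ?]|].
have IS (s : nat) : complex.Im (\sum_(i < s) G i) = \sum_(i < s) complex.Im (G i).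
  by apply: (big_morph (@complex.Im R)) => [[? ?] [? ?]|].
rewrite (le_lt_trans (modulus_le _)) //.
have -> : complex.Re (\sum_(i < L) G i - (a +i* b)%C) = \sum_(i < L) complex.Re (G i) - a.
  by rewrite -RS; case: (\sum_(i < L) G i).
have -> : complex.Im (\sum_(i < L) G i - (a +i* b)%C) = \sum_(i < L) complex.Im (G i) - b.
  by rewrite -IS; case: (\sum_(i < L) G i).
by rewrite [e]splitr ltrD ?h ?h'.
Qed.

Lemma abs_tail G M : abs_bounded G M -> forall e, 0 < e ->
  exists N0, forall N, \sum_(i < N | (N0 <= i)%N) modulus (G i) < e.
Proof.
move=> hM e e0; pose A N := \sum_(i < N) modulus (G i).
have hs : has_sup (range A).
  by split; [exists (A 0%N), 0%N|exists M => _ [N _ <-]; exact: hM].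
have [_ [N0 _ <-] h] := sup_adherent e0 hs; exists N0 => N.
have [NN|NN] := leqP N0 N; last first.
  by rewrite big_pred0 // => i; apply/negbTE; rewrite -ltnNge (ltn_trans (ltn_ord i)).
have := sup_upper_bound hs (x := A N) (ex_intro2 _ _ N I erefl) => /= hN.
have AN : A N = A N0 + \sum_(i < N | (N0 <= i)%N) modulus (G i).
  rewrite /A (bigID (fun i : 'I_N => (i < N0)%N)) /= (big_ord_widen_cond N predT (fun i => modulus (G i)) NN) /=.
  by congr (_ + _); apply: eq_bigl => i; rewrite -leqNgt.
by rewrite -(ltrD2l (A N0)) -AN (le_lt_trans hN) // -ltrBlDr.
Qed.

(** The partial sum of the Cauchy product is the product of the partial sums minus the terms with i
    + j >= N. For N >= N3 + N4 such a term has i >= N3 or j >= N4 and lies in one of the tails. *)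
Lemma sumsM G H a b M M' : abs_bounded G M -> abs_bounded H M' -> sums G a -> sums H b ->
  sums ((G : ser C) * (H : ser C)) (a * b).
Proof.
move=> GM HM Ga Hb.
have M0 : 0 <= M by have := GM 0%N; rewrite big_ord0.
have M0' : 0 <= M' by have := HM 0%N; rewrite big_ord0.
have diff N : (\sum_(i < N) ((G : ser C) * (H : ser C)) i) =
    (\sum_(i < N) G i) * (\sum_(j < N) H j) - \sum_(i < N) \sum_(j < N | (N <= i + j)%N) G i * H j.
  rewrite mulr_suml -sumrB; under [LHS]eq_bigr => i _ do rewrite serME.
  rewrite (eq_bigr (fun i : 'I_N => \sum_(j < N) if (j <= i)%N then G j * H (i - j)%N else 0)); last first.
    move=> i _; rewrite (big_ord_widen_cond N predT (fun j => G j * H (i - j)%N)) /=; last exact: ltn_ord.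
    by rewrite big_mkcond.
  rewrite exchange_big; apply: eq_bigr => i _; rewrite mulr_sumr.
  rewrite [in RHS](bigID (fun j : 'I_N => (N <= i + j)%N)) /= addrC addrK.
  rewrite -big_mkcond /=.
  rewrite -(big_mkord (fun l => (i <= l)%N) (fun l => G i * H (l - i)%N)).
  rewrite -(big_mkord (fun j => ~~ (N <= i + j)%N) (fun j => G i * H j)).
  rewrite (big_cat_nat (n := i)) //=; last exact: ltnW.
  rewrite big_nat_cond big1 ?add0r; last by move=> l /andP[/andP[_ h1] h2]; rewrite leqNgt h1 in h2.
  rewrite -{1}[i : nat]add0n big_addn.
  rewrite [in RHS](big_cat_nat (n := (N - i)%N)) //=; last exact: leq_subr.
  rewrite [X in _ + X]big_nat_cond [X in _ + X]big1 ?addr0; last first.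
    by move=> l /andP[/andP[h1 _]]; rewrite leq_subLR in h1; rewrite h1.
  rewrite big_nat_cond [RHS]big_nat_cond; apply: eq_big => [l|l _]; last by rewrite addnK.
  by apply/idP/idP; have := ltn_ord i; lia.
move=> e e0; set D := M + M' + modulus a + modulus b + 1.
have D1 : 1 <= D by rewrite /D; have := modulus_ge0 a; have := modulus_ge0 b; lra.
have D0 : 0 < D by lra.
(* The errors add up to at most e'(2M + M' + |b|), which is smaller than 4 e' D = e. *)
pose e' := e / (4 * D); have e'0 : 0 < e' by rewrite divr_gt0 ?mulr_gt0.
have e'D : e' * D * 4 = e by rewrite /e'; field; lra.
have [N1 h1] := Ga _ e'0; have [N2 h2] := Hb _ e'0.
have [N3 h3] := abs_tail GM e'0; have [N4 h4] := abs_tail HM e'0.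
exists (maxn (maxn N1 N2) (N3 + N4)) => N; rewrite !geq_max -andbA => /and3P[n1 n2 n34].
set SG := \sum_(i < N) G i in h1 h2 *; set SH := \sum_(i < N) H i in h2 *.
have {}h1 := h1 N n1; have {}h2 := h2 N n2; rewrite -/SG -/SH in h1 h2.
have SGM : modulus SG <= M by rewrite (le_trans (modulus_sum _ _ _)) // GM.
set T := \sum_(i < N) \sum_(j < N | (N <= i + j)%N) G i * H j.
have TE : modulus T <= e' * M' + M * e'.
  have -> : T = \sum_(i < N | (N3 <= i)%N) \sum_(j < N | (N <= i + j)%N) G i * H j
       + \sum_(i < N | ~~ (N3 <= i)%N) \sum_(j < N | (N <= i + j)%N) G i * H j by rewrite /T (bigID (fun i : 'I_N => (N3 <= i)%N)).
  rewrite (le_trans (modulusD _ _)) // lerD //.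
    rewrite (le_trans (modulus_sum _ _ _)) // (@le_trans _ _ (\sum_(i < N | (N3 <= i)%N) modulus (G i) * M')) //.
      apply: ler_sum => i _; rewrite (le_trans (modulus_sum _ _ _)) //.
      rewrite (eq_bigr (fun j : 'I_N => modulus (G i) * modulus (H j))) => [|j _]; last exact: modulusM.
      rewrite -mulr_sumr ler_wpM2l ?modulus_ge0 // (le_trans _ (HM N)) //.
      by rewrite big_mkcond ler_sum // => j _; case: ifP => // _; exact: modulus_ge0.
    by rewrite -mulr_suml ler_wpM2r // ltW.
  rewrite (le_trans (modulus_sum _ _ _)) // (@le_trans _ _ (\sum_(i < N) modulus (G i) * e')) //.
    rewrite [leLHS]big_mkcond; apply: ler_sum => i _; case: ifP => i3; last by rewrite mulr_ge0 ?modulus_ge0 ?ltW.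
    rewrite (le_trans (modulus_sum _ _ _)) //.
    rewrite (eq_bigr (fun j : 'I_N => modulus (G i) * modulus (H j))) => [|j _]; last exact: modulusM.
    rewrite -mulr_sumr ler_wpM2l ?modulus_ge0 // ltW // (le_lt_trans _ (h4 N)) //.
    rewrite big_mkcond [leRHS]big_mkcond ler_sum // => j _.
    case: ifP => ij; case: ifP => j4 //; try exact: modulus_ge0.
    by move: i3 j4 ij n34; lia.
  by rewrite -mulr_suml ler_wpM2r // ltW.
rewrite diff -/SG -/SH -/T.
rewrite (_ : _ - a * b = SG * (SH - b) + ((SG - a) * b + - T)); last by ring.
rewrite (le_lt_trans (modulusD _ _)) // modulusM.
have := modulusD ((SG - a) * b) (- T); rewrite modulusM modulusN => hT.
have := modulus_ge0 b; have := modulus_ge0 a; have := modulus_ge0 SG.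
have := modulus_ge0 (SG - a); have := modulus_ge0 (SH - b).
move=> y0 x0 s0 a0 b0.
have p1 : modulus SG * modulus (SH - b) <= M * e' by apply: ler_pM => //; exact: ltW.
have p2 : modulus (SG - a) * modulus b <= e' * modulus b by apply: ler_wpM2r => //; exact: ltW.
have p3 : e' * D = e' * M + e' * M' + e' * modulus a + e' * modulus b + e' by rewrite /D; ring.
have p4 : 0 <= e' * M by rewrite mulr_ge0 // ltW.
have p5 : 0 <= e' * M' by rewrite mulr_ge0 // ltW.
have p6 : 0 <= e' * modulus a by rewrite mulr_ge0 // ltW.
have p7 : 0 <= e' * modulus b by rewrite mulr_ge0 // ltW.
have p8 : M * e' = e' * M by rewrite mulrC.
clearbody SG SH T e'; clear D1 D0; move: p3 e'D; move: (e' * D) => eD p3 e'D.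
lra.
Qed.

End ComplexModulus.

Section UniqSums.
Variables (R : numDomainType) (T : eqType).
Implicit Types (s t : seq T) (F : T -> R).

Lemma sum_uniq_le s t F : uniq s -> {subset s <= t} -> (forall x, 0 <= F x) ->
  \sum_(x <- s) F x <= \sum_(x <- t) F x.
Proof.
elim: s t => [|x s IH] t /=; first by move=> _ _ F0; rewrite big_nil sumr_ge0.
case/andP=> xs us st F0; have xt : x \in t by apply: st; rewrite mem_head.
rewrite big_cons (perm_big _ (perm_to_rem xt)) big_cons lerD2l; apply: IH => // y ys.
have := st y; rewrite inE ys orbT => /(_ isT); rewrite (perm_mem (perm_to_rem xt)) inE.
by case: eqP => // e; rewrite -e ys in xs.
Qed.

Lemma sum_disjoint_le (U : eqType) (s : seq U) (t : seq T) (g : T -> U) F :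
  uniq s -> (forall x, 0 <= F x) ->
  \sum_(u <- s) \sum_(x <- t | u == g x) F x <= \sum_(x <- t) F x.
Proof.
move=> us F0; under eq_bigr => u _ do rewrite big_mkcond; rewrite exchange_big /=.
apply: ler_sum => x _; rewrite -big_mkcond /= big_const_seq iter_addr_0.
rewrite (@eq_count _ _ (pred1 (g x))) // (count_uniq_mem _ us).
by case: (g x \in s); rewrite ?mulr1n ?mulr0n.
Qed.

End UniqSums.

Definition bounded_multinoms n b : seq (multinom n) := [seq val m | m <- index_enum (bmultinom n b)].

Lemma mem_bounded_multinoms n b (m : multinom n) : (m \in bounded_multinoms n b) = (mdeg m < b)%N.
Proof.
apply/mapP/idP => [[x _ ->]|h]; first exact: bmdeg.
by exists (BMultinom h) => //; exact: mem_index_enum.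
Qed.

Lemma bounded_multinoms_uniq n b : uniq (bounded_multinoms n b).
Proof. by rewrite map_inj_uniq ?index_enum_uniq //; exact: val_inj. Qed.

Lemma sub_bounded_multinoms n (s : seq (multinom n)) :
  {subset s <= bounded_multinoms n (\max_(m <- s) mdeg m).+1}.
Proof. by move=> m ms; rewrite mem_bounded_multinoms ltnS; exact: leq_bigmax_seq. Qed.

(** * Weighted norms and majorants *)

Section Norms.
Variables (R : realType) (n : nat).
Local Notation C := (R[i]).
Implicit Types (f g : fps C n) (rho : 'I_n -> R) (v : 'I_n -> C) (m : multinom n).

Definition monval (S : comNzRingType) (v : 'I_n -> S) m : S := \prod_i v i ^+ m i.

Lemma monvalD (S : comNzRingType) (v : 'I_n -> S) m m' :
  monval v (mnm_add m m') = monval v m * monval v m'.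
Proof. by rewrite /monval -big_split; apply: eq_bigr => i _; rewrite mnmDE exprD. Qed.

Lemma monval0 (S : comNzRingType) (v : 'I_n -> S) : monval v mnm0 = 1.
Proof. by rewrite /monval big1 // => i _; rewrite mnm0E expr0. Qed.

Lemma monval1 (S : comNzRingType) (v : 'I_n -> S) i : monval v (mnm1 i) = v i.
Proof.
rewrite /monval (bigD1 i) //= mnm1E eqxx expr1 big1 ?mulr1 // => l li.
by rewrite mnm1E eq_sym (negbTE li) expr0.
Qed.

Lemma monval_ge0 rho m : (forall i, 0 <= rho i) -> 0 <= monval rho m.
Proof. by move=> h; apply: prodr_ge0 => i _; exact: exprn_ge0. Qed.

Lemma monval_le rho rho' m : (forall i, 0 <= rho i <= rho' i) -> monval rho m <= monval rho' m.
Proof.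
move=> h; apply: ler_prod => i _; have /andP[h0 h1] := h i.
by rewrite exprn_ge0 //= lerXn2r // nnegrE // (le_trans h0).
Qed.

Lemma modulus_monval v m : modulus (monval v m) = monval (fun i => modulus (v i)) m.
Proof.
rewrite /monval (big_morph (@modulus R) (@modulusM R) (modulus1 R)).
by apply: eq_bigr => i _; rewrite modulusX.
Qed.

(** A bound for the weighted sum of moduli of the coefficients, stated over finite families without
    repetition; this covers every order of summation at once. *)
Definition norm_le rho f (M : R) : Prop := forall s : seq (multinom n), uniq s ->
  \sum_(m <- s) modulus (f m) * monval rho m <= M.

Section NormRules.
Variable rho : 'I_n -> R.
Hypothesis rho0 : forall i, 0 <= rho i.

Let term_ge0 f m : 0 <= modulus (f m) * monval rho m.
Proof. by rewrite mulr_ge0 ?modulus_ge0 ?monval_ge0. Qed.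

Lemma norm_le_ge0 f M : norm_le rho f M -> 0 <= M.
Proof. by move=> h; have := h [::] isT; rewrite big_nil. Qed.

Lemma norm_le_trans f M M' : M <= M' -> norm_le rho f M -> norm_le rho f M'.
Proof. by move=> MM h s us; exact: le_trans (h s us) MM. Qed.

Lemma norm_le_dom f g M : (forall m, modulus (f m) <= modulus (g m)) -> norm_le rho g M -> norm_le rho f M.
Proof.
move=> fg h s us; apply: le_trans (h s us); apply: ler_sum => m _.
by rewrite ler_wpM2r ?monval_ge0.
Qed.

Lemma norm_leD f g M M' : norm_le rho f M -> norm_le rho g M' -> norm_le rho (f + g) (M + M').
Proof.
move=> hf hg s us; apply: le_trans (lerD (hf s us) (hg s us)); rewrite -big_split /=.
by apply: ler_sum => m _; rewrite -mulrDl ler_wpM2r ?monval_ge0 ?modulusD.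
Qed.

Lemma norm_leN f M : norm_le rho f M -> norm_le rho (- f) M.
Proof. by apply: norm_le_dom => m; rewrite fpsNE modulusN. Qed.

Lemma norm_leB f g M M' : norm_le rho f M -> norm_le rho g M' -> norm_le rho (f - g) (M + M').
Proof. by move=> hf /norm_leN; exact: norm_leD. Qed.

Lemma norm_le_mono m0 (c : C) f : (forall m, f m = if m == m0 then c else 0) ->
  norm_le rho f (modulus c * monval rho m0).
Proof.
move=> fE s us; rewrite (eq_bigr (fun m => if m == m0 then modulus c * monval rho m0 else 0)); last first.
  by move=> m _; rewrite fE; case: eqP => [->|_] //; rewrite modulus0 mul0r.
rewrite -big_mkcond big_const_seq iter_addr_0.
rewrite (@eq_count _ _ (pred1 m0)) // (count_uniq_mem _ us).
by case: (m0 \in s); rewrite ?mulr1n ?mulr0n ?mulr_ge0 ?modulus_ge0 ?monval_ge0.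
Qed.

Lemma norm_le_const c : norm_le rho (@fps_const C n c) (modulus c).
Proof. by have := @norm_le_mono mnm0 c _ (fun=> erefl); rewrite monval0 mulr1. Qed.

Lemma norm_le_X i : norm_le rho (fps_X C i) (rho i).
Proof.
have := @norm_le_mono (mnm1 i) 1 (fps_X C i); rewrite monval1 modulus1 mul1r; apply => m.
by rewrite /fps_X; case: (m == mnm1 i).
Qed.

Lemma norm_leM f g M M' : norm_le rho f M -> norm_le rho g M' -> norm_le rho (f * g) (M * M').
Proof.
move=> hf hg s us; set B := bounded_multinoms n (\max_(m <- s) mdeg m).+1.
pose F m := modulus (f m) * monval rho m; pose G m := modulus (g m) * monval rho m.
have M0 := norm_le_ge0 hf.
pose t := [seq (a, b) | a <- B, b <- B].
apply: (@le_trans _ _ (\sum_(m <- s) \sum_(x <- t | m == mnm_add x.1 x.2) F x.1 * G x.2)); last first.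
  apply: le_trans (_ : \sum_(x <- t) F x.1 * G x.2 <= _).
    by apply: sum_disjoint_le => // x; rewrite mulr_ge0 ?term_ge0.
  rewrite /t big_allpairs_dep /=; under eq_bigr => a _ do rewrite -mulr_sumr.
  rewrite -mulr_suml; have uB := bounded_multinoms_uniq n (\max_(m <- s) mdeg m).+1.
  apply: le_trans (_ : M * \sum_(i <- B) G i <= _).
    by rewrite ler_wpM2r ?sumr_ge0 //; [move=> i _; exact: term_ge0|exact: hf].
  by rewrite ler_wpM2l //; exact: hg.
rewrite big_seq [leRHS]big_seq; apply: ler_sum => m ms; rewrite {1}/GRing.mul /= /fps_mul.
apply: le_trans (ler_wpM2r (monval_ge0 _ rho0) (modulus_sum _ _ _)) _; rewrite mulr_suml.
rewrite (eq_bigr (fun e : bmultinom n (mdeg m).+1 * bmultinom n (mdeg m).+1 =>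
    F (val e.1) * G (val e.2))); last first.
  move=> e /eqP me; rewrite modulusM /F /G mulrACA -monvalD; congr (_ * monval _ _).
  exact: me.
pose h (e : bmultinom n (mdeg m).+1 * bmultinom n (mdeg m).+1) := (val e.1, val e.2).
rewrite -big_filter -[leRHS]big_filter -(big_map h predT (fun x => F x.1 * G x.2)).
apply: sum_uniq_le => [||x]; last by rewrite mulr_ge0 ?term_ge0.
- rewrite map_inj_uniq ?filter_uniq ?index_enum_uniq //.
  by move=> [a b] [a' b'] [] /val_inj -> /val_inj ->.
- move=> x /mapP[e]; rewrite mem_filter => /andP[me _] ->; rewrite mem_filter me /=.
  apply/allpairsP; exists (h e); have lt (a : bmultinom n (mdeg m).+1) : val a \in B.
    rewrite mem_bounded_multinoms (leq_trans (bmdeg a)) // ltnS.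
    exact: (@leq_bigmax_seq _ _ _ (@mdeg n) m ms).
  by split; [exact: lt|exact: lt|].
Qed.

Lemma norm_le1 : norm_le rho 1 1.
Proof. by have := norm_le_const 1; rewrite modulus1 (rmorph1 (@fps_const C n)). Qed.

Lemma norm_leX f M e : norm_le rho f M -> norm_le rho (f ^+ e) (M ^+ e).
Proof. by move=> h; elim: e => [|e IH]; rewrite ?expr0 ?exprS; [exact: norm_le1|exact: norm_leM]. Qed.

End NormRules.
End Norms.

(** Submultiplicativity bounds the substituted monomial of exponent e by the weight of e at radii
    [rho]; the sum over e is then a bound for [f] at these radii. *)
Lemma norm_le_subst (R : realType) n n' (v : 'I_n -> fps R[i] n') (rho : 'I_n -> R)
    (sig : 'I_n' -> R) f M :
  (forall i, 0 <= sig i) -> (forall i, norm_le sig (v i) (rho i)) ->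
  norm_le rho f M -> norm_le sig (fps_subst v f) M.
Proof.
move=> s0 hv hf s us; have rho0 i : 0 <= rho i by exact: norm_le_ge0 (hv i).
set b := (\max_(m <- s) mdeg m).+1; pose B := bounded_multinoms n b.
have hmon e : norm_le sig (mmap1 v e : fps R[i] n') (monval rho e).
  rewrite /mmap1 /monval; apply: (big_rec2 (fun (x : fps R[i] n') y => norm_le sig x y)).
    exact: norm_le1.
  by move=> i x y _ h; apply: norm_leM => //; exact: norm_leX.
apply: (@le_trans _ _ (\sum_(m <- s) \sum_(e <- B) modulus (f e) * (modulus ((mmap1 v e : fps R[i] n') m) * monval sig m))).
  rewrite big_seq [leRHS]big_seq; apply: ler_sum => m ms; rewrite /fps_subst.
  apply: le_trans (ler_wpM2r (monval_ge0 _ s0) (modulus_sum _ _ _)) _; rewrite mulr_suml.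
  rewrite (eq_bigr (fun e : bmultinom n (mdeg m).+1 => (fun e : multinom n =>
    modulus (f e) * (modulus ((mmap1 v e : fps R[i] n') m) * monval sig m)) (val e))); last first.
    by move=> e _; rewrite modulusM mulrA.
  rewrite -(big_map val predT (fun e : multinom n => modulus (f e) * (modulus ((mmap1 v e : fps R[i] n') m) * monval sig m))).
  apply: sum_uniq_le => [||e]; last by rewrite !mulr_ge0 ?modulus_ge0 ?monval_ge0.
    exact: bounded_multinoms_uniq.
  move=> e; rewrite !mem_bounded_multinoms => /leq_trans; apply; rewrite ltnS.
  exact: (@leq_bigmax_seq _ _ _ (@mdeg n') m ms).
rewrite exchange_big /=; under eq_bigr => e _ do rewrite -mulr_sumr.
apply: le_trans (hf B (bounded_multinoms_uniq _ _)); apply: ler_sum => e _.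
by rewrite ler_wpM2l ?modulus_ge0 //; exact: hmon.
Qed.

Section Evaluation.
Variables (R : realType) (n : nat).
Local Notation C := (R[i]).
Implicit Types (f g : fps C n) (rho : 'I_n -> R) (v : 'I_n -> C) (m : multinom n).

(** Restriction to the complex line through [v] collects terms by degree and reduces evaluation at
    [v] to summing a series in one variable. *)
Definition line v i : fps C 1 := @fps_const C 1 (v i) * fps_X C ord0.

Lemma line0 v i : line v i mnm0 = 0.
Proof. by rewrite /line fps_coef0M fps_X_coef0 mulr0. Qed.

Definition line_hom v : {rmorphism fps C n -> ser C} :=
  ser_map (@fps_coef0 C 0) \o (peel ord0 \o fps_subst_hom (line0 v)).

Lemma line_mono v m : mmap1 (line v) m = @fps_const C 1 (monval v m) * fps_X C ord0 ^+ mdeg m.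
Proof.
rewrite /mmap1 /line /monval mdegE -prodrXr (rmorph_prod (@fps_const C 1)) -big_split /=.
by apply: eq_bigr => i _; rewrite exprMn (rmorphXn (@fps_const C 1)).
Qed.

Lemma line_homE v f d : line_hom v f d =
  \sum_(m <- bounded_multinoms n d.+1 | mdeg m == d) f m * monval v m.
Proof.
rewrite /bounded_multinoms big_map big_mkcond /=.
transitivity (fps_subst (line v) f (mins ord0 d mnm0)); first by [].
rewrite /fps_subst mdeg_mins mdeg0 addn0; apply: eq_bigr => m _.
have Xpow e : (fps_X C ord0 ^+ e : fps C 1) (mins ord0 d mnm0) = (d == e)%:R.
  have PX : peel ord0 (fps_X C ord0 : fps C 1) = serX _ by exact: peel_Xj.
  have PE : peel ord0 ((fps_X C ord0 : fps C 1) ^+ e) = serX _ ^+ e by rewrite -PX; exact: (rmorphXn (peel ord0)).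
  transitivity (peel ord0 ((fps_X C ord0 : fps C 1) ^+ e) d mnm0); first by [].
  rewrite PE serX_expE.
  by case: (d == e); rewrite ?fps0E ?mulr1n ?fps1E ?eqxx.
move: (val m) => {}m; rewrite line_mono fps_constM Xpow eq_sym.
by case: (mdeg m == d); rewrite ?mulr1 ?mulr0.
Qed.

Lemma sum_by_degree (S : zmodType) (F : multinom n -> S) N :
  \sum_(d < N) \sum_(m <- bounded_multinoms n d.+1 | mdeg m == d) F m =
  \sum_(m <- bounded_multinoms n N) F m.
Proof.
transitivity (\sum_(d < N) \sum_(m <- bounded_multinoms n N | mdeg m == d) F m).
  apply: eq_bigr => d _; rewrite -big_filter -[RHS]big_filter; apply/perm_big/uniq_perm.
  - by rewrite filter_uniq ?bounded_multinoms_uniq.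
  - by rewrite filter_uniq ?bounded_multinoms_uniq.
  - move=> m; rewrite !mem_filter !mem_bounded_multinoms; case: eqP => [->|//] /=.
    by rewrite ltnSn ltn_ord.
under eq_bigr => d _ do rewrite big_mkcond; rewrite exchange_big big_seq [RHS]big_seq.
apply: eq_bigr => m; rewrite mem_bounded_multinoms => mN.
rewrite (bigD1 (Ordinal mN)) //= eqxx big1 ?addr0 // => d dm.
by case: eqP => // e; case/eqP: dm; apply: val_inj.
Qed.

Lemma line_partial v f N : \sum_(d < N) line_hom v f d = \sum_(m <- bounded_multinoms n N) f m * monval v m.
Proof. by rewrite -sum_by_degree; apply: eq_bigr => d _; exact: line_homE. Qed.

Lemma line_bounded rho v f M : (forall i, modulus (v i) <= rho i) -> norm_le rho f M ->
  abs_bounded (line_hom v f) M.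
Proof.
move=> vr hf N; apply: le_trans (hf _ (bounded_multinoms_uniq n N)); rewrite -sum_by_degree.
apply: ler_sum => d _; rewrite line_homE (le_trans (modulus_sum _ _ _)) //.
apply: ler_sum => m _; rewrite modulusM ler_wpM2l ?modulus_ge0 // modulus_monval.
by apply: monval_le => i; rewrite modulus_ge0 vr.
Qed.

(** The value is 0 where the series diverges. *)
Definition ev v f : C := if pselect (exists z, sums (line_hom v f) z) is left h then projT1 (cid h) else 0.

Lemma ev_eq v f z : sums (line_hom v f) z -> ev v f = z.
Proof.
rewrite /ev => h; case: pselect => [h'|]; last by case; exists z.
by case: (cid h') => z' /= h2; exact: sums_uniq h2 h.
Qed.

Section EvRules.
Variables (rho : 'I_n -> R) (v : 'I_n -> C).
Hypothesis vr : forall i, modulus (v i) <= rho i.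

Lemma evP f M : norm_le rho f M -> sums (line_hom v f) (ev v f).
Proof.
move=> hf; have [z hz] := abs_sums (line_bounded vr hf).
by rewrite (ev_eq hz).
Qed.

Lemma evD f g M M' : norm_le rho f M -> norm_le rho g M' -> ev v (f + g) = ev v f + ev v g.
Proof.
by move=> hf hg; apply: ev_eq; rewrite (rmorphD (line_hom v)); exact: sumsD (evP hf) (evP hg).
Qed.

Lemma evN f M : norm_le rho f M -> ev v (- f) = - ev v f.
Proof. by move=> hf; apply: ev_eq; rewrite (rmorphN (line_hom v)); exact: sumsN (evP hf). Qed.

Lemma evM f g M M' : norm_le rho f M -> norm_le rho g M' -> ev v (f * g) = ev v f * ev v g.
Proof.
move=> hf hg; apply: ev_eq; rewrite (rmorphM (line_hom v)).
exact: sumsM (line_bounded vr hf) (line_bounded vr hg) (evP hf) (evP hg).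
Qed.

Lemma ev_modulus f M : norm_le rho f M -> modulus (ev v f) <= M.
Proof.
move=> hf; apply: sums_le (evP hf) _ => N; rewrite (le_trans (modulus_sum _ _ _)) //.
exact: line_bounded vr hf N.
Qed.

End EvRules.

Lemma ev_mono v m0 c f : (forall m, f m = if m == m0 then c else 0) -> ev v f = c * monval v m0.
Proof.
move=> fE; apply: ev_eq => e e0; exists (mdeg m0).+1 => N mN; rewrite line_partial.
rewrite (bigD1_seq m0) ?bounded_multinoms_uniq ?mem_bounded_multinoms //= fE eqxx big1 => [|m mm].
  by rewrite addr0 subrr modulus0.
by rewrite fE (negbTE mm) mul0r.
Qed.

Lemma ev_const v c : ev v (@fps_const C n c) = c.
Proof. by rewrite (@ev_mono v mnm0 c) // monval0 mulr1. Qed.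

Lemma ev_X v i : ev v (fps_X C i) = v i.
Proof.
rewrite (@ev_mono v (mnm1 i) 1) ?mul1r ?monval1 // => m.
by rewrite /fps_X; case: (m == mnm1 i).
Qed.

Lemma ev_0 f : ev (fun=> 0) f = f mnm0.
Proof.
apply: ev_eq => e e0; exists 1%N => N N1; rewrite line_partial.
rewrite (bigD1_seq mnm0) ?bounded_multinoms_uniq ?mem_bounded_multinoms ?mdeg0 //= monval0 mulr1.
rewrite big1 => [|m m0]; first by rewrite addr0 subrr modulus0.
have [i mi] : exists i, m i != 0%N.
  apply: contrapT => h; case/eqP: m0; apply/mnmP => i; rewrite mnm0E.
  by apply/eqP; apply: contrapT => /negP hi; apply: h; exists i.
by rewrite /monval (bigD1 i) //= expr0n (negbTE mi) mul0r mulr0.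
Qed.

End Evaluation.

Section SecondOrder.
Variable R : realType.
Local Notation C := (R[i]).

(** Terms of order i >= 2 in t satisfy |t|^i <= (|t|/tau)^2 tau^i. The recursion [step], applied
    both to a, t and to |a|, tau, replaces the binomial formula. *)
Lemma pow_second_order (a t : C) (tau : R) e : 0 < tau -> modulus t <= tau ->
  modulus ((a + t) ^+ e - a ^+ e - t * (e%:R * a ^+ e.-1)) <=
  (modulus t / tau) ^+ 2 * (modulus a + tau) ^+ e.
Proof.
move=> t0 tt; set al := modulus a; set x := modulus t in tt *.
have al0 : 0 <= al := modulus_ge0 a; have x0 : 0 <= x := modulus_ge0 t.
apply: (@le_trans _ _ ((x / tau) ^+ 2 * ((al + tau) ^+ e - al ^+ e - tau * (e%:R * al ^+ e.-1)))); last first.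
  rewrite ler_wpM2l ?sqr_ge0 // -addrA gerDl -opprD oppr_le0 addr_ge0 ?exprn_ge0 //.
  by rewrite !mulr_ge0 ?exprn_ge0 ?ler0n ?(ltW t0).
elim: e => [|e IH]; first by rewrite !expr0 !mulr0n !mul0r !mulr0 !subr0 !subrr modulus0 mulr0.
have step (S : comNzRingType) (b y : S) : (b + y) ^+ e.+1 - b ^+ e.+1 - y * (e.+1%:R * b ^+ e) =
    (b + y) * ((b + y) ^+ e - b ^+ e - y * (e%:R * b ^+ e.-1)) + y ^+ 2 * (e%:R * b ^+ e.-1).
  case: e {IH} => [|e]; first by rewrite !expr0 !mulr0n !mul0r; ring.
  by rewrite !succnK -[e.+2%:R]natr1 !exprS; ring.
rewrite /= !step [leRHS]mulrDr; apply: le_trans (modulusD _ _) _; apply: lerD.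
  rewrite modulusM [leRHS]mulrCA ler_pM ?modulus_ge0 //; apply: le_trans (modulusD _ _) _.
  by rewrite lerD2l.
rewrite !modulusM !modulusX modulus_nat -/al -/x [leRHS]mulrA ler_wpM2r ?mulr_ge0 ?exprn_ge0 //.
by rewrite -exprMn divfK // gt_eqF.
Qed.

Variable n : nat.

Definition move_coord (S : zmodType) (v : 'I_n -> S) i (t : S) l := if l == i then v l + t else v l.

Lemma monval_move (S : comNzRingType) (v : 'I_n -> S) i t (m : multinom n) :
  monval (move_coord v i t) m = (v i + t) ^+ m i * \prod_(l | l != i) v l ^+ m l.
Proof.
rewrite /monval (bigD1 i) //= /move_coord eqxx; congr (_ * _).
by apply: eq_bigr => l /negbTE ->.
Qed.

Lemma monval_split (S : comNzRingType) (v : 'I_n -> S) i (m : multinom n) :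
  monval v m = v i ^+ m i * \prod_(l | l != i) v l ^+ m l.
Proof. by rewrite /monval (bigD1 i). Qed.

Lemma derivative_partial (f : fps C n) (v : 'I_n -> C) i N :
  \sum_(m <- bounded_multinoms n N) fps_d i f m * monval v m =
  \sum_(m <- bounded_multinoms n N.+1)
    f m * ((m i)%:R * v i ^+ (m i).-1 * \prod_(l | l != i) v l ^+ m l).
Proof.
rewrite [RHS](bigID (fun m : multinom n => (0 < m i)%N)) /= [X in _ + X]big1 ?addr0; last first.
  by move=> m; rewrite -leqNgt leqn0 => /eqP ->; rewrite !mul0r mulr0.
rewrite -[RHS]big_filter.
transitivity (\sum_(m <- [seq mnm_add m (mnm1 i) | m <- bounded_multinoms n N])
    f m * ((m i)%:R * v i ^+ (m i).-1 * \prod_(l | l != i) v l ^+ m l)); last first.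
  apply: perm_big; rewrite perm_sym.
  apply: uniq_perm.
  - by rewrite filter_uniq ?bounded_multinoms_uniq.
  - by rewrite map_inj_uniq ?bounded_multinoms_uniq //; exact: addIm.
  - move=> m; rewrite mem_filter mem_bounded_multinoms; apply/andP/mapP => [[mi mN]|[e eN ->]].
      have mE : m = mnm_add (mnm_sub m (mnm1 i)) (mnm1 i).
        by apply/mnmP => l; rewrite mnmDE mnmBE mnm1E; case: eqP => [<-|_]; rewrite ?subn0 ?addn0 // subnK.
      exists (mnm_sub m (mnm1 i)) => //; move: mN; rewrite {1}mE mdegD mdeg1 addn1 ltnS.
      by rewrite mem_bounded_multinoms.
    rewrite mem_bounded_multinoms in eN; rewrite mnmDE mnm1E eqxx addn1 mdegD mdeg1 addn1.
    by split.
rewrite [RHS]big_map; apply: eq_bigr => m _; rewrite /fps_d mnmDE mnm1E eqxx addn1 /= (monval_split _ i).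
rewrite [in RHS](eq_bigr (fun l => v l ^+ m l)) => [|l li]; last by rewrite mnmDE mnm1E eq_sym (negbTE li) addn0.
by rewrite -mulr_natr; ring.
Qed.

End SecondOrder.

Section ConvergentSeries.
Variables (R : realType) (n : nat).
Local Notation C := (R[i]).
Implicit Types (f g : fps C n) (rho : 'I_n -> R) (v : 'I_n -> C).

(** Bounds on every strictly smaller polydisc, unlike a bound on the polydisc itself, are stable
    under differentiation. *)
Definition convergent rho : {pred fps C n} := fun f => `[< forall rho',
  (forall i, 0 < rho' i < rho i) -> exists M, norm_le rho' f M >].

Lemma convergentP rho f : reflect (forall rho', (forall i, 0 < rho' i < rho i) -> exists M, norm_le rho' f M)
  (f \in convergent rho).
Proof. exact: asboolP. Qed.

Lemma norm_le_radius rho rho' f M : (forall i, 0 <= rho' i <= rho i) -> norm_le rho f M -> norm_le rho' f M.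
Proof.
move=> h hf s us; apply: le_trans (hf s us); apply: ler_sum => m _.
by rewrite ler_wpM2l ?modulus_ge0 ?monval_le.
Qed.

Lemma convergent_norm rho f M : norm_le rho f M -> f \in convergent rho.
Proof.
move=> hf; apply/convergentP => rho' h; exists M; apply: norm_le_radius hf => i.
by have /andP[h1 h2] := h i; rewrite !ltW.
Qed.

Lemma convergent_le rho rho' f : (forall i, rho' i <= rho i) -> f \in convergent rho -> f \in convergent rho'.
Proof.
move=> h /convergentP hf; apply/convergentP => r hr; apply: hf => i.
by have /andP[-> h2] := hr i; exact: lt_le_trans (h i).
Qed.

Let arith1 (x y d : R) : y <= (d - x) / 2 -> x < d -> x + y < d. Proof. by move=> *; lra. Qed.
Let arith2 (K e : R) : 0 < K -> 0 < e -> K * (e / (2 * K)) < e.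
Proof. by move=> K0 e0; have -> : K * (e / (2 * K)) = e / 2; [field; lra|lra]. Qed.
Let arith3 (a b : R) : a + b <= `|b| + `|a| + 1.
Proof. by have := ler_norm a; have := ler_norm b; lra. Qed.
Let arith4 (a b c s t e' e : R) : a < e' -> b < e' -> c < e' -> s <= b + t * c -> t * c <= t * e' ->
  e' * (2 + t + 1) = e -> 0 < e' -> a + s < e.
Proof. by move=> *; nra. Qed.

Let arith5 (S : comPzRingType) (t a b c d : S) : t * (c - d) = (a - b - t * d) - (a - b - t * c).
Proof. by ring. Qed.

Let arith6 (S : comPzRingType) (A B D t x y z : S) :
  x - y - t * z = - (A - x) + ((B - y) + t * (D - z)) + (A - B - t * D).
Proof. by ring. Qed.

Let pos rho' rho : (forall i, 0 < rho' i < rho i) -> forall i : 'I_n, 0 <= (rho' i : R).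
Proof. by move=> h i; have /andP[/ltW] := h i. Qed.

Lemma convergent_subring rho : subring_closed (convergent rho).
Proof.
split=> [|f g /convergentP hf /convergentP hg|f g /convergentP hf /convergentP hg]; apply/convergentP => r hr.
- by exists 1; apply: norm_le1; exact: pos hr.
- have [M hM] := hf r hr; have [M' hM'] := hg r hr; exists (M + M').
  by apply: norm_leB => //; exact: pos hr.
- have [M hM] := hf r hr; have [M' hM'] := hg r hr; exists (M * M').
  by apply: norm_leM => //; exact: pos hr.
Qed.

Definition conv_set rho := SubringSet (convergent_subring rho).

Lemma convergent_const rho c : @fps_const C n c \in convergent rho.
Proof. by apply/convergentP => r hr; exists (modulus c); apply: norm_le_const; exact: pos hr. Qed.

Lemma convergent_X rho i : fps_X C i \in convergent rho.
Proof. by apply/convergentP => r hr; exists (r i); apply: norm_le_X; exact: pos hr. Qed.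

Lemma between rho v : (forall i, modulus (v i) < rho i) ->
  exists2 r, forall i, 0 < r i < rho i & forall i, modulus (v i) < r i.
Proof.
move=> h; exists (fun i => (modulus (v i) + rho i) / 2) => i; have := h i; have := modulus_ge0 (v i); lra.
Qed.

(** From y^(e+1) - x^(e+1) >= (e+1) x^e (y - x): a slightly larger radius absorbs the factor created
    by differentiation. *)
Lemma power_bernoulli (x y : R) : 0 < x -> x < y -> exists K, forall e, e.+1%:R * x ^+ e <= K * y ^+ e.+1.
Proof.
move=> x0 xy; have y0 : 0 < y by exact: lt_trans xy.
have d0 : 0 < y - x by rewrite subr_gt0.
exists (y - x)^-1 => e; rewrite ler_pdivlMl //.
elim: e => [|e IH]; first by rewrite expr0 expr1; lra.
have h1 : x ^+ e.+1 <= y ^+ e.+1 by rewrite lerXn2r ?nnegrE ?ltW.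
have h2 : (y - x) * (e.+2%:R * x ^+ e.+1) = x * ((y - x) * (e.+1%:R * x ^+ e)) + (y - x) * x ^+ e.+1.
  by rewrite -[e.+2%:R]natr1 exprS; ring.
have h3 : x * ((y - x) * (e.+1%:R * x ^+ e)) <= x * y ^+ e.+1 by rewrite ler_pM2l.
have h4 : (y - x) * x ^+ e.+1 <= (y - x) * y ^+ e.+1 by rewrite ler_pM2l.
rewrite h2 [y ^+ e.+2]exprS; apply: le_trans (lerD h3 h4) _.
by rewrite -mulrDl addrC subrK.
Qed.

Lemma convergent_d rho i f : f \in convergent rho -> fps_d i f \in convergent rho.
Proof.
move=> /convergentP hf; apply/convergentP => r hr.
pose r' l := (r l + rho l) / 2.
have hr' l : r l < r' l < rho l by rewrite /r'; have := hr l; lra.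
have [|M hM] := hf r'; first by move=> l; have := hr l; have := hr' l; lra.
have /andP[ri0 _] := hr i; have /andP[rr' _] := hr' i.
have [K hK] := power_bernoulli ri0 rr'.
have K0 : 0 <= K.
  have := hK 0%N; rewrite expr0 expr1 mulr1 => h.
  by rewrite -(pmulr_lge0 _ (lt_trans ri0 rr')) (le_trans _ h) // ler01.
exists (K * M) => s us.
apply: (@le_trans _ _ (K * \sum_(m <- [seq mnm_add m (mnm1 i) | m <- s]) modulus (f m) * monval r' m)); last first.
  by rewrite ler_wpM2l // hM // map_inj_uniq //; exact: addIm.
rewrite big_map mulr_sumr; apply: ler_sum => m _; rewrite /fps_d -mulr_natr modulusM modulus_nat -mulrA.
rewrite [leRHS]mulrCA ler_wpM2l ?modulus_ge0 // (monval_split r i) (monval_split r' i) !mulrA ler_pM //.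
- by rewrite mulr_ge0 // exprn_ge0 // ltW.
- by apply: prodr_ge0 => l _; rewrite exprn_ge0 // (pos hr).
- by rewrite mnmDE mnm1E eqxx addn1 hK.
- apply: ler_prod => l li; rewrite mnmDE mnm1E eq_sym (negbTE li) addn0 exprn_ge0 ?(pos hr) //=.
  have := hr l; have := hr' l => h1 h2; rewrite lerXn2r // ?nnegrE; lra.
Qed.

Lemma conv_evP rho v f : (forall i, modulus (v i) < rho i) -> f \in convergent rho -> sums (line_hom v f) (ev v f).
Proof.
move=> /between[r r0 vr] /convergentP /(_ r r0)[M hM].
by apply: (@evP _ _ r v _ f M hM) => i; rewrite ltW.
Qed.

Lemma ev_derivative rho v f i : (forall l, modulus (v l) < rho l) -> f \in convergent rho ->
  exists2 tau, 0 < tau & exists K, forall t, modulus t <= tau ->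
  modulus (ev (move_coord v i t) f - ev v f - t * ev v (fps_d i f)) <= K * modulus t ^+ 2.
Proof.
move=> vr cf; have [r r0 vr'] := between vr; have /convergentP /(_ r r0)[M hM] := cf.
have M0 := norm_le_ge0 hM.
pose tau := r i - modulus (v i); have tau0 : 0 < tau by rewrite subr_gt0.
exists tau => //; exists (M / tau ^+ 2) => t tt.
have movr l : modulus (move_coord v i t l) < rho l.
  have /andP[_ hr] := r0 l; apply: le_lt_trans hr; rewrite /move_coord; case: eqP => [->|_]; last exact: ltW.
  by apply: le_trans (modulusD _ _) _; rewrite -lerBrDl.
have s1 := conv_evP movr cf; have s2 := conv_evP vr cf.
have s3 := conv_evP vr (convergent_d i cf).
apply: le_of_lt_eps => e e0; pose e' := e / (2 + modulus t + 1).
have t0 := modulus_ge0 t.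
have d0 : 0 < 2 + modulus t + 1 by lra.
have e'0 : 0 < e' by rewrite divr_gt0.
have e'E : e' * (2 + modulus t + 1) = e by rewrite divfK // gt_eqF.
have [N1 h1] := s1 _ e'0; have [N2 h2] := s2 _ e'0; have [N3 h3] := s3 _ e'0.
pose N := maxn N1 (maxn N2 N3).
have {}h1 := h1 N.+1 (leq_trans (leq_maxl _ _) (leqnSn _)).
have {}h2 := h2 N.+1 (leq_trans (leq_trans (leq_maxl _ _) (leq_maxr _ _)) (leqnSn _)).
have {}h3 := h3 N (leq_trans (leq_maxr _ _) (leq_maxr _ _)).
rewrite (line_partial (move_coord v i t) f N.+1) in h1; rewrite (line_partial v f N.+1) in h2.
rewrite (line_partial v (fps_d i f) N) (derivative_partial f v i N) in h3.
set A := \sum_(m <- _) _ in h1; set B := \sum_(m <- _) _ in h2; set D := \sum_(m <- _) _ in h3.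
have hS : modulus (A - B - t * D) <= M / tau ^+ 2 * modulus t ^+ 2.
  rewrite /A /B /D mulr_sumr -!sumrB; apply: le_trans (modulus_sum _ _ _) _.
  rewrite (_ : M / _ * _ = (modulus t / tau) ^+ 2 * M); last by rewrite exprMn exprVn; ring.
  apply: le_trans (ler_wpM2l (sqr_ge0 _) (hM _ (bounded_multinoms_uniq n N.+1))); rewrite mulr_sumr.
  apply: ler_sum => m _; rewrite monval_move (monval_split v i) (monval_split r i).
  set P := \prod_(l | l != i) v l ^+ m l; set Q := \prod_(l | l != i) r l ^+ m l.
  have PQ : modulus P <= Q.
    rewrite /P (big_morph (@modulus R) (@modulusM R) (modulus1 R)); apply: ler_prod => l _.
    by rewrite modulus_ge0 modulusX lerXn2r // ?nnegrE ?modulus_ge0 ?(pos r0) // ltW.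
  rewrite (_ : _ - _ = f m * (((v i + t) ^+ m i - v i ^+ m i - t * ((m i)%:R * v i ^+ (m i).-1)) * P)); last by ring.
  rewrite modulusM modulusM [leRHS]mulrCA ler_wpM2l ?modulus_ge0 // [leRHS]mulrA ler_pM ?modulus_ge0 //.
  have := @pow_second_order R (v i) t tau (m i) tau0 tt.
  by rewrite (_ : modulus (v i) + tau = r i) // /tau addrC subrK.
rewrite (arith6 A B D).
apply: le_lt_trans (modulusD _ _) _; rewrite addrC; apply: ler_ltD => //.
apply: le_lt_trans (modulusD _ _) _; rewrite modulusN.
have := modulusD (B - ev v f) (t * (D - ev v (fps_d i f))); rewrite modulusM.
have := ler_wpM2l t0 (ltW h3) => p2 p3; exact: arith4 h1 h2 h3 p3 p2 e'E e'0.
Qed.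

Definition shift v (h : 'I_n -> C) l := v l + h l.

(** The two sums agree near h, hence so do their increments in direction [i]; as both have quadratic
    remainders, the derivatives differ by at most K t for all small t. *)
Lemma expansion_d rho r v f g del i : (forall l, modulus (v l) + del < rho l) -> (forall l, del < r l) ->
  f \in convergent rho -> g \in convergent r ->
  (forall h, (forall l, modulus (h l) < del) -> ev h g = ev (shift v h) f) ->
  forall h, (forall l, modulus (h l) < del) -> ev h (fps_d i g) = ev (shift v h) (fps_d i f).
Proof.
move=> vr dr cf cg E h hd.
have [|t1 t10 [K1 H1]] := @ev_derivative r h g i _ cg; first by move=> l; exact: lt_trans (dr l).
have [|t2 t20 [K2 H2]] := @ev_derivative rho (shift v h) f i _ cf.
  move=> l; apply: le_lt_trans (modulusD _ _) _; apply: lt_trans (vr l).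
  by rewrite ltrD2l.
apply/eqP; rewrite -subr_eq0; apply/eqP/modulus_eps => e e0; set z := _ - _.
pose K := `|K1| + `|K2| + 1.
have K0 : 0 < K by rewrite /K; have := normr_ge0 K1; have := normr_ge0 K2; lra.
pose t := Num.min (Num.min t1 t2) (Num.min ((del - modulus (h i)) / 2) (e / (2 * K))).
have t0 : 0 < t by rewrite !lt_min t10 t20 divr_gt0 ?subr_gt0 // divr_gt0 // mulr_gt0.
have tC : modulus (t%:C%C : C) = t by rewrite modulus_real // ltW.
have tt1 : t <= t1 by rewrite !ge_min lexx.
have tt2 : t <= t2 by rewrite !ge_min lexx orbT.
have tt3 : t <= (del - modulus (h i)) / 2 by rewrite !ge_min lexx !orbT.
have tt4 : t <= e / (2 * K) by rewrite !ge_min lexx !orbT.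
have := H1 (t%:C%C : C); have := H2 (t%:C%C : C); rewrite tC => /(_ tt2) h2 /(_ tt1) h1.
have Em : ev (move_coord h i t%:C%C) g = ev (move_coord (shift v h) i t%:C%C) f.
  rewrite E.
    congr (ev _ f); apply/funext => l; rewrite /shift /move_coord; case: eqP => // _.
    by rewrite addrA.
  move=> l; rewrite /move_coord; case: eqP => [->|_] //; apply: le_lt_trans (modulusD _ _) _.
  by rewrite tC; apply: arith1 => //; exact: hd.
have zt : t * modulus z <= K * t ^+ 2.
  rewrite -tC -modulusM (_ : _ * z = (ev (move_coord (shift v h) i t%:C%C) f - ev (shift v h) f - t%:C%C * ev (shift v h) (fps_d i f))
     - (ev (move_coord h i t%:C%C) g - ev h g - t%:C%C * ev h (fps_d i g))); last first.
    by rewrite Em (E h hd) /z; exact: arith5.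
  apply: le_trans (modulusD _ _) _; rewrite modulusN tC; apply: le_trans (lerD h2 h1) _.
  rewrite -mulrDl ler_wpM2r ?sqr_ge0 // /K; exact: arith3.
have : modulus z <= K * t by move: zt; rewrite expr2 mulrCA ler_pM2l.
move=> /le_lt_trans; apply; have : K * t <= K * (e / (2 * K)) by rewrite ler_wpM2l // ltW.
move=> /le_lt_trans; apply; exact: arith2.
Qed.

End ConvergentSeries.

Section ConvergentEvaluation.
Variables (R : realType) (n : nat) (rho : 'I_n -> R) (v : 'I_n -> R[i]).
Hypothesis vr : forall i, modulus (v i) < rho i.
Local Notation C := (R[i]).

Lemma conv_evB f g : f \in convergent rho -> g \in convergent rho -> ev v (f - g) = ev v f - ev v g.
Proof.
have [r r0 vr'] := between vr => /convergentP /(_ r r0)[M hM] /convergentP /(_ r r0)[M' hM'].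
have vr'' i : modulus (v i) <= r i by rewrite ltW.
rewrite (evD vr'' hM (norm_leN _ hM')) ?(evN vr'' hM') // => i.
by have /andP[/ltW] := r0 i.
Qed.

Lemma conv_evM f g : f \in convergent rho -> g \in convergent rho -> ev v (f * g) = ev v f * ev v g.
Proof.
have [r r0 vr'] := between vr => /convergentP /(_ r r0)[M hM] /convergentP /(_ r r0)[M' hM'].
by rewrite (evM (rho := r) _ hM hM') // => i; rewrite ltW.
Qed.

Section OnRing.
Variables (O : comNzRingType) (iota : {rmorphism O -> fps C n}).
Hypothesis conv : forall x, iota x \in convergent rho.

Let F x := ev v (iota x).
Lemma conv_eval_is_additive : additive F.
Proof. by move=> x y; rewrite /F (rmorphB iota); apply: conv_evB; exact: conv. Qed.
Lemma conv_eval_is_monoid : monoid_morphism F.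
Proof.
split=> [|x y]; rewrite /F; first by rewrite (rmorph1 iota) -(rmorph1 (@fps_const C n)) ev_const.
by rewrite (rmorphM iota); apply: conv_evM; exact: conv.
Qed.
Definition conv_eval : {rmorphism O -> C} := HB.pack F
  (GRing.isZmodMorphism.Build _ _ _ conv_eval_is_additive)
  (GRing.isMonoidMorphism.Build _ _ _ conv_eval_is_monoid).

Lemma conv_evalE x : conv_eval x = ev v (iota x). Proof. by []. Qed.
End OnRing.
End ConvergentEvaluation.

Section ExpansionUniqueness.
Variables (R : realType) (n : nat) (rho : 'I_n -> R) (v : 'I_n -> R[i]).
Local Notation C := (R[i]).

Lemma C_char0 : char0 C. Proof. by move=> m; rewrite pnatr_eq0. Qed.

Lemma common_bound (a b : 'I_n -> R) : (forall l, 0 < a l) -> (forall l, 0 < b l) ->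
  exists2 d : R, 0 < d & forall l, d < a l /\ d < b l.
Proof.
move=> a0 b0; pose d := \big[Num.min/1]_l Num.min (a l) (b l).
have d0 : 0 < d by apply: lt_bigmin => // l _; rewrite lt_min a0 b0.
exists (d / 2); first by rewrite divr_gt0.
move=> l; have : d <= Num.min (a l) (b l) by apply: bigmin_le_cond.
by rewrite le_min => /andP[]; lra.
Qed.

(** Links the analytic notion of expansion with the algebraic one: having the same sum is preserved
    by derivatives, by [expansion_d], and yields equal constant terms. *)
Lemma taylor_expansion (O : comNzRingType) (d : 'I_n -> O -> O) (hd : dsystem d)
    (iota : {rmorphism O -> fps C n}) (kap : {rmorphism O -> C}) x g r del :
  (forall i y, iota (d i y) = fps_d i (iota y)) -> (forall y, iota y \in convergent rho) ->
  (forall y, kap y = ev v (iota y)) -> (forall l, modulus (v l) + del < rho l) ->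
  0 < del -> (forall l, del < r l) -> g \in convergent r ->
  (forall h, (forall l, modulus (h l) < del) -> ev h g = ev (shift v h) (iota x)) ->
  g = taylor_hom hd kap C_char0 x.
Proof.
move=> id conv kE vr del0 dr cg E.
apply: (fps_char0_ind C_char0 (f := fun a b => exists y, [/\ b = taylor_hom hd kap C_char0 y,
   a \in convergent r & forall h, (forall l, modulus (h l) < del) -> ev h a = ev (shift v h) (iota y)])).
- move=> a b [y [-> ca Ea]]; rewrite [RHS]taylor0 -(ev_0 a) Ea => [|l]; last by rewrite modulus0.
  have -> : shift v (fun=> 0) = v by apply/funext => l; rewrite /shift addr0.
  by rewrite kE.
- move=> i a b [y [-> ca Ea]]; exists (d i y); split; first by rewrite [LHS](taylor_d hd kap C_char0).
    exact: convergent_d.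
  by move=> h hd'; rewrite id; exact: (@expansion_d R n rho r v (iota y) a del i vr dr (conv y) ca Ea h hd').
- by exists x.
Qed.

(** All derivatives again have sum zero near the origin, so every coefficient vanishes. *)
Lemma convergent_zero (r : 'I_n -> R) (del : R) (f : fps C n) : 0 < del -> (forall l, del < r l) -> f \in convergent r ->
  (forall h, (forall l, modulus (h l) < del) -> ev h f = 0) -> f = 0.
Proof.
move=> del0 dr cf E.
apply: (fps_char0_ind C_char0 (f := fun a b => b = 0 /\ (a \in convergent r /\
   forall h, (forall l, modulus (h l) < del) -> ev h a = 0))); last by split.
- move=> a b [-> [ca Ea]]; rewrite fps0E -(ev_0 a) Ea // => l; by rewrite modulus0.
- move=> i a b [-> [ca Ea]]; split; first by rewrite (der0 ((fps_dsystem C n).1 i)).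
  split; first exact: convergent_d.
  have z0 : (0 : fps C n) = @fps_const C n 0 by rewrite (rmorph0 (@fps_const C n)).
  move=> h hd'; rewrite (@expansion_d R n r r (fun=> 0) 0 a del i) //.
  + by rewrite (der0 ((fps_dsystem C n).1 i)) z0 ev_const.
  + by move=> l; rewrite modulus0 add0r.
  + by rewrite z0 convergent_const.
  + by move=> h' h'd; rewrite Ea // z0 ev_const.
Qed.

End ExpansionUniqueness.

(** * Convergence of Weierstrass quotients *)

Section WeierstrassBound.
Variables (R : realType) (n : nat) (j : 'I_n.+1) (e : nat).
Local Notation C := (R[i]).
Variables (a : R) (g h Q : fps C n.+1) (Mg Mh : R).
Hypotheses (a0 : 0 < a) (hg : norm_le (fun=> a) g Mg) (hh : norm_le (fun=> a) h Mh).
Hypotheses (hlow : wlow j e e.+1 h) (QE : Q = wtau j e (g - Q * h)).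

(** Radii adapted to the weight [wdeg]: besides a power of [a], a monomial is measured by x to its
    weight. *)
Definition wradius (x : R) (i : 'I_n.+1) : R := a * x ^+ (if i == j then 1%N else e.+1).

Lemma monval_wradius x m : monval (wradius x) m = a ^+ mdeg m * x ^+ wdeg j e m.
Proof.
rewrite /monval /wradius; under eq_bigr => i _ do rewrite exprMn -exprM.
rewrite big_split /= !prodrXr mdegE; congr (_ * _); congr (x ^+ _).
rewrite /wdeg mdegE big_distrr /= (bigD1 j) //= eqxx mul1n addnC; congr (_ + _)%N.
rewrite (eq_bigl (fun i => j != i)) => [|i]; last by rewrite eq_sym.
rewrite [in RHS](eq_bigr (fun i => e.+1 * m (lift j i))%N) => [|i _]; last by rewrite mnmE.
rewrite (eq_bigr (fun i => e.+1 * m i)%N) => [|i /negbTE ji]; last by rewrite eq_sym ji.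
rewrite -big_filter -(big_map (lift j) predT (fun i => e.+1 * m i)%N); apply: perm_big.
apply: uniq_perm; rewrite ?filter_uniq ?map_inj_uniq ?index_enum_uniq //; first exact: lift_inj.
move=> i; rewrite mem_filter mem_index_enum andbT; apply/idP/mapP => [ji|[l _ ->]]; last exact: neq_lift.
by case: (unliftP j i) ji => [l ->|->]; rewrite ?eqxx // => _; exists l; rewrite ?mem_index_enum.
Qed.

(** Since [h] has weight above [e], multiplication by it gains one factor x over what division by
    the [e]-th power loses; for small x the map with fixed point [Q] contracts the norm by at least
    one half. *)
Lemma weierstrass_bound : exists2 x0 : R, 0 < x0 & forall x, 0 < x <= x0 -> x <= 1 ->
  exists M, norm_le (wradius x) Q M.
Proof.
have Mh0 := norm_le_ge0 hh; have Mg0 := norm_le_ge0 hg.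
exists (a ^+ e / (2 * (Mh + 1))); first by rewrite divr_gt0 ?exprn_gt0 // mulr_gt0 //; lra.
move=> x /andP[x0 xx] x1; pose s := wradius x.
have s0 i : 0 <= s i by rewrite mulr_ge0 ?exprn_ge0 // ltW.
have hgs : norm_le s g Mg.
  apply: norm_le_radius hg => i; rewrite s0 /=; rewrite /s /wradius -[leRHS]mulr1 ler_pM2l //.
  by rewrite exprn_ile1 // ltW.
have hhs : norm_le s h (x ^+ e.+1 * Mh).
  move=> t ut; apply: le_trans (_ : x ^+ e.+1 * \sum_(m <- t) modulus (h m) * monval (fun=> a) m <= _); last first.
    by rewrite ler_wpM2l ?exprn_ge0 ?hh // ltW.
  rewrite mulr_sumr; apply: ler_sum => m _; rewrite mulrCA.
  have [/hlow ->|wm] := ltnP (wdeg j e m) e.+1; first by rewrite modulus0 !mul0r.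
  rewrite ler_wpM2l ?modulus_ge0 // monval_wradius mulrC.
  have -> : monval (fun=> a) m = a ^+ mdeg m by rewrite mdegE -prodrXr.
  by rewrite ler_wpM2r ?exprn_ge0 ?(ltW a0) // ler_wiXn2l // ltW.
pose th := x ^+ e * a ^+ e; have th0 : 0 < th by rewrite mulr_gt0 ?exprn_gt0.
have tauN f M : norm_le s f M -> norm_le s (wtau j e f) (M / th).
  move=> hf t ut; rewrite ler_pdivlMr // mulr_suml.
  pose up (m : multinom n.+1) := mins j (m j + e) (mdel j m).
  have upI : injective up.
    by move=> m m' /mins_inj[/addIn e1 e2]; rewrite -(mins_del j m) -(mins_del j m') e1 e2.
  apply: le_trans (hf [seq up m | m <- t] _); last by rewrite map_inj_uniq.
  rewrite big_map; apply: ler_sum => m _; rewrite wtauE -mulrA ler_wpM2l ?modulus_ge0 //.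
  rewrite !monval_wradius /up mdeg_mins wdeg_mins /wdeg -{1}(mins_del j m) mdeg_mins /th.
  rewrite [leLHS](_ : _ = a ^+ (m j + mdeg (mdel j m) + e) * x ^+ (e.+1 * mdeg (mdel j m) + m j + e)).
    by rewrite addnAC addnA.
  by rewrite !exprD; ring.
pose L := 2 * (Mg / th); have L0 : 0 <= L by rewrite mulr_ge0 // divr_ge0 // ltW.
(* The norm of [Q] is not known to be finite beforehand. The bound is proved for the truncations by
   weight, each of which determines the next one. *)
pose Qb b : fps C n.+1 := fun m => if (wdeg j e m < b)%N then Q m else 0.
have Lb b : norm_le s (Qb b) L.
  elim: b => [|b IH].
    by move=> t _; rewrite big1 // => m _; rewrite modulus0 mul0r.
  apply: (norm_le_dom s0 (g := wtau j e (g - Qb b * h))).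
    move=> m; rewrite /Qb; case: ifP => mb; last by rewrite modulus0 modulus_ge0.
    rewrite {1}QE (_ : wtau j e (g - Q * h) = wtau j e (g - Qb b * h) - wtau j e ((Q - Qb b) * h)).
      have z : wtau j e ((Q - Qb b) * h) m = 0.
        apply: (@wtau_low _ _ j e b.+1 ((Q - Qb b) * h)) => //; rewrite addSnnS; apply: wlowM => // m' m'b.
        by rewrite fpsBE /Qb m'b subrr.
      by rewrite fpsBE z subr0.
    by rewrite -wtauB mulrBl; congr wtau; rewrite opprB addrA subrK.
  apply: norm_le_trans (tauN _ _ (norm_leB s0 hgs (norm_leM s0 IH hhs))).
  have LE : L * th = Mg + Mg by rewrite /L -mulrA divfK ?gt_eqF // mulr2n mulrDl mul1r.
  rewrite ler_pdivrMr // LE lerD2l /L.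
  have a_e : 0 < a ^+ e by rewrite exprn_gt0.
  have k1 : x * (2 * (Mh + 1)) <= a ^+ e by rewrite -ler_pdivlMr // mulr_gt0 //; lra.
  have k2 : x * (2 * Mh) <= a ^+ e.
    by apply: le_trans k1; rewrite ler_pM2l //; lra.
  rewrite (_ : _ * (x ^+ e.+1 * Mh) = Mg * (x * (2 * Mh) / a ^+ e)); last first.
    by rewrite /th exprS; field; rewrite !gt_eqF ?exprn_gt0.
  by rewrite ler_piMr // ler_pdivrMr // mul1r.
exists L => t ut; pose b := (\max_(m <- t) wdeg j e m).+1.
apply: le_trans (Lb b t ut); rewrite big_seq [leRHS]big_seq; apply: ler_sum => m mt.
by rewrite /Qb ltnS (@leq_bigmax_seq _ _ _ (wdeg j e) m mt).
Qed.

End WeierstrassBound.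

Section Germs.
Variable R : realType.
Local Notation C := (R[i]).

Definition germ n (f : fps C n) : Prop := exists2 s : R, 0 < s & exists M, norm_le (fun=> s) f M.

Lemma germ_radius n (f : fps C n) (rho : 'I_n -> R) M : (forall i, 0 < rho i) -> norm_le rho f M -> germ f.
Proof.
move=> r0 hf; have [s s0 sr] := common_bound r0 r0; exists s => //; exists M.
by apply: norm_le_radius hf => i; have [h _] := sr i; rewrite !ltW.
Qed.

Lemma germ2 n (f g : fps C n) : germ f -> germ g ->
  exists2 s : R, 0 < s & exists M M', norm_le (fun=> s) f M /\ norm_le (fun=> s) g M'.
Proof.
move=> [s s0 [M hM]] [t t0 [M' hM']]; exists (Num.min s t); first by rewrite lt_min s0.
exists M, M'; split; [apply: norm_le_radius hM => i|apply: norm_le_radius hM' => i].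
  by rewrite ge_min lexx andbT le_min !ltW.
by rewrite ge_min lexx orbT andbT le_min !ltW.
Qed.

Lemma germM n (f g : fps C n) : germ f -> germ g -> germ (f * g).
Proof.
move=> hf /(germ2 hf)[s s0 [M [M' [h1 h2]]]]; exists s => //; exists (M * M').
by apply: norm_leM => // i; exact: ltW.
Qed.

Lemma germB n (f g : fps C n) : germ f -> germ g -> germ (f - g).
Proof.
move=> hf /(germ2 hf)[s s0 [M [M' [h1 h2]]]]; exists s => //; exists (M + M').
by apply: norm_leB => // i; exact: ltW.
Qed.

Lemma germ_const n c : germ (@fps_const C n c).
Proof. by exists 1 => //; exists (modulus c); exact: norm_le_const. Qed.

Lemma germ_X n i : germ (fps_X C i : fps C n).
Proof. by exists 1 => //; exists 1; exact: (@norm_le_X _ _ (fun=> 1)). Qed.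

Lemma germ1 n : germ (1 : fps C n).
Proof. by rewrite -(rmorph1 (@fps_const C n)); exact: germ_const. Qed.

Lemma germX n (f : fps C n) e : germ f -> germ (f ^+ e).
Proof. by move=> hf; elim: e => [|e IH]; rewrite ?expr0 ?exprS; [exact: germ1|exact: germM]. Qed.

Lemma germ_weierstrass n (j : 'I_n.+1) e (g h Q : fps C n.+1) : germ g -> germ h ->
  wlow j e e.+1 h -> Q = wtau j e (g - Q * h) -> germ Q.
Proof.
move=> hg /(germ2 hg)[a a0 [M [M' [h1 h2]]]] hlow QE.
have [x0 x00 H] := weierstrass_bound a0 h1 h2 hlow QE; pose x := Num.min x0 1.
have xp : 0 < x by rewrite lt_min x00 ltr01.
have [||N hN] := H x; [by rewrite xp ge_min lexx|by rewrite ge_min lexx orbT|].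
by apply: germ_radius hN => i; rewrite mulr_gt0 // exprn_gt0.
Qed.

Lemma germ_division n (j : 'I_n.+1) e (c g q : fps C n.+1) (r : {poly fps C n}) :
  germ c -> germ g -> wlow j e e.+1 (c - fps_X C j ^+ e) ->
  g = c * q + poly_fps j r -> (size r <= e)%N -> germ q.
Proof.
move=> hc hg clow gE sr; apply: (germ_weierstrass hg (germB hc (germX e (germ_X j))) clow).
apply/weierstrass_fixP => i ei; have -> : fps_X C j ^+ e + (c - fps_X C j ^+ e) = c by rewrite addrC subrK.
rewrite gE addrAC subrr add0r peel_poly_fps nth_default //.
exact: leq_trans sr ei.
Qed.

Lemma germ_coef n (j : 'I_n.+1) (r : {poly fps C n}) i : germ (poly_fps j r) -> germ r`_i.
Proof.
move=> [s s0 [M hM]]; exists s => //; exists (M / s ^+ i) => t ut; rewrite ler_pdivlMr ?exprn_gt0 // mulr_suml.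
apply: le_trans (hM [seq mins j i m | m <- t] _); last first.
  by rewrite map_inj_uniq // => m m' /mins_inj[].
rewrite big_map; apply: ler_sum => m _; rewrite -(peel_poly_fps j r i) -mulrA ler_wpM2l ?modulus_ge0 //.
have mE n' (m' : multinom n') : monval (fun=> s) m' = s ^+ mdeg m' by rewrite mdegE -prodrXr.
by rewrite !mE mdeg_mins exprD mulrC.
Qed.

Lemma germs_common n (l : seq (fps C n)) (s1 : R) : 0 < s1 -> (forall f, f \in l -> germ f) ->
  exists2 s : R, 0 < s <= s1 & forall f, f \in l -> f \in convergent (fun=> s).
Proof.
move=> s10; elim: l => [|f l IH] h; first by exists s1; rewrite ?s10 ?lexx.
have [|s /andP[s0 ss] hs] := IH; first by move=> g gl; apply: h; rewrite inE gl orbT.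
have [t t0 [M hM]] := h f (mem_head _ _); exists (Num.min s t).
  by rewrite lt_min s0 t0 ge_min ss.
move=> g; rewrite inE => /orP[/eqP ->|/hs]; last by apply: convergent_le => i; rewrite ge_min lexx.
by apply: (convergent_le (rho := fun=> t)) (convergent_norm hM) => i; rewrite ge_min lexx orbT.
Qed.

Lemma ev_small n (f : fps C n) (eta : R) : germ f -> f mnm0 = 0 -> 0 < eta ->
  exists2 x0 : R, 0 < x0 & forall y, (forall l, modulus (y l) <= x0) -> modulus (ev y f) < eta.
Proof.
move=> [s s0 [M hM]] f0 e0; have M0 := norm_le_ge0 hM.
pose x := Num.min 1 (eta / (2 * (M + 1))).
have x0 : 0 < x by rewrite lt_min ltr01 divr_gt0 // mulr_gt0 //; lra.
have x1 : x <= 1 by rewrite ge_min lexx.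
have xM : x * M < eta.
  have : x * (2 * (M + 1)) <= eta by rewrite -ler_pdivlMr ?ge_min ?lexx ?orbT // mulr_gt0 //; lra.
  by nra.
exists (x * s); first by rewrite mulr_gt0.
move=> y hy; apply: le_lt_trans xM; apply: (ev_modulus (rho := fun=> x * s)) => // t ut.
apply: le_trans (_ : x * \sum_(m <- t) modulus (f m) * monval (fun=> s) m <= _); last first.
  by rewrite ler_wpM2l ?hM // ltW.
rewrite mulr_sumr; apply: ler_sum => m _; rewrite mulrCA.
have [->|m0] := eqVneq m mnm0; first by rewrite f0 modulus0 !mul0r.
rewrite ler_wpM2l ?modulus_ge0 //.
have mE (u : R) : monval (fun=> u) m = u ^+ mdeg m by rewrite mdegE -prodrXr.
rewrite !mE exprMn ler_wpM2r ?exprn_ge0 ?(ltW s0) //.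
have : (0 < mdeg m)%N by rewrite lt0n mdeg_eq0.
by case: (mdeg m) => // d _; rewrite exprS ler_piMr ?exprn_ile1 // ltW.
Qed.

(** A root of modulus at least s would satisfy |rho|^m < eta m max(1, |rho|^(m-1)), contrary to eta
    m <= s^m and s <= 1. *)
Lemma root_small (P : {poly C}) m (s eta : R) rho : P \is monic -> size P = m.+1 -> root P rho ->
  0 < s -> s <= 1 -> eta * m%:R <= s ^+ m -> (forall i, (i < m)%N -> modulus P`_i < eta) -> modulus rho < s.
Proof.
move=> Pm sP /rootP; rewrite horner_coef sP big_ord_recr /=.
have -> : P`_m = 1 by rewrite -(monicP Pm) lead_coefE sP.
rewrite mul1r => /eqP; rewrite addrC addr_eq0 => /eqP rE s0 s1 em hP; rewrite ltNge; apply/negP => sr.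
have r0 := modulus_ge0 rho.
case: m => [|m] in sP rE em hP *.
  by move: rE; rewrite expr0 big_ord0 oppr0 => /eqP; rewrite oner_eq0.
pose B := Num.max 1 (modulus rho ^+ m).
have B1 : 1 <= B by rewrite le_max lexx.
have hB i : (i < m.+1)%N -> modulus rho ^+ i <= B.
  rewrite ltnS => im; have [r1|r1] := leP (modulus rho) 1; first by apply: le_trans B1; exact: exprn_ile1.
  by rewrite le_max; apply/orP; right; rewrite ler_weXn2l // ltW.
have lt : modulus rho ^+ m.+1 < eta * m.+1%:R * B.
  rewrite -modulusX rE modulusN; apply: le_lt_trans (modulus_sum _ _ _) _.
  rewrite [ltRHS](_ : _ = \sum_(i < m.+1) eta * B); last by rewrite sumr_const card_ord -mulr_natr; ring.
  apply: (@lt_le_trans _ _ (\sum_(i < m.+1) eta * B)) => //.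
  apply: ltr_sum; first by apply/hasP; exists ord0; rewrite ?mem_index_enum.
  move=> i _; rewrite modulusM modulusX.
  apply: (@le_lt_trans _ _ (modulus P`_i * B)); first by rewrite ler_wpM2l ?modulus_ge0 ?hB.
  by rewrite ltr_pM2r ?hP //; lra.
have s_le : s ^+ m.+1 <= modulus rho ^+ m.+1 by rewrite lerXn2r ?nnegrE // ltW.
have lt2 : modulus rho ^+ m.+1 < s ^+ m.+1 * B.
  by apply: lt_le_trans lt _; rewrite ler_wpM2r //; lra.
have [r1|r1] := leP (modulus rho) 1.
  have BE : B = 1 by apply/eqP; rewrite eq_le B1 ge_max lexx exprn_ile1.
  by move: lt2; rewrite BE mulr1 ltNge s_le.
have : s ^+ m.+1 * B <= B by rewrite ler_piMl ?exprn_ile1 ?(ltW s0) //; lra.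
move/(lt_le_trans lt2); rewrite /B lt_max => /orP[h|h].
  by have := exprn_ege1 m.+1 (ltW r1); rewrite leNgt h.
by move: h; rewrite exprS ltNge ler_peMl ?exprn_ge0 // ltW.
Qed.

End Germs.

(** * The analytic case *)

Lemma poly_lift (A B : comNzRingType) (e : {rmorphism A -> B}) (p : {poly B}) :
  (forall i, exists a, e a = p`_i) -> exists q, map_poly e q = p.
Proof.
move=> /choice [a aE]; exists (\poly_(i < size p) a i); apply/polyP => i.
rewrite (@coef_map _ _ e) coef_poly; case: ltnP => h; first exact: aE.
by rewrite [LHS](rmorph0 e) nth_default.
Qed.

Lemma poly_fps_X (K : comNzRingType) n (j : 'I_n.+1) : poly_fps j 'X = fps_X K j.
Proof.
apply: (@peel_inj _ _ j); apply/funext => i; rewrite peel_poly_fps coefX.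
by have := congr1 (fun f : ser (fps K n) => f i) (peel_Xj K j) => /= ->; rewrite /serX.
Qed.

Section DirectionalTest.
Variables (K : closedFieldType) (n : nat) (O : comNzRingType) (d : 'I_n -> O -> O).
Hypotheses (hd : dsystem d) (K0 : char0 K).
Variables (iota : {rmorphism O -> fps K n}) (cst : {rmorphism K -> O}) (kap : {rmorphism O -> K}).
Hypothesis inj : injective iota.
Hypothesis id_ : forall i x, iota (d i x) = fps_d i (iota x).
Hypothesis ic : forall a, iota (cst a) = @fps_const K n a.
Hypothesis kc : algebraic_point cst kap.
Variable la : 'I_n -> K.
Let Th := taylor_hom hd kap K0.

Definition directional x := \sum_l cst (la l) * d l x.
Let Dla (g : fps K n) := \sum_l @fps_const K n (la l) * fps_d l g.

Let hDla : derivation Dla.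
Proof.
split=> x y; rewrite /Dla.
  by rewrite -big_split; apply: eq_bigr => l _; rewrite fps_dD mulrDr.
rewrite mulr_suml mulr_sumr -big_split; apply: eq_bigr => l _.
by rewrite fps_dM mulrDr mulrA [@fps_const _ _ _ * (x * _)]mulrCA.
Qed.

Let ThD a x : fps_coef0 (iter a Dla (Th x)) = kap (iter a directional x).
Proof.
have -> : iter a Dla (Th x) = Th (iter a directional x).
  elim: a => //= a ->; rewrite /Dla /directional -[RHS]/(Th _) rmorph_sum; apply: eq_bigr => l _.
  by rewrite rmorphM (taylor_cst hd K0 inj id_ ic _ kc) /= taylor_d.
by rewrite /fps_coef0 /= taylor0.
Qed.

Lemma directional_neq0 a c : kap (iter a directional c) != 0 -> Th c != 0.
Proof.
apply: contraNneq => Thc; rewrite -ThD Thc.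
have -> : iter a Dla 0 = 0 by elim: a => //= k ->; exact: (der0 hDla).
by rewrite rmorph0.
Qed.

Lemma directional_vanish a c N S : Th N = Th c * S ->
  (forall b, (b <= a)%N -> kap (iter b directional c) = 0) -> kap (iter a directional N) = 0.
Proof.
move=> E h; rewrite -ThD E.
by apply: (leibniz_vanish (phi := @fps_coef0 K n)) => // b ba; rewrite [LHS]ThD h.
Qed.

End DirectionalTest.

(** * Polynomials with convergent coefficients and their evaluation *)

Section PolynomialEmbedding.
Variables (R : realType) (n : nat) (j : 'I_n.+1) (s : R).
Local Notation C := (R[i]).
Let u l : multinom n.+1 := mnm1 (lift j l).

Definition embed_chart l : fps C n.+1 := fps_X C (lift j l).

Let mexpE e : mexp u e = mins j 0 e.
Proof.
apply/mnmP => l; rewrite mexpE; case: (unliftP j l) => [l' ->|->].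
  rewrite mins_lift (bigD1 l') //= mnm1E eqxx muln1 big1 ?addn0 // => i il.
  by rewrite mnm1E (inj_eq (@lift_inj _ j)) (negbTE il) muln0.
rewrite mins_j big1 // => i _; rewrite mnm1E; case: eqP => [e'|]; last by rewrite muln0.
by have := neq_lift j i; rewrite e' eqxx.
Qed.

Lemma embed_chart0 l : embed_chart l mnm0 = 0. Proof. exact: fps_X_coef0. Qed.

Lemma poly_fpsC c : poly_fps j c%:P = fps_subst embed_chart c.
Proof.
have vu l : embed_chart l = fps_mono C (u l) by [].
have u0 l : u l != mnm0 by rewrite -mdeg_eq0 mdeg1.
have inj : injective (mexp u) by move=> a b; rewrite !mexpE => /mins_inj[].
apply/funext => m; rewrite /poly_fps /unpeel coefC; case: eqP => [xm|xm].
  have {2}-> : m = mexp u (mdel j m) by rewrite mexpE -{1}(mins_del j m) xm.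
  by rewrite (fps_subst_mexp vu u0 inj).
rewrite (fps_subst_out vu) // => e; apply/eqP => em; apply: xm.
by rewrite -em mexpE mins_j.
Qed.

(** The substitution carries the line through [v] to the line through [y], so both values are sums
    of the same one-variable series and nothing is rearranged. *)
Lemma ev_subst n1 n2 (w : 'I_n1 -> fps C n2) (v : 'I_n2 -> C) (y : 'I_n1 -> C) c :
  (forall i, w i mnm0 = 0) -> (forall i, fps_subst (line v) (w i) = line y i) ->
  ev v (fps_subst w c) = ev y c.
Proof.
move=> w0 wE; have E : line_hom v (fps_subst w c) = line_hom y c.
  rewrite /line_hom /=; congr (ser_map _ (peel _ _)).
  rewrite (fps_subst_comp (@C_char0 R) _ w0 (line0 v)); congr (fps_subst _ _).
  exact/funext.
by rewrite /ev E.
Qed.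

Lemma line_X n2 (v : 'I_n2 -> C) i : fps_subst (line v) (fps_X C i) = line v i.
Proof. exact: fps_substX (line0 v) i. Qed.

Lemma ev_embed (v : 'I_n.+1 -> C) (c : fps C n) : ev v (poly_fps j c%:P) = ev (fun l => v (lift j l)) c.
Proof. by rewrite poly_fpsC; apply: ev_subst embed_chart0 _ => i; rewrite line_X. Qed.

Lemma convM n' (rho : 'I_n' -> R) f g : f \in convergent rho -> g \in convergent rho -> f * g \in convergent rho.
Proof. by case: (convergent_subring rho) => _ _; apply. Qed.

Lemma convD n' (rho : 'I_n' -> R) f g : f \in convergent rho -> g \in convergent rho -> f + g \in convergent rho.
Proof.
case: (convergent_subring rho) => c1 cB _ hf hg; rewrite -[g]opprK -[- g]sub0r.
by apply: (cB) => //; apply: (cB) => //; rewrite -(subrr (1 : fps C n')); exact: cB.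
Qed.

Lemma conv_embed c : c \in convergent (fun=> s) -> poly_fps j c%:P \in convergent (fun=> s).
Proof.
move=> /convergentP hc; apply/convergentP => r hr.
have [|M hM] := hc (fun l => r (lift j l)); first by move=> l; exact: hr.
have r0 i : 0 <= r i by have /andP[/ltW] := hr i.
exists M; rewrite poly_fpsC; apply: norm_le_subst hM => // l.
exact: (norm_le_X r0).
Qed.

Local Notation A := (subring_of (conv_set (fun _ : 'I_n => s))).
Local Notation B := (subring_of (conv_set (fun _ : 'I_n.+1 => s))).
Let iA : {rmorphism A -> fps C n} := (val : A -> fps C n).
Let iB : {rmorphism B -> fps C n.+1} := (val : B -> fps C n.+1).

Lemma conv_poly (p : {poly A}) : poly_fps j (map_poly iA p) \in convergent (fun=> s).
Proof.
elim/poly_ind: p => [|p c IH].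
  rewrite rmorph0 -[0](rmorph0 (@polyC (fps C n))); apply: conv_embed.
  by rewrite -(rmorph0 (@fps_const C n)); exact: convergent_const.
have -> : map_poly iA (p * 'X + c%:P) = map_poly iA p * 'X + (iA c)%:P.
  by rewrite rmorphD rmorphM /= (map_polyX iA) (map_polyC iA).
rewrite (rmorphD (@poly_fps n j C)) (rmorphM (@poly_fps n j C)); apply: convD; last exact: conv_embed (valP c).
have X_in : poly_fps j ('X : {poly fps C n}) \in convergent (fun=> s) by rewrite poly_fps_X convergent_X.
exact: convM IH X_in.
Qed.

Let F (p : {poly A}) : B := exist _ (poly_fps j (map_poly iA p)) (conv_poly p).
Let G : {rmorphism {poly A} -> fps C n.+1} := @poly_fps n j C \o map_poly iA.
Let F_is_additive : additive F.
Proof. by move=> p q; apply: val_inj; exact: (rmorphB G). Qed.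
Let F_is_monoid : monoid_morphism F.
Proof. by split=> [|p q]; apply: val_inj; [exact: (rmorph1 G)|exact: (rmorphM G)]. Qed.
Definition conv_poly_fps : {rmorphism {poly A} -> B} := HB.pack F
  (GRing.isZmodMorphism.Build _ _ _ F_is_additive)
  (GRing.isMonoidMorphism.Build _ _ _ F_is_monoid).

Definition conv_d i (x : B) : B := exist _ (fps_d i (val x)) (convergent_d i (valP x)).

Lemma conv_d_derivation i : derivation (conv_d i).
Proof. by split=> x y; apply: val_inj; rewrite /= ?fps_dD ?fps_dM. Qed.

Lemma conv_d_poly p : conv_d j (conv_poly_fps p) = conv_poly_fps p^`().
Proof.
apply: val_inj; apply: etrans (poly_fps_d j _) _.
exact: (congr1 (@poly_fps n j C) (deriv_map iA p)).
Qed.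

Definition insert (y : 'I_n -> C) (z : C) i := if unlift j i is Some l then y l else z.

Lemma insert_lift y z l : insert y z (lift j l) = y l. Proof. by rewrite /insert liftK. Qed.
Lemma insert_j y z : insert y z j = z. Proof. by rewrite /insert unlift_none. Qed.

Section Point.
Variables (y : 'I_n -> C) (z : C).
Hypotheses (ys : forall l, modulus (y l) < s) (zs : modulus z < s).

Lemma insert_lt i : modulus (insert y z i) < s.
Proof. by rewrite /insert; case: (unlift j i). Qed.

Definition evA : {rmorphism A -> C} := conv_eval ys (iota := iA) (fun x => valP x).
Definition evB : {rmorphism B -> C} := conv_eval insert_lt (iota := iB) (fun x => valP x).

Lemma evAB p : evB (conv_poly_fps p) = (map_poly evA p).[z].
Proof.
elim/poly_ind: p => [|p c IH]; first by rewrite !rmorph0 horner0.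
rewrite (rmorphD conv_poly_fps) (rmorphM conv_poly_fps) (rmorphD evB) (rmorphM evB) IH.
rewrite (rmorphD (map_poly evA)) (rmorphM (map_poly evA)) /= (map_polyX evA) (map_polyC evA).
rewrite hornerMXaddC; congr (_ * _ + _).
  transitivity (ev (insert y z) (fps_X C j)); last by rewrite ev_X insert_j.
  rewrite -[LHS]/(ev _ (poly_fps j (map_poly iA 'X))); congr (ev _ _).
  by rewrite (map_polyX iA); exact: poly_fps_X.
rewrite -[LHS]/(ev _ (poly_fps j (map_poly iA c%:P))) (map_polyC iA) ev_embed.
rewrite -[RHS]/(ev y (iA c)); have -> : (fun l => insert y z (lift j l)) = y by apply/funext => l; exact: insert_lift.
by [].
Qed.

End Point.
End PolynomialEmbedding.

Section AnalyticPoints.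
Variables (R : realType) (n : nat) (O : comNzRingType) (d : 'I_n -> O -> O).
Local Notation C := (R[i]).
Hypothesis hd : dsystem d.
Variables (iota : {rmorphism O -> fps C n}) (w : O) (cst : {rmorphism C -> O}).
Hypothesis inj : injective iota.
Hypothesis id_ : forall i x, iota (d i x) = fps_d i (iota x).
Hypothesis ic : forall a, iota (cst a) = @fps_const C n a.
Variables (rho : 'I_n -> R) (del : R).
Hypotheses (del0 : 0 < del) (delr : forall i, del < rho i).
Hypothesis conv : forall x, iota x \in convergent rho.

Definition analytic_point (kap : {rmorphism O -> C}) : Prop :=
  exists2 u, forall i, modulus (u i) < del & forall x, kap x = ev u (iota x).

Lemma analytic_point_exists u : (forall i, modulus (u i) < del) ->
  exists2 kap, analytic_point kap & forall x, kap x = ev u (iota x).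
Proof.
move=> ud; have ur i : modulus (u i) < rho i by exact: lt_trans (delr i).
by exists (conv_eval ur conv) => //; exists u.
Qed.

Lemma analytic_points_dense : iota w != 0 -> points_dense iota w analytic_point.
Proof.
move=> w0 s s0; apply: contrapT => no; have : iota (w * s) = 0.
  apply: (convergent_zero del0 delr (conv _)) => h hd'.
  have [kap pk kE] := analytic_point_exists hd'; rewrite -kE; apply/eqP; apply: contrapT => /negP k0.
  by apply: no; exists kap.
by move/eqP; rewrite rmorphM mulf_eq0 (negbTE w0) (negbTE s0).
Qed.

Lemma analytic_algebraic kap : analytic_point kap -> algebraic_point cst kap.
Proof. by move=> [u _ kE] a; rewrite kE ic ev_const. Qed.

End AnalyticPoints.

(** The scheme is that of [algebraic_points_divide], but the roots z of [P] are taken over each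
    actual point y near the origin, where (y, z) is an actual point for the hypothesis. This
    requires the series of the division to converge; the remainder is zero because its values at all
    such y are. *)
Lemma analytic_points_divide (R : realType) n (O : comNzRingType) (d : 'I_n -> O -> O)
    (hd : dsystem d) (iota : {rmorphism O -> fps R[i] n}) (w : O) (cst : {rmorphism R[i] -> O})
    (rho : 'I_n -> R) (del : R) :
  injective iota -> (forall i x, iota (d i x) = fps_d i (iota x)) ->
  (forall a, iota (cst a) = @fps_const R[i] n a) ->
  0 < del -> (forall i, del < rho i) -> (forall x, iota x \in convergent rho) ->
  points_divide hd (@C_char0 R) iota w (analytic_point iota del).
Proof.
move=> inj id_ ic del0 delr conv; case: n d hd iota inj id_ ic rho delr conv => [|n] d hd iota inj id_ ic rho delr conv.
  exact: fps0_divide.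
set K0 := @C_char0 R; move=> c N c0 hdiv; pose j : 'I_n.+1 := ord0.
have [la [m [u [lj u0 clow]]]] := shear_regular K0 j c0.
have s0 := shear_coef0 j la; pose psi := fps_subst_hom s0.
set c1 := _ * _ in clow.
have [P [q [Pm Psz PE q0]]] := weierstrass_polynomial clow.
(* The unit [q] is inverted by a Weierstrass division with e = 0, so that [germ_division] also gives
   convergence of its inverse. *)
have qlow : wlow j 0 1 (q - fps_X R[i] j ^+ 0).
  move=> e; rewrite ltnS leqn0 /wdeg mul1n addn_eq0 mdeg_eq0 => /andP[/eqP e1 /eqP e2].
  have -> : e = mnm0 by rewrite -(mins_del j e) e1 e2 mins00.
  by rewrite expr0 fpsBE q0 fps1E eqxx subrr.
have [V [r0 [VE sr0]]] := weierstrass_division qlow 1.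
have qV : q * V = 1.
  by rewrite VE; move: sr0; rewrite leqn0 size_poly_eq0 => /eqP ->; rewrite rmorph0 addr0.
have c1P : c1 = poly_fps j P * V by rewrite PE -mulrA qV mulr1.
have [q1 [r [E sr]]] := weierstrass_division clow (psi (iota w) ^+ m * psi (iota N)).
pose SL := \sum_l modulus (la l).
have SL0 : 0 <= SL by apply: sumr_ge0 => l _; exact: modulus_ge0.
(* The shear maps the polydisc of radius [t] into that of radius [del], where the elements of [O]
   converge. *)
pose t := del / (2 * (1 + SL)); have t0 : 0 < t by rewrite divr_gt0 // mulr_gt0 //; lra.
have tla l : t + modulus (la l) * t < del.
  have h : modulus (la l) <= SL by rewrite /SL (bigD1 l) //= lerDl sumr_ge0 // => i _; exact: modulus_ge0.
  have tE : t * (2 * (1 + SL)) = del by rewrite divfK // gt_eqF // mulr_gt0 //; lra.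
  by rewrite -tE; clearbody t SL; nra.
have shear_norm l : norm_le (fun=> t) (shear j la l) (t + modulus (la l) * t).
  have t0' : forall i : 'I_n.+1, 0 <= t by move=> _; exact: ltW.
  apply: norm_leD => //; last first.
    by apply: norm_leM => //; [exact: norm_le_const|exact: (@norm_le_X _ _ (fun=> t))].
  case: eqP => _; last exact: (@norm_le_X _ _ (fun=> t)).
  rewrite -(rmorph0 (@fps_const R[i] n.+1)); apply: norm_le_trans (norm_le_const _ _) => //.
  by rewrite modulus0 ltW.
have gpsi x : germ (psi (iota x)).
  have /convergentP /(_ (fun l => (del + rho l) / 2))[|M hM] := conv x.
    by move=> l; have := delr l; lra.
  exists t => //; exists M; apply: (norm_le_subst (rho := fun l => (del + rho l) / 2)) hM => //.
    by move=> _; exact: ltW.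
  move=> l; apply: norm_le_trans (shear_norm l); have := tla l; have := delr l; lra.
have gc1 : germ c1 by apply: germM (germ_const _ _) (gpsi c).
have gq : germ q.
  have gE : fps_X R[i] j ^+ m = c1 * q + poly_fps j ('X^m - P).
    by rewrite -PE rmorphB rmorphXn -(poly_fps_X _ j) addrC subrK.
  have sE : (size ('X^m - P)%R <= m)%N.
    apply/leq_sizeP => i; rewrite leq_eqVlt coefB coefXn => /orP[/eqP <-|mi].
      by rewrite eqxx (_ : P`_m = 1) ?subrr // -(monicP Pm) lead_coefE Psz.
    by rewrite gtn_eqF // nth_default ?subrr // Psz.
  exact: (germ_division gc1 (germX m (germ_X _ j)) clow gE sE).
have gV : germ V := germ_division gq (germ1 _ _) qlow VE sr0.
have gq1 : germ q1 := germ_division gc1 (germM (germX _ (gpsi w)) (gpsi N)) clow E sr.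
have gP i : germ P`_i by apply: (@germ_coef _ _ j); rewrite PE; exact: germM.
have gr i : germ r`_i.
  apply: (@germ_coef _ _ j); rewrite (_ : poly_fps j r = psi (iota w) ^+ m * psi (iota N) - c1 * q1).
    by apply: germB; [apply: germM (gpsi N); exact: germX|exact: germM].
  by rewrite E addrC addKr.
have P0 i : (i < m)%N -> P`_i mnm0 = 0.
  move=> im; rewrite -(peel_poly_fps j P i) PE.
  have c1m : wlow j m m c1.
    rewrite -(subrK (fps_X R[i] j ^+ m) c1); apply: wlowD; first exact: wlow_le clow.
    move=> e em; have -> : fps_X R[i] j ^+ m = fps_mono R[i] (mnm_muln (mnm1 j) m) by rewrite -fps_monoX.
    rewrite /fps_mono; case: eqP => // ee; move: em; rewrite ee /wdeg mulmnE mnm1E eqxx mul1n.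
    by rewrite ltnNge leq_addl.
  have := @wlowM _ _ j m m 0 c1 q c1m; rewrite addn0; apply; first by [].
  by rewrite wdeg_mins mdeg0 muln0.
have [s2 /andP[s20 s2t] hs2] := @germs_common R n.+1 [:: c1; q; V; q1; psi (iota w); psi (iota N)] (Num.min t 1)
  ltac:(by rewrite lt_min t0 ltr01) ltac:(by move=> f; rewrite !inE => /or4P[/eqP->|/eqP->|/eqP->|/or3P[/eqP->|/eqP->|/eqP->]]).
have [s /andP[sp ss2] hs] := @germs_common R n (polyseq P ++ polyseq r) s2 s20
  ltac:(by move=> f; rewrite mem_cat => /orP[/(nthP 0)[i _ <-]|/(nthP 0)[i _ <-]]).
have st : s <= t by apply: le_trans ss2 (le_trans s2t _); rewrite ge_min lexx.
have s1 : s <= 1 by apply: le_trans ss2 (le_trans s2t _); rewrite ge_min lexx orbT.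
pose A := subring_of (conv_set (fun _ : 'I_n => s)); pose B := subring_of (conv_set (fun _ : 'I_n.+1 => s)).
pose iA : {rmorphism A -> fps R[i] n} := (val : A -> fps R[i] n).
pose iB : {rmorphism B -> fps R[i] n.+1} := (val : B -> fps R[i] n.+1).
have toB f : f \in [:: c1; q; V; q1; psi (iota w); psi (iota N)] -> {x : B | iB x = f}.
  move=> fl; suff fB : f \in convergent (fun=> s) by exists (exist _ f fB).
  by apply: (convergent_le (rho := fun=> s2)) (hs2 f fl).
have [c1B c1BE] := toB c1 ltac:(by rewrite !inE eqxx).
have [qB qBE] := toB q ltac:(by rewrite !inE eqxx ?orbT).
have [VB VBE] := toB V ltac:(by rewrite !inE eqxx ?orbT).
have [q1B q1BE] := toB q1 ltac:(by rewrite !inE eqxx ?orbT).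
have [wB wBE] := toB (psi (iota w)) ltac:(by rewrite !inE eqxx ?orbT).
have [NB NBE] := toB (psi (iota N)) ltac:(by rewrite !inE eqxx ?orbT).
have toA f : f \in polyseq P ++ polyseq r -> exists x : A, iA x = f.
  by move=> fl; exists (exist _ f (hs f fl)).
have lift0 (p : {poly fps R[i] n}) : {subset polyseq p <= polyseq P ++ polyseq r} -> exists pA, map_poly iA pA = p.
  move=> sub; apply: poly_lift => i; have [ip|ip] := ltnP i (size p); first by apply/toA/sub/mem_nth.
  by exists 0; rewrite rmorph0 nth_default.
have [PA PAE] := lift0 P ltac:(by move=> f fp; rewrite mem_cat fp).
have [rA rAE] := lift0 r ltac:(by move=> f fp; rewrite mem_cat fp orbT).
pose pf := conv_poly_fps j s; pose D := conv_d (R := R) (s := s) j.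
have iB_inj : injective iB by exact: val_inj.
have pfE p : iB (pf p) = poly_fps j (map_poly iA p) by [].
have PB : pf PA = c1B * qB by apply: iB_inj; rewrite pfE PAE PE rmorphM c1BE qBE.
have cB : c1B = pf PA * VB by apply: iB_inj; rewrite rmorphM pfE PAE VBE c1BE.
have EB : wB ^+ m * NB = c1B * q1B + pf rA.
  by apply: iB_inj; rewrite rmorphD !rmorphM rmorphXn pfE rAE wBE NBE c1BE q1BE.
have hD : derivation D by exact: conv_d_derivation.
have Dpf p : D (pf p) = pf p^`() by exact: conv_d_poly.
pose dla := directional d cst la.
have Dpsi x : fps_d j (psi (iota x)) = psi (iota (dla x)).
  pose ps : {rmorphism O -> fps R[i] n.+1} := psi \o iota.
  transitivity (\sum_l ps (cst (la l)) * ps (d l x)).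
    rewrite /= fps_subst_d //; apply: eq_bigr => l _.
    by rewrite shear_d ic id_ fps_substC // mulrC.
  by rewrite -[RHS]/(ps (dla x)) rmorph_sum; apply: eq_bigr => l _; rewrite rmorphM.
have iterD a x xB : iB xB = psi (iota x) -> iB (iter a D xB) = psi (iota (iter a dla x)).
  by move=> xE; elim: a => [//|a IH]; rewrite !iterS -Dpsi -IH.
have iA_inj : injective iA by exact: val_inj.
have PAm : PA \is monic.
  by rewrite monicE; apply/eqP/iA_inj; rewrite -(lead_coef_map_inj iA_inj) ?rmorph0 // PAE (monicP Pm) rmorph1.
have PAs : size PA = m.+1 by rewrite -Psz -PAE (size_map_inj_poly iA_inj) ?rmorph0.
have rAs : (size rA <= m)%N by rewrite -(size_map_inj_poly iA_inj) ?rmorph0 // rAE.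
pose eta := s ^+ m / m.+1%:R; have eta0 : 0 < eta by rewrite divr_gt0 ?exprn_gt0.
have etam : eta * m%:R <= s ^+ m.
  by rewrite /eta mulrAC ler_pdivrMr // ler_pM2l ?exprn_gt0 // ler_nat.
(* Over base points of radius [x] the lower coefficients of [P] stay below [eta], and [root_small]
   then keeps all roots inside the polydisc of radius [s]. *)
have [x x0 [xs xP]] : exists2 x : R, 0 < x & x < s /\ forall i : 'I_m, forall y : 'I_n -> R[i],
    (forall l, modulus (y l) < x) -> modulus (ev y P`_i) < eta.
  have /choice [xs xsP] (i : 'I_m) : exists x : R, 0 < x /\ forall y : 'I_n -> R[i],
      (forall l, modulus (y l) <= x) -> modulus (ev y P`_i) < eta.
    by have [x x0 H] := ev_small (gP i) (P0 i (ltn_ord i)) eta0; exists x.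
  have [x x0 hx] := common_bound (fun i => (xsP i).1) (fun i => (xsP i).1).
  exists (Num.min x (s / 2)); first by rewrite lt_min x0 divr_gt0.
  split; first by rewrite gt_min; apply/orP; right; rewrite ltr_pdivrMr // mulr_natr mulr2n ltrDl.
  move=> i y hy; apply: (xsP i).2 => l; apply: le_trans (ltW (hy l)) _.
  by rewrite ge_min (ltW (hx i).1).
have r0E : r = 0.
  apply/polyP => i; rewrite coef0.
  have ri : r`_i \in convergent (fun=> s).
    by rewrite -rAE (@coef_map _ _ iA); exact: (valP rA`_i).
  apply: (convergent_zero x0 (fun=> xs) ri) => y yx.
  have ys l : modulus (y l) < s := lt_trans (yx l) xs.
  pose eA := evA ys.
  have eAE p i0 : (map_poly eA p)`_i0 = ev y (map_poly iA p)`_i0.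
    by rewrite (@coef_map _ _ eA) (@coef_map _ _ iA).
  suff h : map_poly eA rA = 0 by rewrite -rAE -eAE h coef0.
  have [sq sqE] := closed_poly_roots (monic_map eA PAm).
  have sz : size sq = m.
    by have := congr1 (fun p : {poly R[i]} => size p) sqE; rewrite size_prod_XsubC size_map_monic // PAs => -[].
  suff h : \prod_(z <- sq) ('X - z%:P) %| map_poly eA rA.
    apply: contraTeq h => h; rewrite gtNdvdp // size_prod_XsubC sz ltnS.
    exact: leq_trans (size_poly _ _) rAs.
  apply: count_dvdp => z zs.
  have zsm : modulus z < s.
    apply: (@root_small _ (map_poly eA PA) m s eta) => //; first exact: monic_map.
    - by rewrite size_map_monic.
    - by rewrite sqE root_prod_XsubC.
    - by move=> i0 im; rewrite eAE PAE; exact: (xP (Ordinal im) y yx).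
  pose v := insert j y z; pose J := evB j ys zsm.
  have JE p : J (pf p) = (map_poly eA p).[z] by exact: evAB.
  (* The image of the point (y, z) under the shear, at which the elements of [O] are evaluated. *)
  pose uu l := (if l == j then 0 else v l) + la l * v j.
  have vs l : modulus (v l) < s := insert_lt j ys zsm l.
  have ud l : modulus (uu l) < del.
    apply: le_lt_trans (modulusD _ _) _; apply: le_lt_trans _ (tla l); rewrite modulusM lerD //.
      case: eqP => _; first by rewrite modulus0 ltW.
      exact: le_trans (ltW (vs l)) st.
    by rewrite ler_wpM2l ?modulus_ge0 //; exact: le_trans (ltW (vs j)) st.
  have [kap pk kE] := analytic_point_exists delr conv ud.
  have evpsi y0 : ev v (psi (iota y0)) = kap y0.
    rewrite kE; apply: (ev_subst (w := shear j la)) => // l.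
    rewrite /shear -[LHS]/(fps_subst_hom (line0 v) _) rmorphD rmorphM.
    rewrite [fps_subst_hom _ (fps_const _)](fps_substC (line0 v)) [fps_subst_hom _ (fps_X _ j)](line_X v j).
    rewrite /line /uu (rmorphD (@fps_const R[i] 1)) (rmorphM (@fps_const R[i] 1)) mulrDl mulrA; congr (_ + _).
    by case: eqP => _; [rewrite (rmorph0 (@fps_const R[i] 1)) mul0r; exact: (rmorph0 (fps_subst_hom _))|exact: line_X].
  have Jpsi a y0 yB : iB yB = psi (iota y0) -> J (iter a D yB) = kap (iter a dla y0).
    by move=> yE; rewrite -evpsi -(iterD a y0 yB yE).
  have ck : algebraic_point cst kap by exact: (analytic_algebraic ic pk).
  have c1psi : iB c1B = psi (iota (cst u * c)).
    by rewrite c1BE rmorphM rmorphM ic /c1; congr (_ * _); rewrite /= fps_substC.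
  have iterc b : iter b dla (cst u * c) = cst u * iter b dla c.
    elim: b => [//|b IH]; rewrite !iterS IH /dla /directional mulr_sumr; apply: eq_bigr => l _.
    by rewrite (derM (hd.1 l)) (cst_d inj id_ ic) mul0r add0r mulrCA.
  have Jc b : J (iter b D c1B) = u * kap (iter b dla c).
    by rewrite (Jpsi b _ _ c1psi) iterc rmorphM ck.
  have EB' : wB ^+ size sq * NB = c1B * q1B + pf rA by rewrite sz.
  apply: (root_test_dvd hD Dpf K0 sqE JE cB EB').
  have [kw|kw] := eqVneq (kap w) 0; first by left; rewrite -kw -(Jpsi 0%N w wB).
  right=> a ha; rewrite (Jpsi a N NB) //.
  have [a' Ja'] := root_test_nonzero hD Dpf K0 sqE JE PB.
  have Thc : taylor_hom hd kap K0 c != 0.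
    apply: (directional_neq0 hd K0 inj id_ ic ck (la := la) (a := a')).
    by apply: contraNneq Ja' => e; rewrite Jc e mulr0.
  have [S SE] := hdiv kap pk kw Thc.
  apply: (directional_vanish inj id_ ic ck SE) => b ba.
  have := root_test_vanish hD Dpf sqE JE cB (leq_ltn_trans ba ha).
  by rewrite Jc => /eqP; rewrite mulf_eq0 (negbTE u0) => /eqP.
have [v v0 vK] := shearK K0 lj.
exists m, (@fps_const R[i] n.+1 u * fps_subst v q1).
have vM a b : fps_subst v (a * b) = fps_subst v a * fps_subst v b by exact: (rmorphM (fps_subst_hom v0)).
have vX a e : fps_subst v (a ^+ e) = fps_subst v a ^+ e by exact: (rmorphXn (fps_subst_hom v0)).
have pK a : fps_subst v (psi a) = a := (vK a).1.
have E1 : iota w ^+ m * iota N = fps_subst v c1 * fps_subst v q1.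
  rewrite -(pK (iota w)) -(pK (iota N)) -vX -!vM; congr (fps_subst v _).
  by rewrite E r0E (rmorph0 (@poly_fps n j R[i])) addr0.
have E2 : fps_subst v c1 = @fps_const R[i] n.+1 u * iota c.
  by rewrite /c1 vM (fps_substC v0) -[fps_subst (shear j la) (iota c)]/(psi (iota c)) pK.
by rewrite rmorphM rmorphXn E1 E2 mulrA (mulrC (iota c)).
Qed.

Section RootComponentNorm.
Variables (R : realType) (r q k : nat).
Local Notation C := (R[i]).
Local Notation n := (r + q + k.-1)%N.

(** For s <= 1 the substitution w -> w^p does not leave the polydisc, and taking a homogeneous part
    only drops terms. *)
Lemma norm_le_root (s : R) m (f : fps C n) M : 0 <= s -> s <= 1 ->
  norm_le (fun=> s) f M -> norm_le (fun=> s) (@root_component C r q k m f) M.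
Proof.
move=> s0 s1 hf; have p0 := puiseux_index_gt0 k; set p := puiseux_index k in p0.
have sp : s ^+ p <= s by rewrite -{2}(expr1 s) ler_wiXn2l.
apply: (norm_le_dom (fun=> s0) (g := fps_subst (@root_chart C r q k p) f)).
  by move=> d; rewrite /root_component /xhom; case: ifP => _ //; rewrite modulus0 modulus_ge0.
apply: (norm_le_subst (rho := fun l : 'I_n => if (l < r)%N then s ^+ p else s)) => //.
  move=> l; rewrite /root_chart; case: ifP => _; last exact: (norm_le_X (fun=> s0)).
  by apply: norm_leX => //; exact: (norm_le_X (fun=> s0)).
by apply: norm_le_radius hf => l; case: ifP => _; rewrite ?exprn_ge0 ?s0 ?lexx.
Qed.

Lemma convergent_root (s : R) m (f : fps C n) : s <= 1 ->
  f \in convergent (fun=> s) -> @root_component C r q k m f \in convergent (fun=> s).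
Proof.
move=> s1 /convergentP hf; apply/convergentP => rho hr.
(* Without coordinates there is no largest radius, and a series is its constant term. *)
case: (posnP n) => n0.
  exists (modulus (@root_component C r q k m f mnm0)) => t ut.
  apply: (@le_trans _ _ (\sum_(d <- [:: mnm0]) modulus (@root_component C r q k m f d) * monval rho d)).
    apply: sum_uniq_le => // [d _|d]; last first.
      by rewrite mulr_ge0 ?modulus_ge0 ?monval_ge0 // => i; have /andP[/ltW] := hr i.
    by rewrite inE; apply/eqP/mnmP => i; have := ltn_ord i; lia.
  by rewrite big_seq1 monval0 mulr1.
(* The estimate for w -> w^p is made with equal radii, so [rho] is enlarged to its maximum, which is
   still below [s]. *)
pose l0 := Ordinal n0; pose t := \big[Num.max/rho l0]_l rho l.
have rt l : rho l <= t by rewrite /t; exact: le_bigmax_cond.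
have ts : t < s by apply: bigmax_lt => [|l _]; [have /andP[_] := hr l0|have /andP[_] := hr l].
have t0 : 0 < t by apply: lt_le_trans (rt l0); have /andP[] := hr l0.
have [|M hM] := hf (fun=> t); first by move=> _; rewrite t0.
exists M; apply: (norm_le_radius (rho := fun=> t)).
  by move=> l; rewrite rt andbT ltW //; have /andP[] := hr l.
by apply: norm_le_root => //; [exact: ltW|rewrite ltW // (lt_le_trans ts)].
Qed.

End RootComponentNorm.

Lemma geometric_small (R : realType) (M e : R) : 0 < e -> exists N, M * (2 / 3) ^+ N < e.
Proof.
move=> e0; have [K hK] := @power_bernoulli R (2 / 3) 1 ltac:(lra) ltac:(lra).
have M0 := normr_ge0 M.
pose b := `|M| * `|K| / e; have b0 : 0 <= b by rewrite divr_ge0 ?mulr_ge0 ?normr_ge0 // ltW.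
exists (Num.bound b); set N := Num.bound b; have := archi_boundP b0; rewrite -/N => bN.
have h := hK N; rewrite expr1n mulr1 in h.
have x0 : 0 <= (2 / 3 : R) ^+ N by rewrite exprn_ge0 //; lra.
have KK := ler_norm K; have MM := ler_norm M.
have N0 : 0 < N.+1%:R :> R by rewrite ltr0n.
have bN' : `|M| * `|K| < e * N.+1%:R.
  have : b * e < N.+1%:R * e by rewrite ltr_pM2r // (lt_le_trans bN) // ler_nat leqnSn.
  by rewrite /b divfK ?gt_eqF // (mulrC e).
have h1 : `|M| * (N.+1%:R * (2 / 3) ^+ N) <= `|M| * `|K|.
  by apply: ler_wpM2l => //; exact: le_trans h KK.
have h2 : N.+1%:R * (M * (2 / 3) ^+ N) <= `|M| * (N.+1%:R * (2 / 3) ^+ N).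
  by rewrite mulrCA ler_wpM2r // mulr_ge0 // ltW.
have : N.+1%:R * (M * (2 / 3) ^+ N) < N.+1%:R * e by rewrite (mulrC _ e); lra.
by rewrite ltr_pM2l.
Qed.

Lemma expansion_limit (K : numFieldType) n (p : 'rV[K]_n) (g : 'rV[K]_n -> K) (c : fps K n) :
  analytic_expansion p g c -> exists2 e : K, 0 < e &
  (exists M : K, forall N : nat, \sum_(m : bmultinom n N) `|c m| * e ^+ mdeg m <= M) /\
  forall h : 'rV[K]_n, (forall i, `|h 0 i| < e) -> forall t : K, 0 < t -> exists N0, forall N, (N0 <= N)%N ->
    `|g (p + h) - \sum_(m : bmultinom n N) c m * \prod_i h 0 i ^+ m i| < t.
Proof.
move=> [e e0 [hM hg]]; exists e => //; split=> // h hh t t0.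
by have [N0 _ H] := (cvgrPdist_lt _ _).1 (hg _ hh) _ t0; exists N0 => N NN; exact: H.
Qed.

Lemma open_polydisc_num (K : numFieldType) n (V : set 'rV[K]_n) : open_nbhd0 V ->
  exists2 e : K, 0 < e & forall v : 'rV[K]_n, (forall l, `|v 0 l| < e) -> V v.
Proof.
move=> [Vo V0]; have : nbhs (0 : 'rV[K]_n) V by apply: open_nbhs_nbhs.
move=> /nbhs_ballP[e e0 hV]; exists e => // v hv; apply: hV; split=> // i j.
by rewrite (ord1 i) mxE /ball /= sub0r normrN.
Qed.

(** A positive element of [R[i]] is real; this turns the radius and the bound of
    [analytic_expansion] into real ones. *)
Lemma expansion_ev (R : realType) n (p : 'rV[R[i]]_n) (g : 'rV[R[i]]_n -> R[i]) (c : fps R[i] n) :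
  analytic_expansion p g c -> exists2 e : R, 0 < e &
  (exists M, norm_le (fun=> e) c M) /\
  forall h : 'I_n -> R[i], (forall l, modulus (h l) < e) -> ev h c = g (p + \row_l h l).
Proof.
move=> /expansion_limit[eC eC0 [[MC hM] hg]].
have eE : eC = (complex.Re eC)%:C%C.
  by move: eC0; rewrite ltcE /=; case: (eC) => a b /= /andP[/eqP -> _].
have e0 : 0 < complex.Re eC by move: eC0; rewrite eE (ltcR 0).
set e := complex.Re eC in eE e0; exists e => //; split.
  exists (complex.Re MC) => s us; pose b := (\max_(m <- s) mdeg m).+1.
  apply: (@le_trans _ _ (\sum_(m <- bounded_multinoms n b) modulus (c m) * monval (fun=> e) m)).
    apply: sum_uniq_le => // [|m]; first exact: sub_bounded_multinoms.
    by rewrite mulr_ge0 ?modulus_ge0 // monval_ge0 // => _; exact: ltW.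
  have := hM b; rewrite (_ : \sum_m _ = (\sum_(m <- bounded_multinoms n b) modulus (c m) * monval (fun=> e) m)%:C%C).
    by rewrite lecE /= => /andP[_].
  rewrite /bounded_multinoms big_map (rmorph_sum (real_complex R)); apply: eq_bigr => m _.
  rewrite [LHS]/= modulusE eE -(rmorphXn (real_complex R)) -[RHS]/(real_complex R _) (rmorphM (real_complex R)).
  by congr (_ * real_complex R _); rewrite mdegE -prodrXr.
move=> h he; apply: ev_eq => t t0.
have hh : forall i, `|(\row_l h l) 0 i| < eC by move=> i; rewrite mxE modulusE eE ltcR.
have tC : (0 : R[i]) < t%:C%C by rewrite (ltcR 0).
have [N0 H] := hg _ hh _ tC.
exists N0 => N NN; have := H N NN; rewrite /= modulusE ltcR line_partial; congr (_ < t).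
rewrite -modulusN opprB; congr (modulus (_ - _)); rewrite /bounded_multinoms big_map; apply: eq_bigr => m _.
by congr (_ * _); apply: eq_bigr => i _; rewrite mxE.
Qed.

Lemma open_polydisc (R : realType) n (V : set 'rV[R[i]]_n) : open_nbhd0 V ->
  exists2 e : R, 0 < e & forall v : 'rV[R[i]]_n, (forall l, modulus (v 0 l) < e) -> V v.
Proof.
move=> /open_polydisc_num[eC eC0 hV].
have eE : eC = (complex.Re eC)%:C%C.
  by move: eC0; rewrite ltcE /=; case: (eC) => a b /= /andP[/eqP -> _].
exists (complex.Re eC); first by move: eC0; rewrite {1}eE (ltcR 0).
by move=> v hv; apply: hV => l; rewrite modulusE eE ltcR; exact: hv.
Qed.

Section AnalyticInstance.
Variables (R : realType) (r q k : nat).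
Local Notation C := (R[i]).
Local Notation n := (r + q + k.-1)%N.
Variable e : R.
Hypotheses (e0 : 0 < e) (e1 : e <= 1).
Let half_gt0 : 0 < e / 2. Proof. by move: e0; lra. Qed.
Let half_ltx (x : R) : 0 < x -> x / 2 < x. Proof. lra. Qed.
Let ltr_room (m x y : R) : x <= y -> y < e - m -> m + x < e. Proof. lra. Qed.
Let half_le1 : e / 2 <= 1. Proof. by move: e0 e1; lra. Qed.
Let half_lt : e / 2 < e. Proof. by move: e0; lra. Qed.
Let S := conv_set (fun _ : 'I_n => e).
Local Notation O := (subring_of S).
Let K0 := @C_char0 R.

Let S_const c : @fps_const C n c \in subring_pred S. Proof. exact: convergent_const. Qed.
Let S_X i : fps_X C i \in subring_pred S. Proof. exact: convergent_X. Qed.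
Let S_d i f : f \in subring_pred S -> fps_d i f \in subring_pred S. Proof. exact: convergent_d. Qed.
Let S_root m f : f \in subring_pred S -> @root_component C r q k m f \in subring_pred S.
Proof. exact: convergent_root. Qed.
Let iota : {rmorphism O -> fps C n} := (val : O -> fps C n).
Let cst := sub_cst S_const.
Let hd := sub_dsystem S_d.

Let low_part (f : O) N : O := \sum_(m <- bounded_multinoms n N) cst (val f m) * \prod_l sub_X S_X l ^+ m l.

Let low_partE f N d : iota (low_part f N) d = if (mdeg d < N)%N then val f d else 0.
Proof.
rewrite (rmorph_sum iota) fps_sumE.
have term m : iota (cst (val f m) * \prod_l sub_X S_X l ^+ m l) d = if d == m then val f m else 0.
  rewrite (rmorphM iota) [iota (cst _)]/(@fps_const C n _) fps_constM (rmorph_prod iota).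
  have -> : \prod_l iota (sub_X S_X l ^+ m l) = fps_mono C m.
    rewrite fps_monoE mpolyXE_id (rmorph_prod (@mp_fps C n)); apply: eq_bigr => l _.
    rewrite (rmorphXn iota) [RHS](rmorphXn (@mp_fps C n)); congr (_ ^+ _); exact/esym/mp_fpsX.
  by rewrite /fps_mono; case: eqP => _; rewrite ?mulr1 ?mulr0.
rewrite (eq_bigr (fun m => if d == m then val f m else 0)) => [|m _]; last exact: term.
have [dN|dN] := ltnP (mdeg d) N.
  rewrite (bigD1_seq d) ?bounded_multinoms_uniq ?mem_bounded_multinoms //= eqxx big1 ?addr0 // => m.
  by rewrite eq_sym => /negbTE ->.
rewrite big_seq big1 // => m; rewrite mem_bounded_multinoms; case: eqP => // <-.
by rewrite ltnNge dN.
Qed.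

(** Below [kap] only the values at constants and coordinates are explicit, which settles the case of
    polynomials. The remainders of the truncations have values tending to zero on both sides. *)
Lemma below_ev (kap : {rmorphism O -> C}) (u : 'I_n -> C) (x : O) :
  (forall l, modulus (u l) < e / 2) -> (forall y, kap y = ev u (iota y)) ->
  (forall l, modulus (below S_root kap (sub_X S_X l)) < e / 2) /\
  below S_root kap x = ev (fun l => below S_root kap (sub_X S_X l)) (iota x).
Proof.
move=> ue kE; set kap' := below S_root kap; pose v l := kap' (sub_X S_X l).
have kX l : kap (sub_X S_X l) = u l by rewrite kE /= ev_X.
have ve l : modulus (v l) < e / 2.
  rewrite /v /kap' below_X kX; case: ifP => _; first by rewrite modulus0 divr_gt0.
  case: ifP => _ //; rewrite modulusX; apply: le_lt_trans (ue l).
  rewrite -{2}(expr1 (modulus _)) ler_wiXn2l ?modulus_ge0 ?puiseux_index_gt0 //.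
  by rewrite ltW // (lt_le_trans (ue l)).
split=> //.
have ve' l : modulus (v l) < e by exact: lt_trans (ve l) half_lt.
pose E := conv_eval ve' (iota := iota) (fun y => valP y).
rewrite -[RHS]/(E x).
have /convergentP /(_ (fun=> 3 / 4 * e))[|M hM] := valP x; first by move=> _; move: e0; lra.
have lowE N : kap' (low_part x N) = E (low_part x N).
  rewrite /low_part !rmorph_sum; apply: eq_bigr => m _; rewrite !rmorphM !rmorph_prod; congr (_ * _).
    have Ec a : E (cst a) = a by rewrite conv_evalE [iota (cst a)]/(@fps_const C n a) ev_const.
    by rewrite Ec [LHS]below_const // kE [iota _]/(@fps_const C n _) ev_const.
  by apply: eq_bigr => l _; rewrite !rmorphXn conv_evalE [iota (sub_X S_X l)]/(fps_X C l) ev_X.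
(* The points have radius e/2 while the series is bounded at radius 3e/4; terms of degree at least N
   gain the factor (2/3)^N. *)
have tailN N : norm_le (fun=> e / 2) (iota (x - low_part x N)) (M * (2 / 3) ^+ N).
  have h34 : 0 <= 3 / 4 * e by move: e0; lra.
  move=> t ut; have x0 : 0 <= (2 / 3) ^+ N :> R by rewrite exprn_ge0 //; lra.
  apply: (@le_trans _ _ ((2 / 3) ^+ N * \sum_(m <- t) modulus (\val x m) * monval (fun=> 3 / 4 * e) m)); last first.
    by rewrite [leRHS]mulrC; apply: ler_wpM2l => //; exact: hM.
  rewrite mulr_sumr; apply: ler_sum => m _; rewrite (rmorphB iota) fpsBE low_partE mulrCA.
  have mE (b : R) : monval (fun=> b) m = b ^+ mdeg m by rewrite mdegE -prodrXr.
  case: ltnP => mN.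
    by rewrite subrr modulus0 mul0r mulr_ge0 ?modulus_ge0 // mulr_ge0 ?exprn_ge0 ?monval_ge0.
  rewrite subr0 ler_wpM2l ?modulus_ge0 // !mE (_ : e / 2 = 2 / 3 * (3 / 4 * e)); last by field.
  rewrite exprMn ler_wpM2r ?exprn_ge0 // ler_wiXn2l //; lra.
apply/eqP; rewrite -subr_eq0; apply/eqP/modulus_eps => t t0.
have [N hN] := geometric_small (M + M) t0; apply: le_lt_trans hN.
have -> : kap' x - E x = kap' (x - low_part x N) - E (x - low_part x N).
  by rewrite (rmorphB kap') (rmorphB E) lowE opprB addrA subrK.
apply: le_trans (modulusD _ _) _; rewrite modulusN mulrDl lerD //.
  rewrite /kap' /below /= kE; apply: (ev_modulus (rho := fun=> e / 2)); first by move=> l; exact: ltW.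
  exact: norm_le_root (ltW half_gt0) half_le1 (tailN N).
by rewrite conv_evalE; apply: (ev_modulus (rho := fun=> e / 2)) (tailN N) => l; exact: ltW.
Qed.

Variables (a : 'I_k -> 'rV[C]_n -> C) (c : 'I_k -> fps C n).
Hypothesis c_conv : forall i, c i \in subring_pred S.
Hypothesis c_ev : forall i (h : 'I_n -> C), (forall l, modulus (h l) < e) -> ev h (c i) = a i (\row_l h l).
Hypothesis split_at : forall v : 'rV[C]_n, (forall l, modulus (v 0 l) < e) -> x_part v = 0 ->
  \prod_j w_part v 0 j != 0 -> exists2 F, expands_to (analytic_expansion v) a F & splits_formally F.

Lemma analytic_splits : splits_after_blowups (monic_of c).
Proof.
pose w := sub_w S_X.
have w0 : iota w != 0.
  by rewrite sub_wE prodf_seq_neq0; apply/allP => l _; rewrite fps_X_neq0 implybT.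
have he1 (l : 'I_n) : e / 2 < e := half_lt.
have conv x : iota x \in convergent (fun=> e) by exact: valP.
have dense := @analytic_points_dense R n O iota w (fun=> e) (e / 2) half_gt0 he1 conv w0.
have divide : points_divide hd K0 iota w (analytic_point iota (e / 2)).
  exact: (@analytic_points_divide R n O _ hd iota w cst (fun=> e) (e / 2) val_inj (fun _ _ => erefl) (fun=> erefl) half_gt0 he1 conv).
pose cO i : O := exist _ (c i) (c_conv i).
have -> : c = val \o cO by [].
apply: (splits_of_closed_subring S_const (S_root := S_root) dense divide) => kap [u ue kE] kw.
set kap' := below S_root kap; pose v l := kap' (sub_X S_X l).
have [ve _] := below_ev 0 ue kE; have kvE x : kap' x = ev v (iota x) by have [_ ->] := below_ev x ue kE.
have ve' l : modulus (v l) < e by exact: lt_trans (ve l) half_lt.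
pose vr : 'rV[C]_n := \row_l v l.
have xv : x_part vr = 0.
  by apply/rowP => i; rewrite /x_part [LHS]mxE [LHS]mxE /v /kap' [LHS]below_X leq_addr mxE.
have wv : \prod_j w_part vr 0 j != 0.
  rewrite prodf_seq_neq0; apply/allP => j _; apply/implyP => _.
  rewrite /w_part [X in X != 0]mxE [X in X != 0]mxE [X in X != 0]mxE; set l := lshift _ (lshift _ j).
  have lr : (l < r)%N by exact: ltn_ord j.
  rewrite /v /kap' [X in X != 0]below_X lr ifF; last by apply/negbTE; rewrite -ltnNge (leq_trans lr) ?leq_addr.
  rewrite expf_neq0 //; apply: contraNneq kw => kl.
  by rewrite /sub_w (rmorph_prod kap) (bigD1 l) //= kl mul0r.
have [|F [c' cE ->] spl] := split_at _ xv wv; first by move=> l; rewrite mxE.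
suff -> : taylor_hom hd kap' K0 \o cO = c' by [].
apply/funext => i; have [e' e'0 [[M hM] H]] := expansion_ev (cE i).
have ve2 l : 0 < e - modulus (v l) by rewrite subr_gt0.
have [del del0 dele] := common_bound (fun=> e'0) ve2.
have e2 : 0 < e' / 2 by rewrite divr_gt0.
have de : Num.min del (e' / 2) < e' by rewrite gt_min half_ltx ?orbT.
have dd : Num.min del (e' / 2) <= del by rewrite ge_min lexx.
(* Near the image point, the given expansion of the coefficient and the shifted series [c i] have
   the same sum; the radius leaves room for both to converge. *)
apply/esym/(@taylor_expansion R n (fun=> e) v O _ hd iota kap' (cO i) (c' i) (fun=> e') (Num.min del (e' / 2))) => //.
- by move=> l; have [_] := dele l; exact: ltr_room.
- by rewrite lt_min del0.
- exact: convergent_norm hM.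
- move=> h hh; rewrite H; last by move=> l; exact: lt_trans (hh l) de.
  have -> : iota (cO i) = c i by []; rewrite c_ev.
    by congr (a i _); apply/rowP => l; rewrite !mxE.
  move=> l; apply: le_lt_trans (modulusD _ _) _.
  by have [_] := dele l; apply: ltr_room; apply: le_trans dd; exact: ltW.
Qed.

End AnalyticInstance.

Theorem analytic_theorem (R : realType) (r q k : nat) (V : set 'rV[R[i]]_(r + q + k.-1))
    (a : 'I_k -> 'rV[R[i]]_(r + q + k.-1) -> R[i]) F :
  open_nbhd0 V -> expands_to (analytic_expansion 0) a F ->
  (forall v, V v -> x_part v = 0 -> \prod_j w_part v 0 j != 0 ->
     exists2 F, expands_to (analytic_expansion v) a F & splits_formally F) ->
  splits_after_blowups F.
Proof.
move=> /open_polydisc[eV eV0 hV] [c cE ->] split_at.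
have [ei ei0 hei] : exists2 ei : 'I_k -> R, (forall i, 0 < ei i) & forall i,
    (exists M, norm_le (fun=> ei i) (c i) M) /\
    forall h, (forall l, modulus (h l) < ei i) -> ev h (c i) = a i (0 + \row_l h l).
  have ex i : {ei : R | 0 < ei & (exists M, norm_le (fun=> ei) (c i) M) /\
    forall h, (forall l, modulus (h l) < ei) -> ev h (c i) = a i (0 + \row_l h l)}.
    by apply: cid2; exact: expansion_ev (cE i).
  by exists (fun i => s2val (ex i)) => i; case: (ex i).
have [d d0 hd] := common_bound ei0 (fun=> eV0).
have m0 : 0 < Num.min eV 1 by rewrite lt_min eV0 ltr01.
(* Besides the radii of convergence and that of [V], the bound 1 is imposed, because w -> w^p has to
   preserve the polydisc. *)
pose e := Num.min d (Num.min eV 1).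
have e0 : 0 < e by rewrite lt_min d0.
have ed : e <= d by rewrite ge_min lexx.
have em : e <= Num.min eV 1 by rewrite ge_min lexx orbT.
have e1 : e <= 1 by apply: le_trans em _; rewrite ge_min lexx orbT.
have eeV : e <= eV by apply: le_trans em _; rewrite ge_min lexx.
have eei i : e <= ei i by apply: le_trans ed _; apply: ltW; have [] := hd i.
apply: (@analytic_splits R r q k e e0 e1 a c).
- move=> i; have [[M hM] _] := hei i.
  exact: convergent_le (fun=> eei i) (convergent_norm hM).
- move=> i h hh; have [_ ->] := hei i; first by rewrite add0r.
  by move=> l; exact: lt_le_trans (hh l) (eei i).
- by move=> v hv; apply: split_at; apply: hV => l; exact: lt_le_trans (hv l) eeV.
Qed.

Theorem theorem1p1 (r q k : nat) (k_gt0 : (0 < k)%N) :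
  (forall (K : closedFieldType)
     (K_uncountable : ~ countable [set: K]%classic)
     (K_char0 : [pchar K] =i pred0)
     (U : etale_nbhd K (r + q + k.-1))
     (a : 'I_k -> mpoly (r + q + k.-1 + etale_dim U) K)
     (f_in_ideal : exists2 F,
        expands_to (etale_expansion (etale_origin U)) a F & in_ideal_xz F)
     (f_splits : forall v : 'rV[K]_(r + q + k.-1 + etale_dim U),
        etale_point v -> x_part (lsubmx v) = 0 ->
        \prod_j w_part (lsubmx v) 0 j != 0 ->
        exists2 F, expands_to (etale_expansion v) a F & splits_formally F),
   exists2 F,
     expands_to (etale_expansion (etale_origin U)) a F &
     splits_after_blowups F)
  /\
  (forall (R : realType)
     (V : set 'rV[R[i]]_(r + q + k.-1))
     (V_nbhd : open_nbhd0 V)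
     (a : 'I_k -> 'rV[R[i]]_(r + q + k.-1) -> R[i])
     (a_analytic : forall i, analytic_on V (a i))
     (f_in_ideal : exists2 F,
        expands_to (analytic_expansion 0) a F & in_ideal_xz F)
     (f_splits : forall v : 'rV[R[i]]_(r + q + k.-1),
        V v -> x_part v = 0 -> \prod_j w_part v 0 j != 0 ->
        exists2 F, expands_to (analytic_expansion v) a F & splits_formally F),
   exists2 F,
     expands_to (analytic_expansion 0) a F & splits_after_blowups F).
Proof.
split=> [K Kunc K0 U a [F FE _] split_at|R V V0 a _ [F FE _] split_at]; exists F => //.
  apply: (etale_theorem _ Kunc FE split_at k_gt0) => m.
  by rewrite ((pcharf0P K).1 K0).
exact: analytic_theorem V0 FE split_at.
Qed.
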